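(* Let $v_0\in L_{\mathbf K}(\Omega;\mathbb R^n)$ and let $v$ be a strong solution on $[0,T]$ to the problem $\partial_t v=L(\mathbf F(v))$, $v(0,\cdot)=v_0$. Then for any $T_1\in(0,T)$ there exists $\gamma>0$ such that, with the weight $\mathfrak h(t):=\exp(-\gamma t)$ on $[0,T_1]$ and $\mathfrak H(t):=\int_t^{T_1}\mathfrak h(s)\,ds$, the restriction $v|_{[0,T_1]\times\Omega}$ is a strong solution on $[0,T_1]$ and $$\mathfrak h(t)I\succeq-2\mathfrak H(t)L^*(v^{\#})\quad\text{a.e. in }(0,T_1)\times\Omega .$$ Consequently, consistency holds on $[0,T_1]$ for this weight: $\mathcal I(v_0,T_1)=\tilde{\mathcal J}(v_0,T_1)=\tilde{\mathcal I}(v_0,T_1)=\mathcal J(v_0,T_1)=\mathfrak H(0)K_0$; the pair $(E_+,B_+)=(\partial_t a,L^*a)$ with $a=\mathfrak Hv^{\#}$ belongs to $L_{\mathbf K^*}((0,T_1)\times\Omega;\mathbb R^n)\times L^\infty((0,T_1)\times\Omega;\mathbb R^{N\times N}_s)$ and is a maximizer of the dual problem (D) on $(0,T_1)$; and $v(t,x)=\nabla\mathbf K^*\big(\frac1{\mathfrak H(t)}\int_t^{T_1}(-E_+)(s,x)\,ds\big)$ for $t<T_1$.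
   Context: **Spaces and matrices.** $\Omega=\mathbb T^d$ is the periodic box with Lebesgue measure, $(u,w)=\int_\Omega u\cdot w\,dx$ (for matrix fields, the Frobenius product $A:B$ is used). $\mathbb R^{N\times N}_s$ and $\mathbb R^{N\times N}_+$ are the symmetric and the nonnegative-definite matrices; $A\succeq B$ means $A-B\in\mathbb R^{N\times N}_+$. $I$ is the identity matrix. A Young function is a convex even $\Phi:\mathbb R\to\mathbb R_+$ with $\Phi(s)=0$ iff $s=0$, $\Phi(s)/s\to0$ as $s\to0$ and $\Phi(s)/s\to+\infty$ as $s\to+\infty$. An $N$-function is a convex even $\mathbf K:\mathbb R^n\to\mathbb R_+$ such that $\Phi_-(|y|)\le\mathbf K(y)\le\Phi_+(|y|)$ for some Young functions $\Phi_\pm$. It satisfies the $\Delta_2$-condition if $\mathbf K(2y)\le C(\mathbf K(y)+1)$ for all $y$. $\mathbf K^*$ is the Legendre transform. $L_{\mathbf K}(Q;\mathbb R^n)$ is the anisotropic Orlicz space of measurable $f:Q\to\mathbb R^n$ with $\int_Q\mathbf K(f)\,dx<\infty$ (a Banach space with the Luxemburg norm; its dual is $L_{\mathbf K^*}$). **Data and standing assumptions.** $\mathbf F:\mathbb R^n\to\mathbb R^{N\times N}_s$ is $C^2$; $L$ is a linear differential operator with constant coefficients mapping $\mathbb R^{N\times N}_s$-valued functions on $\Omega$ to $\mathbb R^n$-valued functions, and $L^*$ is its adjoint, with values in $\mathbb R^{N\times N}_s$. It is assumed that: 1. (Entropy) $\mathbf K(v):=\frac12\operatorname{Tr}(\mathbf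 F(v)-\mathbf F(0))$ is strictly convex, is an $N$-function, and $\mathbf K,\mathbf K^*$ satisfy $\Delta_2$. Write $v^{\#}:=\nabla\mathbf K(v)$, so that $v=\nabla\mathbf K^*(v^{\#})$. 2. ($\Lambda$-convexity) Let $\Lambda\subset\mathbb R^{N\times N}_s$ be the smallest linear subspace containing $I$ and all values $L^*u(x)$, $u:\Omega\to\mathbb R^n$ smooth, $x\in\Omega$. For every $P\in\Lambda\cap\mathbb R^{N\times N}_+$ the function $\mathbf F:P$ is convex. 3. ($\Lambda$-order) Let $\mathbb R^{N\times N}_\Lambda=\{\Xi\in\mathbb R^{N\times N}_s:\ \Xi:P\ge0\ \forall P\in\Lambda\cap\mathbb R^{N\times N}_+\}$ and write $B\le A$ when $A-B\in\mathbb R^{N\times N}_\Lambda$. Then $\mathbf F(\mathbb R^n)\subset\mathbb R^{N\times N}_\Lambda$, and, with $\pi_\Lambda$ the orthogonal projection onto $\Lambda$, $|\pi_\Lambda\partial_l\mathbf F(v)|\le C(|\nabla\mathbf K(v)|+1)$ for all $v\in\mathbb R^n$, $l=1,\dots,n$. 4. (Conservativity) $(\mathbf F(v),L^*(v^{\#}))=0$ whenever $v^{\#}:\Omega\to\mathbb R^n$ is smooth and $v=\nabla\mathbf K^*(v^{\#})$. In the definitions below, $S$ denotes the length of the time interval ($S=T$ or $S=T_1$). **Weight.** A weight on $[0,S]$ is a positive scalar function $\mathfrak h$ on $[0,S]$ bounded away from $0$ and $\infty$; $\mathfrak H(t)=\int_t^S\mathfrak h(s)\,ds$. **Constraint (C)**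 on $(E,B)\in L_{\mathbf K^*}((0,S)\times\Omega;\mathbb R^n)\times L^\infty((0,S)\times\Omega;\mathbb R^{N\times N}_s)$: $\int_0^S[(B,\partial_t\Psi)+(E,L\Psi)]\,dt=0$ for all smooth $\Psi:[0,S]\times\Omega\to\mathbb R^{N\times N}_s$ with $\Psi(0)=0$ (weak form of $\partial_tB=L^*E$, $B(S)=0$). **Weak solution on $[0,S]$:** $v\in L_{\mathbf K}((0,S)\times\Omega;\mathbb R^n)$ with $\int_0^S[(v-v_0,E)+(\mathbf F(v),B)]\,dt=0$ for all $(E,B)\in L_{\mathbf K^*}((0,S)\times\Omega;\mathbb R^n)\times L^\infty((0,S)\times\Omega;\mathbb R^{N\times N}_s)$ satisfying (C). **Strong solution on $[0,S]$:** a weak solution $v$ such that $\partial_t(\mathfrak Hv^{\#})\in L_{\mathbf K^*}((0,S)\times\Omega;\mathbb R^n)$, $\mathfrak HL^*(v^{\#})\in L^\infty((0,S)\times\Omega;\mathbb R^{N\times N}_s)$, and $\partial_t(v^{\#})_l+L^*(v^{\#}):\partial_l\mathbf F(\nabla\mathbf K^*(v^{\#}))=0$ a.e. in $(0,S)\times\Omega$ for $l=1,\dots,n$, $v^{\#}(0,\cdot)=(v_0)^{\#}$ a.e. in $\Omega$. This notion does not depend on the choice of the weight on $[0,S]$. (Then $v^{\#}\in C([0,S);L_{\mathbf K^*}(\Omega;\mathbb R^n))$.) **Optimization problems (on $(0,S)$, for a given weight on $[0,S]$).** Below $v$ (or $z$) ranges over $L_{\mathbf K}((0,S)\times\Omega;\mathbb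 R^n)$, $M$ over $L^1((0,S)\times\Omega;\mathbb R^{N\times N}_s)$ with $\mathbf F(v)\le M$ (resp. $\mathbf F(z)\le M$) a.e. in the $\Lambda$-order, and $(E,B)$ over the pairs in $L_{\mathbf K^*}\times L^\infty$ satisfying (C): $$\mathcal I(v_0,S)=\inf_v\sup_{E,B}\int_0^S\!\big[(v-v_0,E)+\tfrac12(\mathbf F(v),\mathfrak hI+2B)\big]dt,$$ $$\mathcal J(v_0,S)=\sup_{E,B}\inf_v\int_0^S\!\big[(v-v_0,E)+\tfrac12(\mathbf F(v),\mathfrak hI+2B)\big]dt,$$ $$\tilde{\mathcal I}(v_0,S)=\inf_{v,M}\sup_{E,B}\int_0^S\!\big[(v-v_0,E)+\tfrac12(M,\mathfrak hI+2B)\big]dt,$$ $$\tilde{\mathcal J}(v_0,S)=\sup_{E,B}\inf_{v,M}\int_0^S\!\big[(v-v_0,E)+\tfrac12(M,\mathfrak hI+2B)\big]dt.$$ With $\mathcal K(E,B)=\inf_{\mathbf F(z)\le M}\int_0^S[(z,E)+\frac12(M,\mathfrak hI+2B)]\,dt$, the last problem is equivalent to the dual problem $$\text{(D)}\qquad\tilde{\mathcal J}(v_0,S)=\sup\Big\{-\int_0^S(v_0,E)\,dt+\mathcal K(E,B)\Big\},$$ the supremum being over pairs $(E,B)\in L_{\mathbf K^*}((0,S)\times\Omega;\mathbb R^n)\times L^\infty((0,S)\times\Omega;\mathbb R^{N\times N}_s)$ satisfying (C) and $\mathfrak hI+2B\succeq0$ a.e. Finally, $K_0:=\frac12\int_\Omega\operatorname{Tr}\mathbf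 F(v_0)\,dx$. *)

(* Defs.v *)
From HB Require Import structures.
From mathcomp Require Import all_boot all_order all_algebra.
From mathcomp Require Import all_classical all_reals all_analysis.
Set Implicit Arguments. Unset Strict Implicit. Unset Printing Implicit Defensive.
Import Order.TTheory GRing.Theory Num.Theory numFieldNormedType.Exports.
Local Open Scope classical_set_scope.
Local Open Scope ring_scope.

(* The Borel sigma-algebra of R^d, generated by the coordinates. *)
Definition rV_display : measure_display -> measure_display.
Proof. exact. Qed.

Section measurable_rV.
Context {R : realType} {d : nat}.
Let coors (i : 'I_d) (x : 'rV[R]_d) : R := x 0 i.
Let rV_set0 : g_sigma_preimage coors set0.
Proof. exact: sigma_algebra0. Qed.
Let rV_setC A : g_sigma_preimage coors A -> g_sigma_preimage coors (~` A).
Proof. exact: sigma_algebraC. Qed.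
Let rV_bigcup (F : (set 'rV[R]_d)^nat) : (forall i, g_sigma_preimage coors (F i)) ->
  g_sigma_preimage coors (\bigcup_i (F i)).
Proof. exact: sigma_algebra_bigcup. Qed.

HB.instance Definition _ := @isMeasurable.Build (rV_display default_measure_display)
  'rV[R]_d (g_sigma_preimage coors) rV_set0 rV_setC rV_bigcup.

Lemma measurable_coord (i : 'I_d) : measurable_fun setT (fun x : 'rV[R]_d => x 0 i).
Proof.
move=> _ Y mY; rewrite setTI; apply: sub_sigma_algebra => /=.
rewrite -bigcup_seq/=; exists i => /=; first by rewrite mem_index_enum.
by exists Y => //; rewrite setTI.
Qed.

Lemma measurable_fun_rVP d' (T : measurableType d') (f : T -> 'rV[R]_d) :
  (forall i, measurable_fun setT (fun t => f t 0 i)) -> measurable_fun setT f.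
Proof.
move=> mf _ A mA; rewrite setTI.
have : g_sigma_preimage (fun i => coors i \o f) `<=` measurable.
  apply: smallest_sub; first exact: sigma_algebra_measurable.
  rewrite -bigcup_seq => B [i /= _ [C mC <-]].
  exact: mf.
by rewrite g_sigma_preimage_comp; apply; exists A => //; rewrite setTI.
Qed.

End measurable_rV.

Section torus_step.
Context {R : realType} {d : nat}.

Definition cons_rV (p : measurableTypeR R * 'rV[R]_d) : 'rV[R]_d.+1 :=
  \row_i (if unlift ord0 i is Some j then p.2 0 j else p.1).

Lemma measurable_cons_rV : measurable_fun setT cons_rV.
Proof.
apply: measurable_fun_rVP => i.
pose f (p : measurableTypeR R * 'rV[R]_d) : R :=
  if unlift ord0 i is Some j then p.2 0 j else p.1.
apply: (eq_measurable_fun f) => [t _|]; first by rewrite /f mxE.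
rewrite /f; case: (unlift ord0 i) => [j|]; last exact: measurable_fst.
exact: (measurableT_comp (measurable_coord j) measurable_snd).
Qed.

Variable mu : probability 'rV[R]_d R.

Let step := pushforward
  (mrestr (@lebesgue_measure R) (measurable_itv `[0%R, 1%R[) \x mu)%E cons_rV.

Let step0 : step set0 = 0%E.
Proof. by rewrite /step /pushforward preimage_set0 measure0. Qed.

Let mpre A : measurable A -> measurable (cons_rV @^-1` A).
Proof. by move=> mA; rewrite -[X in measurable X]setTI; exact: measurable_cons_rV. Qed.

Let step_ge0 A : (0 <= step A)%E.
Proof. by rewrite /step /pushforward measure_ge0. Qed.

Let step_sigma_additive : semi_sigma_additive step.
Proof.
move=> F mF tF mUF; rewrite /step /pushforward preimage_bigcup.
apply: measure_semi_sigma_additive.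
- by move=> n; exact: mpre.
- apply/trivIsetP => /= i j _ _ ij; rewrite -preimage_setI.
  by move/trivIsetP : tF => /(_ _ _ _ _ ij) ->//; rewrite preimage_set0.
- by rewrite -preimage_bigcup; exact: mpre.
Qed.

HB.instance Definition _ :=
  isMeasure.Build _ _ _ step step0 step_ge0 step_sigma_additive.

Let step_setT : step setT = 1%E.
Proof.
rewrite /step /pushforward preimage_setT -setXTT product_measure1E//.
rewrite [X in (_ * X)%E]probability_setT mule1 /= /mrestr setTI.
by rewrite lebesgue_measure_itv/= lte_fin ltr01 oppr0 adde0.
Qed.

HB.instance Definition _ := Measure_isProbability.Build _ _ _ step step_setT.

Definition torus_step : probability 'rV[R]_d.+1 R := step.

End torus_step.

(* The torus T^d = R^d / Z^d is represented by the fundamental domain [0, 1[^d: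
   [torus R d] is the Lebesgue measure of R^d restricted to it, built one
   coordinate at a time.  Functions on the torus with no regularity are taken
   on R^d up to [torus R d]-null sets; smooth ones are Z^d-periodic. *)
Fixpoint torus (R : realType) (d : nat) : probability 'rV[R]_d R :=
  if d is d'.+1 then torus_step (torus R d') else \d_(0 : 'rV[R]_0).

Section linear_algebra.
Context {R : realType}.

Definition dotv n (u w : 'rV[R]_n) : R := \sum_i u 0 i * w 0 i.

Definition enorm n (u : 'rV[R]_n) : R := Num.sqrt (dotv u u).

Definition frob N (A B : 'M[R]_N) : R := \sum_i \sum_j A i j * B i j.

Definition sym N (A : 'M[R]_N) : Prop := A^T = A.

Definition psd N (A : 'M[R]_N) : Prop :=
  sym A /\ forall x : 'rV[R]_N, 0 <= (x *m A *m x^T) 0 0.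

Definition loewner_ge N (A B : 'M[R]_N) : Prop := psd (A - B).

End linear_algebra.

Section calculus.
Context {R : realType}.

(* In finite dimension this is the usual class C^k. *)
Fixpoint Ck (V : normedModType R) (k : nat) (f : V -> R) : Prop :=
  continuous f /\
  if k is k'.+1
  then forall v, (forall x, derivable f x v) /\ Ck k' (fun x => 'D_v f x)
  else True.

Definition smooth (V : normedModType R) (f : V -> R) : Prop :=
  forall k, Ck k f.

Definition partial n (i : 'I_n) (f : 'rV[R]_n -> R) (x : 'rV[R]_n) : R :=
  'D_(delta_mx 0 i) f x.

Definition grad n (f : 'rV[R]_n -> R) (x : 'rV[R]_n) : 'rV[R]_n :=
  \row_i partial i f x.

Definition mx_partial n N (l : 'I_n) (F : 'rV[R]_n -> 'M[R]_N)
    (x : 'rV[R]_n) : 'M[R]_N :=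
  \matrix_(i, j) partial l (fun y => F y i j) x.

Definition multi_partial n (a : 'I_n -> nat) (f : 'rV[R]_n -> R) :
    'rV[R]_n -> R :=
  foldr (fun i g => iter (a i) (@partial n i) g) f (enum 'I_n).

Definition even_fun (V : zmodType) (f : V -> R) : Prop :=
  forall y, f (- y) = f y.

Definition strictly_convex n (f : 'rV[R]_n -> R) : Prop :=
  forall (x y : 'rV[R]_n) (t : R), x != y -> 0 < t -> t < 1 ->
    f (t *: x + (1 - t) *: y) < t * f x + (1 - t) * f y.

Definition young (Phi : R -> R) : Prop :=
  [/\ convex_function (setT : set R^o) Phi,
      even_fun Phi,
      forall s, 0 <= Phi s,
      forall s, Phi s = 0 <-> s = 0 &
      (Phi s / s @[s --> 0^'] --> 0) /\ (Phi s / s @[s --> +oo] --> +oo)].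

Definition n_function n (K : 'rV[R]_n -> R) : Prop :=
  [/\ convex_function (setT : set 'rV[R]_n) K,
      even_fun K,
      forall y, 0 <= K y &
      exists Phim Phip, [/\ young Phim, young Phip &
        forall y, Phim (enorm y) <= K y <= Phip (enorm y)]].

Definition Delta2 n (K : 'rV[R]_n -> R) : Prop :=
  exists C, forall y, K (2 *: y) <= C * (K y + 1).

(* The supremum is finite when K is superlinear, as every N-function is. *)
Definition legendre n (K : 'rV[R]_n -> R) (y : 'rV[R]_n) : R :=
  sup [set dotv y x - K x | x in setT].

End calculus.

Section function_spaces.
Context {R : realType} {disp : measure_display} {T : measurableType disp}.
Variables (mu : {measure set T -> \bar R}) (D : set T).

Definition orlicz n (K : 'rV[R]_n -> R) (f : T -> 'rV[R]_n) : Prop :=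
  (forall i, measurable_fun D (fun z => f z 0 i)) /\
  (\int[mu]_(z in D) (K (f z))%:E < +oo)%E.

Definition luxemburg n (K : 'rV[R]_n -> R) (f : T -> 'rV[R]_n) : \bar R :=
  ereal_inf [set r%:E | r in
    [set r : R | 0 < r /\ (\int[mu]_(z in D) (K (r^-1 *: f z))%:E <= 1)%E]].

Definition Linfty_sym N (B : T -> 'M[R]_N) : Prop :=
  [/\ forall z, sym (B z),
      forall i j, measurable_fun D (fun z => B z i j) &
      exists C : R, {ae mu, forall z, D z -> forall i j, `|B z i j| <= C}].

Definition L1_sym N (M : T -> 'M[R]_N) : Prop :=
  (forall z, sym (M z)) /\
  forall i j, mu.-integrable D (fun z => (M z i j)%:E).

End function_spaces.

(* The first factor is the time axis; [measurableTypeR R] is R with the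
   sigma-algebra on which the library defines the Lebesgue measure. *)
Definition spacetime (R : realType) (d : nat) :
    {measure set (measurableTypeR R * 'rV[R]_d) -> \bar R} :=
  (lebesgue_measure \x torus R d)%E.

Definition cylinder {R : realType} {d : nat} (S : R) : set (R * 'rV[R]_d) :=
  [set z | 0 < z.1 < S].

Definition int_cyl {R : realType} {d : nat} (S : R) (f : R * 'rV[R]_d -> R) :
    \bar R :=
  (\int[spacetime R d]_(z in cylinder S) (f z)%:E)%E.

Definition periodic {R : realType} {d : nat} (u : 'rV[R]_d -> R) : Prop :=
  forall x i, u (x + delta_mx 0 i) = u x.

Definition dt {R : realType} {d : nat} (f : R * 'rV[R]_d -> R)
    (z : R * 'rV[R]_d) : R :=
  'D_(1, 0) f z.

(* Smooth functions on [0, S] x T^d, smoothness at the ends of the interval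
   included, are the restrictions of the smooth functions on R x T^d. *)
Definition smooth_st {R : realType} {d : nat} (f : R * 'rV[R]_d -> R) : Prop :=
  smooth f /\ forall t, periodic (fun x => f (t, x)).

Definition smooth_torus_vec {R : realType} {d n : nat}
    (u : 'rV[R]_d -> 'rV[R]_n) : Prop :=
  forall l, smooth (fun x => u x 0 l) /\ periodic (fun x => u x 0 l).

Definition smooth_st_sym {R : realType} {d N : nat}
    (Psi : R * 'rV[R]_d -> 'M[R]_N) : Prop :=
  (forall z, sym (Psi z)) /\ forall i j, smooth_st (fun z => Psi z i j).

Definition supported_in {R : realType} {d : nat} {V : zmodType} (a b : R)
    (f : R * 'rV[R]_d -> V) : Prop :=
  forall t x, ~~ (a <= t <= b) -> f (t, x) = 0.

(* (L Psi)_l = \sum_a coef a l : (derivative of Psi of multi-index a), over the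
   multi-indices a with all entries at most [dop_order]. *)
Record diffop (R : realType) (d n N : nat) := DiffOp {
  dop_order : nat;
  dop_coef : {ffun 'I_d -> 'I_dop_order.+1} -> 'I_n -> 'M[R]_N;
  dop_sym : forall a l, sym (dop_coef a l) }.

Arguments dop_coef {R d n N} _ _ _.

Section system.
Context {R : realType} {d n N : nat}.
Variables (F : 'rV[R]_n -> 'M[R]_N) (L : diffop R d n N).

Definition mx_multi_partial (a : 'I_d -> nat) (Psi : 'rV[R]_d -> 'M[R]_N)
    (x : 'rV[R]_d) : 'M[R]_N :=
  \matrix_(i, j) multi_partial a (fun y => Psi y i j) x.

Definition apply_op (Psi : 'rV[R]_d -> 'M[R]_N) (x : 'rV[R]_d) : 'rV[R]_n :=
  \row_l \sum_(a : {ffun 'I_d -> 'I_(dop_order L).+1})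
    frob (dop_coef L a l) (mx_multi_partial (fun i => a i) Psi x).

Definition apply_adj (u : 'rV[R]_d -> 'rV[R]_n) (x : 'rV[R]_d) : 'M[R]_N :=
  \sum_(a : {ffun 'I_d -> 'I_(dop_order L).+1}) (-1) ^+ (\sum_i a i)%N *:
    \sum_l multi_partial (fun i => a i) (fun y => u y 0 l) x *: dop_coef L a l.

Definition entropy (v : 'rV[R]_n) : R := 2^-1 * \tr (F v - F 0).

Local Notation K := entropy.
Local Notation Ks := (legendre entropy).

Definition sharp (v : 'rV[R]_n) : 'rV[R]_n := grad K v.

Definition entropy_condition : Prop :=
  [/\ strictly_convex K, n_function K, Delta2 K & Delta2 Ks].

Definition Lambda (P : 'M[R]_N) : Prop :=
  forall V : {vspace 'M[R]_N}, 1%:M \in V ->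
    (forall u x, smooth_torus_vec u -> apply_adj u x \in V) ->
    P \in V.

Definition Lambda_convexity : Prop :=
  forall P, Lambda P -> psd P ->
    convex_function (setT : set 'rV[R]_n) (fun v => frob (F v) P).

Definition Lambda_cone (X : 'M[R]_N) : Prop :=
  sym X /\ forall P, Lambda P -> psd P -> 0 <= frob X P.

Definition Lambda_le (B A : 'M[R]_N) : Prop := Lambda_cone (A - B).

(* Q is the orthogonal projection of X onto Lambda. *)
Definition Lambda_proj (X Q : 'M[R]_N) : Prop :=
  Lambda Q /\ forall P, Lambda P -> frob (X - Q) P = 0.

Definition Lambda_order_condition : Prop :=
  (forall v, Lambda_cone (F v)) /\
  exists C : R, forall v l Q, Lambda_proj (mx_partial l F v) Q ->
    Num.sqrt (frob Q Q) <= C * (enorm (grad K v) + 1).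

Definition conservativity : Prop :=
  forall w : 'rV[R]_d -> 'rV[R]_n, smooth_torus_vec w ->
    (\int[torus R d]_x (frob (F (grad Ks (w x))) (apply_adj w x))%:E = 0)%E.

Definition standing_assumptions : Prop :=
  [/\ (forall v, sym (F v)) /\ (forall i j, Ck 2 (fun v => F v i j)),
      entropy_condition, Lambda_convexity, Lambda_order_condition &
      conservativity].

Definition is_weight (S : R) (h : R -> R) : Prop :=
  measurable_fun (`[0, S]%classic : set (measurableTypeR R)) h /\
  exists c C : R, 0 < c /\ forall t, 0 <= t <= S -> c <= h t <= C.

Definition primitive (h : R -> R) (S t : R) : R :=
  \int[lebesgue_measure]_(s in `[t, S]) h s.

Definition in_LK (S : R) : (R * 'rV[R]_d -> 'rV[R]_n) -> Prop :=
  orlicz (spacetime R d) (cylinder S) K.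

Definition in_LKs (S : R) : (R * 'rV[R]_d -> 'rV[R]_n) -> Prop :=
  orlicz (spacetime R d) (cylinder S) Ks.

Definition in_Linfty (S : R) : (R * 'rV[R]_d -> 'M[R]_N) -> Prop :=
  @Linfty_sym _ _ _ (spacetime R d) (cylinder S) N.

Definition in_L1 (S : R) : (R * 'rV[R]_d -> 'M[R]_N) -> Prop :=
  @L1_sym _ _ _ (spacetime R d) (cylinder S) N.

Definition ae_cyl (S : R) (P : R * 'rV[R]_d -> Prop) : Prop :=
  {ae spacetime R d, forall z, cylinder S z -> P z}.

Definition mx_dt (Psi : R * 'rV[R]_d -> 'M[R]_N) (z : R * 'rV[R]_d) :
    'M[R]_N :=
  \matrix_(i, j) dt (fun y => Psi y i j) z.

Definition apply_op_st (Psi : R * 'rV[R]_d -> 'M[R]_N) (z : R * 'rV[R]_d) :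
    'rV[R]_n :=
  apply_op (fun x => Psi (z.1, x)) z.2.

Definition constraint (S : R) (E : R * 'rV[R]_d -> 'rV[R]_n)
    (B : R * 'rV[R]_d -> 'M[R]_N) : Prop :=
  forall Psi, smooth_st_sym Psi -> (forall x, Psi (0, x) = 0) ->
    int_cyl S (fun z => frob (B z) (mx_dt Psi z) + dotv (E z) (apply_op_st Psi z))
    = 0%E.

Definition feasible (S : R)
    (p : (R * 'rV[R]_d -> 'rV[R]_n) * (R * 'rV[R]_d -> 'M[R]_N)) : Prop :=
  [/\ in_LKs S p.1, in_Linfty S p.2 & constraint S p.1 p.2].

Definition weak_solution (S : R) (v0 : 'rV[R]_d -> 'rV[R]_n)
    (v : R * 'rV[R]_d -> 'rV[R]_n) : Prop :=
  in_LK S v /\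
  forall E B, feasible S (E, B) ->
    int_cyl S (fun z => dotv (v z - v0 z.2) (E z) + frob (F (v z)) (B z)) = 0%E.

Definition loc_integrable (S : R) (f : R * 'rV[R]_d -> R) : Prop :=
  forall a b : R, 0 < a -> a < b -> b < S ->
    (spacetime R d).-integrable [set z : R * 'rV[R]_d | a <= z.1 <= b]
      (fun z => (f z)%:E).

(* The distribution dt f on ]0, S[ x T^d is the locally integrable g. *)
Definition weak_dt (S : R) (f g : R * 'rV[R]_d -> 'rV[R]_n) : Prop :=
  forall l : 'I_n,
  [/\ loc_integrable S (fun z => f z 0 l),
      loc_integrable S (fun z => g z 0 l) &
      forall (phi : R * 'rV[R]_d -> R) (a b : R), smooth_st phi ->
        0 < a -> b < S -> supported_in a b phi ->
        int_cyl S (fun z => f z 0 l * dt phi z)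
        = (- int_cyl S (fun z => g z 0 l * phi z)%R)%E].

(* The distribution L^* f on ]0, S[ x T^d is the locally integrable G. *)
Definition weak_adj (S : R) (f : R * 'rV[R]_d -> 'rV[R]_n)
    (G : R * 'rV[R]_d -> 'M[R]_N) : Prop :=
  [/\ forall z, sym (G z),
      forall l, loc_integrable S (fun z => f z 0 l),
      forall i j, loc_integrable S (fun z => G z i j) &
      forall (Psi : R * 'rV[R]_d -> 'M[R]_N) (a b : R),
        smooth_st_sym Psi ->
        0 < a -> b < S -> supported_in a b Psi ->
        int_cyl S (fun z => dotv (f z) (apply_op_st Psi z))
        = int_cyl S (fun z => frob (G z) (Psi z))].

(* f has a representative in C([0, S[; L_{K^*}(T^d)) whose value at t = 0 is
   f0 almost everywhere. *)
Definition initial_value (S : R) (f : R * 'rV[R]_d -> 'rV[R]_n)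
    (f0 : 'rV[R]_d -> 'rV[R]_n) : Prop :=
  exists w : R -> 'rV[R]_d -> 'rV[R]_n,
  [/\ ae_cyl S (fun z => w z.1 z.2 = f z),
      forall t : R, 0 <= t < S -> orlicz (torus R d) setT Ks (w t),
      forall t : R, 0 <= t < S ->
        luxemburg (torus R d) setT Ks (fun x => w s x - w t x)
          @[s --> within `[0, S[ (nbhs t)] --> 0%E &
      {ae torus R d, forall x, w 0 x = f0 x}].

(* Dt and G are dt (v^#) and L^* (v^#); the notion does not depend on the
   weight h on [0, S]. *)
Definition strong_solution (h : R -> R) (S : R) (v0 : 'rV[R]_d -> 'rV[R]_n)
    (v : R * 'rV[R]_d -> 'rV[R]_n) : Prop :=
  let H := primitive h S in
  let vs z := sharp (v z) in
  weak_solution S v0 v /\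
  exists Dt G,
  [/\ weak_dt S vs Dt /\ weak_adj S vs G,
      exists E, weak_dt S (fun z => H z.1 *: vs z) E /\ in_LKs S E,
      in_Linfty S (fun z => H z.1 *: G z),
      ae_cyl S (fun z => forall l : 'I_n,
        Dt z 0 l + frob (G z) (mx_partial l F (grad Ks (vs z))) = 0) &
      initial_value S vs (fun x => sharp (v0 x))].

Section optimization.
Variables (h : R -> R) (S : R) (v0 : 'rV[R]_d -> 'rV[R]_n).

(* [constraint] puts B in Lambda a.e., and the Lambda-order condition bounds
   the projection of F(v) on Lambda by K(v) up to constants: the integrand with
   M = F(v) is integrable for feasible (E, B) even where F(v) is not. *)
Definition lagrangian (v : R * 'rV[R]_d -> 'rV[R]_n)
    (M : R * 'rV[R]_d -> 'M[R]_N)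
    (p : (R * 'rV[R]_d -> 'rV[R]_n) * (R * 'rV[R]_d -> 'M[R]_N)) : \bar R :=
  int_cyl S (fun z => dotv (v z - v0 z.2) (p.1 z) +
    2^-1 * frob (M z) ((h z.1)%:M + 2 *: p.2 z)).

Definition relaxed
    (q : (R * 'rV[R]_d -> 'rV[R]_n) * (R * 'rV[R]_d -> 'M[R]_N)) : Prop :=
  [/\ in_LK S q.1, in_L1 S q.2 &
      ae_cyl S (fun z => Lambda_le (F (q.1 z)) (q.2 z))].

Definition pI : \bar R :=
  ereal_inf [set ereal_sup [set lagrangian v (F \o v) p | p in feasible S]
            | v in in_LK S].

Definition pJ : \bar R :=
  ereal_sup [set ereal_inf [set lagrangian v (F \o v) p | v in in_LK S]
            | p in feasible S].

Definition pI_relaxed : \bar R :=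
  ereal_inf [set ereal_sup [set lagrangian q.1 q.2 p | p in feasible S]
            | q in relaxed].

Definition pJ_relaxed : \bar R :=
  ereal_sup [set ereal_inf [set lagrangian q.1 q.2 p | q in relaxed]
            | p in feasible S].

Definition calK
    (p : (R * 'rV[R]_d -> 'rV[R]_n) * (R * 'rV[R]_d -> 'M[R]_N)) : \bar R :=
  ereal_inf [set int_cyl S (fun z => dotv (q.1 z) (p.1 z) +
      2^-1 * frob (q.2 z) ((h z.1)%:M + 2 *: p.2 z)) | q in relaxed].

Definition dual_feasible
    (p : (R * 'rV[R]_d -> 'rV[R]_n) * (R * 'rV[R]_d -> 'M[R]_N)) : Prop :=
  feasible S p /\ ae_cyl S (fun z => psd ((h z.1)%:M + 2 *: p.2 z)).

Definition dual_cost
    (p : (R * 'rV[R]_d -> 'rV[R]_n) * (R * 'rV[R]_d -> 'M[R]_N)) : \bar R :=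
  (- int_cyl S (fun z => dotv (v0 z.2) (p.1 z)) + calK p)%E.

Definition dual_maximizer
    (p : (R * 'rV[R]_d -> 'rV[R]_n) * (R * 'rV[R]_d -> 'M[R]_N)) : Prop :=
  dual_feasible p /\
  forall q, dual_feasible q -> (dual_cost q <= dual_cost p)%E.

End optimization.

Definition K0 (v0 : 'rV[R]_d -> 'rV[R]_n) : \bar R :=
  ((2^-1 : R)%:E * \int[torus R d]_x (\tr (F (v0 x)))%:E)%E.

End system.

(* Main.v *)
Require Import Defs.
From HB Require Import structures.
From mathcomp Require Import all_boot all_order all_algebra.
From mathcomp Require Import all_classical all_reals all_analysis.
From mathcomp Require Import measurable_realfun ring lra.
Set Implicit Arguments.
Unset Strict Implicit.
Unset Printing Implicit Defensive.
Import Order.TTheory GRing.Theory Num.Theory numFieldNormedType.Exports.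
Local Open Scope classical_set_scope.
Local Open Scope ring_scope.

(** Let A = H(0) K_0. All four values are squeezed to A by a saddle point ([saddle_values]).

    On the primal side the competitor is v. For every admissible (E, B) the terms of the
    Lagrangian containing E and B form the weak formulation and vanish; what remains is the
    integral of h/2 tr F(v), which is A by conservation of energy ([solution_lagrangian],
    [energy_identity]). In the relaxed problems F(v) is replaced by an integrable matrix
    field with the same pairings with Lambda ([flux_majorant]).

    On the dual side the competitor is (E_+, B_+) = (dt (H v^#), H L^* v^#). On [0, T_1] the
    field L^* v^# is bounded, and gamma H <= h for h = exp (- gamma t): for large gamma the
    matrix P = h I + 2 B_+ is nonnegative ([dual_weighted_psd]). It takes its values in Lambda,
    so F : P is convex, and the equation for dt v^# says that v is a critical point of the
    integrand (v - v_0).E_+ + F(v) : P / 2. Thus v minimizes it pointwise, and every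
    competitor has Lagrangian at least A against this pair ([dual_gradient],
    [dual_lower_bound]).

    The regularity of v^# enters at three places. Since dt (H_0 v^#) lies in L_{K^*}, H_0
    being the primitive of the given weight, which vanishes only at T, Leibniz's rule puts
    dt v^# in L_{K^*} on [0, T_1], and v^# is the integral in time of its derivative from its initial value
    ([weighted_product_rule], [time_representation]). This gives the constraint for the dual
    pair by integration by parts in time ([dual_constraint]), and the representation of v by
    the tail of E_+ ([dual_E_tail]). The energy identity follows by testing the weak
    formulation with the dual pair: the chain rule for K^* along absolutely continuous curves
    ([chain_rule]) treats the term in E_+, and conservativity, extended from smooth fields by
    mollification ([mollified_conservativity]), cancels the term in B_+. Finally, the constraint
    forces B into Lambda ([constraint_Lambda]), where |F(v) : P| is at most a multiple of
    tr F(v) ([flux_pairing_le]); this makes all pairings integrable. *)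

Local Notation periodic := Defs.periodic.

(** * Calculus of C^k functions *)

Section CkCalculus.
Context {R : realType}.
Implicit Types V U : normedModType R.

Lemma Ck_continuous V k (f : V -> R) : Ck k f -> continuous f.
Proof. by case: k => [|k] []. Qed.

Lemma CkW V k (f : V -> R) : Ck k.+1 f -> Ck k f.
Proof.
elim: k f => [|k IH] f; first by case.
move=> [cf Df]; split=> // v; have [df Ckf] := Df v; split=> //.
exact: IH.
Qed.

Lemma Ck_cst V k (c : R) : Ck k (fun _ : V => c).
Proof.
elim: k c => [|k IH] c; split=> //; first exact: cst_continuous.
  exact: cst_continuous.
move=> v; split=> [x|]; first exact: derivable_cst.
have -> : (fun x : V => 'D_v (fun=> c) x) = (fun=> 0).
  by apply/funext => x; rewrite derive_cst.
exact: IH.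
Qed.

Lemma CkD V k (f g : V -> R) : Ck k f -> Ck k g -> Ck k (fun x => f x + g x).
Proof.
elim: k f g => [|k IH] f g [cf Df] [cg Dg]; split=> //.
- by move=> x; apply: cvgD; [exact: cf|exact: cg].
- by move=> x; apply: cvgD; [exact: cf|exact: cg].
move=> v; have [df Cf] := Df v; have [dg Cg] := Dg v; split=> [x|].
  exact: derivableD.
have -> : (fun x : V => 'D_v (fun x => f x + g x) x)
          = (fun x => 'D_v f x + 'D_v g x).
  by apply/funext => x; rewrite deriveD.
exact: IH.
Qed.

Lemma CkM V k (f g : V -> R) : Ck k f -> Ck k g -> Ck k (fun x => f x * g x).
Proof.
elim: k f g => [|k IH] f g kf kg; have [cf Df] := kf; have [cg Dg] := kg; split=> //.
- by move=> x; apply: cvgM; [exact: cf|exact: cg].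
- by move=> x; apply: cvgM; [exact: cf|exact: cg].
move=> v; have [df Cf] := Df v; have [dg Cg] := Dg v; split=> [x|].
  exact: derivableM.
have -> : (fun x : V => 'D_v (fun x => f x * g x) x)
          = (fun x => f x * 'D_v g x + g x * 'D_v f x).
  by apply/funext => x; rewrite deriveM.
by apply: CkD; apply: IH => //; exact: CkW.
Qed.

(** [A] is affine with linear part [A']. *)
Lemma derive_affine U V (A A' : U -> V) (f : V -> R) v x :
  (forall x h v, A (h *: v + x) = h *: A' v + A x) ->
  'D_v (fun x => f (A x)) x = 'D_(A' v) f (A x).
Proof.
move=> hA; rewrite /derive.
set G := (X in lim (X @ _)); set G' := (X in _ = lim (X @ _)).
suff -> : G = G' by [].
by apply/funext => h /=; rewrite /G /G' /= hA.
Qed.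

Lemma derivable_affine U V (A A' : U -> V) (f : V -> R) v x :
  (forall x h v, A (h *: v + x) = h *: A' v + A x) ->
  derivable f (A x) (A' v) -> derivable (fun x => f (A x)) x v.
Proof.
move=> hA; rewrite /derivable.
set G := (X in cvg (X @ _) -> _); set G' := (X in _ -> cvg (X @ _)).
suff -> : G' = G by [].
by apply/funext => h /=; rewrite /G /G' /= hA.
Qed.

Lemma Ck_affine U V (A A' : U -> V) k (f : V -> R) : continuous A ->
  (forall x h v, A (h *: v + x) = h *: A' v + A x) ->
  Ck k f -> Ck k (fun x => f (A x)).
Proof.
move=> cA hA; elim: k f => [|k IH] f [cf Df]; split=> //.
- by move=> x; apply: (continuous_comp (cA x) (cf _)).
- by move=> x; apply: (continuous_comp (cA x) (cf _)).
move=> v; have [df Cf] := Df (A' v); split=> [x|].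
  exact: (derivable_affine hA).
have -> : (fun x => 'D_v (fun x => f (A x)) x) = (fun x => 'D_(A' v) f (A x)).
  by apply/funext => x; exact: derive_affine.
exact: (IH (fun x => 'D_(A' v) f x)).
Qed.

Lemma derive_R (f : R -> R) (x v : R) : derivable f x 1 ->
  derivable f x v /\ 'D_v f x = v * 'D_1 f x.
Proof.
move=> df; have dif : differentiable f x by exact/derivable1_diffP.
split; first exact: diff_derivable.
by rewrite !deriveE// -[v in LHS]mulr1 -[(v * 1)%R]/(v *: (1:R)) linearZ.
Qed.

(** In one variable every directional derivative is a multiple of the derivative,
    so it suffices that this derivative be of class C^k. *)
Lemma CkS_R k (f f' : R -> R) :
  (forall x : R, is_derive x (1 : R) f (f' x)) -> Ck k f' -> Ck k.+1 f.
Proof.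
move=> df Cf'; have d x : derivable f x 1 by apply: ex_derive.
split=> [x|v]; first exact/differentiable_continuous/derivable1_diffP.
split=> [x|]; first by have [] := derive_R v (d x).
have -> : (fun x => 'D_v f x) = (fun x => v * f' x).
  apply/funext => x; have [_ ->] := derive_R v (d x).
  by have -> : 'D_1 f x = f' x by apply: derive_val.
by apply: CkM => //; exact: Ck_cst.
Qed.

Lemma smooth_continuous V (f : V -> R) : smooth f -> continuous f.
Proof. by move=> /(_ 0%N) []. Qed.

Lemma smooth_derivable V (f : V -> R) x v : smooth f -> derivable f x v.
Proof. by move=> /(_ 1%N) [_ /(_ v)] []. Qed.

Lemma smooth_derive V (f : V -> R) v : smooth f -> smooth (fun x => 'D_v f x).
Proof. by move=> sf k; have [_ /(_ v) []] := sf k.+1. Qed.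

Lemma smooth_cst V (c : R) : smooth (fun _ : V => c).
Proof. by move=> k; exact: Ck_cst. Qed.

Lemma smoothD V (f g : V -> R) : smooth f -> smooth g -> smooth (fun x => f x + g x).
Proof. by move=> sf sg k; exact: CkD. Qed.

Lemma smoothM V (f g : V -> R) : smooth f -> smooth g -> smooth (fun x => f x * g x).
Proof. by move=> sf sg k; exact: CkM. Qed.

Lemma smoothZ V (c : R) (f : V -> R) : smooth f -> smooth (fun x => c * f x).
Proof. by move=> sf; apply: smoothM => //; exact: smooth_cst. Qed.

Lemma smoothN V (f : V -> R) : smooth f -> smooth (fun x => - f x).
Proof.
move=> sf; have -> : (fun x => - f x) = (fun x => (-1) * f x).
  by apply/funext => x; rewrite mulN1r.
exact: smoothZ.
Qed.

Lemma smoothB V (f g : V -> R) : smooth f -> smooth g -> smooth (fun x => f x - g x).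
Proof. by move=> sf sg; apply: smoothD => //; exact: smoothN. Qed.

Lemma smooth_sum V (I : Type) (r : seq I) (P : pred I) (f : I -> V -> R) :
  (forall i, smooth (f i)) -> smooth (fun x => \sum_(i <- r | P i) f i x).
Proof.
move=> sf; elim: r => [|i r IH].
  by under eq_fun do rewrite big_nil; exact: smooth_cst.
under eq_fun do rewrite big_cons.
by case: (P i) => //; exact: smoothD.
Qed.

Lemma smooth_prod V (I : Type) (r : seq I) (P : pred I) (f : I -> V -> R) :
  (forall i, smooth (f i)) -> smooth (fun x => \prod_(i <- r | P i) f i x).
Proof.
move=> sf; elim: r => [|i r IH].
  by under eq_fun do rewrite big_nil; exact: smooth_cst.
under eq_fun do rewrite big_cons.
by case: (P i) => //; exact: smoothM.
Qed.

Lemma smooth_affine U V (A A' : U -> V) (f : V -> R) : continuous A ->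
  (forall x h v, A (h *: v + x) = h *: A' v + A x) ->
  smooth f -> smooth (fun x => f (A x)).
Proof. by move=> cA hA sf k; exact: (Ck_affine cA hA). Qed.

Lemma smooth_R (f f' : R -> R) :
  (forall x : R, is_derive x (1 : R) f (f' x)) -> smooth f' -> smooth f.
Proof. by move=> df sf' [|k]; [apply: CkW|]; apply: (CkS_R df); exact: sf'. Qed.

Lemma Ck_expR k : Ck k (@expR R).
Proof.
elim: k => [|k IH]; first by split=> // x; exact: continuous_expR.
by apply: (CkS_R (f' := expR)) => // x; exact: is_derive_expR.
Qed.

Lemma Ck_sin_cos k : Ck k (@sin R) /\ Ck k (@cos R).
Proof.
elim: k => [|k [IHs IHc]].
  by split; split=> // x; [exact: continuous_sin|exact: continuous_cos].
split.
  by apply: (CkS_R (f' := cos)) => // x; exact: is_derive_sin.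
apply: (CkS_R (f' := fun x => (-1) * sin x)) => [x|].
  by rewrite mulN1r; exact: is_derive_cos.
by apply: CkM => //; exact: Ck_cst.
Qed.

Lemma smooth_expR : smooth (@expR R).
Proof. by move=> k; exact: Ck_expR. Qed.

Lemma smooth_sin : smooth (@sin R).
Proof. by move=> k; have [] := Ck_sin_cos k. Qed.

Lemma smooth_id : smooth (fun x : R => x).
Proof.
by apply: (smooth_R (f' := fun=> 1)); exact: smooth_cst.
Qed.

(** Induction on the order, through (f o g)' = (f' o g) g'. *)
Lemma smooth_comp_R (f g : R -> R) : smooth f -> smooth g -> smooth (fun x => f (g x)).
Proof.
move=> sf sg k; elim: k f sf => [|k IH] f sf.
  split=> // x; apply: continuous_comp; exact: smooth_continuous.
pose f' x := 'D_1 f x.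
apply: (@CkS_R k (fun x => f (g x)) (fun x => f' (g x) * 'D_1 g x)) => [x|].
  have dg : is_derive x 1 g ('D_1 g x) by apply/derivableP/smooth_derivable.
  have df : is_derive (g x) 1 f (f' (g x)) by apply/derivableP/smooth_derivable.
  by have := is_derive1_comp df dg.
by apply: CkM; [apply: IH; exact: smooth_derive|exact: smooth_derive].
Qed.

End CkCalculus.

(** * The flat exponential and the symmetry of second derivatives *)

Section Flat.
Context {R : realType}.

(** [flat 0] is exp (- 1 / x) extended by zero; the powers of 1 / x make the
    family closed under derivation. *)
Definition flat (j : nat) (x : R) : R :=
  if 0 < x then x^-1 ^+ j * expR (- x^-1) else 0.

Lemma flat_le0 j x : x <= 0 -> flat j x = 0.
Proof. by rewrite /flat ltNge => ->. Qed.

Lemma flat_ge0 j x : 0 <= flat j x.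
Proof.
rewrite /flat; case: ifPn => // x0.
by rewrite mulr_ge0 ?expR_ge0// exprn_ge0// invr_ge0 ltW.
Qed.

(** This is e^y >= (y / m)^m for y = 1 / x and m = j + 1. Applied to [flat j.+1],
    it gives the derivative of [flat j] at the origin. *)
Lemma flat_bound j x : flat j x <= j.+1%:R ^+ j.+1 * `|x|.
Proof.
rewrite /flat; case: ifPn => [x0|_]; last by rewrite mulr_ge0// exprn_ge0.
rewrite (gtr0_norm x0) -ler_pdivrMr// mulrAC -exprSr expRN.
rewrite ler_pdivrMr ?expR_gt0//.
have -> : expR x^-1 = expR (x^-1 / j.+1%:R) ^+ j.+1.
  by rewrite -expRM_natl; congr expR; rewrite mulrCA divff ?mulr1// pnatr_eq0.
rewrite -exprMn lerXn2r// ?nnegrE ?invr_ge0 ?(ltW x0)//.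
rewrite -ler_pdivrMl// mulrC; apply: le_trans (expR_ge1Dx _).
by rewrite lerDr.
Qed.

Lemma flat0_le1 x : flat 0 x <= 1.
Proof.
rewrite /flat; case: ifPn => // x0; rewrite expr0 mul1r -[leRHS]expR0.
by rewrite ler_expR oppr_le0 invr_ge0 ltW.
Qed.

Lemma flatS j x : flat j.+1 x = x^-1 * flat j x.
Proof. by rewrite /flat; case: ifPn; rewrite ?mulr0// exprS mulrA. Qed.

Lemma is_derive_flat j (x : R) :
  is_derive x (1 : R) (flat j) (flat j.+2 x - j%:R * flat j.+1 x).
Proof.
have [x0|x0|->] := ltgtP x 0.
- rewrite !flat_le0 ?ltW// mulr0 subr0.
  apply: (near_eq_is_derive (f := cst 0)).
  by near=> y; rewrite flat_le0//; near: y; have := lt_nbhsl x0; apply: filterS => z /ltW.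
- apply: (near_eq_is_derive (f := fun y : R => y^-1 ^+ j * expR (- y^-1))).
    by near=> y; rewrite /flat ifT//; near: y; exact: lt_nbhsr.
  have dV : is_derive x (1:R) (fun y : R => y^-1) (- x ^- 2).
    have := is_deriveV (f := id) (lt0r_neq0 x0) (is_derive_id x 1).
    by rewrite /GRing.scale /= mulr1.
  have dX := is_deriveX j dV.
  have dE : is_derive x (1:R) (fun y : R => expR (- y^-1)) (expR (- x^-1) * x ^- 2).
    have dN := is_deriveN dV.
    have := @is_derive1_comp _ expR (fun y : R => - y^-1) _ _ _ (is_derive_expR (- x^-1)) dN.
    by rewrite opprK.
  have EX : (fun y : R => y^-1) ^+ j = (fun y : R => y^-1 ^+ j).
    by apply/funext => y; elim: j {dX} => [|j IH]; rewrite ?expr0// !exprS -IH.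
  rewrite EX in dX.
  have dM : is_derive x (1 : R) (fun y : R => y^-1 ^+ j * expR (- y^-1)) _ :=
    is_deriveM dX dE.
  apply: (is_derive_eq dM).
  rewrite /flat x0 /GRing.scale /=.
  clear EX dX dM; rewrite -exprVn.
  by case: j => [|j] /=; rewrite ?exprS ?expr0; ring.
- rewrite !flat_le0// mulr0 subr0.
  set C : R := j.+1.+1%:R ^+ j.+1.+1.
  suff cv : (h^-1 *: (flat j (h *: (1:R) + 0) - flat j 0)) @[h --> 0^'] --> (0 : R).
    by apply: DeriveDef; [apply/cvg_ex; exists 0|exact/cvg_lim].
  apply/cvgrPdist_le => e e0.
  have C0 : 0 < C by rewrite exprn_gt0.
  near=> h.
  rewrite (flat_le0 _ (lexx 0)) subr0 addr0 sub0r normrN.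
  rewrite -[(h *: 1)%R]/(h * 1) mulr1 -[(_ *: _)%R]/(h^-1 * flat j h) -flatS.
  rewrite ger0_norm ?flat_ge0//; apply: (le_trans (flat_bound _ _)).
  rewrite -ler_pdivlMl// mulrC -/C.
  near: h; apply: dnbhs0_le; first by rewrite divr_gt0.
Unshelve. all: by end_near. Qed.

Lemma smooth_flat j : smooth (flat j).
Proof.
move=> k; elim: k j => [|k IH] j.
  split=> // x; apply: differentiable_continuous; apply/derivable1_diffP.
  by have := is_derive_flat j x => -[].
apply: (CkS_R (is_derive_flat j)).
have -> : (fun x => flat j.+2 x - j%:R * flat j.+1 x)
        = (fun x => flat j.+2 x + (- j%:R) * flat j.+1 x).
  by apply/funext => x; rewrite mulNr.
by apply: CkD => //; apply: CkM => //; exact: Ck_cst.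
Qed.

Lemma flat_cvg (y : R ^nat) (c : R) : 0 < c ->
  (\forall n \near \oo, c * n%:R <= y n) -> flat 0 (y n) @[n --> \oo] --> (1 : R).
Proof.
move=> c0 yl.
apply: (@squeeze_cvgr _ _ _ _ (fun n : nat => 1 - c^-1 / n%:R) (fun=> 1)).
- near=> n; rewrite flat0_le1 andbT.
  have n0 : 0 < n%:R :> R by rewrite ltr0n; near: n; exists 1%N.
  have cy : c * n%:R <= y n by near: n.
  have y0 : 0 < y n by apply: lt_le_trans cy; exact: mulr_gt0.
  rewrite /flat y0 expr0 mul1r; apply: (le_trans _ (expR_ge1Dx _)).
  by rewrite lerD2l lerN2 -invfM lef_pV2// posrE// mulr_gt0.
- rewrite -[X in _ --> X]subr0; apply: cvgB; first exact: cvg_cst.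
  rewrite -(mulr0 c^-1); apply: cvgM; first exact: cvg_cst.
  by apply/gtr0_cvgV0; [near=> n; rewrite ltr0n; near: n; exists 1%N|exact: cvgr_idn].
- exact: cvg_cst.
Unshelve. all: by end_near. Qed.

End Flat.

Section Lines.
Context {R : realType} {V : normedModType R}.

Lemma is_derive_line (f : V -> R) (y u : V) (s : R) : (forall x, derivable f x u) ->
  is_derive s (1 : R) (fun s : R => f (s *: u + y)) ('D_u f (s *: u + y)).
Proof.
move=> df.
have hA (x h v : R) : (h *: v + x) *: u + y = h *: (v *: u) + (x *: u + y).
  by rewrite scalerDl scalerA addrA.
apply: DeriveDef.
  apply: (derivable_affine (A := fun s : R => s *: u + y) (A' := fun v => v *: u)) => //.
  by rewrite scale1r.
by rewrite (derive_affine (A := fun s : R => s *: u + y) (A' := fun v => v *: u))// scale1r.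
Qed.

Lemma mean_value_line (f : V -> R) (y u : V) (h : R) : (forall x, derivable f x u) ->
  0 < h -> exists2 s : R, 0 <= s <= h & f (h *: u + y) - f y = h * 'D_u f (s *: u + y).
Proof.
move=> df h0.
have dl s : is_derive s (1 : R) (fun s : R => f (s *: u + y)) ('D_u f (s *: u + y)).
  exact: is_derive_line.
have [|s sh] := @MVT_segment _ (fun s : R => f (s *: u + y)) _ 0 h (ltW h0).
  apply: derivable_within_continuous => x _.
  by have := dl x => -[].
rewrite scale0r add0r subr0 => ->; exists s; last by rewrite mulrC.
by rewrite in_itv in sh.
Qed.

Let le_dist_half (x y z e : R) : `|x - y| <= e / 2 -> `|x - z| <= e / 2 -> `|z - y| <= e.
Proof.
move=> h1 h2; rewrite [e]splitr -(subrKA x) (le_trans (ler_normD _ _))// lerD//.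
by rewrite distrC.
Qed.

(** Schwarz's theorem. The mean value theorem, applied twice, makes the second
    difference of [f] along [u] and [v] equal to h^2 times either mixed derivative at
    a point that tends to [x] with h. *)
Lemma derive_comm (f : V -> R) (u v x : V) : smooth f ->
  'D_u ('D_v f) x = 'D_v ('D_u f) x.
Proof.
move=> sf.
have step (a b : V) : forall h : R, 0 < h -> exists s t : R,
  [/\ 0 <= s <= h, 0 <= t <= h &
  f (h *: a + (h *: b + x)) - f (h *: b + x) - f (h *: a + x) + f x =
    h * (h * 'D_b ('D_a f) (t *: b + (s *: a + x)))].
  move=> h h0.
  pose g y := f (h *: b + y) - f y.
  have dg y : derivable g y a /\ 'D_a g y = 'D_a f (h *: b + y) - 'D_a f y.
    have hA (z : V) (k : R) (w : V) : h *: b + (k *: w + z) = k *: w + (h *: b + z).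
      by rewrite addrCA.
    have d1 : derivable (fun y => f (h *: b + y)) y a.
      by apply: (derivable_affine (A' := id)) => //; exact: smooth_derivable.
    have d2 : derivable f y a by exact: smooth_derivable.
    split; first exact: derivableB d1 d2.
    rewrite (deriveB d1 d2).
    by congr (_ - _); rewrite (derive_affine (A' := id)).
  have [|s sh E] := @mean_value_line g x a h _ h0; first by move=> y; have [] := dg y.
  have [|t th E'] := @mean_value_line ('D_a f) (s *: a + x) b h _ h0.
    by move=> y; apply: smooth_derivable; exact: smooth_derive.
  exists s, t; split=> //.
  rewrite -E' -(dg (s *: a + x)).2 -E /g.
  by rewrite [h *: b + (h *: a + x)]addrCA; ring.
apply/eqP; rewrite -subr_eq0 -normr_le0; apply/ler_addgt0Pr => e e0; rewrite add0r.
have cts (a b : V) : exists2 r : R, 0 < r & forall h s t : R, 0 < h < r ->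
    0 <= s <= h -> 0 <= t <= h ->
    `|'D_b ('D_a f) (t *: b + (s *: a + x)) - 'D_b ('D_a f) x| <= e / 2.
  have sD : smooth ('D_b ('D_a f)) by do 2 apply: smooth_derive.
  have e20 : 0 < e / 2 by rewrite divr_gt0.
  have := smooth_continuous sD; move=> /(_ x) /cvgrPdist_le /(_ _ e20).
  move=> /nbhs_ballP[r /= r0 rP].
  have ab0 : 0 < `|a| + `|b| + 1 by rewrite ltr_wpDl ?addr_ge0.
  exists (r / (`|a| + `|b| + 1)); first exact: divr_gt0.
  move=> h s t /andP[h0 hr] /andP[s0 sh] /andP[t0 th].
  rewrite distrC; apply: rP; rewrite -ball_normE /=.
  rewrite (_ : x - _ = - (t *: b) - s *: a); last first.
    by rewrite addrA opprD addrCA subrr addr0 opprD.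
  have ht : `|t *: b| <= h * `|b| by rewrite normrZ (ger0_norm t0) ler_wpM2r.
  have hs : `|s *: a| <= h * `|a| by rewrite normrZ (ger0_norm s0) ler_wpM2r.
  rewrite ltr_pdivlMr// in hr; apply: le_lt_trans hr.
  rewrite (le_trans (ler_normB _ _))// normrN.
  rewrite (le_trans (lerD ht hs))// -mulrDr ler_wpM2l ?(ltW h0)// [`|b| + _]addrC.
  by rewrite lerDl.
have [r r0 C1] := cts u v; have [r' r0' C2] := cts v u.
pose h := Num.min r r' / 2.
have m0 : 0 < Num.min r r' by rewrite lt_min r0.
have h0 : 0 < h by rewrite divr_gt0.
have hm : h < Num.min r r' by rewrite ltr_pdivrMr// ltr_pMr// ltr1n.
have hr : 0 < h < r by rewrite h0 (lt_le_trans hm)// ge_min lexx.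
have hr' : 0 < h < r' by rewrite h0 (lt_le_trans hm)// ge_min lexx orbT.
have [s [t [sh th E]]] := step u v _ h0.
have [s' [t' [sh' th' E']]] := step v u _ h0.
have {E E'} EE : 'D_v ('D_u f) (t *: v + (s *: u + x)) = 'D_u ('D_v f) (t' *: u + (s' *: v + x)).
  apply: (@mulfI _ h); first by rewrite gt_eqF.
  apply: (@mulfI _ h); first by rewrite gt_eqF.
  apply: (etrans (esym E)); apply: (etrans _ E').
  by rewrite [h *: v + (h *: u + x)]addrCA; ring.
have H1 := C1 _ _ _ hr sh th; have H2 := C2 _ _ _ hr' sh' th'.
rewrite EE in H1; exact: le_dist_half H1 H2.
Qed.

End Lines.

(** * Test functions and iterated partial derivatives *)

Section Antiderivative.
Context {R : realType}.
Implicit Types eta : R -> R.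

Lemma continuous_integrable_itv (f : R -> R) (a b : R) : continuous f ->
  lebesgue_measure.-integrable `[a, b] (EFin \o f).
Proof.
move=> cf; apply: continuous_compact_integrable; first exact: segment_compact.
exact: continuous_subspaceT.
Qed.

(** The integral starts before [a], where [eta] vanishes, so that it is a primitive
    on the whole line. *)
Lemma antiderivative eta (a : R) : continuous eta -> (forall t, t <= a -> eta t = 0) ->
  exists Phi : R -> R, [/\ forall t : R, is_derive t (1 : R) Phi (eta t) &
    forall t, t <= a -> Phi t = 0].
Proof.
move=> ceta eta0; pose c := a - 1.
have ca : c < a by rewrite ltrBlDr ltrDl.
pose Phi t := \int[lebesgue_measure]_(s in `[c, t]) eta s.
have Phi0 t : t <= a -> Phi t = 0.
  move=> ta; rewrite /Phi (@eq_Rintegral _ _ _ _ _ (fun=> 0)).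
    by rewrite Rintegral_cst// mul0r.
  move=> s; rewrite inE/= in_itv/= => /andP[_ st].
  by rewrite eta0// (le_trans st).
exists Phi; split=> // t.
have [ct|tc] := ltP c t.
  have tt1 : t < t + 1 by rewrite ltrDl.
  have [dP eP] := @continuous_FTC1_closed _ eta c t (t + 1) tt1
    (continuous_integrable_itv c (t + 1) ceta) ct (ceta t).
  by apply: DeriveDef; [exact: dP|rewrite -derive1E].
have ta : t < a by apply: le_lt_trans ca.
rewrite eta0 ?(ltW ta)//; apply: (near_eq_is_derive (f := cst 0)).
by near=> y; rewrite Phi0//; apply/ltW; near: y; exact: lt_nbhsl.
Unshelve. all: by end_near. Qed.

Lemma constant_after (Phi eta : R -> R) (b t : R) :
  (forall t : R, is_derive t (1 : R) Phi (eta t)) -> (forall t, b <= t -> eta t = 0) ->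
  b <= t -> Phi t = Phi b.
Proof.
move=> dP eta0 bt.
have [|s sbt E] := @MVT_segment _ Phi eta b t bt.
  apply: derivable_within_continuous => x _.
  by have := dP x => -[].
apply/eqP; rewrite -subr_eq0 E eta0 ?mul0r//.
by move: sbt; rewrite in_itv/= => /andP[].
Qed.

End Antiderivative.

Section Bumps.
Context {R : realType}.

(** Smooth approximations of the indicator of ]a, b[ from inside. *)
Definition time_bump (a b : R) (n : nat) (t : R) : R :=
  flat 0 (n%:R * (t - a - n.+1%:R^-1)) * flat 0 (n%:R * (b - n.+1%:R^-1 - t)).

(** For 0 <= c <= 1 the product of sines is positive on ]c, 1[ and nonpositive on ]0, c],
    and it has period 1 since both factors change sign: smooth periodic approximations of
    the indicator of ]c, 1[. *)
Definition space_bump (c : R) (n : nat) (s : R) : R :=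
  flat 0 (n%:R * (sin (pi * (s - c)) * sin (pi * (1 - s)))).

Definition orthant_bump d (c : 'I_d -> R) (n : nat) (x : 'rV[R]_d) : R :=
  \prod_i space_bump (c i) n (x 0 i).

Lemma smooth_time_bump a b n : smooth (time_bump a b n).
Proof.
apply: smoothM.
  apply: (smooth_comp_R (f := flat 0)); first exact: smooth_flat.
  apply: smoothZ; apply: smoothB; last exact: smooth_cst.
  by apply: smoothB; [exact: smooth_id|exact: smooth_cst].
apply: (smooth_comp_R (f := flat 0)); first exact: smooth_flat.
by apply: smoothZ; apply: smoothB; [exact: smooth_cst|exact: smooth_id].
Qed.

Lemma time_bump_ge0 a b n t : 0 <= time_bump a b n t.
Proof. by rewrite mulr_ge0// flat_ge0. Qed.

Lemma time_bump_le1 a b n t : time_bump a b n t <= 1.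
Proof. by rewrite mulr_ile1// ?flat_ge0 ?flat0_le1. Qed.

Lemma time_bump_out a b n t :
  ~~ (a + n.+1%:R^-1 <= t <= b - n.+1%:R^-1) -> time_bump a b n t = 0.
Proof.
rewrite negb_and -!ltNge /time_bump => /orP[H|H].
  by rewrite flat_le0 ?mul0r// mulr_ge0_le0// -addrA -opprD subr_le0 ltW.
by rewrite [X in _ * X]flat_le0 ?mulr0// mulr_ge0_le0// subr_le0 ltW.
Qed.

Lemma cvg_affine_flat (y : R) :
  0 < y -> flat 0 (n%:R * (y - n.+1%:R^-1)) @[n --> \oo] --> (1 : R).
Proof.
move=> y0; apply: (@flat_cvg _ _ (y / 2)); first exact: divr_gt0.
have y2 : 0 < y / 2 by rewrite divr_gt0.
have := @cvg_harmonic R; move=> /cvgrPdist_le /(_ _ y2) [N _ HN].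
exists N => // n Nn; rewrite mulrC ler_wpM2l//.
have := HN _ Nn; rewrite /= sub0r normrN ger0_norm ?invr_ge0// => h.
by rewrite lerBrDr {2}[y]splitr lerD2l.
Qed.

Lemma cvg_time_bump a b t :
  time_bump a b n t @[n --> \oo] --> ((a < t < b)%R%:R : R).
Proof.
have [/andP[ta tb]|H] := boolP (a < t < b).
  rewrite [X in _ --> X](_ : _ = 1 * 1); last by rewrite mulr1.
  apply: cvgM; first by apply: cvg_affine_flat; rewrite subr_gt0.
  under eq_fun do rewrite addrAC.
  by apply: cvg_affine_flat; rewrite subr_gt0.
rewrite [X in X @ _](_ : _ = fun=> 0); first exact: cvg_cst.
apply/funext => n; apply: time_bump_out; apply: contra H => /andP[h1 h2].
have n0 : 0 < n.+1%:R^-1 :> R by rewrite invr_gt0.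
by rewrite (lt_le_trans _ h1) ?ltrDl// (le_lt_trans h2)// ltrBlDr ltrDl.
Qed.

Lemma smooth_space_bump c n : smooth (space_bump c n).
Proof.
apply: (smooth_comp_R (f := flat 0)); first exact: smooth_flat.
apply: smoothZ; apply: smoothM.
  apply: (smooth_comp_R (f := sin)); first exact: smooth_sin.
  by apply: smoothZ; apply: smoothB; [exact: smooth_id|exact: smooth_cst].
apply: (smooth_comp_R (f := sin)); first exact: smooth_sin.
by apply: smoothZ; apply: smoothB; [exact: smooth_cst|exact: smooth_id].
Qed.

Lemma space_bump_periodic c n s : space_bump c n (s + 1) = space_bump c n s.
Proof.
rewrite /space_bump (_ : pi * (s + 1 - c) = pi * (s - c) + pi); last by ring.
rewrite (_ : pi * (1 - s) = pi * (1 - (s + 1)) + pi); last by ring.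
by rewrite !sinDpi !mulNr !mulrN.
Qed.

Lemma cvg_space_bump c s : 0 <= c <= 1 -> 0 < s < 1 ->
  space_bump c n s @[n --> \oo] --> ((c < s)%R%:R : R).
Proof.
move=> /andP[c0 c1] /andP[s0 s1].
have p0 := pi_gt0 R.
have s2 : 0 < sin (pi * (1 - s)).
  by rewrite sin_gt0_pi// mulr_gt0 ?subr_gt0//= gtr_pMr// ltrBlDr ltrDl.
case: ltP => cs.
  apply: flat_cvg; last by near=> n; rewrite mulrC.
  rewrite mulr_gt0// sin_gt0_pi// mulr_gt0 ?subr_gt0//= gtr_pMr//.
  by rewrite ltrBlDr; apply: (lt_le_trans s1); rewrite lerDl.
rewrite [X in X @ _](_ : _ = fun=> 0); first exact: cvg_cst.
apply/funext => n; rewrite /space_bump flat_le0// mulr_ge0_le0//.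
rewrite mulr_le0_ge0//; last exact: ltW.
rewrite -opprB mulrN sinN oppr_le0 sin_ge0_pi// mulr_ge0 ?subr_ge0 ?(ltW p0)//=.
by rewrite ger_pMr// lerBlDr; apply: (le_trans c1); rewrite lerDl ltW.
Unshelve. all: by end_near. Qed.

Variable d : nat.
Implicit Types (c : 'I_d -> R).

Lemma coord_affine (i : 'I_d) (x : 'rV[R]_d) (h : R) (v : 'rV[R]_d) :
  (h *: v + x) 0 i = h *: (v 0 i) + x 0 i.
Proof. by rewrite !mxE. Qed.

Lemma smooth_coord (f : R -> R) (i : 'I_d) :
  smooth f -> smooth (fun x : 'rV[R]_d => f (x 0 i)).
Proof.
apply: (smooth_affine (A' := fun v : 'rV[R]_d => v 0 i)).
  by move=> x; exact: coord_continuous.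
by move=> *; exact: coord_affine.
Qed.

Lemma smooth_orthant_bump c n : smooth (orthant_bump c n).
Proof. by apply: smooth_prod => i; apply: smooth_coord; exact: smooth_space_bump. Qed.

Lemma orthant_bump_periodic c n : periodic (orthant_bump c n).
Proof.
move=> x i; apply: eq_bigr => j _; rewrite !mxE eqxx/=.
by have [->|] := eqVneq j i; rewrite ?space_bump_periodic// addr0.
Qed.

Lemma orthant_bump_ge0 c n x : 0 <= orthant_bump c n x.
Proof. by apply: prodr_ge0 => i _; exact: flat_ge0. Qed.

Lemma orthant_bump_le1 c n x : orthant_bump c n x <= 1.
Proof. by apply: prodr_ile1 => i; rewrite flat_ge0 flat0_le1. Qed.

Lemma cvg_orthant_bump c (x : 'rV[R]_d) : (forall i, 0 <= c i <= 1) -> (forall i, 0 < x 0 i < 1) ->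
  orthant_bump c n x @[n --> \oo] --> ([forall i, (c i < x 0 i)%R]%:R : R).
Proof.
move=> hc hx.
have -> : [forall i, (c i < x 0 i)%R]%:R = \prod_i (c i < x 0 i)%R%:R :> R.
  case: (boolP [forall i, c i < x 0 i]) => [/forallP H|].
    by rewrite big1// => i _; rewrite H.
  rewrite negb_forall => /existsP[i /negbTE Hi].
  by rewrite (bigD1 i)//= Hi mul0r.
rewrite /orthant_bump; elim: (index_enum _) => [|i r IH].
  by under eq_fun do rewrite big_nil; rewrite big_nil; exact: cvg_cst.
under eq_fun do rewrite big_cons.
by rewrite big_cons; apply: cvgM => //; exact: cvg_space_bump.
Qed.

End Bumps.

Lemma sub_continuous (R : realType) (V : normedModType R) (z : V) :
  continuous (fun x => z - x).
Proof. by move=> x; apply: cvgB; [exact: cvg_cst|exact: cvg_id]. Qed.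

Section MultiPartial.
Context {R : realType} {d : nat}.
Implicit Types (f g : 'rV[R]_d -> R) (s : seq 'I_d).

Definition partials s f := foldr (@partial R d) f s.

(** Lists of directions carry the inductions; multi-indices only count them. *)
Lemma multi_partialE (a : 'I_d -> nat) : exists s, size s = (\sum_i a i)%N /\
  forall f, multi_partial a f = partials s f.
Proof.
exists (flatten [seq nseq (a i) i | i <- enum 'I_d]); split.
  rewrite size_flatten /shape -map_comp sumnE big_map big_enum.
  by apply: eq_bigr => i _; rewrite /= size_nseq.
move=> f; rewrite /multi_partial /partials.
elim: (enum 'I_d) => //= i e ->.
by rewrite foldr_cat; elim: (a i) => //= k ->.
Qed.

Lemma smooth_partials s f : smooth f -> smooth (partials s f).
Proof. by move=> sf; elim: s => //= i s IH; exact: smooth_derive. Qed.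

Lemma partials_periodic s f : smooth f -> periodic f -> periodic (partials s f).
Proof.
move=> sf pf; elim: s => //= i s IH x j.
rewrite /partial; have sg := smooth_partials s sf.
rewrite -(derive_affine (A := fun y => y + delta_mx 0 j) (A' := id))//; last first.
  by move=> *; rewrite addrA.
by rewrite (_ : (fun _ => _) = partials s f)//; apply/funext => y; exact: IH.
Qed.

Lemma partialsZ s c f : smooth f ->
  partials s (fun x => c * f x) = fun x => c * partials s f x.
Proof.
move=> sf; elim: s => //= i s ->; apply/funext => x.
by rewrite /partial deriveZ//; apply: smooth_derivable; exact: smooth_partials.
Qed.

Lemma reflect_affine (z x : 'rV[R]_d) (h : R) v :
  z - (h *: v + x) = h *: (- v) + (z - x).
Proof. by rewrite opprD addrCA scalerN. Qed.

Lemma reflect_continuous (z : 'rV[R]_d) : continuous (fun x : 'rV[R]_d => z - x).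
Proof. exact: sub_continuous. Qed.

Lemma smooth_reflect z f : smooth f -> smooth (fun y => f (z - y)).
Proof.
apply: (smooth_affine (A' := -%R)); first exact: reflect_continuous.
by move=> *; exact: reflect_affine.
Qed.

Lemma periodicN f : periodic f -> forall x i, f (x - delta_mx 0 i) = f x.
Proof. by move=> pf x i; rewrite -[in RHS](subrK (delta_mx 0 i) x) pf. Qed.

Lemma periodic_reflect z f : periodic f -> periodic (fun y => f (z - y)).
Proof. by move=> pf y i; rewrite opprD addrA periodicN. Qed.

Lemma derive_opp_dir f v x : smooth f -> 'D_(- v) f x = - 'D_v f x.
Proof.
move=> sf; rewrite -scaleN1r.
have dl : derivable (fun t : R => f (t *: v + x)) 0 1.
  have df y : derivable f y v by exact: smooth_derivable.
  by have := is_derive_line x 0 df => -[].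
have [_] := derive_R (-1) dl.
have hA (a h b : R) : (h *: b + a) *: v + x = h *: (b *: v) + (a *: v + x).
  by rewrite scalerDl scalerA addrA.
rewrite !(derive_affine (A := fun t : R => t *: v + x) (A' := fun t : R => t *: v))//.
by rewrite !scale0r !add0r scale1r mulN1r.
Qed.

Lemma partials_reflect s z f : smooth f ->
  partials s (fun y => f (z - y)) = fun y => (-1) ^+ size s * partials s f (z - y).
Proof.
move=> sf; elim: s => [|i s IH] /=; first by apply/funext => y; rewrite mul1r.
rewrite IH; apply/funext => y; have sg := smooth_partials s sf.
have sr := smooth_reflect z sg.
rewrite /partial deriveZ; last exact: smooth_derivable.
rewrite (derive_affine (A := fun y => z - y) (A' := -%R)); last first.
  by move=> *; exact: reflect_affine.
rewrite derive_opp_dir//.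
by rewrite exprS mulN1r scalerN mulNr.
Qed.

Implicit Types Psi : R * 'rV[R]_d -> R.

(** Spatial derivatives are taken as directional derivatives of the joint function of
    (t, x), so that [derive_comm] exchanges them with [dt]. *)
Definition st_partials s Psi := 
  foldr (fun i (g : R * 'rV[R]_d -> R) (z : R * 'rV[R]_d) =>
    'D_((0, delta_mx 0 i) : R * 'rV[R]_d) g z) Psi s.

Lemma smooth_st_partials s Psi : smooth Psi -> smooth (st_partials s Psi).
Proof. by move=> sf; elim: s => //= i s IH; exact: smooth_derive. Qed.

Lemma slice_affine (t : R) (x : 'rV[R]_d) (h : R) (v : 'rV[R]_d) :
  (t, h *: v + x) = h *: ((0, v) : R * 'rV[R]_d) + (t, x).
Proof. by congr pair; rewrite /= scaler0 add0r. Qed.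

Lemma slice_continuous (t : R) : continuous (fun x : 'rV[R]_d => (t, x)).
Proof. by move=> x; apply: (@cvg_pair _ _ _ (nbhs x) (nbhs t) (nbhs x)); [exact: cvg_cst|exact: cvg_id]. Qed.

Lemma smooth_slice t Psi : smooth Psi -> smooth (fun x => Psi (t, x)).
Proof.
apply: (smooth_affine (A' := fun v => (0, v))); first exact: slice_continuous.
by move=> *; exact: slice_affine.
Qed.

Lemma tslice_affine (x : 'rV[R]_d) (t h v : R) :
  (h *: v + t, x) = h *: ((v, 0) : R * 'rV[R]_d) + (t, x).
Proof. by congr pair; rewrite /= scaler0 add0r. Qed.

Lemma tslice_continuous (x : 'rV[R]_d) : continuous (fun t : R => (t, x)).
Proof. by move=> t; apply: (@cvg_pair _ _ _ (nbhs t) (nbhs t) (nbhs x)); [exact: cvg_id|exact: cvg_cst]. Qed.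

Lemma smooth_tslice x Psi : smooth Psi -> smooth (fun t => Psi (t, x)).
Proof.
apply: (smooth_affine (A' := fun v : R => (v, 0))); first exact: tslice_continuous.
by move=> *; exact: tslice_affine.
Qed.

Lemma partials_slice s t Psi : smooth Psi ->
  partials s (fun x => Psi (t, x)) = fun x => st_partials s Psi (t, x).
Proof.
move=> sP; elim: s => //= i s ->; apply/funext => x.
rewrite /partial (derive_affine (A := fun x => (t, x)) (A' := fun v => (0, v)))//.
by move=> *; exact: slice_affine.
Qed.

Lemma is_derive_tslice x Psi (t : R) : smooth Psi ->
  is_derive t (1 : R) (fun t => Psi (t, x)) (dt Psi (t, x)).
Proof.
move=> sP; have hA := tslice_affine x.
apply: DeriveDef; last first.
  by rewrite (derive_affine (A := fun t => (t, x)) (A' := fun v : R => (v, 0))).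
by apply: (derivable_affine (A := fun t => (t, x)) (A' := fun v : R => (v, 0))) => //;
  exact: smooth_derivable.
Qed.

Lemma smooth_dt Psi : smooth Psi -> smooth (dt Psi).
Proof. exact: smooth_derive. Qed.

Lemma dt_st_partials s Psi : smooth Psi ->
  dt (st_partials s Psi) = st_partials s (dt Psi).
Proof.
move=> sP; elim: s => //= i s <-; apply/funext => z.
by rewrite /dt derive_comm//; exact: smooth_st_partials.
Qed.

Lemma smooth_fst (f : R -> R) : smooth f -> smooth (fun z : R * 'rV[R]_d => f z.1).
Proof.
by apply: (smooth_affine (A' := fst)) => [x|//]; exact: cvg_fst.
Qed.

Lemma smooth_snd (f : 'rV[R]_d -> R) : smooth f -> smooth (fun z : R * 'rV[R]_d => f z.2).
Proof.
by apply: (smooth_affine (A' := snd)) => [x|//]; exact: cvg_snd.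
Qed.

End MultiPartial.

(** * Borel sets of R^d and the law of the torus *)

(** An open set is a countable union of balls with centres in a dense sequence and
    radii 1 / (k + 1). *)
Lemma open_measurable_separable (R : realType) (T : pseudoMetricType R)
    (M : set (set T)) (I : countType) (D : I -> T) :
  M set0 -> (forall F : (set T)^nat, (forall n, M (F n)) -> M (\bigcup_n F n)) ->
  (forall i (e : R), 0 < e -> M (ball (D i) e)) ->
  (forall x (e : R), 0 < e -> exists i, ball x e (D i)) ->
  forall U, open U -> M U.
Proof.
move=> M0 MU MB dense U oU.
pose F (n : nat) : set T := if unpickle n is Some (i, k) then
  (if `[< ball (D i) (k.+1%:R^-1) `<=` U >] then ball (D i) (k.+1%:R^-1) else set0)
  else set0.
have -> : U = \bigcup_n F n.
  apply/seteqP; split=> [x Ux|x [n _]]; last first.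
    rewrite /F; case: (unpickle n) => [[i k]|//].
    by case: asboolP => // h /h.
  have [e e0 eU] : exists2 e : R, 0 < e & ball x e `<=` U.
    by have /nbhs_ballP[e /= e0 eU] := open_nbhs_nbhs (conj oU Ux); exists e.
  have e20 : 0 < e / 2 by rewrite divr_gt0.
  have [k ke] : exists k : nat, k.+1%:R^-1 < e / 2.
    have [k _ /(_ k (leqnn _)) kP] := near_infty_natSinv_lt (PosNum e20).
    by exists k.
  have [i xi] := dense x k.+1%:R^-1 (ltac:(by rewrite invr_gt0)).
  exists (pickle (i, k)) => //; rewrite /F pickleK.
  case: asboolP => [_|[]]; first exact: ball_sym.
  move=> y iy; apply: eU; rewrite [e]splitr; apply: ball_triangle.
    exact: le_ball (ltW ke) _ xi.
  exact: le_ball (ltW ke) _ iy.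
apply: MU => n; rewrite /F; case: (unpickle n) => // -[i k].
by case: asboolP => // _; exact: MB.
Qed.

Section RowMeasurable.
Context {R : realType}.

Lemma ball_rV n (x y : 'rV[R]_n) (e : R) : 0 < e ->
  ball x e y <-> forall j, `|x 0 j - y 0 j| < e.
Proof.
move=> e0; split=> [[_ H] j|H]; first exact: H.
by split=> // i j; rewrite ord1; exact: H.
Qed.

Lemma measurable_rV_ball n (x : 'rV[R]_n) (e : R) : 0 < e -> measurable (ball x e).
Proof.
move=> e0.
have -> : ball x e = \bigcap_(j in [set: 'I_n]) ((fun y : 'rV[R]_n => y 0 j) @^-1` ball (x 0 j) e).
  apply/seteqP; split=> y; first by move/(ball_rV _ _ e0) => H j _; exact: H.
  by move=> H; apply/(ball_rV _ _ e0) => j; exact: (H j).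
apply: fin_bigcap_measurable => // j _.
rewrite -[X in measurable X]setTI; apply: measurable_coord => //.
by apply: open_measurable; exact: ball_open.
Qed.

Lemma rV_ratr_dense n (x : 'rV[R]_n) (e : R) : 0 < e ->
  exists q : 'rV[rat]_n, ball x e (map_mx ratr q).
Proof.
move=> e0.
have /choice[f fP] : forall j, exists q : rat, ratr q \in `]x 0 j, (x 0 j + e)[.
  by move=> j; apply: rat_in_itvoo; rewrite ltrDl.
exists (\row_j f j); apply/(ball_rV _ _ e0) => j; rewrite !mxE distrC.
have := fP j; rewrite in_itv/= => /andP[h1 h2].
by rewrite ger0_norm ?subr_ge0 ?(ltW h1)// ltrBlDl.
Qed.

Lemma open_measurable_rV n (U : set 'rV[R]_n) : open U -> measurable U.
Proof.
apply: (@open_measurable_separable R 'rV[R]_n measurable _ (map_mx ratr)) => //.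
- by move=> F mF; exact: bigcupT_measurable.
- by move=> *; exact: measurable_rV_ball.
- by move=> *; exact: rV_ratr_dense.
Qed.

Lemma continuous_measurable_rV n (phi : 'rV[R]_n -> R) :
  continuous phi -> measurable_fun setT phi.
Proof.
move=> cphi; apply: (measurability (@RGenOpens.G R)).
  exact: RGenOpens.measurableE.
move=> _ [_ [a [b ->]] <-]; rewrite setTI; apply: open_measurable_rV.
by apply: open_comp => //; exact: interval_open.
Qed.

Lemma measurable_rV_comp d (T : measurableType d) (D : set T) n
    (f : T -> 'rV[R]_n) (phi : 'rV[R]_n -> R) : measurable D ->
  (forall i, measurable_fun D (fun z => f z 0 i)) -> continuous phi ->
  measurable_fun D (phi \o f).
Proof.
move=> mD mf cphi.
pose g z : 'rV[R]_n := if z \in D then f z else 0.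
have mg : measurable_fun setT g.
  apply: measurable_fun_rVP => i.
  have -> : (fun t => g t 0 i) = (fun z => f z 0 i) \_ D.
    by apply/funext => z; rewrite /g patchE; case: ifPn; rewrite // mxE.
  exact/(measurable_restrictT _ mD).
apply: (eq_measurable_fun (phi \o g)).
  by move=> z zD /=; rewrite /g zD.
apply: measurable_funTS; apply: measurableT_comp mg.
exact: continuous_measurable_rV.
Qed.

Lemma open_measurable_st d (U : set (R * 'rV[R]_d)) : open U ->
  @measurable _ (measurableTypeR R * 'rV[R]_d)%type U.
Proof.
apply: (open_measurable_separable (M := @measurable _ (measurableTypeR R * 'rV[R]_d)%type)
  (D := fun q : rat * 'rV[rat]_d => (ratr q.1, map_mx ratr q.2) : R * 'rV[R]_d)) => //.
- by move=> F mF; exact: bigcupT_measurable.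
- move=> i e e0.
  rewrite (_ : ball _ e = ball (ratr i.1 : R) e `*` ball (map_mx ratr i.2 : 'rV[R]_d) e)//.
  apply: measurableX; last exact: measurable_rV_ball.
  by apply: open_measurable; exact: ball_open.
- move=> [t x] e e0.
  have [q qP] := rV_ratr_dense x e0.
  have [p pP] : exists p : rat, ratr p \in `]t, (t + e)[.
    by apply: rat_in_itvoo; rewrite ltrDl.
  exists (p, q); split=> //=; rewrite /ball /= distrC.
  move: pP; rewrite in_itv/= => /andP[h1 h2].
  by rewrite ger0_norm ?subr_ge0 ?(ltW h1)// ltrBlDl.
Qed.

Lemma continuous_measurable_st d (phi : R * 'rV[R]_d -> R) : continuous phi ->
  @measurable_fun _ _ (measurableTypeR R * 'rV[R]_d)%type _ setT phi.
Proof.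
move=> cphi; apply: (measurability (@RGenOpens.G R)).
  exact: RGenOpens.measurableE.
move=> _ [_ [a [b ->]] <-]; rewrite setTI; apply: open_measurable_st.
by apply: open_comp => //; exact: interval_open.
Qed.

(** A pi-system that generates the Borel sets and whose indicators are limits of smooth
    periodic functions on the fundamental cell. *)
Definition orthants d : set (set 'rV[R]_d) :=
  [set A | exists c : 'I_d -> R, A = [set x : 'rV[R]_d | forall i, c i < x 0 i]].

Definition st_orthants d : set (set (R * 'rV[R]_d)) :=
  [set A | exists (a : R) (c : 'I_d -> R),
     A = [set z : R * 'rV[R]_d | a < z.1 /\ forall i, c i < z.2 0 i]].

Lemma orthants_setI d : setI_closed (@orthants d).
Proof.
move=> _ _ [c ->] [c' ->]; exists (fun i => Num.max (c i) (c' i)).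
apply/seteqP; split=> [x [h h'] i|x h]; first by rewrite gt_max h h'.
by split=> i; have := h i; rewrite gt_max => /andP[].
Qed.

Lemma st_orthants_setI d : setI_closed (@st_orthants d).
Proof.
move=> _ _ [a [c ->]] [a' [c' ->]]; exists (Num.max a a'), (fun i => Num.max (c i) (c' i)).
apply/seteqP; split=> [x [[ha h] [ha' h']]|x [ha h]].
  by split=> [|i]; rewrite gt_max ?h ?h' ?ha ?ha'.
by move: ha; rewrite gt_max => /andP[ha ha']; split; split=> // i; have := h i;
  rewrite gt_max => /andP[].
Qed.

Lemma exists_lt_coords d (x : 'rV[R]_d) : exists n : nat, forall i, - n%:R < x 0 i.
Proof.
exists (Num.bound (\sum_j `|x 0 j|)) => i; rewrite ltrNl.
apply: le_lt_trans (archi_boundP _); last by apply: sumr_ge0.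
rewrite (le_trans (ler_norm _))// normrN (bigD1 i)//= lerDl.
exact: sumr_ge0.
Qed.

Let coord_gt_bigcup d (i : 'I_d) (a : R) : [set x : 'rV[R]_d | a < x 0 i] =
  \bigcup_n [set x | forall j, (if j == i then a else - n%:R) < x 0 j].
Proof.
apply/seteqP; split=> [x /= ax|x [n _ /(_ i)]]; last by rewrite eqxx.
have [n nP] := exists_lt_coords x.
by exists n => // j; case: eqP => [->|].
Qed.

Lemma measurable_gt_ray d (T : measurableType d) (f : T -> R) :
  (forall a, measurable (f @^-1` `]a, +oo[)) -> measurable_fun setT f.
Proof.
move=> mf; apply: (measurability (@RGenOInfty.G R)).
  exact: RGenOInfty.measurableE.
by move=> _ [_ [a ->] <-]; rewrite setTI.
Qed.

Lemma measurable_orthants d : @measurable _ 'rV[R]_d = <<s @orthants d >>.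
Proof.
apply/seteqP; split; last first.
  apply: smallest_sub; first exact: sigma_algebra_measurable.
  move=> _ [c ->].
  have -> : [set x : 'rV[R]_d | forall i, c i < x 0 i] =
      \bigcap_(i in [set: 'I_d]) ((fun y : 'rV[R]_d => y 0 i) @^-1` `]c i, +oo[).
    apply/seteqP; split=> x h i; first by move=> _ /=; rewrite in_itv/= andbT; exact: h.
    by have := h i I; rewrite /= in_itv/= andbT.
  apply: fin_bigcap_measurable => // i _.
  by rewrite -[X in measurable X]setTI; exact: measurable_coord.
move=> A mA.
pose T := g_sigma_algebraType (@orthants d).
have mid : measurable_fun setT (id : T -> 'rV[R]_d).
  apply: measurable_fun_rVP => i; apply: measurable_gt_ray => a.
  rewrite (_ : _ @^-1` _ = [set x : 'rV[R]_d | a < x 0 i]); last first.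
    by apply/seteqP; split=> x /=; rewrite in_itv/= andbT.
  rewrite coord_gt_bigcup; apply: bigcupT_measurable => n.
  apply: sub_sigma_algebra; eexists (fun j => if j == i then a else - n%:R).
  by [].
by have := mid measurableT _ mA; rewrite setTI preimage_id.
Qed.

Lemma measurable_st_orthants d :
  @measurable _ (measurableTypeR R * 'rV[R]_d)%type = <<s @st_orthants d >>.
Proof.
apply/seteqP; split; last first.
  apply: smallest_sub; first exact: sigma_algebra_measurable.
  move=> _ [a [c ->]].
  have -> : [set z : R * 'rV[R]_d | a < z.1 /\ forall i, c i < z.2 0 i] =
      `]a, +oo[%classic `*` [set x : 'rV[R]_d | forall i, c i < x 0 i].
    by apply/seteqP; split=> x /= [h1 h2]; split=> //; move: h1; rewrite in_itv/= andbT.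
  apply: measurableX => //; rewrite measurable_orthants.
  by apply: sub_sigma_algebra; exists c.
move=> A mA.
pose T := g_sigma_algebraType (@st_orthants d).
have mid : measurable_fun setT (fun z : T => (z.1, z.2) : measurableTypeR R * 'rV[R]_d).
  apply: measurable_fun_pair.
    apply: measurable_gt_ray => a.
    rewrite (_ : _ @^-1` _ = \bigcup_n [set z : R * 'rV[R]_d | a < z.1 /\ forall i, - n%:R < z.2 0 i]).
      apply: bigcupT_measurable => n.
      by apply: sub_sigma_algebra; exists a, (fun=> - n%:R).
    apply/seteqP; split=> z /=; rewrite in_itv/= andbT; last by move=> [n _ []].
    by move=> az; have [n nP] := exists_lt_coords z.2; exists n.
  apply: measurable_fun_rVP => i; apply: measurable_gt_ray => a.
  rewrite (_ : _ @^-1` _ = \bigcup_n [set z : R * 'rV[R]_d | - n%:R < z.1 /\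
      forall j, (if j == i then a else - n%:R) < z.2 0 j]).
    apply: bigcupT_measurable => n.
    by apply: sub_sigma_algebra; exists (- n%:R), (fun j => if j == i then a else - n%:R).
  apply/seteqP; split=> z /=; rewrite in_itv/= andbT; last first.
    by move=> [n _ [_ /(_ i)]]; rewrite eqxx.
  move=> az; have [n nP] := exists_lt_coords z.2.
  pose m := maxn n (Num.bound `|z.1|).
  have mn : n%:R <= m%:R :> R by rewrite ler_nat leq_maxl.
  exists m => //; split.
    rewrite ltrNl; apply: (@lt_le_trans _ _ (Num.bound `|z.1|)%:R).
      by apply: (le_lt_trans (ler_norm _)); rewrite normrN; exact: archi_boundP.
    by rewrite ler_nat leq_maxr.
  by move=> j; case: eqP => [->//|_]; apply: le_lt_trans (nP j); rewrite lerN2.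
have := mid measurableT _ mA; rewrite setTI.
by rewrite (_ : _ @^-1` _ = A)//; apply/seteqP; split=> -[].
Qed.

End RowMeasurable.

Section TorusLaw.
Context {R : realType}.

Lemma torus_coord d (i : 'I_d) (A : set R) : measurable A ->
  torus R d ((fun x : 'rV[R]_d => x 0 i) @^-1` A) = lebesgue_measure (A `&` `[0%R, 1%R[).
Proof.
elim: d i => [[]//|d IH] i mA; rewrite /= /pushforward.
have -> : cons_rV @^-1` ((fun x : 'rV[R]_d.+1 => x 0 i) @^-1` A) =
    (if unlift ord0 i is Some j then setT `*` ((fun x : 'rV[R]_d => x 0 j) @^-1` A)
     else (A : set (measurableTypeR R)) `*` setT).
  apply/seteqP; split=> -[s x] /=; rewrite /cons_rV mxE; case: unliftP => [j|] _ //=.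
  - by case.
  - by case.
case: unliftP => [j|] _.
  have mj : measurable ((fun x : 'rV[R]_d => x 0 j) @^-1` A).
    by rewrite -[X in measurable X]setTI; exact: measurable_coord.
  rewrite product_measure1E//= IH// [X in (X * _)%E](_ : _ = 1%E) ?mul1e//.
  by rewrite /mrestr setTI lebesgue_measure_itv/= lte_fin ltr01 oppr0 adde0.
by rewrite product_measure1E//= [X in (_ * X)%E]probability_setT mule1.
Qed.

Lemma torus_ae_interior d : {ae torus R d, forall x : 'rV[R]_d, forall i, 0 < x 0 i < 1}.
Proof.
apply: filter_forall => i.
exists ((fun x : 'rV[R]_d => x 0 i) @^-1` ~` `]0, 1[); split.
- rewrite -[X in measurable X]setTI; apply: measurable_coord => //.
  by apply: measurableC; exact: measurable_itv.
- rewrite torus_coord; last by apply: measurableC; exact: measurable_itv.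
  rewrite (_ : _ `&` _ = [set 0%R]) ?lebesgue_measure_set1//.
  apply/seteqP; split=> x /=; rewrite !in_itv/=; last by move=> ->; rewrite ltxx lexx ltr01.
  move=> [/negP h /andP[x0 x1]]; apply/eqP; rewrite eq_le x0 andbT leNgt.
  by move: h; rewrite x1 andbT.
- by move=> x /= H; rewrite in_itv.
Qed.

Lemma torus_ae_neq d (c : 'I_d -> R) : {ae torus R d, forall x : 'rV[R]_d, forall i, x 0 i != c i}.
Proof.
apply: filter_forall => i.
exists ((fun x : 'rV[R]_d => x 0 i) @^-1` [set c i]); split.
- by rewrite -[X in measurable X]setTI; exact: measurable_coord.
- rewrite torus_coord//; apply/eqP; rewrite eq_le measure_ge0 andbT.
  rewrite -(lebesgue_measure_set1 (c i)); apply: le_measure; rewrite ?inE//.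
  by apply: measurableI => //; exact: measurable_itv.
- by move=> x /= /negP; rewrite negbK => /eqP.
Qed.

Local Open Scope ereal_scope.

(** Induction on [d] with Tonelli's theorem, as [torus] is built one coordinate at a time. *)
Lemma torus_prod d (theta : 'I_d -> R -> R) :
  (forall i s, (0 <= theta i s)%R) -> (forall i, measurable_fun setT (theta i)) ->
  \int[torus R d]_x (\prod_i theta i (x 0%R i))%:E =
  \prod_i \int[lebesgue_measure]_(s in `[0%R, 1%R[) (theta i s)%:E.
Proof.
elim: d theta => [|d IH] theta t0 mt.
  under eq_integral do rewrite big_ord0.
  by rewrite big_ord0 integral_cst// mul1e; exact: probability_setT.
rewrite /= big_ord_recl -IH//.
have mprod n (th : 'I_n -> R -> R) : (forall i, measurable_fun setT (th i)) ->
    measurable_fun setT (fun x : 'rV[R]_n => (\prod_i th i (x 0%R i))%:E).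
  move=> mth; apply/measurable_EFinP; apply: measurable_prod => i _.
  by apply: measurableT_comp => //; exact: measurable_coord.
rewrite ge0_integral_pushforward//; last 3 first.
- exact: measurable_cons_rV.
- exact: mprod.
- by move=> x _; rewrite lee_fin; apply: prodr_ge0.
rewrite preimage_setT.
have mind : measurable_fun setT ((fun x : 'rV[R]_d.+1 => (\prod_i theta i (x 0%R i))%:E) \o cons_rV).
  by apply: measurableT_comp; [exact: mprod|exact: measurable_cons_rV].
pose D : set (measurableTypeR R) := `[0%R, 1%R[%classic.
have mD : measurable D by exact: measurable_itv.
have Doo : lebesgue_measure D < +oo.
  by rewrite lebesgue_measure_itv/= lte_fin ltr01 oppr0 adde0 ltry.
pose nu : {finite_measure set (measurableTypeR R) -> \bar R} := mfrestr mD Doo.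
have mt0 : measurable_fun setT (fun s : measurableTypeR R => (theta ord0 s)%:E).
  by apply/measurable_EFinP; exact: mt.
pose g := (fun x : 'rV[R]_d.+1 => (\prod_i theta i (x 0%R i))%:E) \o cons_rV.
have g0 z : 0 <= g z by rewrite lee_fin; apply: prodr_ge0.
have E := @fubini_tonelli1 _ _ _ _ R nu (torus R d) g mind g0.
rewrite -[LHS]/(\int[nu \x torus R d]_z g z) E {E}.
transitivity (\int[nu]_s
    ((theta ord0 s)%:E * \int[torus R d]_x (\prod_i theta (lift ord0 i) (x 0%R i))%:E)).
  apply: eq_integral => s _; rewrite /fubini_F -ge0_integralZl//; last 3 first.
  - exact: (mprod d (fun i => theta (lift ord0 i))).
  - by move=> x _; rewrite lee_fin; apply: prodr_ge0.
  - by rewrite lee_fin.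
  apply: eq_integral => x _; rewrite -EFinM; congr EFin.
  rewrite big_ord_recl /cons_rV mxE unlift_none; congr (_ * _)%R.
  by apply: eq_bigr => i _; rewrite mxE liftK.
rewrite ge0_integralZr//.
- congr (_ * _).
  have -> : \int[lebesgue_measure]_(s in D) (theta ord0 s)%:E =
      \int[nu]_(s in D) (theta ord0 s)%:E.
    apply: eq_measure_integral => /= A mA AD.
    by rewrite -[RHS]/(lebesgue_measure (A `&` D)) setIidl.
  rewrite (@ge0_negligible_integral _ _ _ _ setT (~` D))//.
  - by congr integral; rewrite setTD setCK.
  - exact: measurableC.
  - by move=> x _; rewrite lee_fin.
  - by rewrite -[LHS]/(lebesgue_measure (~` D `&` D)) setICl measure0.
- by move=> x _; rewrite lee_fin.
- by apply: integral_ge0 => x _; rewrite lee_fin; apply: prodr_ge0.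
Qed.

End TorusLaw.

(** * Fubini's theorem on rectangles *)

Section FubiniRect.
Context {d1 d2 : measure_display} {T1 : measurableType d1} {T2 : measurableType d2}.
Context {R : realType}.
Variables (m1 : {sigma_finite_measure set T1 -> \bar R}).
Variables (m2 : {sigma_finite_measure set T2 -> \bar R}).
Variables (A : set T1) (B : set T2).
Hypotheses (mA : measurable A) (mB : measurable B).

Lemma integrable_fine {d} {T : measurableType d} (mu : {measure set T -> \bar R})
    (D : set T) (F : T -> \bar R) : measurable D -> mu.-integrable D F ->
  mu.-integrable D (EFin \o (fine \o F)) /\
  (\int[mu]_(x in D) F x)%E = (\int[mu]_(x in D) fine (F x))%:E.
Proof.
move=> mD iF.
have ae := integrable_ae mD iF.
have mF := measurable_int mu iF.
have mfF : measurable_fun D (EFin \o (fine \o F)).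
  by apply/measurable_EFinP; exact: measurableT_comp.
have e : ae_eq mu D F (EFin \o (fine \o F)).
  by apply: filterS ae => x /= H Dx; rewrite fineK// H.
have i2 : mu.-integrable D (EFin \o (fine \o F)).
  by apply: (le_integrable mD mfF _ iF) => x _ /=; case: (F x) => [r||] /=; rewrite ?normr0 ?lexx ?leey.
split=> //; rewrite /Rintegral fineK; last exact: integrable_fin_num.
by apply: ae_eq_integral => //; exact: measurable_int i2.
Qed.

Let D := A `*` B.
Let mD : measurable D. Proof. exact: measurableX. Qed.

Section integrable_f.
Variable f : T1 * T2 -> R.
Hypothesis intf : (m1 \x m2)%E.-integrable D (EFin \o f).

Let g := (EFin \o f) \_ D.
Let intg : (m1 \x m2)%E.-integrable setT g.
Proof. exact/(integrable_mkcond _ mD). Qed.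

Let g1 x : (fun y => g (x, y)) =
  if x \in A then (EFin \o (fun y => f (x, y))) \_ B else cst 0%E.
Proof.
apply/funext => y; rewrite /g patchE in_setX /=.
by case: (x \in A); rewrite //= patchE.
Qed.

Let g2 y : (fun x => g (x, y)) =
  if y \in B then (EFin \o (fun x => f (x, y))) \_ A else cst 0%E.
Proof.
apply/funext => x; rewrite /g patchE in_setX /= andbC.
by case: (y \in B); rewrite //= patchE.
Qed.

Lemma rect_ae_integrable1 :
  {ae m1, forall x, A x -> m2.-integrable B (EFin \o (fun y => f (x, y)))}.
Proof.
have := ae_integrable1 intg; apply: filterS => x /= H Ax.
by apply/(integrable_mkcond _ mB); rewrite g1 mem_set in H.
Qed.

Lemma rect_ae_integrable2 :
  {ae m2, forall y, B y -> m1.-integrable A (EFin \o (fun x => f (x, y)))}.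
Proof.
have := ae_integrable2 intg; apply: filterS => y /= H By.
by apply/(integrable_mkcond _ mA); rewrite g2 mem_set in H.
Qed.

Let F1 x := (\int[m2]_(y in B) (f (x, y))%:E)%E.
Let F2 y := (\int[m1]_(x in A) (f (x, y))%:E)%E.

Let E1 : fubini_F m2 g = F1 \_ A.
Proof.
apply/funext => x; rewrite /fubini_F g1 patchE.
by case: ifPn => xA; [rewrite -integral_mkcond|rewrite integral0].
Qed.

Let E2 : fubini_G m1 g = F2 \_ B.
Proof.
apply/funext => y; rewrite /fubini_G g2 patchE.
by case: ifPn => xA; [rewrite -integral_mkcond|rewrite integral0].
Qed.

Let iF1 : m1.-integrable A F1.
Proof. by apply/(integrable_mkcond _ mA); rewrite -E1; exact: integrable_fubini_F. Qed.

Let iF2 : m2.-integrable B F2.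
Proof.
apply/(integrable_mkcond _ mB); rewrite -E2.
have mg := measurable_int _ intg.
have mag : measurable_fun setT (abse \o g) by exact: measurableT_comp.
have mG := measurable_fun_fubini_tonelli_G (m1 := m1) (abse \o g) mag (fun z => abse_ge0 (g z)).
apply/integrableP; split; first exact: (measurable_fubini_G intg).
apply: le_lt_trans ((integrable21ltyP _ _ mg).1 intg); apply: ge0_le_integral => //.
- by apply: measurableT_comp => //; exact: (measurable_fubini_G intg).
- move=> y _; apply: le_abse_integral => //; exact: measurableT_comp.
Qed.

Lemma rect_integrable1 :
  m1.-integrable A (EFin \o (fun x => \int[m2]_(y in B) f (x, y))).
Proof. exact: (integrable_fine mA iF1).1. Qed.

Lemma rect_integrable2 :
  m2.-integrable B (EFin \o (fun y => \int[m1]_(x in A) f (x, y))).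
Proof. exact: (integrable_fine mB iF2).1. Qed.

Lemma rect_fubini1 : \int[(m1 \x m2)%E]_(z in D) f z =
  \int[m1]_(x in A) \int[m2]_(y in B) f (x, y).
Proof.
apply: EFin_inj; rewrite -(integrable_fine mA iF1).2.
rewrite /Rintegral fineK; last exact: integrable_fin_num.
by rewrite integral_mkcond -integral12_prod_meas1// E1 -integral_mkcond.
Qed.

Lemma rect_fubini2 : \int[(m1 \x m2)%E]_(z in D) f z =
  \int[m2]_(y in B) \int[m1]_(x in A) f (x, y).
Proof.
apply: EFin_inj; rewrite -(integrable_fine mB iF2).2.
rewrite /Rintegral fineK; last exact: integrable_fin_num.
by rewrite integral_mkcond -integral21_prod_meas1// E2 -integral_mkcond.
Qed.

End integrable_f.

Lemma rect_tonelli1 (f : T1 * T2 -> \bar R) : measurable_fun D f ->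
  (forall z, (0 <= f z)%E) ->
  (\int[(m1 \x m2)]_(z in D) f z = \int[m1]_(x in A) \int[m2]_(y in B) f (x, y))%E.
Proof.
move=> mf f0; rewrite integral_mkcond fubini_tonelli1; last 2 first.
- exact/(measurable_restrictT _ mD).
- by move=> z; rewrite patchE; case: ifP.
rewrite [RHS]integral_mkcond; apply: eq_integral => x _.
rewrite /fubini_F patchE; case: ifPn => xA.
  rewrite [RHS]integral_mkcond; apply: eq_integral => y _.
  by rewrite !patchE in_setX xA.
by rewrite integral0_eq// => y _; rewrite patchE in_setX (negbTE xA).
Qed.

Lemma rect_integrable_tonelli (f : T1 * T2 -> R) : measurable_fun D f ->
  (\int[m1]_(x in A) \int[m2]_(y in B) `|f (x, y)|%:E < +oo)%E ->
  (m1 \x m2)%E.-integrable D (EFin \o f).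
Proof.
move=> mf H; apply/integrableP; split; first exact/measurable_EFinP.
rewrite (rect_tonelli1 (f := fun z => `|(EFin \o f) z|%E))//.
by apply: measurableT_comp => //; exact/measurable_EFinP.
Qed.

Lemma ge0_ae_integral0 {d} {T : measurableType d} (mu : {measure set T -> \bar R})
    (E : set T) (F : T -> \bar R) : measurable E -> measurable_fun E F ->
  (forall x, (0 <= F x)%E) -> (\int[mu]_(x in E) F x)%E = 0%E ->
  {ae mu, forall x, E x -> F x = 0%E}.
Proof.
move=> mE mF F0 I0; have := (ae_eq_integral_abs mu mE mF).1.
rewrite (eq_integral F); last by move=> x _; rewrite gee0_abs.
by move=> /(_ I0).
Qed.

Lemma rect_ae1 (P : T1 * T2 -> Prop) :
  {ae (m1 \x m2)%E, forall z, D z -> P z} ->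
  {ae m1, forall x, A x -> {ae m2, forall y, B y -> P (x, y)}}.
Proof.
move=> [N [mN N0 sN]].
have mI : measurable_fun setT (fun z => (\1_N z)%:E : \bar R).
  by apply/measurable_EFinP; exact: measurable_indic.
have I0 : (\int[m1 \x m2]_z (\1_N z)%:E = 0)%E by rewrite integral_indic// setIT.
have i0 (z : T1 * T2) : (0 <= (\1_N z)%:E :> \bar R)%E by rewrite lee_fin.
rewrite (fubini_tonelli1 (fun z => (\1_N z)%:E))// in I0.
have mF := measurable_fun_fubini_tonelli_F (m2 := m2) (fun z => (\1_N z)%:E) mI i0.
have := ge0_ae_integral0 measurableT mF (fun x => integral_ge0 _ (fun y _ => i0 (x, y))) I0.
apply: filterS => x /(_ I); rewrite /fubini_F => Hx Ax.
have mx : measurable (xsection N x) by exact: measurable_xsection.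
exists (xsection N x); split=> //.
  rewrite -(setIT (xsection N x)) -integral_indic//.
  rewrite -{}Hx; apply: eq_integral => y _; congr EFin.
  by rewrite !indicE mem_xsection.
move=> y /= H; rewrite /xsection /= inE; apply: sN => /= HP.
by apply: H => By; apply: HP.
Qed.

Lemma rect_ae2 (P : T1 * T2 -> Prop) :
  {ae (m1 \x m2)%E, forall z, D z -> P z} ->
  {ae m2, forall y, B y -> {ae m1, forall x, A x -> P (x, y)}}.
Proof.
move=> [N [mN N0 sN]].
have mI : measurable_fun setT (fun z => (\1_N z)%:E : \bar R).
  by apply/measurable_EFinP; exact: measurable_indic.
have I0 : (\int[m1 \x m2]_z (\1_N z)%:E = 0)%E by rewrite integral_indic// setIT.
have i0 (z : T1 * T2) : (0 <= (\1_N z)%:E :> \bar R)%E by rewrite lee_fin.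
rewrite (fubini_tonelli1 (fun z => (\1_N z)%:E))// fubini_tonelli// in I0.
have mF := measurable_fun_fubini_tonelli_G (m1 := m1) (fun z => (\1_N z)%:E) mI i0.
have := ge0_ae_integral0 measurableT mF (fun x => integral_ge0 _ (fun y _ => i0 (y, x))) I0.
apply: filterS => y /(_ I); rewrite /fubini_G => Hy By.
have my : measurable (ysection N y) by exact: measurable_ysection.
exists (ysection N y); split=> //.
  rewrite -(setIT (ysection N y)) -integral_indic//.
  rewrite -{}Hy; apply: eq_integral => x _; congr EFin.
  by rewrite !indicE mem_ysection.
move=> x /= H; rewrite /ysection /= inE; apply: sN => /= HP.
by apply: H => Ax; apply: HP.
Qed.

End FubiniRect.

(** * Integrals of real functions *)

Section Integrals.
Context {d : measure_display} {T : measurableType d} {R : realType}.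
Variable mu : {measure set T -> \bar R}.
Implicit Types (D : set T) (f g h : T -> R).

Local Notation intg D f := (mu.-integrable D (EFin \o f)).

Lemma intg_measurable D f : intg D f -> measurable_fun D f.
Proof. by move=> /measurable_int /measurable_EFinP. Qed.

Lemma intg_le D f g : measurable D -> measurable_fun D f ->
  (forall z, D z -> `|f z| <= g z) -> intg D g -> intg D f.
Proof.
move=> mD mf fg ig; apply: (le_integrable mD _ _ ig); first exact/measurable_EFinP.
by move=> z Dz; rewrite /= lee_fin (le_trans (fg _ Dz))// ler_norm.
Qed.

Lemma intgD D f g : measurable D -> intg D f -> intg D g -> intg D (fun z => f z + g z).
Proof. by move=> mD; exact: integrableD. Qed.

Lemma intgB D f g : measurable D -> intg D f -> intg D g -> intg D (fun z => f z - g z).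
Proof. by move=> mD; exact: integrableB. Qed.

Lemma intgZ D (c : R) f : measurable D -> intg D f -> intg D (fun z => c * f z).
Proof. by move=> mD; exact: integrableZl. Qed.

Lemma intgN D f : measurable D -> intg D f -> intg D (fun z => - f z).
Proof. by move=> mD i; have := intgZ (-1) mD i; under eq_fun do rewrite mulN1r. Qed.

Lemma intg_norm D f : intg D f -> intg D (fun z => `|f z|).
Proof. exact: integrable_norm. Qed.

Lemma intg_sum D (I : Type) (r : seq I) (P : pred I) (f : I -> T -> R) : measurable D ->
  (forall i, intg D (f i)) -> intg D (fun z => \sum_(i <- r | P i) f i z).
Proof.
move=> mD H; elim: r => [|i r IH].
  by under eq_fun do rewrite big_nil; exact: integrable0.
under eq_fun do rewrite big_cons.
by case: (P i) => //; exact: intgD.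
Qed.

Lemma Rintegral_sum D (I : Type) (r : seq I) (P : pred I) (f : I -> T -> R) : measurable D ->
  (forall i, intg D (f i)) ->
  \int[mu]_(z in D) (\sum_(i <- r | P i) f i z) = \sum_(i <- r | P i) \int[mu]_(z in D) f i z.
Proof.
move=> mD H; elim: r => [|i r IH].
  rewrite big_nil; under eq_Rintegral do rewrite big_nil.
  by rewrite Rintegral_cst// mul0r.
rewrite big_cons; under eq_Rintegral do rewrite big_cons.
by case: (P i) => //; rewrite RintegralD// ?IH//; exact: intg_sum.
Qed.

Lemma intg_bounded_mul D f g (C : R) : measurable D -> measurable_fun D g ->
  (forall z, D z -> `|g z| <= C) -> intg D f -> intg D (fun z => f z * g z).
Proof.
move=> mD mg gC i; apply: (@intg_le _ _ (fun z => C * `|f z|)) => //.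
- by apply: measurable_funM => //; exact: intg_measurable.
- by move=> z Dz; rewrite normrM mulrC ler_wpM2r// gC.
- by apply: intgZ => //; exact: intg_norm.
Qed.

Lemma intg_bounded D f (C : R) : measurable D -> (mu D < +oo)%E -> measurable_fun D f ->
  (forall z, D z -> `|f z| <= C) -> intg D f.
Proof.
move=> mD Doo mf fC; apply: (@intg_le _ _ (fun=> C)) => //.
by apply: measurable_bounded_integrable => //; exists `|C|; split=> // M CM z _ /=; exact: ltW.
Qed.

Lemma ae_intg D f g : measurable D -> measurable_fun D g ->
  {ae mu, forall z, D z -> f z = g z} -> intg D f -> intg D g.
Proof.
move=> mD mg fg i; apply/integrableP; split; first exact/measurable_EFinP.
have [mf fi] := integrableP _ _ _ i.
rewrite (@ae_eq_integral _ _ _ _ _ (fun z => `|(EFin \o f) z|)%E)//.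
- by apply: measurableT_comp => //; exact/measurable_EFinP.
- exact: measurableT_comp.
- by apply: filterS fg => z H Dz /=; rewrite H.
Qed.

Lemma ae_Rintegral D f g : measurable D -> measurable_fun D f -> measurable_fun D g ->
  {ae mu, forall z, D z -> f z = g z} ->
  \int[mu]_(z in D) f z = \int[mu]_(z in D) g z.
Proof.
move=> mD mf mg fg; congr fine; apply: ae_eq_integral => //; try exact/measurable_EFinP.
by apply: filterS fg => z H Dz /=; rewrite H.
Qed.

Lemma EFin_Rintegral D f : measurable D -> intg D f ->
  (\int[mu]_(z in D) (f z)%:E)%E = (\int[mu]_(z in D) f z)%:E.
Proof. by move=> mD i; rewrite /Rintegral fineK//; exact: integrable_fin_num. Qed.

Lemma Rdominated D (f_ : nat -> T -> R) f g : measurable D ->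
  (forall n, measurable_fun D (f_ n)) -> measurable_fun D f ->
  {ae mu, forall z, D z -> f_ ^~ z @ \oo --> f z} ->
  intg D g -> (forall n z, D z -> `|f_ n z| <= g z) ->
  (intg D f) /\ (\int[mu]_(z in D) f_ n z @[n --> \oo] --> \int[mu]_(z in D) f z).
Proof.
move=> mD mfn mf fcv ig fg.
have [||||| if_ _ H] := @dominated_convergence _ T R mu D mD (fun n => EFin \o f_ n) (EFin \o f)
  (EFin \o g) => //.
- by move=> n; exact/measurable_EFinP.
- exact/measurable_EFinP.
- by apply: filterS fcv => z Hz Dz /=; apply: cvg_EFin; [exact: nearW|exact: Hz].
- by apply: aeW => z n Dz; rewrite /= lee_fin fg.
split=> //; apply: (fine_cvg (f := fun n => (\int[mu]_(z in D) (f_ n z)%:E)%E)).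
by rewrite -(EFin_Rintegral mD if_); exact: H.
Qed.

Lemma ae_Rdominated D (f_ : nat -> T -> R) f g : measurable D ->
  (forall n, measurable_fun D (f_ n)) -> measurable_fun D f ->
  {ae mu, forall z, D z -> f_ ^~ z @ \oo --> f z} ->
  intg D g -> {ae mu, forall z, D z -> forall n, `|f_ n z| <= g z} ->
  (intg D f) /\ (\int[mu]_(z in D) f_ n z @[n --> \oo] --> \int[mu]_(z in D) f z).
Proof.
move=> mD mfn mf fcv ig fg.
have [||||| if_ _ H] := @dominated_convergence _ T R mu D mD (fun n => EFin \o f_ n) (EFin \o f)
  (EFin \o g) => //.
- by move=> n; exact/measurable_EFinP.
- exact/measurable_EFinP.
- by apply: filterS fcv => z Hz Dz /=; apply: cvg_EFin; [exact: nearW|exact: Hz].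
- by apply: filterS fg => z h n Dz; rewrite /= lee_fin h.
split=> //; apply: (fine_cvg (f := fun n => (\int[mu]_(z in D) (f_ n z)%:E)%E)).
by rewrite -(EFin_Rintegral mD if_); exact: H.
Qed.

Lemma Rintegral_ae_le D f g : measurable D -> intg D f -> intg D g ->
  {ae mu, forall z, D z -> f z <= g z} ->
  \int[mu]_(z in D) f z <= \int[mu]_(z in D) g z.
Proof.
move=> mD i1 i2 fg; rewrite -subr_ge0 -RintegralB//.
have ib := intgB mD i2 i1.
rewrite (@ae_Rintegral _ _ (fun z => `|g z - f z|))//.
- by apply: Rintegral_ge0.
- exact: intg_measurable.
- by apply: measurableT_comp => //; exact: intg_measurable.
- by apply: filterS fg => z h Dz; rewrite ger0_norm// subr_ge0 h.
Qed.

Lemma Rintegral0_ae D f : measurable D -> intg D f -> (forall z, D z -> 0 <= f z) ->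
  \int[mu]_(z in D) f z = 0 -> {ae mu, forall z, D z -> f z = 0}.
Proof.
move=> mD i f0 I0.
have := (ae_eq_integral_abs mu mD (measurable_int _ i)).1.
rewrite (@eq_integral _ _ _ _ _ (EFin \o f)); last first.
  by move=> z /set_mem Dz /=; rewrite ger0_norm// f0.
rewrite EFin_Rintegral// I0 => /(_ erefl); apply: filterS => z h Dz.
by have [] := h Dz.
Qed.

End Integrals.

Lemma measurable_Rintegral_param {d1 d2 : measure_display} {T1 : measurableType d1}
    {T2 : measurableType d2} {R : realType} (m2 : {sigma_finite_measure set T2 -> \bar R})
    (f : T1 * T2 -> R) : measurable_fun setT f ->
  measurable_fun setT (fun x => \int[m2]_y f (x, y)).
Proof.
move=> mf; apply: measurableT_comp => //.
have mEf : measurable_fun setT (EFin \o f) by exact/measurable_EFinP.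
have mp : measurable_fun setT ((EFin \o f)^\+)%E by exact: measurable_funepos.
have mn : measurable_fun setT ((EFin \o f)^\-)%E by exact: measurable_funeneg.
have -> : (fun x => \int[m2]_y (f (x, y))%:E)%E =
    (fubini_F m2 (EFin \o f)^\+ \- fubini_F m2 (EFin \o f)^\-)%E.
  apply/funext => x; rewrite [LHS]integralE /fubini_F.
  by congr (_ - _)%E; apply: eq_integral => y _; rewrite ?funeposE ?funenegE.
by apply: emeasurable_funB; exact: measurable_fun_fubini_tonelli_F.
Qed.

Lemma measurable_lt_indic {d : measure_display} {T : measurableType d} {R : realType}
    (f g : T -> R) : measurable_fun setT f -> measurable_fun setT g ->
  measurable_fun setT (fun z => (f z < g z)%R%:R : R).
Proof.
move=> mf mg; apply: (measurableT_comp (f := fun b : bool => b%:R : R)) => //.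
exact: measurable_fun_ltr.
Qed.

Section Tensor.
Context {d1 d2 : measure_display} {T1 : measurableType d1} {T2 : measurableType d2}.
Context {R : realType}.
Variables (m1 : {sigma_finite_measure set T1 -> \bar R}).
Variables (m2 : {sigma_finite_measure set T2 -> \bar R}).
Variables (A : set T1) (B : set T2).
Hypotheses (mA : measurable A) (mB : measurable B).
Variables (q : T1 -> R) (p : T2 -> R).

Lemma measurable_tensor : measurable_fun A q -> measurable_fun B p ->
  measurable_fun (A `*` B) (fun z => q z.1 * p z.2).
Proof.
move=> mq mp; have mD : measurable (A `*` B) by exact: measurableX.
apply: measurable_funM.
- apply: (measurable_comp (F := A) (g := fst)) => //; last exact: measurable_funTS.
  by move=> _ [z [Az _] <-].
- apply: (measurable_comp (F := B) (g := snd)) => //; last exact: measurable_funTS.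
  by move=> _ [z [_ Bz] <-].
Qed.

Hypothesis iq : m1.-integrable A (EFin \o q).
Hypothesis ip : m2.-integrable B (EFin \o p).

Lemma tensor_integrable : (m1 \x m2)%E.-integrable (A `*` B) (EFin \o (fun z => q z.1 * p z.2)).
Proof.
apply: rect_integrable_tonelli => //.
  by apply: measurable_tensor; [exact: intg_measurable iq|exact: intg_measurable ip].
have ipn := EFin_Rintegral mB (intg_norm ip).
have iqn := EFin_Rintegral mA (intg_norm iq).
rewrite (eq_integral (fun t => (`|q t|)%:E * (\int[m2]_(s in B) `|p s|)%:E)%E); last first.
  move=> t _; rewrite -ipn -ge0_integralZl//.
  - by apply: eq_integral => s _; rewrite -EFinM normrM.
  - by apply/measurable_EFinP; apply: measurableT_comp => //; exact: intg_measurable ip.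
rewrite ge0_integralZr//.
- by rewrite iqn -EFinM ltry.
- by apply/measurable_EFinP; apply: measurableT_comp => //; exact: intg_measurable iq.
- by rewrite lee_fin; apply: Rintegral_ge0.
Qed.

Lemma tensor_Rintegral : \int[(m1 \x m2)%E]_(z in A `*` B) (q z.1 * p z.2) =
  (\int[m1]_(x in A) q x) * \int[m2]_(y in B) p y.
Proof.
rewrite (rect_fubini1 mA mB tensor_integrable) -RintegralZr//.
by apply: eq_Rintegral => x _ /=; rewrite RintegralZl.
Qed.

End Tensor.

Section OneDim.
Context {R : realType}.
Local Notation leb := (@lebesgue_measure R).
Local Notation intI a b f := (leb.-integrable `]a, b[ (EFin \o f)).

Lemma lebesgue_itvoo_lty (a b : R) : (leb `]a, b[ < +oo)%E.
Proof. by rewrite lebesgue_measure_itv/=; case: ifP => // _; rewrite -EFinB ltry. Qed.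

Lemma FTC2_oo (Phi theta : R -> R) (a b : R) : a <= b ->
  (forall t : R, is_derive t (1 : R) Phi (theta t)) -> continuous theta ->
  \int[leb]_(t in `]a, b[) theta t = Phi b - Phi a.
Proof.
move=> ab dP ct; have [->|nab] := eqVneq a b.
  by rewrite set_itvoo0 Rintegral_set0 subrr.
have {}ab : a < b by rewrite lt_neqAle nab.
have ic : leb.-integrable `[a, b] (EFin \o theta) by exact: continuous_integrable_itv.
have cP : continuous Phi.
  move=> x; apply/differentiable_continuous/derivable1_diffP.
  by have := dP x => -[].
rewrite Rintegral_itv_bndo_bndc; last first.
  by apply: integrableS ic => //; exact: subset_itv_oo_cc.
rewrite Rintegral_itv_obnd_cbnd; last first.
  by apply: integrableS ic => //; apply: subset_itvr; rewrite bnd_simp.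
rewrite /Rintegral (@continuous_FTC2 _ theta Phi)//.
- exact: continuous_subspaceT.
- split.
  + by move=> x _; have := dP x => -[].
  + by apply: cvg_at_right_filter; exact: cP.
  + by apply: cvg_at_left_filter; exact: cP.
- by move=> x _; rewrite derive1E; have := dP x => -[].
Qed.

Lemma continuous_intI (f : R -> R) (a b : R) : continuous f -> intI a b f.
Proof.
move=> cf; apply: integrableS (continuous_integrable_itv a b cf) => //.
exact: subset_itv_oo_cc.
Qed.

Lemma intI_sub (f : R -> R) (a b a' b' : R) : a <= a' -> b' <= b -> intI a b f -> intI a' b' f.
Proof.
move=> aa bb; apply: integrableS => //.
by apply: subset_itv; rewrite bnd_simp.
Qed.

Lemma Rintegral_lt_indic (p : R -> R) (a b t : R) : t <= b ->
  \int[leb]_(s in `]a, b[) (p s * (s < t)%R%:R) = \int[leb]_(s in `]a, t[) p s.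
Proof.
move=> tb; have -> : `]a, t[%classic = `]a, b[ `&` [set s | s < t].
  apply/seteqP; split=> s /=; rewrite !in_itv/=; last by move=> [/andP[-> _] ->].
  by move=> /andP[-> st]; split=> //; exact: (lt_le_trans st).
rewrite Rintegral_mkcondr; apply: eq_Rintegral => s _.
rewrite patchE; case: ifPn => [/set_mem/= ->|]; first by rewrite mulr1.
by rewrite notin_setE /= => /negP/negbTE ->; rewrite mulr0.
Qed.

Lemma Rintegral_gt_indic (q : R -> R) (a b s : R) : a <= s ->
  \int[leb]_(t in `]a, b[) (q t * (s < t)%R%:R) = \int[leb]_(t in `]s, b[) q t.
Proof.
move=> sa; have -> : `]s, b[%classic = `]a, b[ `&` [set t | s < t].
  apply/seteqP; split=> t /=; rewrite !in_itv/=; last by move=> [/andP[_ ->] ->].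
  by move=> /andP[st ->]; split=> //; rewrite andbT; exact: (le_lt_trans sa).
rewrite Rintegral_mkcondr; apply: eq_Rintegral => t _.
rewrite patchE; case: ifPn => [/set_mem/= ->|]; first by rewrite mulr1.
by rewrite notin_setE /= => /negP/negbTE ->; rewrite mulr0.
Qed.

(** Both sides integrate p(s) q(t) over the triangle a < s < t < b. *)
Lemma triangle_fubini (p q : R -> R) (a b : R) : intI a b p -> intI a b q ->
  \int[leb]_(t in `]a, b[) (q t * \int[leb]_(s in `]a, t[) p s) =
  \int[leb]_(s in `]a, b[) (p s * \int[leb]_(t in `]s, b[) q t).
Proof.
move=> ip iq.
pose D : set (measurableTypeR R) := `]a, b[%classic.
have mD : measurable D by exact: measurable_itv.
have mp : measurable_fun D p by exact: intg_measurable ip.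
have mq : measurable_fun D q by exact: intg_measurable iq.
pose h (z : measurableTypeR R * measurableTypeR R) := q z.1 * p z.2 * (z.2 < z.1)%R%:R.
have mDD : measurable (D `*` D) by exact: measurableX.
have ih : (leb \x leb)%E.-integrable (D `*` D) (EFin \o h).
  apply: (@intg_bounded_mul _ _ _ _ _ _ _ 1) => //.
  - apply: measurable_funTS; apply: measurable_lt_indic; first exact: measurable_snd.
    exact: measurable_fst.
  - by move=> z _; case: (_ < _); rewrite ?normr1 ?normr0.
  - exact: (tensor_integrable mD mD iq ip).
have E1 := rect_fubini1 mD mD ih.
have E2 := rect_fubini2 mD mD ih.
transitivity (\int[leb]_(t in D) \int[leb]_(s in D) h (t, s)).
  apply: eq_Rintegral => t /set_mem; rewrite /D /= in_itv/= => /andP[at_ tb].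
  rewrite -(@Rintegral_lt_indic p a b t (ltW tb)) -RintegralZl//.
    by apply: eq_Rintegral => s _; rewrite /h mulrA.
  apply: (@intg_bounded_mul _ _ _ _ _ _ _ 1) => //.
    by apply: measurable_funTS; apply: measurable_lt_indic.
  by move=> s _; case: (_ < _); rewrite ?normr1 ?normr0.
rewrite -E1 E2; apply: eq_Rintegral => s /set_mem; rewrite /D /= in_itv/= => /andP[as_ sb].
rewrite -(@Rintegral_gt_indic q a b s (ltW as_)) -RintegralZl//.
  by apply: eq_Rintegral => t _; rewrite /h mulrA [q t * p s]mulrC.
apply: (@intg_bounded_mul _ _ _ _ _ _ _ 1) => //.
  by apply: measurable_funTS; apply: measurable_lt_indic.
by move=> t _; case: (_ < _); rewrite ?normr1 ?normr0.
Qed.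

End OneDim.

(** * Slabs of space-time and separated test functions *)

Section Slab.
Context {R : realType} {d : nat}.
Local Notation leb := (@lebesgue_measure R).
Local Notation st := (spacetime R d).
Implicit Types (f g r : R * 'rV[R]_d -> R) (a b : R).

Definition slab a b : set (measurableTypeR R * 'rV[R]_d) := `]a, b[%classic `*` setT.

Lemma cylinder_slab (S : R) : cylinder S = slab 0 S.
Proof.
apply/seteqP; split=> -[t x]; rewrite /cylinder /slab /= in_itv/=; first by move=> ->.
by move=> [].
Qed.

Lemma slabP a b z : slab a b z <-> a < z.1 < b.
Proof. by rewrite /slab /= in_itv/=; split=> [[]|]. Qed.

Lemma measurable_slab a b : measurable (slab a b).
Proof. by apply: measurableX => //; exact: measurable_itv. Qed.

Let mI a b : measurable (`]a, b[%classic : set (measurableTypeR R)).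
Proof. exact: measurable_itv. Qed.

Lemma spacetimeE (A : set (measurableTypeR R)) (B : set 'rV[R]_d) :
  measurable A -> measurable B -> st (A `*` B) = (leb A * torus R d B)%E.
Proof. exact: product_measure1E. Qed.

Lemma slab_lty a b : (st (slab a b) < +oo)%E.
Proof.
rewrite spacetimeE//.
by rewrite [X in (_ * X)%E]probability_setT mule1 lebesgue_itvoo_lty.
Qed.

Lemma slab_subset a b a' b' : a <= a' -> b' <= b -> slab a' b' `<=` slab a b.
Proof.
move=> aa bb z /slabP/andP[h1 h2]; apply/slabP.
by rewrite (le_lt_trans aa h1) (lt_le_trans h2 bb).
Qed.

Local Notation stin a b f := (st.-integrable (slab a b) (EFin \o f)).

Lemma int_cylE (S : R) f : stin 0 S f ->
  int_cyl S f = (\int[st]_(z in slab 0 S) f z)%:E.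
Proof. by move=> i; rewrite /int_cyl cylinder_slab EFin_Rintegral//; exact: measurable_slab. Qed.

Lemma stin_sub a b a' b' f : a <= a' -> b' <= b -> stin a b f -> stin a' b' f.
Proof.
by move=> aa bb; apply: integrableS; [exact: measurable_slab|exact: measurable_slab|exact: slab_subset].
Qed.

Lemma measurable_time (q : R -> R) : measurable_fun setT q ->
  measurable_fun setT (fun z : measurableTypeR R * 'rV[R]_d => q z.1).
Proof. by move=> mq; apply: measurableT_comp mq _; exact: measurable_fst. Qed.

Lemma measurable_space (p : 'rV[R]_d -> R) : measurable_fun setT p ->
  measurable_fun setT (fun z : measurableTypeR R * 'rV[R]_d => p z.2).
Proof. by move=> mq; apply: measurableT_comp mq _; exact: measurable_snd. Qed.

Lemma slab_fubini1 a b f : stin a b f ->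
  \int[st]_(z in slab a b) f z = \int[leb]_(t in `]a, b[) \int[torus R d]_x f (t, x).
Proof. by move=> i; rewrite (rect_fubini1 _ _ i). Qed.

Lemma slab_fubini2 a b f : stin a b f ->
  \int[st]_(z in slab a b) f z = \int[torus R d]_x \int[leb]_(t in `]a, b[) f (t, x).
Proof. by move=> i; rewrite (rect_fubini2 _ _ i). Qed.

Lemma slab_integrable1 a b f : stin a b f ->
  leb.-integrable `]a, b[ (EFin \o (fun t => \int[torus R d]_x f (t, x))).
Proof. by move=> i; apply: (rect_integrable1 _ _ i). Qed.

Lemma slab_integrable2 a b f : stin a b f ->
  (torus R d).-integrable setT (EFin \o (fun x => \int[leb]_(t in `]a, b[) f (t, x))).
Proof. by move=> i; apply: (rect_integrable2 _ _ i). Qed.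

Lemma slab_ae_integrable1 a b f : stin a b f ->
  {ae leb, forall t : R, a < t < b ->
    (torus R d).-integrable setT (EFin \o (fun x => f (t, x)))}.
Proof.
move=> i; have := rect_ae_integrable1 (mI a b) measurableT i.
by apply: filterS => t H tab; apply: H; rewrite /= in_itv.
Qed.

Lemma slab_ae_integrable2 a b f : stin a b f ->
  {ae torus R d, forall x, leb.-integrable `]a, b[ (EFin \o (fun t => f (t, x)))}.
Proof.
move=> i; have := rect_ae_integrable2 (mI a b) measurableT i.
by apply: filterS => x H; apply: H.
Qed.

Lemma slab_ae1 a b (P : R * 'rV[R]_d -> Prop) : {ae st, forall z, slab a b z -> P z} ->
  {ae leb, forall t : R, a < t < b -> {ae torus R d, forall x, P (t, x)}}.
Proof.
move=> H; have := rect_ae1 (A := (`]a, b[%classic : set (measurableTypeR R))) (B := setT) H.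
apply: filterS => t {}H tab; have : `]a, b[%classic t by rewrite /= in_itv.
by move/H; apply: filterS => x; apply.
Qed.

Lemma slab_ae2 a b (P : R * 'rV[R]_d -> Prop) : {ae st, forall z, slab a b z -> P z} ->
  {ae torus R d, forall x, {ae leb, forall t : R, a < t < b -> P (t, x)}}.
Proof.
move=> H; have := rect_ae2 (A := (`]a, b[%classic : set (measurableTypeR R))) (B := setT) H.
apply: filterS => x /(_ I); apply: filterS => t {}H tab; apply: H.
by rewrite /= in_itv.
Qed.

Lemma ae_slab_space a b (P : 'rV[R]_d -> Prop) : {ae torus R d, forall x, P x} ->
  {ae st, forall z, slab a b z -> P z.2}.
Proof.
move=> [N [mN N0 sN]]; exists (setT `*` N); split.
- exact: measurableX.
- by rewrite spacetimeE//= N0 mule0.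
- move=> [t x] /= H; split=> //; apply: sN => HP; apply: H => _; exact: HP.
Qed.

Lemma slab_tensor a b (q : R -> R) (p : 'rV[R]_d -> R) :
  leb.-integrable `]a, b[ (EFin \o q) -> (torus R d).-integrable setT (EFin \o p) ->
  stin a b (fun z => q z.1 * p z.2) /\
  \int[st]_(z in slab a b) (q z.1 * p z.2) =
    (\int[leb]_(t in `]a, b[) q t) * \int[torus R d]_x p x.
Proof.
move=> iq ip; split.
  exact: (tensor_integrable (mI a b) measurableT iq ip).
exact: (tensor_Rintegral (mI a b) measurableT iq ip).
Qed.

Section separated_tests.
Variables (a b : R) (r : R * 'rV[R]_d -> R).
Hypothesis ir : stin a b r.
Hypothesis tests : forall (eta : R -> R) (psi : 'rV[R]_d -> R) (a' b' : R),
  smooth eta -> (forall t, ~~ (a' <= t <= b') -> eta t = 0) -> a < a' -> b' < b ->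
  smooth psi -> periodic psi ->
  \int[st]_(z in slab a b) (r z * (eta z.1 * psi z.2)) = 0.

(* The cell [0, 1]^d does not distinguish a corner from its projection. *)
Let clip (s : R) := Num.max 0 (Num.min s 1).
Let clip01 s : 0 <= clip s <= 1.
Proof. by rewrite /clip le_max lexx/= ge_max ler01 ge_min lexx orbT. Qed.

Let orthant_zero (a0 : R) (c : 'I_d -> R) :
  (\int[st]_(z in slab a b `&` [set z : R * 'rV[R]_d | (a0 < z.1)%R /\ forall i, (c i < z.2 0 i)%R]) (r z)%:E = 0)%E.
Proof.
set O := [set z | _].
have mO : measurable (O : set (measurableTypeR R * 'rV[R]_d)).
  by rewrite measurable_st_orthants; apply: sub_sigma_algebra; exists a0, c.
have mS := measurable_slab a b.
have irO : st.-integrable (slab a b `&` O) (EFin \o r).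
  by apply: integrableS ir => //; exact: measurableI.
rewrite EFin_Rintegral//; last exact: measurableI.
rewrite Rintegral_mkcondr; congr EFin.
pose phi n (z : R * 'rV[R]_d) := time_bump (Num.max a a0) b n z.1 *
  orthant_bump (fun i => clip (c i)) n z.2.
have mphi n : measurable_fun (setT : set (measurableTypeR R * 'rV[R]_d)) (phi n).
  apply: measurable_funM.
    apply: measurable_time; apply: continuous_measurable_fun.
    exact/smooth_continuous/smooth_time_bump.
  apply: measurable_space; apply: continuous_measurable_rV.
  exact/smooth_continuous/smooth_orthant_bump.
have phi1 n z : `|phi n z| <= 1.
  rewrite normrM mulr_ile1// ger0_norm ?time_bump_ge0 ?time_bump_le1//.
    exact: orthant_bump_le1.
exact: orthant_bump_ge0.
have mr := intg_measurable ir.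
have [_ H] : st.-integrable (slab a b) (EFin \o (r \_ O)) /\
    \int[st]_(z in slab a b) (r z * phi n z) @[n --> \oo] -->
    \int[st]_(z in slab a b) ((r \_ O) z).
  apply: (@ae_Rdominated _ _ _ st (slab a b) (fun n z => r z * phi n z) (r \_ O)
    (fun z => `|r z|)) => //.
  - by move=> n; apply: measurable_funM => //; exact: measurable_funTS.
  - by apply/(measurable_restrict _ mO) => //; apply: measurable_funS mr.
  - have := ae_slab_space a b (torus_ae_interior d); apply: filterS => z Hz zS.
    have zi := Hz zS; move/slabP : zS => /andP[az zb].
    have -> : (r \_ O) z = r z * (((Num.max a a0 < z.1 < b)%R)%:R *
        ([forall i, (clip (c i) < z.2 0 i)%R]%:R)).
      rewrite patchE zb andbT gt_max az /=.
      have EO : (z \in O) = (a0 < z.1) && [forall i, clip (c i) < z.2 0 i].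
        apply/idP/andP => [/set_mem[h1 h2]|[h1 /forallP h2]].
          split=> //; apply/forallP => i; have /andP[z0 z1] := zi i.
          by rewrite /clip gt_max z0/= gt_min h2.
        apply/mem_set; split=> // i; have /andP[z0 z1] := zi i.
        have := h2 i; rewrite /clip gt_max z0/= gt_min => /orP[//|].
        by rewrite ltNge (ltW z1).
      by rewrite EO; case: (a0 < z.1); case: [forall _, _]; rewrite /= ?(mulr1, mulr0, mul0r).
    apply: cvgM; first exact: cvg_cst.
    apply: cvgM; first exact: cvg_time_bump.
    by apply: cvg_orthant_bump => // i; exact: clip01.
  - exact: intg_norm.
  - by apply: aeW => z _ n; rewrite normrM ler_piMr.
have E0 n : \int[st]_(z in slab a b) (r z * phi n z) = 0.
  apply: (tests (a' := Num.max a a0 + n.+1%:R^-1) (b' := b - n.+1%:R^-1)).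
  - exact: smooth_time_bump.
  - by move=> t; exact: time_bump_out.
  - by rewrite (@le_lt_trans _ _ (Num.max a a0))// ?le_max ?lexx// ltrDl invr_gt0.
  - by rewrite ltrBlDr ltrDl invr_gt0.
  - exact: smooth_orthant_bump.
  - exact: orthant_bump_periodic.
have H0 : \int[st]_(z in slab a b) (r z * phi n z) @[n --> \oo] --> (0 : R).
  by rewrite (_ : (fun n => _) = fun=> 0); [exact: cvg_cst|apply/funext].
by have /cvg_lim <- // := H; have /cvg_lim <- // := H0.
Qed.

(** Products of bumps converge boundedly to the indicators of orthants, so [r] has zero
    integral on orthants; Dynkin's lemma extends this to every measurable subset of the slab. *)
Lemma separated_tests_zero : {ae st, forall z, slab a b z -> r z = 0}.
Proof.
have mS := measurable_slab a b.
pose P (A : set (measurableTypeR R * 'rV[R]_d)) :=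
  (\int[st]_(z in slab a b `&` A) (r z)%:E = 0)%E.
have irA (A : set (measurableTypeR R * 'rV[R]_d)) : measurable A ->
    st.-integrable (slab a b `&` A) (EFin \o r).
  by move=> mA; apply: integrableS ir => //; exact: measurableI.
have PT : P setT.
  rewrite /P setIT; have := orthant_zero (a - 1) (fun=> -1).
  set O := [set z | _]; rewrite EFin_Rintegral//; last 2 first.
  - apply: measurableI => //.
    by rewrite measurable_st_orthants; apply: sub_sigma_algebra; exists (a-1), (fun=> -1).
  - apply: irA.
    by rewrite measurable_st_orthants; apply: sub_sigma_algebra; exists (a-1), (fun=> -1).
  rewrite Rintegral_mkcondr => H; rewrite EFin_Rintegral// -[RHS]H; congr EFin.
  have mO : measurable (O : set (measurableTypeR R * 'rV[R]_d)).
    by rewrite measurable_st_orthants; apply: sub_sigma_algebra; exists (a-1), (fun=> -1).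
  apply: ae_Rintegral => //; first exact: intg_measurable ir.
    apply/(measurable_restrict _ mO) => //.
    by apply: measurable_funS (intg_measurable ir).
  have := ae_slab_space a b (torus_ae_interior d); apply: filterS => z Hz zS.
  rewrite patchE mem_set//; split.
    move/slabP : zS => /andP[az _]; apply: lt_trans az.
    by rewrite ltrBlDr ltrDl.
  move=> i; have /andP[z0 _] := Hz zS i.
  by apply: lt_trans z0; rewrite ltrN10.
have key (A : set (measurableTypeR R * 'rV[R]_d)) : measurable A -> P A.
  move=> mA; have := mA; rewrite measurable_st_orthants => sA.
  apply: (dynkin_induction (measurable_st_orthants d) (@st_orthants_setI _ d) PT _ _ _ sA).
  - by move=> _ [a0 [c ->]]; exact: orthant_zero.
  - move=> B mB PB; have := PT; rewrite /P setIT.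
    have E : slab a b = (slab a b `&` B) `|` (slab a b `&` ~` B).
      by rewrite -setIUr setUv setIT.
    rewrite {1}E integral_setU_EFin//.
    + by rewrite [X in (X + _)%E]PB add0e.
    + exact: measurableI.
    + by apply: measurableI => //; exact: measurableC.
    + by rewrite -setIUr setUv setIT; exact: intg_measurable ir.
    + by apply/disj_setPS => z [[_ Bz] [_ nBz]]; exact: nBz.
  - move=> F mF tF PF; rewrite /P setI_bigcupr integral_bigcup//.
    + by rewrite eseries0// => i _ _; exact: PF.
    + apply/trivIsetP => i j _ _ ij; move/trivIsetP : tF => /(_ i j I I ij) FF.
      by rewrite setIACA FF setI0.
    + by move=> i; exact: measurableI.
    + by rewrite -setI_bigcupr; apply: irA; exact: bigcupT_measurable.
have H : ae_eq st (slab a b) (EFin \o r) (cst 0%E).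
  apply: integral_ae_eq => // E ES mE.
  rewrite integral0 (_ : E = slab a b `&` E); last by rewrite setIidr.
  exact: key.
by apply: filterS H => z h zS; have [] := h zS.
Qed.

End separated_tests.

End Slab.

(** * The du Bois-Reymond lemma *)

Section Primitive.
Context {R : realType} {d : nat}.
Local Notation leb := (@lebesgue_measure R).
Local Notation st := (spacetime R d).
Local Notation stin a b f := (st.-integrable (slab a b) (EFin \o f)).
Implicit Types (f g r : R * 'rV[R]_d -> R) (a b : R).

Definition time_primitive a g (z : R * 'rV[R]_d) : R :=
  \int[leb]_(s in `]a, z.1[) g (s, z.2).

Lemma measurable_time_primitive a b g : measurable_fun (slab a b) g ->
  measurable_fun (slab a b) (time_primitive a g).
Proof.
move=> mg; have mS := @measurable_slab R d a b.
pose h (w : (measurableTypeR R * 'rV[R]_d) * measurableTypeR R) : R :=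
  (g \_ (slab a b)) (w.2, w.1.2) * (w.2 < w.1.1)%R%:R.
have mh : measurable_fun setT h.
  apply: measurable_funM.
    have mgS : measurable_fun setT (g \_ (slab a b)).
      exact/(measurable_restrictT _ mS).
    apply: (measurableT_comp mgS); apply: measurable_fun_pair; first exact: measurable_snd.
    by apply: measurableT_comp; [exact: measurable_snd|exact: measurable_fst].
  apply: measurable_lt_indic; first exact: measurable_snd.
  by apply: measurableT_comp; [exact: measurable_fst|exact: measurable_fst].
have := measurable_Rintegral_param leb mh => mH.
apply: (eq_measurable_fun (fun z => \int[leb]_y h (z, y))); last exact: measurable_funTS.
move=> [t x] /set_mem/slabP/= /andP[at_ tb].
rewrite /time_primitive /= [RHS]Rintegral_mkcond; apply: eq_Rintegral => s _.
rewrite /h /= !patchE.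
have E : (s \in `]a, t[%classic) = ((s, x) \in slab a b) && (s < t).
  apply/idP/andP => [/set_mem/=|[/set_mem/slabP/= /andP[h1 _] h2]].
    rewrite in_itv/= => /andP[h1 h2]; split=> //.
    by apply/mem_set/slabP; rewrite /= h1 (lt_trans h2).
  by apply/mem_set; rewrite /= in_itv/= h1.
rewrite E; case: (_ \in _); case: (s < t); rewrite /= ?(mulr1, mulr0, mul0r)//.
Qed.

Lemma norm_time_primitive_le a b g x : leb.-integrable `]a, b[ (EFin \o (fun s => g (s, x))) ->
  forall t : R, a < t < b ->
  `|time_primitive a g (t, x)| <= \int[leb]_(s in `]a, b[) `|g (s, x)|.
Proof.
move=> ig t /andP[at_ tb]; rewrite /time_primitive /=.
have it : leb.-integrable `]a, t[ (EFin \o (fun s => g (s, x))).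
  by apply: intI_sub ig => //; exact: ltW.
apply: (le_trans (le_normr_Rintegral _ it)) => //.
have mD : measurable (`]a, b[%classic : set (measurableTypeR R)) by exact: measurable_itv.
rewrite -(@Rintegral_lt_indic _ _ a b t (ltW tb)).
apply: le_Rintegral => //.
- apply: (@intg_bounded_mul _ _ _ _ _ _ _ 1) => //; last exact: intg_norm.
    by apply: measurable_funTS; apply: measurable_lt_indic.
  by move=> s _; case: (_ < _); rewrite ?normr1 ?normr0.
- exact: intg_norm.
- by move=> s _; case: (_ < _); rewrite ?mulr1 ?mulr0.
Qed.

Lemma time_primitive_integrable a b g : stin a b g -> stin a b (time_primitive a g).
Proof.
move=> ig; have mS := @measurable_slab R d a b.
pose M x := \int[leb]_(s in `]a, b[) `|g (s, x)|.
have iM : stin a b (fun z => 1 * M z.2).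
  have [|i _] := @slab_tensor R d a b (fun=> 1) M _ (slab_integrable2 (intg_norm ig)) => //.
  by apply: continuous_intI => x; exact: cvg_cst.
apply/integrableP; split.
  by apply/measurable_EFinP; apply: measurable_time_primitive; exact: intg_measurable ig.
have [_ Moo] := integrableP _ _ _ iM.
apply: le_lt_trans Moo; apply: ae_ge0_le_integral => //.
- apply: measurableT_comp => //; apply/measurable_EFinP.
  by apply: measurable_time_primitive; exact: intg_measurable ig.
- by apply: measurableT_comp => //; apply/measurable_EFinP; exact: intg_measurable iM.
have := ae_slab_space a b (slab_ae_integrable2 ig); apply: filterS => -[t x] H zS.
rewrite /= lee_fin mul1r; have /slabP/= tab := zS.
by apply: le_trans (norm_time_primitive_le (H zS) tab) _; exact: ler_norm.
Qed.

Lemma periodic_shift (u : 'rV[R]_d -> R) : periodic u ->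
  forall (k : 'I_d -> int) x, u (x + \row_i (k i)%:~R) = u x.
Proof.
move=> pu k x.
have ej (j : nat) : (j.+1%:Z)%:~R = j%:~R + 1 :> R by rewrite -addn1 PoszD intrD.
have step i (m : int) y : u (y + m%:~R *: delta_mx 0 i) = u y.
  case: m => m; last first.
    rewrite NegzE mulrNz scaleNr.
    elim: m.+1 y => [|j IH] y; first by rewrite scale0r subr0.
    by rewrite ej scalerDl opprD addrA scale1r periodicN// IH.
  elim: m y => [|j IH] y; first by rewrite scale0r addr0.
  by rewrite ej scalerDl addrA scale1r pu IH.
rewrite [\row_i _]row_sum_delta.
elim: (index_enum _) x => [|i s IH] x; first by rewrite big_nil addr0.
by rewrite big_cons addrA IH mxE step.
Qed.

Lemma periodic_bounded a b (phi : R * 'rV[R]_d -> R) : continuous phi ->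
  (forall t, periodic (fun x => phi (t, x))) ->
  exists C, forall t x, a <= t <= b -> `|phi (t, x)| <= C.
Proof.
move=> cphi pphi; have [ab|ba] := leP a b; last first.
  exists 0 => t x /andP[h1 h2]; have := le_lt_trans (le_trans h1 h2) ba.
  by rewrite ltxx.
pose Q : set (R * 'rV[R]_d) := `[a, b]%classic `*`
  [set x : 'rV[R]_d | forall i, `[0, 1]%classic (x ord0 i)].
have cQ : compact Q.
  apply: compact_setX; first exact: segment_compact.
  by have := @rV_compact R d (fun=> `[0, 1]%classic) (fun=> @segment_compact R 0 1); exact.
have Q0 : Q !=set0.
  exists (a, 0); split; first by rewrite /= in_itv/= lexx.
  by move=> i; rewrite /= mxE in_itv/= lexx ler01.
have [|w _ wP] := compact_EVT_max Q0 cQ (f := fun z => `|phi z|).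
  by apply: continuous_subspaceT => z; apply: cvg_norm; exact: cphi.
exists `|phi w| => t x tab.
rewrite -(periodic_shift (pphi t) (fun i => - Num.floor (x 0 i))).
apply: wP; apply/mem_set; split; first by rewrite /= in_itv.
move=> i; rewrite /= !mxE in_itv/= mulrNz subr_ge0 lerBlDl.
have /andP[h1 h2] := floor_itv (x 0 i).
by rewrite h1/= ltW//; move: h2; rewrite intrD addrC.
Qed.

Lemma torus_periodic_bounded (psi : 'rV[R]_d -> R) : continuous psi -> periodic psi ->
  exists C, forall x, `|psi x| <= C.
Proof.
move=> cpsi ppsi.
have [|C CP] := @periodic_bounded 0 0 (fun z => psi z.2) _ (fun=> ppsi).
  move=> z; apply: (@continuous_comp _ _ _ snd psi); first exact: cvg_snd.
  exact: cpsi.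
by exists C => x; apply: (CP 0); rewrite lexx.
Qed.

Lemma torus_continuous_mul (p psi : 'rV[R]_d -> R) :
  (torus R d).-integrable setT (EFin \o p) -> continuous psi -> periodic psi ->
  (torus R d).-integrable setT (EFin \o (fun x => p x * psi x)).
Proof.
move=> ip cpsi ppsi; have [C CP] := torus_periodic_bounded cpsi ppsi.
apply: (@intg_bounded_mul _ _ _ _ _ _ _ C) => //.
exact: continuous_measurable_rV.
Qed.

Lemma stin_continuous_mul a b r (phi : R * 'rV[R]_d -> R) : stin a b r -> continuous phi ->
  (forall t, periodic (fun x => phi (t, x))) -> stin a b (fun z => r z * phi z).
Proof.
move=> ir cphi pphi; have [C CP] := periodic_bounded a b cphi pphi.
apply: (@intg_bounded_mul _ _ _ _ _ _ _ C) => //; first exact: measurable_slab.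
  by apply: measurable_funTS; exact: continuous_measurable_st.
by move=> [t x] /slabP/andP[h1 h2]; apply: CP; rewrite !ltW.
Qed.

Lemma intI_continuous_mul (p q : R -> R) a b : leb.-integrable `]a, b[ (EFin \o p) ->
  continuous q -> leb.-integrable `]a, b[ (EFin \o (fun t => p t * q t)).
Proof.
move=> ip cq; have [ab|ba] := leP a b; last first.
  rewrite set_itv_ge -?leNgt//; last by rewrite bnd_simp; exact: ltW.
  exact: integrable_set0.
have [|c cab cP] := @EVT_max R (fun t => `|q t|) a b ab.
  by apply: continuous_subspaceT => t; apply: cvg_norm; exact: cq.
apply: (@intg_bounded_mul _ _ _ _ _ _ _ `|q c|) => //.
  by apply: measurable_funTS; exact: continuous_measurable_fun.
by move=> t /=; rewrite in_itv/= => /andP[h1 h2]; apply: cP; rewrite in_itv/= !ltW.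
Qed.

Lemma normalized_bump a b : a < b -> exists (eta : R -> R) (a' b' : R),
  [/\ smooth eta, forall t, ~~ (a' <= t <= b') -> eta t = 0, a < a' /\ b' < b &
   \int[leb]_(t in `]a, b[) eta t = 1].
Proof.
move=> ab.
have mD : measurable (`]a, b[%classic : set (measurableTypeR R)) by exact: measurable_itv.
have i1 : leb.-integrable `]a, b[ (EFin \o (fun=> 1 : R)).
  by apply: continuous_intI => x; exact: cvg_cst.
have [|||_ H] := @Rdominated _ _ R leb `]a, b[%classic (fun n => time_bump a b n) (fun=> 1) (fun=> 1) mD _ (@measurable_cst _ _ _ _ _ _) _ i1.
- move=> n; apply: measurable_funTS; apply: continuous_measurable_fun.
  exact/smooth_continuous/smooth_time_bump.
- apply: aeW => t; rewrite /= in_itv/= => tab.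
  by have := @cvg_time_bump R a b t; rewrite tab.
- by move=> n t _; rewrite ger0_norm ?time_bump_ge0 ?time_bump_le1.
rewrite Rintegral_cst// mul1r in H.
have ba : fine (leb `]a, b[) = b - a by rewrite lebesgue_measure_itv/= lte_fin ab.
rewrite ba in H.
have [n nP] : exists n, 0 < \int[leb]_(t in `]a, b[) time_bump a b n t.
  have ba0 : 0 < b - a by rewrite subr_gt0.
  have := cvgr_gt _ H _ ba0 => -[N _ /(_ N (leqnn _)) ?].
  by exists N.
set c := \int[leb]_(t in `]a, b[) time_bump a b n t in nP.
have ib : leb.-integrable `]a, b[ (EFin \o (time_bump a b n)).
  by apply: continuous_intI; exact/smooth_continuous/smooth_time_bump.
exists (fun t => c^-1 * time_bump a b n t), (a + n.+1%:R^-1), (b - n.+1%:R^-1); split.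
- exact/smoothZ/smooth_time_bump.
- by move=> t h; rewrite time_bump_out ?mulr0.
- by rewrite ltrDl ltrBlDr ltrDl invr_gt0.
- by rewrite RintegralZl// mulVf// gt_eqF.
Qed.

Lemma smooth_separated (eta : R -> R) (psi : 'rV[R]_d -> R) :
  smooth eta -> smooth psi -> periodic psi ->
  smooth_st (fun z : R * 'rV[R]_d => eta z.1 * psi z.2).
Proof.
move=> se sp pp; split; last by move=> t x i /=; rewrite pp.
by apply: smoothM; [exact: smooth_fst|exact: smooth_snd].
Qed.

Lemma dt_separated (Phi eta : R -> R) (psi : 'rV[R]_d -> R) :
  (forall t : R, is_derive t (1 : R) Phi (eta t)) -> smooth Phi -> smooth psi -> periodic psi ->
  dt (fun z : R * 'rV[R]_d => Phi z.1 * psi z.2) = (fun z => eta z.1 * psi z.2).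
Proof.
move=> dP sP sp pp; apply/funext => -[t x] /=.
have [s1 _] := smooth_separated sP sp pp.
have := is_derive_tslice x t s1 => /= H1.
have H2 : is_derive t (1 : R) (fun t => Phi t * psi x) (eta t * psi x).
  have := @is_deriveZ _ _ _ Phi (psi x) t 1 _ (dP t) => H.
  have -> : (fun t => Phi t * psi x) = psi x \*: Phi by apply/funext => s; rewrite mulrC.
  by rewrite mulrC.
by rewrite -(derive_val (is_derive := H1)) (derive_val (is_derive := H2)).
Qed.

(** The du Bois-Reymond lemma. Once the primitive of [g] is subtracted, [f] pairs to zero
    with every test function of zero mean in time, since this is the time derivative of a
    test function. Hence [f] minus its mean against a fixed bump pairs to zero with all
    separated tests. *)
Lemma weak_derivative_primitive a b f g : a < b -> stin a b f -> stin a b g ->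
  (forall (phi : R * 'rV[R]_d -> R) (a' b' : R), smooth_st phi -> a < a' -> b' < b ->
    supported_in a' b' phi ->
    \int[st]_(z in slab a b) (f z * dt phi z) = - \int[st]_(z in slab a b) (g z * phi z)) ->
  exists c : 'rV[R]_d -> R, (torus R d).-integrable setT (EFin \o c) /\
    {ae st, forall z, slab a b z -> f z = c z.2 + time_primitive a g z}.
Proof.
move=> ab if_ ig weak.
have mS := @measurable_slab R d a b.
have mI : measurable (`]a, b[%classic : set (measurableTypeR R)) by exact: measurable_itv.
have iP := time_primitive_integrable ig.
pose r z := f z - time_primitive a g z.
have ir : stin a b r by exact: intgB.
have [eta0 [a0 [b0 [se0 e0out [aa0 bb0] e0int]]]] := normalized_bump ab.
pose c x := \int[leb]_(t in `]a, b[) (r (t, x) * eta0 t).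
have ire (eta : R -> R) : smooth eta -> stin a b (fun z => r z * eta z.1).
  move=> se; apply: stin_continuous_mul => //.
  exact/smooth_continuous/smooth_fst.
have ic : (torus R d).-integrable setT (EFin \o c) by exact: slab_integrable2 (ire _ se0).
exists c; split=> //.
have i1 : stin a b (fun z => 1 * c z.2).
  by apply: (slab_tensor (q := fun=> 1) _ ic).1; apply: continuous_intI => x; exact: cvg_cst.
have irc : stin a b (fun z => r z - 1 * c z.2) by exact: intgB.
suff : {ae st, forall z, slab a b z -> r z - 1 * c z.2 = 0}.
  apply: filterS => z h zS; have /eqP := h zS; rewrite mul1r subr_eq0 /r => /eqP H.
  by rewrite -H subrK.
apply: separated_tests_zero => // eta psi a' b' se eo aa' bb' sp pp.
pose I := \int[leb]_(t in `]a, b[) eta t.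
(* The bump [eta0] corrects the mean of [eta], so that [theta] has a primitive with
   compact support in ]a, b[. *)
pose theta t := eta t - I * eta0 t.
have sth : smooth theta by apply: smoothB => //; exact: smoothZ.
pose m := Num.min a' a0; pose M := Num.max b' b0.
have th0 t : ~~ (m <= t <= M) -> theta t = 0.
  move=> h; rewrite /theta eo ?e0out ?mulr0 ?subrr//; apply: contra h => /andP[h1 h2].
    by rewrite ge_min h1 orbT le_max h2 orbT.
  by rewrite ge_min h1 le_max h2.
have th0l t : t <= m -> theta t = 0.
  rewrite le_eqVlt => /orP[/eqP tm|tm]; last by rewrite th0// negb_and -ltNge tm.
  have cth := smooth_continuous sth; apply/eqP; apply: contraT => thn.
  have := cth t; move=> /cvgrPdist_lt /(_ `|theta t|); rewrite normr_gt0 => /(_ thn).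
  move=> /nbhs_ballP[e /= e0 eP].
  have := eP (t - e / 2); rewrite -ball_normE /= opprB addrCA subrr addr0 ger0_norm ?divr_ge0 ?(ltW e0)//.
  rewrite ltr_pdivrMr// ltr_pMr// ltr1n => /(_ isT).
  rewrite [theta (t - _)]th0 ?subr0 ?ltxx// negb_and -ltNge -tm.
  by rewrite ltrBlDr ltrDl divr_gt0.
have th0r t : M < t -> theta t = 0.
  by move=> tm; rewrite th0// negb_and -!ltNge tm orbT.
have am : a < m by rewrite lt_min aa' aa0.
have Mb : M < b by rewrite gt_max bb' bb0.
have [Phi [dP P0]] := antiderivative (smooth_continuous sth) th0l.
have sP : smooth Phi by exact: smooth_R dP sth.
have ieta : leb.-integrable `]a, b[ (EFin \o eta) by exact/continuous_intI/smooth_continuous.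
have ieta0 : leb.-integrable `]a, b[ (EFin \o eta0) by exact/continuous_intI/smooth_continuous.
have Pb : Phi b = 0.
  have := FTC2_oo (ltW ab) dP (smooth_continuous sth).
  rewrite [X in _ - X]P0 ?(ltW am)// subr0 => <-.
  rewrite RintegralB//; last exact: intgZ.
  by rewrite RintegralZl// e0int mulr1 subrr.
pose M' := (M + b) / 2.
have MM' : M < M' by rewrite ltr_pdivlMr// mulr_natr mulr2n ltrD2l.
have M'b : M' < b by rewrite ltr_pdivrMr// mulr_natr mulr2n ltrD2r.
have P0r t : M' <= t -> Phi t = 0.
  move=> M't; have th0' s : M' <= s -> theta s = 0 by move=> h; apply: th0r; exact: lt_le_trans h.
  by rewrite (constant_after dP th0' M't) -(constant_after dP th0' (ltW M'b)) Pb.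
have sphi := smooth_separated sP sp pp.
have E1 : \int[st]_(z in slab a b) (f z * (theta z.1 * psi z.2)) =
    - \int[st]_(z in slab a b) (g z * (Phi z.1 * psi z.2)).
  rewrite -(weak _ m M')//; first by rewrite (dt_separated dP sP sp pp).
  move=> t x; rewrite negb_and -!ltNge => /orP[tm|Mt] /=.
    by rewrite P0 ?mul0r// ltW.
  by rewrite P0r ?mul0r// ltW.
have sep (e : R -> R) (r' : R * 'rV[R]_d -> R) : smooth e -> stin a b r' ->
    stin a b (fun z => r' z * (e z.1 * psi z.2)).
  move=> se' ir'; apply: stin_continuous_mul => //.
    by apply: smooth_continuous; apply: smoothM; [exact: smooth_fst|exact: smooth_snd].
  by move=> t x i; rewrite pp.
have E2 : \int[st]_(z in slab a b) (time_primitive a g z * (theta z.1 * psi z.2)) =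
    - \int[st]_(z in slab a b) (g z * (Phi z.1 * psi z.2)).
  have iPt := sep _ _ sth iP; have igP := sep _ _ sP ig.
  rewrite (slab_fubini2 iPt) (slab_fubini2 igP) -mulN1r -RintegralZl//; last exact: slab_integrable2 igP.
  apply: ae_Rintegral => //.
  - exact: intg_measurable (slab_integrable2 iPt).
  - by apply: intg_measurable; apply: intgZ => //; exact: slab_integrable2 igP.
  have iPth : stin a b (fun z => time_primitive a g z * theta z.1).
    apply: stin_continuous_mul => //.
    exact/smooth_continuous/smooth_fst.
  have := slab_ae_integrable2 iPth; have := slab_ae_integrable2 ig.
  apply: filterS2 => x igx iPx _.
  have ith : leb.-integrable `]a, b[ (EFin \o theta) by exact/continuous_intI/smooth_continuous.
  have := triangle_fubini igx ith.
  have -> : \int[leb]_(s in `]a, b[) (g (s, x) * \int[leb]_(t in `]s, b[) theta t) =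
      - \int[leb]_(s in `]a, b[) (g (s, x) * Phi s).
    rewrite -mulN1r -RintegralZl//; last first.
      have := intI_continuous_mul igx (smooth_continuous sP); exact.
    apply: eq_Rintegral => s /set_mem; rewrite /= in_itv/= => /andP[as_ sb].
    by rewrite (FTC2_oo (ltW sb) dP (smooth_continuous sth)) Pb sub0r mulrN mulN1r.
  move=> H.
  transitivity (psi x * \int[leb]_(t in `]a, b[) (theta t * \int[leb]_(s in `]a, t[) g (s, x))).
    rewrite -RintegralZl//; last first.
      by apply: eq_integrable iPx => // t _; rewrite /= mulrC.
    by apply: eq_Rintegral => t _ /=; rewrite /time_primitive /=; ring.
  rewrite H mulrN mulN1r; congr (- _); rewrite -RintegralZl//; last first.
    exact: intI_continuous_mul igx (smooth_continuous sP).
  by apply: eq_Rintegral => t _ /=; ring.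
have E3 : \int[st]_(z in slab a b) (r z * (theta z.1 * psi z.2)) = 0.
  under eq_Rintegral do rewrite /r mulrBl.
  by rewrite RintegralB ?E1 ?E2 ?subrr//; exact: sep.
have E4 : \int[st]_(z in slab a b) (1 * c z.2 * (eta z.1 * psi z.2)) =
    I * \int[st]_(z in slab a b) (r z * (eta0 z.1 * psi z.2)).
  have icp := torus_continuous_mul ic (smooth_continuous sp) pp.
  have [_ E] := slab_tensor ieta icp.
  transitivity (\int[st]_(z in slab a b) (eta z.1 * (c z.2 * psi z.2))).
    by apply: eq_Rintegral => z _; ring.
  rewrite E; congr (_ * _); have ir0 := sep _ _ se0 ir; rewrite (slab_fubini2 ir0).
  apply: ae_Rintegral => //.
  - exact: intg_measurable icp.
  - exact: intg_measurable (slab_integrable2 ir0).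
  have := slab_ae_integrable2 (ire _ se0); apply: filterS => x ix _.
  rewrite /c -RintegralZr//; apply: eq_Rintegral => t _ /=; ring.
under eq_Rintegral do rewrite mulrBl.
rewrite RintegralB//; [|exact: sep|exact: sep].
rewrite E4 -RintegralZl//; last exact: sep.
rewrite -RintegralB//; [|exact: sep|by apply: intgZ => //; exact: sep].
rewrite -E3; apply: eq_Rintegral => z _; rewrite /theta; ring.
Qed.

End Primitive.

(** * Convex functions and the Legendre transform *)

Section ContinuousReal.
Context {R : realType} {T : topologicalType}.
Implicit Types f g : T -> R.

Lemma contD f g : continuous f -> continuous g -> continuous (fun z => f z + g z).
Proof. by move=> cf cg z; apply: cvgD; [exact: cf|exact: cg]. Qed.

Lemma contB f g : continuous f -> continuous g -> continuous (fun z => f z - g z).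
Proof. by move=> cf cg z; apply: cvgB; [exact: cf|exact: cg]. Qed.

Lemma contM f g : continuous f -> continuous g -> continuous (fun z => f z * g z).
Proof. by move=> cf cg z; apply: cvgM; [exact: cf|exact: cg]. Qed.

Lemma cont_norm f : continuous f -> continuous (fun z => `|f z|).
Proof. by move=> cf z; apply: cvg_norm; exact: cf. Qed.

End ContinuousReal.

Lemma continuous_ball_lt {R : realType} (V : normedModType R) (f : V -> R) :
  (forall x (e : R), 0 < e -> exists2 del : R, 0 < del &
     forall y, ball x del y -> `|f x - f y| < e) -> continuous f.
Proof.
move=> H x; apply/cvgrPdist_lt => e e0; have [del del0 h] := H x e e0.
by apply/nbhs_ballP; exists del.
Qed.

Section RowVectors.
Context {R : realType} {n : nat}.
Implicit Types (u v w x y : 'rV[R]_n).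

Lemma dotvDl u v w : dotv (u + v) w = dotv u w + dotv v w.
Proof. by rewrite /dotv -big_split; apply: eq_bigr => i _; rewrite mxE mulrDl. Qed.

Lemma dotvZl (c : R) u w : dotv (c *: u) w = c * dotv u w.
Proof. by rewrite /dotv mulr_sumr; apply: eq_bigr => i _; rewrite mxE mulrA. Qed.

Lemma dotvC u w : dotv u w = dotv w u.
Proof. by apply: eq_bigr => i _; rewrite mulrC. Qed.

Lemma dotvNl u w : dotv (- u) w = - dotv u w.
Proof. by rewrite -scaleN1r dotvZl mulN1r. Qed.

Lemma dotvBl u v w : dotv (u - v) w = dotv u w - dotv v w.
Proof. by rewrite dotvDl dotvNl. Qed.

Lemma dotvDr u v w : dotv w (u + v) = dotv w u + dotv w v.
Proof. by rewrite dotvC dotvDl !(dotvC w). Qed.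

Lemma dotvZr (c : R) u w : dotv w (c *: u) = c * dotv w u.
Proof. by rewrite dotvC dotvZl (dotvC w). Qed.

Lemma dotvNr u w : dotv w (- u) = - dotv w u.
Proof. by rewrite dotvC dotvNl (dotvC w). Qed.

Lemma dotvBr u v w : dotv w (u - v) = dotv w u - dotv w v.
Proof. by rewrite dotvDr dotvNr. Qed.

Lemma dotv0l w : dotv 0 w = 0.
Proof. by rewrite /dotv big1// => i _; rewrite mxE mul0r. Qed.

Lemma dotv0r w : dotv w 0 = 0.
Proof. by rewrite dotvC dotv0l. Qed.

Lemma dotv_delta w i : dotv w (delta_mx 0 i) = w 0 i.
Proof.
rewrite /dotv (bigD1 i)//= mxE !eqxx mulr1 big1 ?addr0// => j ji.
by rewrite mxE (negbTE ji) andbF mulr0.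
Qed.

Definition norm1 (x : 'rV[R]_n) : R := \sum_i `|x 0 i|.

Lemma norm1_ge0 x : 0 <= norm1 x.
Proof. exact: sumr_ge0. Qed.

Lemma coord_le_norm1 x i : `|x 0 i| <= norm1 x.
Proof. by rewrite /norm1 (bigD1 i)//= lerDl sumr_ge0. Qed.

Lemma norm1Z (c : R) x : norm1 (c *: x) = `|c| * norm1 x.
Proof. by rewrite /norm1 mulr_sumr; apply: eq_bigr => i _; rewrite mxE normrM. Qed.

Lemma dotv_le (c : R) u w : (forall i, `|u 0 i| <= c) -> `|dotv u w| <= c * norm1 w.
Proof.
move=> uc; rewrite (le_trans (ler_norm_sum _ _ _))// /norm1 mulr_sumr.
by apply: ler_sum => i _; rewrite normrM ler_wpM2r.
Qed.

Lemma coord_le_enorm x i : `|x 0 i| <= enorm x.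
Proof.
rewrite -sqrtr_sqr ler_sqrt; last by apply: sumr_ge0 => j _; rewrite -expr2 sqr_ge0.
rewrite /dotv (bigD1 i)//= -expr2 lerDl; apply: sumr_ge0 => j _.
by rewrite -expr2 sqr_ge0.
Qed.

Lemma continuous_sumr (T : topologicalType) (I : Type) (r : seq I) (f : I -> T -> R) :
  (forall i, continuous (f i)) -> continuous (fun z => \sum_(i <- r) f i z).
Proof.
move=> cf; elim: r => [|i r IH].
  by under eq_fun do rewrite big_nil; exact: cst_continuous.
under eq_fun do rewrite big_cons.
by move=> x; apply: cvgD; [exact: cf|exact: IH].
Qed.

Lemma continuous_dotv (T : topologicalType) (f g : T -> 'rV[R]_n) :
  (forall i, continuous (fun z => f z 0 i)) -> (forall i, continuous (fun z => g z 0 i)) ->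
  continuous (fun z => dotv (f z) (g z)).
Proof.
move=> cf cg; apply: continuous_sumr => i x.
by apply: cvgM; [exact: cf|exact: cg].
Qed.

Lemma continuous_rV (T : topologicalType) (f : T -> 'rV[R]_n) :
  (forall i, continuous (fun z => f z 0 i)) -> continuous f.
Proof.
move=> cf x; apply/cvg_ballP => e e0.
have H : \forall y \near x, forall i, `|f x 0 i - f y 0 i| < e.
  apply: filter_forall => i; have := cf i x; move=> /cvgrPdist_lt; exact.
by near=> y; apply/(ball_rV _ _ e0); near: y.
Unshelve. all: by end_near. Qed.

Lemma continuous_dotvr (y : 'rV[R]_n) : continuous (fun z : 'rV[R]_n => dotv y z).
Proof.
apply: (@continuous_dotv _ (fun=> y) id) => i; first exact: cst_continuous.
by move=> z; exact: coord_continuous.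
Qed.

Lemma coord_continuous_rV i : continuous (fun x : 'rV[R]_n => x 0 i).
Proof. by move=> x; exact: coord_continuous. Qed.

Lemma compact_box x (r : R) : compact [set y : 'rV[R]_n | forall i, `|y 0 i - x 0 i| <= r].
Proof.
have := @rV_compact R n (fun i => `[(x 0 i - r), (x 0 i + r)]%classic)
  (fun i => @segment_compact R _ _).
rewrite (_ : [set v | _] = [set y : 'rV[R]_n | forall i, `|y 0 i - x 0 i| <= r])//.
by apply/seteqP; split=> y h i; have := h i; rewrite /= in_itv/= ler_distl.
Qed.

End RowVectors.

Section ConvexFunctions.
Context {R : realType} {n : nat}.
Implicit Types (f : 'rV[R]_n -> R) (u v w x y : 'rV[R]_n).

Lemma convex_functionP f : convex_function (setT : set 'rV[R]_n) f ->
  forall (t : R) x y, 0 <= t -> t <= 1 ->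
  f (t *: x + (1 - t) *: y) <= t * f x + (1 - t) * f y.
Proof. by move=> H t x y t0 t1; exact: (H (Itv01 t0 t1) x y (mem_set I) (mem_set I)). Qed.

Lemma difference_quotient_cvg f x v : derivable f x v ->
  h^-1 * (f (h *: v + x) - f x) @[h --> 0^'+] --> 'D_v f x.
Proof.
move=> df; have : h^-1 *: (f (h *: v + x) - f x) @[h --> 0^'] --> 'D_v f x by exact: df.
exact: cvg_dnbhs_at_right.
Qed.

Section Differentiable.
Variable f : 'rV[R]_n -> R.
Hypothesis cvxf : convex_function (setT : set 'rV[R]_n) f.
Hypothesis df : forall x v, derivable f x v.

Lemma convex_derive_le x y : 'D_(y - x) f x <= f y - f x.
Proof.
have dv : derivable f x (y - x) by exact: df.
apply: (cvgr_to_le (difference_quotient_cvg dv)).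
near=> h.
have h0 : 0 < h by near: h; exact: nbhs_right_gt.
have h1 : h <= 1 by near: h; exact: nbhs_right_le.
rewrite ler_pdivrMl// lerBlDr.
have -> : h *: (y - x) + x = h *: y + (1 - h) *: x.
  by rewrite scalerBr scalerBl scale1r addrAC addrA.
apply: le_trans (convex_functionP cvxf _ _ (ltW h0) h1) _.
by rewrite le_eqVlt; apply/orP; left; apply/eqP; ring.
Unshelve. all: by end_near. Qed.

Lemma derive_opp_convex x v : 'D_(- v) f x = - 'D_v f x.
Proof.
rewrite -scaleN1r.
have dl : derivable (fun t : R => f (t *: v + x)) 0 1.
  have dv y : derivable f y v by exact: df.
  by have := is_derive_line x 0 dv => -[].
have [_] := derive_R (-1) dl.
have hA (a h b : R) : (h *: b + a) *: v + x = h *: (b *: v) + (a *: v + x).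
  by rewrite scalerDl scalerA addrA.
rewrite !(derive_affine (A := fun t : R => t *: v + x) (A' := fun t : R => t *: v))//.
by rewrite !scale0r !add0r scale1r mulN1r.
Qed.

Lemma derive_scale_convex x v (c : R) : 'D_(c *: v) f x = c * 'D_v f x.
Proof.
have dl : derivable (fun t : R => f (t *: v + x)) 0 1.
  have dv y : derivable f y v by exact: df.
  by have := is_derive_line x 0 dv => -[].
have [_] := derive_R c dl.
have hA (a h b : R) : (h *: b + a) *: v + x = h *: (b *: v) + (a *: v + x).
  by rewrite scalerDl scalerA addrA.
rewrite !(derive_affine (A := fun t : R => t *: v + x) (A' := fun t : R => t *: v))//.
by rewrite !scale0r !add0r scale1r.
Qed.

Let derive_subadd x u v : 'D_(u + v) f x <= 'D_u f x + 'D_v f x.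
Proof.
have d w : derivable f x w by exact: df.
have cu := difference_quotient_cvg (d (2 *: u)).
have cv := difference_quotient_cvg (d (2 *: v)).
have cuv := difference_quotient_cvg (d (u + v)).
have := @cvgD _ _ _ _ (at_right_proper_filter (0 : R)) _ _ _ _ cu cv.
rewrite !derive_scale_convex => c2.
have c2' := cvgM (cvg_cst (2^-1 : R)) c2.
have -> : 'D_u f x + 'D_v f x = 2^-1 * (2 * 'D_u f x + 2 * 'D_v f x).
  by rewrite -mulrDr mulKf.
have pF := at_right_proper_filter (0 : R).
apply: (ler_cvg_to cuv (c2' _ _)); near=> h.
have h0 : 0 < h by near: h; exact: nbhs_right_gt.
set A := f (h *: (2 *: u) + x); set B := f (h *: (2 *: v) + x); set C := f _.
rewrite -[X in _ <= X]/(2^-1 * (h^-1 * (A - f x) + h^-1 * (B - f x))).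
rewrite -mulrDr mulrCA ler_pM2l ?invr_gt0//.
have C2 : C <= 2^-1 * A + (1 - 2^-1) * B.
  rewrite /C (_ : h *: (u + v) + x =
    2^-1 *: (h *: (2 *: u) + x) + (1 - 2^-1) *: (h *: (2 *: v) + x)).
    by apply: (convex_functionP cvxf); rewrite ?invr_ge0// invf_le1// ler1n.
  by apply/rowP => i; rewrite !mxE; field.
by lra.
Unshelve. all: by end_near. Qed.

Lemma derive_add_convex x u v : 'D_(u + v) f x = 'D_u f x + 'D_v f x.
Proof.
apply/eqP; rewrite eq_le derive_subadd/=.
have := derive_subadd x (- u) (- v).
by rewrite -opprD !derive_opp_convex -opprD lerN2.
Qed.

(** The directional derivative of a convex function is sublinear in the direction; being
    odd as well, it is linear. *)
Lemma derive_grad_convex x v : 'D_v f x = dotv (grad f x) v.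
Proof.
rewrite {1}[v]row_sum_delta /dotv.
rewrite (eq_bigr (fun i => 'D_(v 0 i *: delta_mx 0 i) f x)); last first.
  by move=> i _; rewrite derive_scale_convex mxE /partial mulrC.
elim: (index_enum _) => [|i s IH]; last by rewrite !big_cons derive_add_convex IH.
by rewrite !big_nil -(scale0r 0) derive_scale_convex mul0r.
Qed.

Lemma convex_grad_le x y : f x + dotv (grad f x) (y - x) <= f y.
Proof. by rewrite -derive_grad_convex -lerBrDl; exact: convex_derive_le. Qed.

Lemma subgradient_grad x y : (forall z, f x + dotv y (z - x) <= f z) -> grad f x = y.
Proof.
move=> H.
have ge v : dotv y v <= 'D_v f x.
  have dv : derivable f x v by exact: df.
  apply: (cvgr_to_ge (difference_quotient_cvg dv)); near=> h.
  have h0 : 0 < h by near: h; exact: nbhs_right_gt.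
  rewrite ler_pdivlMl// lerBrDl -dotvZr; apply: le_trans (H (h *: v + x)).
  by rewrite addrK.
apply/rowP => i; rewrite mxE /partial; apply/eqP; rewrite eq_le.
have := ge (delta_mx 0 i); rewrite dotv_delta => ->; rewrite andbT.
have := ge (- delta_mx 0 i); rewrite derive_opp_convex dotvNr dotv_delta.
by rewrite lerN2.
Unshelve. all: by end_near. Qed.

End Differentiable.
End ConvexFunctions.

(** The properties of the entropy under which the gradients of [K] and of its Legendre
    transform are inverse to each other. *)
Record legendre_regular {R : realType} {n : nat} (K : 'rV[R]_n -> R) : Prop := LegendreRegular {
  reg_convex : convex_function (setT : set 'rV[R]_n) K;
  reg_strict : strictly_convex K;
  reg_derivable : forall x v, derivable K x v;
  reg_continuous : continuous K;
  reg_zero : K 0 = 0;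
  reg_ge0 : forall x, 0 <= K x;
  reg_even : even_fun K;
  reg_superlinear : forall A : R, exists2 r : R, 0 < r &
    forall x, r <= enorm x -> A * enorm x <= K x }.

Section Conjugate.
Context {R : realType} {n : nat}.
Variable K : 'rV[R]_n -> R.
Hypothesis regK : legendre_regular K.
Let cvxK := reg_convex regK.
Let sK := reg_strict regK.
Let dK := reg_derivable regK.
Let cK := reg_continuous regK.
Let K0 := reg_zero regK.
Let K_ge0 := reg_ge0 regK.
Let evenK := reg_even regK.
Let superK := reg_superlinear regK.
Local Notation Ks := (legendre K).

Let maximizer_exists y : exists x, forall z, dotv y z - K z <= dotv y x - K x.
Proof.
have [r r0 rP] := superK (norm1 y).
pose B := [set z : 'rV[R]_n | forall i, `|z 0 i - (0 : 'rV[R]_n) 0 i| <= r].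
have B0 : B 0 by move=> i; rewrite subrr normr0 ltW.
have cf : continuous (fun z => dotv y z - K z).
  by apply: contB => //; exact: continuous_dotvr.
have cB : compact B by exact: compact_box.
have [|x _ xP] := compact_EVT_max (ex_intro _ _ B0) cB (f := fun z => dotv y z - K z).
  exact: continuous_subspaceT.
exists x => z; have [zB|zB] := pselect (B z); first by apply: xP; rewrite inE.
have rz : r <= enorm z.
  have [i zi] : exists i, r < `|z 0 i|.
    apply: contrapT => h; apply: zB => i; rewrite mxE subr0 leNgt.
    by apply/negP => h'; apply: h; exists i.
  by apply/ltW/(lt_le_trans zi); exact: coord_le_enorm.
apply: (@le_trans _ _ 0); last by have := xP 0 (mem_set B0); rewrite dotv0r K0 subrr.
rewrite subr_le0; apply: le_trans (rP _ rz).
rewrite (le_trans (ler_norm _))// dotvC (le_trans (dotv_le (c := enorm z) _ _))//.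
  by move=> i; exact: coord_le_enorm.
by rewrite mulrC.
Qed.

(** A maximizer of y.x - K x; [grad_legendre] identifies it with the gradient of the
    Legendre transform. *)
Definition conj_grad (y : 'rV[R]_n) : 'rV[R]_n := projT1 (cid (maximizer_exists y)).
Local Notation g := conj_grad.

Lemma conj_gradP y z : dotv y z - K z <= dotv y (g y) - K (g y).
Proof. by rewrite /g; case: cid => x /= xP; exact: xP. Qed.

Lemma legendreE y : Ks y = dotv y (g y) - K (g y).
Proof.
apply/eqP; rewrite eq_le; apply/andP; split.
  apply: ge_sup; first by exists (dotv y 0 - K 0), 0.
  by move=> _ [x _ <-]; exact: conj_gradP.
apply: sup_upper_bound; last by exists (g y).
split; first by exists (dotv y 0 - K 0), 0.
by exists (dotv y (g y) - K (g y)) => _ [x _ <-]; exact: conj_gradP.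
Qed.

Lemma young_ineq y x : dotv y x <= K x + Ks y.
Proof. by rewrite -lerBlDl legendreE; exact: conj_gradP. Qed.

Lemma grad_conj_grad y : grad K (g y) = y.
Proof.
apply: subgradient_grad => // z; have := conj_gradP y z.
rewrite dotvBr; lra.
Qed.

Lemma legendre_grad x : Ks (grad K x) = dotv (grad K x) x - K x.
Proof.
rewrite legendreE; apply/eqP; rewrite eq_le conj_gradP andbT.
have := convex_grad_le cvxK dK x (g (grad K x)).
rewrite dotvBr; lra.
Qed.

Lemma bregman_gt0 x y z : grad K x = y -> z != x -> 0 < K z - K x - dotv y (z - x).
Proof.
move=> gx zx.
have h2 : 2^-1 < 1 :> R by rewrite invf_lt1// ltr1n.
have h0 : 0 < 2^-1 :> R by rewrite invr_gt0.
have := sK zx h0 h2.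
have := convex_grad_le cvxK dK x (2^-1 *: z + (1 - 2^-1) *: x).
have -> : 2^-1 *: z + (1 - 2^-1) *: x - x = 2^-1 *: (z - x).
  by rewrite scalerBl scale1r scalerBr addrA addrAC addrK.
rewrite gx dotvZr; set A := K _; set B := dotv _ _; set C := K z; set E := K x.
by move=> a1 a2; have := le_lt_trans a1 a2; lra.
Qed.

Lemma conj_grad_grad x : g (grad K x) = x.
Proof.
apply/eqP/negPn/negP => /(bregman_gt0 (erefl (grad K x))).
have := conj_gradP (grad K x) x; rewrite dotvBr; lra.
Qed.

(** On the sphere of radius [e] around g y the Bregman divergence of [K] at g y has a
    positive minimum, and by convexity it grows at least linearly outside. Optimality of
    g y' bounds it by (y' - y).(g y' - g y), which excludes that g y' lies outside when y'
    is close to y. *)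
Lemma conj_grad_continuous_at (y : 'rV[R]_n) (e : R) : 0 < e -> exists2 del : R, 0 < del &
  forall y' : 'rV[R]_n, (forall i, `|y' 0 i - (y : 'rV[R]_n) 0 i| <= del) -> norm1 (g y' - g y) < e.
Proof.
move=> e0; pose x := g y.
pose D z := K z - K x - dotv y (z - x).
have cD : continuous D.
  apply: contB; first by apply: contB => //; exact: cst_continuous.
  under eq_fun do rewrite dotvBr.
  by apply: contB; [exact: continuous_dotvr|exact: cst_continuous].
pose S := [set z : 'rV[R]_n | forall i, `|z 0 i - x 0 i| <= e] `&` [set z | norm1 (z - x) = e].
have cS : compact S.
  apply: compact_closedI; first exact: compact_box.
  have cN : continuous (fun z : 'rV[R]_n => norm1 (z - x)).
    apply: continuous_sumr => i; under eq_fun do rewrite mxE.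
    by apply: cont_norm; apply: contD; [exact: coord_continuous_rV|exact: cst_continuous].
  rewrite (_ : [set z | _] = (fun z : 'rV[R]_n => norm1 (z - x)) @^-1` [set e])//.
  by apply: closed_comp => // z _; exact: cN.
have SP z : norm1 (z - x) = e -> S z.
  move=> ze; split=> // i; rewrite -ze; have := coord_le_norm1 (z - x) i.
  by rewrite !mxE.
have [m m0 mP] : exists2 m : R, 0 < m & forall z, S z -> m <= D z.
  have [[z0 Sz0]|nS] := pselect (exists z, S z); last first.
    by exists 1 => // z Sz; exfalso; apply: nS; exists z.
  have [|c cS' cP] := compact_EVT_min (ex_intro _ _ Sz0) cS (f := D).
    exact: continuous_subspaceT.
  exists (D c); last by move=> z Sz; apply: cP; rewrite inE.
  apply: bregman_gt0; first exact: grad_conj_grad.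
  move: cS'; rewrite inE => -[_ ce]; apply/eqP => cx.
  move: ce; rewrite /= cx subrr /norm1 big1; last by move=> i _; rewrite mxE normr0.
  by move=> /eqP; rewrite lt_eqF.
have me : 0 < m / e by rewrite divr_gt0.
exists (m / e / 2); first by rewrite divr_gt0.
move=> y' y'y; rewrite ltNge; apply/negP => en.
set x' := g y' in en; set N := norm1 (x' - x) in en.
have N0 : 0 < N by exact: lt_le_trans en.
pose l := e / N.
have l0 : 0 < l by rewrite divr_gt0.
have l1 : l <= 1 by rewrite ler_pdivrMr// mul1r.
pose z := l *: x' + (1 - l) *: x.
have zx : z - x = l *: (x' - x).
  by rewrite /z scalerBl scale1r scalerBr addrA addrAC addrK.
have Sz : S z by apply: SP; rewrite zx norm1Z ger0_norm ?(ltW l0)// /l mulfVK// gt_eqF.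
have Dz := mP _ Sz.
have cz := convex_functionP cvxK x' x (ltW l0) l1.
have DlD : D z <= l * D x' by rewrite /D zx dotvZr -/z in cz *; lra.
have opt := conj_gradP y' x; rewrite -/x' in opt.
have Dx' : D x' <= dotv (y' - y) (x' - x).
  by rewrite /D dotvBl !dotvBr; move: opt; lra.
have up : dotv (y' - y) (x' - x) <= m / e / 2 * N.
  apply: (le_trans (ler_norm _)); apply: dotv_le => i; rewrite !mxE; exact: y'y.
have : m <= l * (m / e / 2 * N).
  by apply: (le_trans Dz); apply: (le_trans DlD); rewrite ler_wpM2l ?(ltW l0)// (le_trans Dx').
rewrite (_ : l * (m / e / 2 * N) = m / 2); last first.
  rewrite /l; field; rewrite gt_eqF//= gt_eqF//.
by rewrite leNgt ltr_pdivrMr// ltr_pMr// ltr1n.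
Qed.

Lemma continuous_conj_grad i : continuous (fun y => g y 0 i).
Proof.
apply: continuous_ball_lt => y e e0.
have [del del0 H] := conj_grad_continuous_at y e0.
exists del => // y' /(ball_rV _ _ del0) yy'.
rewrite distrC; apply: le_lt_trans (H y' _); last first.
  by move=> j; rewrite distrC ltW.
by have := coord_le_norm1 (g y' - g y) i; rewrite !mxE.
Qed.

Lemma continuous_legendre : continuous Ks.
Proof.
have -> : Ks = (fun y => dotv y (g y) - K (g y)) by apply/funext => y; exact: legendreE.
apply: contB.
  apply: (@continuous_dotv R n 'rV[R]_n id g) => i; first exact: coord_continuous_rV.
  exact: continuous_conj_grad.
by move=> y; apply: continuous_comp; [|exact: cK];
  apply: continuous_rV => i; exact: continuous_conj_grad.
Qed.

Lemma legendre_subgradient y y' : Ks y + dotv (y' - y) (g y) <= Ks y'.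
Proof.
rewrite [Ks y]legendreE; have := young_ineq y' (g y).
by rewrite dotvBl; lra.
Qed.

(** The subgradient inequalities at the two end points enclose the difference quotient
    between two values of the continuous map g. *)
Lemma is_derive_legendre y v : is_derive y v Ks (dotv (g y) v).
Proof.
suff cv : h^-1 *: (Ks (h *: v + y) - Ks y) @[h --> 0^'] --> dotv (g y) v.
  by apply: DeriveDef; [apply/cvg_ex; exists (dotv (g y) v)|exact/cvg_lim].
apply/cvgrPdist_le => e e0.
have v0 : 0 < norm1 v + 1 by rewrite ltr_wpDl// norm1_ge0.
have ev0 : 0 < e / (norm1 v + 1) by rewrite divr_gt0.
have [del del0 H] := conj_grad_continuous_at y ev0.
near=> h.
have hn0 : h != 0 by near: h; exact: nbhs_dnbhs_neq.
have hv : `|h| * norm1 v <= del.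
  have hd : `|h| <= del / (norm1 v + 1).
    by near: h; apply: dnbhs0_le; rewrite divr_gt0.
  apply: (le_trans (ler_wpM2r (norm1_ge0 v) hd)).
  by rewrite mulrAC ler_pdivrMr// ler_wpM2l ?(ltW del0)// lerDl.
have gd : norm1 (g (h *: v + y) - g y) < e / (norm1 v + 1).
  apply: H => i; rewrite !mxE addrK normrM; apply: le_trans hv.
  by rewrite ler_wpM2l// coord_le_norm1.
have a1 := legendre_subgradient y (h *: v + y).
have a2 := legendre_subgradient (h *: v + y) y.
rewrite addrK dotvZl in a1.
have e2 : y - (h *: v + y) = - (h *: v) by rewrite opprD addrCA subrr addr0.
rewrite e2 dotvNl dotvZl in a2.
set G := g (h *: v + y) in gd a2.
have bnd : `|dotv v (G - g y)| <= e.
  rewrite dotvC; apply: (le_trans (dotv_le (c := e / (norm1 v + 1)) _ _)).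
    by move=> i; apply/ltW/(le_lt_trans (coord_le_norm1 _ i)).
  by rewrite mulrAC ler_pdivrMr// ler_wpM2l ?(ltW e0)// lerDl.
rewrite dotvBr in bnd; rewrite distrC [dotv (g y) v]dotvC.
rewrite -[_ *: _]/(h^-1 * (Ks (h *: v + y) - Ks y)).
set q := Ks (h *: v + y) - Ks y.
have q1 : h * dotv v (g y) <= q by rewrite /q lerBrDl.
have q2 : q <= h * dotv v G by rewrite /q; move: a2; lra.
have -> : h^-1 * q - dotv v (g y) = h^-1 * (q - h * dotv v (g y)).
  by set D0 := dotv v (g y); field.
rewrite normrM normfV ger0_norm ?subr_ge0//.
rewrite ler_pdivrMl ?normr_gt0//.
apply: (@le_trans _ _ (h * (dotv v G - dotv v (g y)))); first by rewrite mulrBr lerD2r.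
by apply: (le_trans (ler_norm _)); rewrite normrM ler_wpM2l.
Unshelve. all: by end_near. Qed.

Lemma grad_legendre : grad Ks = g.
Proof.
apply/funext => y; apply/rowP => i; rewrite mxE /partial.
by have -> := derive_val (is_derive := is_derive_legendre y (delta_mx 0 i)); rewrite dotv_delta.
Qed.

Lemma grad_legendre_grad x : grad Ks (grad K x) = x.
Proof. by rewrite grad_legendre conj_grad_grad. Qed.

Lemma legendre0 : Ks 0 = 0.
Proof.
rewrite legendreE dotv0l sub0r; apply/eqP; rewrite eq_le oppr_le0 K_ge0/=.
by have := conj_gradP 0 0; rewrite !dotv0l K0 !sub0r oppr0.
Qed.

Lemma legendre_ge0 y : 0 <= Ks y.
Proof. by rewrite legendreE; have := conj_gradP y 0; rewrite dotv0r K0 subr0. Qed.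

Lemma legendre_even y : Ks (- y) = Ks y.
Proof.
have le z : Ks (- z) <= Ks z.
  rewrite legendreE dotvNl -dotvNr -[K _]evenK lerBlDl; exact: young_ineq.
by apply/eqP; rewrite eq_le le/= -{1}[y]opprK le.
Qed.

Lemma legendre_convex (t : R) y y' : 0 <= t -> t <= 1 ->
  Ks (t *: y + (1 - t) *: y') <= t * Ks y + (1 - t) * Ks y'.
Proof.
move=> t0 t1; rewrite legendreE; set x := g _.
have := young_ineq y x; have := young_ineq y' x.
rewrite dotvDl !dotvZl => h1 h2.
have a1 := ler_wpM2l t0 h2.
have t1' : 0 <= 1 - t by rewrite subr_ge0.
have a2 := ler_wpM2l t1' h1.
move: a1 a2; set A := t * dotv y x; set B := (1 - t) * dotv y' x; lra.
Qed.

(** Convexity between x and 2 x bounds (grad K x).x by K (2 x) - K x. *)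
Lemma legendre_grad_le x : Ks (grad K x) <= K (2 *: x).
Proof.
rewrite legendre_grad; have := convex_grad_le cvxK dK x (2 *: x).
have -> : 2 *: x - x = x by rewrite scaler_nat mulr2n addrK.
by have := K_ge0 x; lra.
Qed.

Lemma conj_grad_le y : K (g y) <= Ks (2 *: y).
Proof.
have := young_ineq (2 *: y) (g y); rewrite dotvZl.
by have := legendreE y; have := legendre_ge0 y; lra.
Qed.

Lemma coord_le_legendre (y : 'rV[R]_n) i : `|y 0 i| <= Ks y + K (delta_mx 0 i).
Proof.
have h1 := young_ineq y (delta_mx 0 i).
have h2 := young_ineq y (- delta_mx 0 i).
rewrite evenK dotvNr in h2; rewrite dotv_delta in h1 h2.
by rewrite ler_norml lerNl addrC h2 h1.
Qed.

Lemma dotv_le_K y x : `|dotv y x| <= K x + Ks y.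
Proof.
have h1 := young_ineq y x; have h2 := young_ineq (- y) x.
by rewrite legendre_even dotvNl in h2; rewrite ler_norml lerNl h2 h1.
Qed.

End Conjugate.

Section Doubling.
Context {R : realType} {n : nat}.
Variable K : 'rV[R]_n -> R.
Hypothesis cvxK : forall (t : R) x y, 0 <= t -> t <= 1 ->
  K (t *: x + (1 - t) *: y) <= t * K x + (1 - t) * K y.
Hypothesis K0 : K 0 = 0.
Hypothesis K_ge0 : forall x, 0 <= K x.
Hypothesis evenK : forall x, K (- x) = K x.
Hypothesis D2 : Delta2 K.

Lemma contraction_le (t : R) x : `|t| <= 1 -> K (t *: x) <= K x.
Proof.
move=> t1; have tx : K (t *: x) = K (`|t| *: x).
  by have [|] := ger0P t => // _; rewrite scaleNr evenK.
rewrite tx; have := cvxK x 0 (normr_ge0 t) t1; rewrite scaler0 addr0 K0 mulr0 addr0.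
by move/le_trans; apply; rewrite ler_piMl.
Qed.

(** The doubling condition is iterated until 2^k exceeds [c]. *)
Lemma dilation_le (c : R) : exists C : R, 0 <= C /\
  forall (t : R) (x : 'rV[R]_n), `|t| <= c -> K (t *: x) <= C * (K x + 1).
Proof.
have [C2 HC2] := D2.
have C20 : 0 <= C2.
  have := HC2 0; rewrite scaler0 K0 add0r mulr1; exact.
have pow k : exists C : R, 0 <= C /\ forall x, K (2 ^+ k *: x) <= C * (K x + 1).
  elim: k => [|k [C [C0 IH]]].
    by exists 1; split=> // x; rewrite expr0 scale1r mul1r lerDl.
  exists (C2 * (C + 1)); split; first by rewrite mulr_ge0// addr_ge0.
  move=> x; rewrite exprS -scalerA; apply: (le_trans (HC2 _)).
  rewrite -mulrA ler_wpM2l// mulrDl mul1r; apply: lerD; first exact: IH.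
  by rewrite lerDr.
have [k ck] : exists k : nat, c <= 2 ^+ k.
  exists (Num.bound `|c|); apply: (le_trans (ler_norm _)).
  have cb := archi_boundP (normr_ge0 c).
  apply: (le_trans (ltW cb)); rewrite -natrX ler_nat; apply: ltnW; exact: ltn_expl.
have [C [C0 HC]] := pow k; exists C; split=> // t x tc.
have p0 : 0 < 2 ^+ k :> R by rewrite exprn_gt0.
have -> : t *: x = (t / 2 ^+ k) *: (2 ^+ k *: x) by rewrite scalerA mulfVK// gt_eqF.
apply: le_trans (HC x); apply: contraction_le.
rewrite normrM normfV (gtr0_norm p0) ler_pdivrMr// mul1r.
exact: le_trans tc ck.
Qed.

Lemma sum_le : exists C : R, 0 <= C /\ forall x y, K (x + y) <= C * (K x + K y + 1).
Proof.
have [C [C0 HC]] := dilation_le 2.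
exists C; split=> // x y.
have h2 : 0 <= 2^-1 :> R by rewrite invr_ge0.
have h1 : 2^-1 <= 1 :> R by rewrite invf_le1// ler1n.
have := cvxK (2 *: x) (2 *: y) h2 h1.
have -> : 1 - 2^-1 = 2^-1 :> R by rewrite {1}[1](splitr 1) mul1r addrK.
rewrite !scalerA mulVf// !scale1r => /le_trans; apply.
have n2 : `|2 : R| <= 2 by rewrite ger0_norm.
have := HC 2 x n2; have := HC 2 y n2.
have := mulr_ge0 C0 (K_ge0 x); have := mulr_ge0 C0 (K_ge0 y).
by rewrite !mulrDr !mulr1; lra.
Qed.

End Doubling.

(** * The chain rule along absolutely continuous curves *)

(** Real induction: the supremum of the times reached from 0 is reached, and it can be
    passed unless it is the target. *)
Lemma segment_induction {R : realType} (b : R) (P : R -> R -> Prop) : 0 <= b ->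
  (forall x y z, 0 <= x -> x <= y -> y <= z -> z <= b -> P x y -> P y z -> P x z) ->
  (forall s, 0 <= s <= b -> exists2 del : R, 0 < del & forall x y, 0 <= x -> x <= s -> s <= y ->
     y <= b -> s - del < x -> y < s + del -> P x y) ->
  forall t, 0 <= t <= b -> P 0 t.
Proof.
move=> b0 cat loc t0 /andP[t00 t0b].
pose A := [set t | 0 <= t <= t0 /\ P 0 t].
have A0 : A 0.
  split; first by rewrite lexx.
  have [|del del0 H] := loc 0; first by rewrite lexx.
  by apply: H => //; rewrite ?sub0r ?oppr_lt0// add0r.
have ubA : ubound A t0 by move=> t [/andP[]].
have hA : has_sup A by split; [exists 0|exists t0].
pose c := sup A.
have c0 : 0 <= c by exact: sup_upper_bound.
have cb : c <= t0 by apply: ge_sup => //; exists 0.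
have [|del del0 H] := loc c; first by rewrite c0 (le_trans cb).
have [t At ct] := sup_adherent del0 hA.
have tc : t <= c by exact: sup_upper_bound.
have [/andP[t_0 t_t0] P0t] := At.
have Pc : P 0 c.
  apply: (cat 0 t c) => //; first exact: le_trans cb t0b.
  by apply: H => //; [exact: le_trans cb t0b|rewrite ltrDl].
have [ct0|] := ltP c t0; last by move=> t0c; rewrite (_ : t0 = c)//; apply/eqP; rewrite eq_le t0c cb.
pose c' := Num.min t0 (c + del / 2).
have del2 : 0 < del / 2 by rewrite divr_gt0.
have cc' : c < c' by rewrite lt_min ct0 ltrDl.
have c't0 : c' <= t0 by rewrite ge_min lexx.
have : A c'.
  split; first by rewrite c't0 andbT (le_trans c0)// ltW.
  apply: (cat 0 c c') => //; [exact: ltW|exact: le_trans c't0 t0b|].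
  apply: H => //; [exact: ltW|exact: le_trans c't0 t0b| |].
    by rewrite ltrBlDr ltrDl.
  by rewrite gt_min ltrD2l gtr_pMr// invf_lt1// ltr1n orbT.
by move=> /(sup_upper_bound hA); rewrite leNgt cc'.
Qed.

Section Primitives.
Context {R : realType}.
Local Notation leb := (@lebesgue_measure R).
Local Notation intI a b f := (leb.-integrable `]a, b[ (EFin \o f)).

Lemma Rintegral_cat (q : R -> R) (a s t : R) : intI a t q -> a <= s -> s <= t ->
  \int[leb]_(r in `]a, t[) q r = \int[leb]_(r in `]a, s[) q r + \int[leb]_(r in `]s, t[) q r.
Proof.
move=> iq as_ st; have [->|snt] := eqVneq s t.
  by rewrite (_ : `]t, t[%classic = set0) ?Rintegral_set0 ?addr0// set_itvoo0.
have lst : s < t by rewrite lt_neqAle snt.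
have := @Rintegral_itvB R q (BRight a) (BLeft t) s iq.
rewrite !bnd_simp => /(_ as_ lst) <-.
rewrite (@Rintegral_itv_bndo_bndc _ (BRight a) s); first by rewrite addrC subrK.
apply: (integrableS _ _ _ iq) => // x /=; rewrite !in_itv/= => /andP[-> xs].
exact: lt_trans xs lst.
Qed.

(** Freezing the argument outside [0, b] makes the primitive of a function integrable on
    ]0, b[ continuous on the whole line. *)
Definition clamp (b t : R) : R := Num.max 0 (Num.min t b).

Lemma clamp_id b t : 0 <= t <= b -> clamp b t = t.
Proof. by move=> /andP[t0 tb]; rewrite /clamp min_l// max_r. Qed.

Lemma clampP b t : 0 <= b -> 0 <= clamp b t <= b.
Proof. by move=> b0; rewrite /clamp le_max lexx/= ge_max b0 ge_min lexx orbT. Qed.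

Lemma clamp_mono b s t : s <= t -> clamp b s <= clamp b t.
Proof.
move=> st; rewrite /clamp ge_max le_max lexx/= le_max.
by rewrite (le_min (Num.min s b)) !ge_min st lexx !orbT.
Qed.

Lemma clamp_dist b s t : 0 <= b -> s <= t -> clamp b t - clamp b s <= t - s.
Proof.
move=> b0 st; rewrite /clamp.
by have [?|?] := leP s b; have [?|?] := leP t b; rewrite ?maxEle; do 2?case: ifPn;
  rewrite -?ltNge => *; lra.
Qed.

Lemma continuous_primitive (q : R -> R) (b : R) : 0 <= b -> intI 0 b q ->
  continuous (fun t => \int[leb]_(r in `]0, clamp b t[) q r).
Proof.
move=> b0 iq; pose q0 := q \_ `]0, b[.
have iq0 : leb.-integrable setT (EFin \o q0).
  by rewrite -restrict_EFin; apply/integrable_restrict => //=; rewrite setTI.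
apply: (@continuous_ball_lt R R^o) => s e e0.
have [del [del0 H]] := integral_normr_continuous iq0 e0.
exists del => // t; rewrite -ball_normE/= => std.
have key x y : x <= y -> y - x < del ->
  `|\int[leb]_(r in `]0, clamp b y[) q r - \int[leb]_(r in `]0, clamp b x[) q r| < e.
  move=> xy yx.
  have /andP[x0 xb] := clampP x b0; have /andP[y0 yb] := clampP y b0.
  have cxy := clamp_mono b xy.
  rewrite (@Rintegral_cat q 0 (clamp b x) (clamp b y))//; last exact: intI_sub iq.
  rewrite addrAC subrr add0r.
  have il : intI (clamp b x) (clamp b y) q by exact: intI_sub iq.
  apply: (@le_lt_trans _ _ (\int[leb]_(r in `]clamp b x, clamp b y[) `|q0 r|)).
    apply: (le_trans (le_normr_Rintegral _ il)) => //.
    rewrite le_eqVlt; apply/orP; left; apply/eqP; apply: eq_Rintegral => r.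
    rewrite inE/= in_itv/= => /andP[xr ry]; rewrite /q0 patchE mem_set//= in_itv/=.
    by rewrite (le_lt_trans x0 xr) (lt_le_trans ry yb).
  have lm : (leb `](clamp b x), (clamp b y)[ < del%:E)%E.
    rewrite lebesgue_measure_itv/=; case: ifPn => // _.
    by rewrite -EFinB lte_fin (le_lt_trans _ yx)// clamp_dist.
  exact: (H _ (measurable_itv _) lm).
case/orP: (le_total s t) => st.
  by rewrite distrC; apply: key => //; rewrite -[t - s]ger0_norm ?subr_ge0// distrC.
by apply: key => //; rewrite -[s - t]ger0_norm ?subr_ge0.
Qed.

End Primitives.

Lemma near_coords {R : realType} (T : topologicalType) (n : nat) (f : 'I_n -> T -> R) (s : T)
    (e : R) : (forall i, continuous (f i)) -> 0 < e ->
  \forall r \near s, forall i, `|f i s - f i r| < e.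
Proof.
by move=> cf e0; apply: filter_forall => i; have := cf i s; move=> /cvgrPdist_lt /(_ _ e0).
Qed.

Section ChainRule.
Context {R : realType} {n : nat}.
Local Notation leb := (@lebesgue_measure R).
Local Notation intI a b f := (leb.-integrable `]a, b[ (EFin \o f)).
Variables (Phi : 'rV[R]_n -> R) (g : 'rV[R]_n -> 'rV[R]_n).
Hypothesis sub_g : forall y y' : 'rV[R]_n, Phi y + dotv (y' - y) (g y) <= Phi y'.
Hypothesis cg : forall i, continuous (fun y => g y 0 i).
Variables (b : R) (u q : R -> 'rV[R]_n).
Hypothesis b0 : 0 <= b.
Hypothesis cu : forall i, continuous (fun t => u t 0 i).
Hypothesis iq : forall i, intI 0 b (fun t => q t 0 i).
Hypothesis uq : forall i (s t : R), 0 <= s -> s <= t -> t <= b ->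
  u t 0 i - u s 0 i = \int[leb]_(r in `]s, t[) q r 0 i.

Let cgu i : continuous (fun t => g (u t) 0 i).
Proof.
move=> t; apply: (@continuous_comp R 'rV[R]_n R u (fun y => g y 0 i)); last exact: cg.
exact: continuous_rV.
Qed.

Lemma chain_integrable : intI 0 b (fun t => dotv (q t) (g (u t))).
Proof.
apply: intg_sum => // i; apply: intI_continuous_mul => //; exact: cgu.
Qed.

(** On a short interval the subgradient inequalities at both ends enclose the increment of
    [Phi] up to [e] times the integral of |q|. These estimates are additive, hence
    [segment_induction] gives them on [0, t], and [e] is arbitrary. *)
Lemma chain_rule (t : R) : 0 <= t <= b ->
  Phi (u t) - Phi (u 0) = \int[leb]_(s in `]0, t[) dotv (q s) (g (u s)).
Proof.
move=> tb; pose f s := dotv (q s) (g (u s)); pose m s := norm1 (q s).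
have if_ : intI 0 b f by exact: chain_integrable.
have im : intI 0 b m by apply: intg_sum => // i; exact: intg_norm (iq i).
have step (e : R) : 0 < e ->
  `|Phi (u t) - Phi (u 0) - \int[leb]_(s in `]0, t[) f s| <= e * \int[leb]_(s in `]0, t[) m s.
  move=> e0.
  pose P x y := `|Phi (u y) - Phi (u x) - \int[leb]_(s in `]x, y[) f s| <=
    e * \int[leb]_(s in `]x, y[) m s.
  apply: (@segment_induction R b P b0 _ _ t tb) => [x y z x0 xy yz zb|s /andP[s0 sb]].
    rewrite /P => h1 h2.
    rewrite (@Rintegral_cat _ f x y z)//; last exact: intI_sub if_.
    rewrite (@Rintegral_cat _ m x y z)//; last exact: intI_sub im.
    rewrite mulrDr (le_trans _ (lerD h1 h2))//.
    rewrite (le_trans _ (ler_normD _ _))// le_eqVlt; apply/orP; left; apply/eqP.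
    by congr (`| _ |); ring.
  have e2 : 0 < e / 2 by rewrite divr_gt0.
  have near_s : \forall r \near s, forall i, `|g (u s) 0 i - g (u r) 0 i| < e / 2.
    exact: (@near_coords R R n (fun i r => g (u r) 0 i) s _ cgu e2).
  move/nbhs_ballP : near_s => [del/= del0 H]; exists del => // x y x0 xs sy yb sx ysd.
  have close r r' i : x <= r <= y -> x <= r' <= y -> `|g (u r) 0 i - g (u r') 0 i| <= e.
    move=> /andP[xr ry] /andP[xr' r'y].
    have B w : x <= w -> w <= y -> `|g (u s) 0 i - g (u w) 0 i| < e / 2.
      move=> xw wy; apply: H; rewrite -ball_normE/= ltr_distlC; apply/andP; split.
        exact: lt_le_trans sx xw.
      exact: le_lt_trans wy ysd.
    rewrite [e]splitr (le_trans (ler_distD (g (u s) 0 i) _ _))// lerD// ?[`|_ - g (u s) 0 i|]distrC ltW// B//.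
  have xy : x <= y by exact: le_trans xs sy.
  have iqxy i : intI x y (fun r => q r 0 i) by exact: intI_sub (iq i).
  have imxy : intI x y m by exact: intI_sub im.
  have ifxy : intI x y f by exact: intI_sub if_.
  have dot_int w : dotv (u y - u x) w = \int[leb]_(r in `]x, y[) dotv (q r) w.
    rewrite /dotv Rintegral_sum//; last first.
      by move=> i; apply: (@intg_bounded_mul _ _ _ _ _ _ _ `|w 0 i|).
    apply: eq_bigr => i _; have e1 := uq i x0 xy yb; rewrite !mxE e1 mulrC -RintegralZl//.
    by apply: eq_Rintegral => r _; rewrite mulrC.
  have idot w : intI x y (fun r => dotv (q r) w).
    by apply: intg_sum => // i; apply: (@intg_bounded_mul _ _ _ _ _ _ _ `|w 0 i|).
  have cmp w : x <= w <= y -> `|dotv (u y - u x) (g (u w)) - \int[leb]_(s in `]x, y[) f s| <=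
      e * \int[leb]_(s in `]x, y[) m s.
    move=> wxy; rewrite dot_int -RintegralB//.
    have idif : intI x y (fun r => dotv (q r) (g (u w)) - f r) by exact: intgB.
    apply: (le_trans (le_normr_Rintegral _ idif)) => //.
    rewrite -RintegralZl//; apply: le_Rintegral => //.
    - exact: intg_norm.
    - exact: intgZ.
    move=> r; rewrite /= in_itv/= => /andP[xr ry]; rewrite /f -dotvBr dotvC.
    by apply: dotv_le => i; rewrite !mxE; apply: close => //; rewrite (ltW xr) (ltW ry).
  have up := sub_g (u y) (u x); have lo := sub_g (u x) (u y).
  have c1 : x <= x <= y by rewrite lexx.
  have c2 : x <= y <= y by rewrite lexx xy.
  have := cmp _ c1; have := cmp _ c2; rewrite /P.
  set I := \int[leb]_(s in `]x, y[) f s; set M := e * _.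
  rewrite -opprB dotvNl in up; rewrite !ler_norml; lra.
apply/eqP; rewrite -subr_eq0 -normr_le0; apply/ler_addgt0Pr => e e0; rewrite add0r.
set J := \int[leb]_(s in `]0, t[) m s in step.
have J0 : 0 <= J by apply: Rintegral_ge0 => s _; exact: norm1_ge0.
have J1 : 0 < J + 1 by rewrite ltr_wpDl.
apply: (le_trans (step (e / (J + 1)) _)); first by rewrite divr_gt0.
by rewrite mulrAC ler_pdivrMr// ler_wpM2l ?(ltW e0)// lerDl.
Qed.

Lemma weighted_chain_rule (h : R -> R) : intI 0 b h ->
  \int[leb]_(t in `]0, b[) (h t * (Phi (u t) - Phi (u 0))) =
  \int[leb]_(s in `]0, b[) (dotv (q s) (g (u s)) * \int[leb]_(t in `]s, b[) h t).
Proof.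
move=> ih; rewrite -triangle_fubini//; last exact: chain_integrable.
apply: eq_Rintegral => t; rewrite inE/= in_itv/= => /andP[t0 tb].
by rewrite chain_rule// !ltW.
Qed.

End ChainRule.

(** * Products of primitives, almost everywhere *)

Section AlmostEverywhere.
Context {d : measure_display} {T : measurableType d} {R : realType}.
Variable mu : {measure set T -> \bar R}.
Implicit Types P Q : T -> Prop.

Lemma aeS P Q : (forall z, P z -> Q z) -> {ae mu, forall z, P z} -> {ae mu, forall z, Q z}.
Proof. by move=> PQ; apply: filterS. Qed.

Lemma aeI P Q : {ae mu, forall z, P z} -> {ae mu, forall z, Q z} -> {ae mu, forall z, P z /\ Q z}.
Proof. by apply: filterS2 => z. Qed.

Lemma ae_finite (I : finType) (P : I -> T -> Prop) : (forall i, {ae mu, forall z, P i z}) ->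
  {ae mu, forall z, forall i, P i z}.
Proof. by move=> H; apply: filter_forall. Qed.

Lemma ae_countable (P : nat -> T -> Prop) : (forall i, {ae mu, forall z, P i z}) ->
  {ae mu, forall z, forall i, P i z}.
Proof. exact: ae_foralln. Qed.

End AlmostEverywhere.

Section AlmostEverywhereDerivative.
Context {R : realType}.
Local Notation leb := (@lebesgue_measure R).
Local Notation intI a b f := (leb.-integrable `]a, b[ (EFin \o f)).
Implicit Types (p q : R -> R) (a b : R).

Lemma ae_dense (P : R -> Prop) a b : a < b -> {ae leb, forall t : R, P t} ->
  exists2 t, a < t < b & P t.
Proof.
move=> ab aeP; apply: contrapT => nP.
have : leb.-negligible (`]a, b[%classic : set (measurableTypeR R)).
  apply: negligibleS aeP => t /=; rewrite in_itv/= => tab Pt.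
  by apply: nP; exists t.
move=> /negligibleP -/(_ (measurable_itv _)) H0.
have : leb `]a, b[%classic = 0%E by exact: H0.
by rewrite lebesgue_measure_itv/= lte_fin ab => /eqP; rewrite -EFinB eqe subr_eq0 gt_eqF.
Qed.

Lemma primitive_is_derive_ae a b q : intI a b q ->
  {ae leb, forall t : R, a < t < b ->
    is_derive t (1 : R) (fun x : R => \int[leb]_(r in `]a, x[) q r) (q t)}.
Proof.
move=> iq; pose q0 := q \_ `]a, b[.
have iq0 : leb.-integrable setT (EFin \o q0).
  by rewrite -restrict_EFin; apply/integrable_restrict => //=; rewrite setTI.
have iq0S D : measurable D -> leb.-integrable D (EFin \o q0).
  by move=> mD; apply: (integrableS _ mD _ iq0).
have lq0 : locally_integrable [set: R] q0 by exact: integrable_locally.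
have := @FTC1 R q0 (BRight a) (fun y => iq0S _ (measurable_itv _)) lq0.
apply: aeS => t H /andP[at_ tb].
have [d1 d2] := H at_.
have eqF : \near t, (fun x => \int[leb]_(r in `]a, x]) q0 r) t =
    (fun x => \int[leb]_(r in `]a, x[) q r) t.
  near=> x.
  have ax : a < x by near: x; exact: lt_nbhsr.
  have xb : x < b by near: x; exact: lt_nbhsl.
  rewrite -Rintegral_itv_bndo_bndc; last exact: iq0S.
  apply: eq_Rintegral => r; rewrite inE/= in_itv/= => /andP[ar rx].
  by rewrite /q0 patchE mem_set//= in_itv/= ar (lt_trans rx).
apply: (@near_eq_is_derive R R^o R^o (fun x : R => \int[leb]_(r in `]a, x]) q0 r) _ t 1 _ eqF).
apply: DeriveDef => //; rewrite -derive1E d2 /q0 patchE mem_set//= in_itv/=.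
by rewrite at_.
Unshelve. all: by end_near. Qed.

(** At almost every t the three primitives are differentiable and their combination
    D = A B - C vanishes. The zeros of D accumulate at t, so D'(t) = 0, which is the claim. *)
Lemma product_rule_ae a b (h p e H : R -> R) (H1 c c' : R) :
  intI a b h -> intI a b p -> intI a b e ->
  (forall t, a < t < b -> H t = H1 - \int[leb]_(r in `]a, t[) h r) ->
  {ae leb, forall t : R, a < t < b ->
    H t * (c + \int[leb]_(r in `]a, t[) p r) = c' + \int[leb]_(r in `]a, t[) e r} ->
  {ae leb, forall t : R, a < t < b ->
    e t = H t * p t - h t * (c + \int[leb]_(r in `]a, t[) p r)}.
Proof.
move=> ih ip ie HE prod; have prod' := prod.
have := aeI (aeI prod (primitive_is_derive_ae ie))
  (aeI (primitive_is_derive_ae ih) (primitive_is_derive_ae ip)).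
apply: aeS => t [[eq_t de] [dh dp]] tab.
have {}eq_t := eq_t tab; have {}de := de tab; have {}dp := dp tab; have {}dh := dh tab.
pose A := fun x : R => H1 - \int[leb]_(r in `]a, x[) h r.
pose B := fun x : R => c + \int[leb]_(r in `]a, x[) p r.
pose C := fun x : R => c' + \int[leb]_(r in `]a, x[) e r.
have dA : is_derive t (1 : R) A (- h t).
  have := is_deriveB (is_derive_cst H1 t (1 : R)) dh; rewrite sub0r; exact.
have dB : is_derive t (1 : R) B (p t).
  have := is_deriveD (is_derive_cst c t (1 : R)) dp; rewrite add0r; exact.
have dC : is_derive t (1 : R) C (e t).
  have := is_deriveD (is_derive_cst c' t (1 : R)) de; rewrite add0r; exact.
pose D := fun x : R => A x * B x - C x.
have dD : is_derive t (1 : R) D (H t * p t - h t * B t - e t).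
  have := is_deriveB (is_deriveM dA dB) dC.
  rewrite (_ : A t *: p t + B t *: - h t - e t = H t * p t - h t * B t - e t); last first.
    by rewrite (HE _ tab) -/(A t) /GRing.scale/=; ring.
  exact.
have Dt0 : D t = 0 by rewrite /D /A /B /C -(HE _ tab) eq_t subrr.
suff : H t * p t - h t * B t - e t = 0 by move/eqP; rewrite subr_eq0 => /eqP <-.
apply/eqP; apply: contraT => neq0; set q := _ - _ in neq0 dD.
have [ex val] := dD.
have cv : h0^-1 *: (D (h0 *: (1 : R) + t) - D t) @[h0 --> 0^'] --> q by rewrite -val; exact: ex.
have := cv; move=> /cvgrPdist_lt /(_ `|q|); rewrite normr_gt0 => /(_ neq0).
move=> /nbhs_ballP[del /= del0 Hd].
have /andP[at_ tb] := tab.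
pose y := Num.min b (t + del).
have ty : t < y by rewrite lt_min tb ltrDl.
have [x /andP[tx xy] Px] := ae_dense ty prod'.
have xab : a < x < b.
  by rewrite (lt_trans at_ tx)/= (lt_le_trans xy)// ge_min lexx.
have Dx0 : D x = 0 by rewrite /D /A /B /C -(HE _ xab) Px// subrr.
have := Hd (x - t); rewrite -ball_normE/= sub0r normrN ger0_norm ?subr_ge0 ?(ltW tx)//.
have -> : x - t < del by rewrite ltrBlDl (lt_le_trans xy)// ge_min lexx orbT.
have xt : x - t != 0 by rewrite subr_eq0 gt_eqF.
move=> /(_ isT xt); rewrite /GRing.scale/= mulr1 subrK Dx0 Dt0 subrr mulr0 subr0 ltxx.
by [].
Qed.

End AlmostEverywhereDerivative.

(** * Orlicz classes of the entropy and of its conjugate *)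

Section OrliczIntegrability.
Context {d : measure_display} {T : measurableType d} {R : realType} {n : nat}.
Variables (mu : {measure set T -> \bar R}) (D : set T) (K : 'rV[R]_n -> R).
Hypotheses (mD : measurable D) (cK : continuous K) (K_ge0 : forall y, 0 <= K y).
Implicit Types f : T -> 'rV[R]_n.

Lemma orlicz_integrable f : orlicz mu D K f -> mu.-integrable D (EFin \o (fun z => K (f z))).
Proof.
move=> [mf fin]; apply/integrableP; split.
  by apply/measurable_EFinP; exact: measurable_rV_comp.
by under eq_integral do rewrite /= ger0_norm//.
Qed.

Lemma integrable_orlicz f : (forall i, measurable_fun D (fun z => f z 0 i)) ->
  mu.-integrable D (EFin \o (fun z => K (f z))) -> orlicz mu D K f.
Proof.
move=> mf /integrableP[_]; split=> //.
by under eq_integral do rewrite -[K _]ger0_norm//.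
Qed.

Lemma orlicz_coord (c : R) f i : (mu D < +oo)%E -> (forall y : 'rV[R]_n, `|y 0 i| <= K y + c) ->
  orlicz mu D K f -> mu.-integrable D (EFin \o (fun z => f z 0 i)).
Proof.
move=> Dfin Kc of_; have [mf _] := of_.
apply: (@intg_le _ _ _ _ _ _ (fun z => K (f z) + c)) => //.
apply: intgD => //; first exact: orlicz_integrable.
exact: (@intg_bounded _ _ _ _ _ _ `|c|).
Qed.

End OrliczIntegrability.

Section Entropy.
Context {R : realType} {d n N : nat}.
Variables (F : 'rV[R]_n -> 'M[R]_N) (L : diffop R d n N).
Hypothesis hFL : standing_assumptions F L.
Local Notation K := (entropy F).
Local Notation Ks := (legendre (entropy F)).

Lemma flux_Ck i j : Ck 2 (fun v => F v i j).
Proof. by have [[_ +] _ _ _ _] := hFL; apply. Qed.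

Lemma flux_continuous i j : continuous (fun v => F v i j).
Proof. exact: Ck_continuous (flux_Ck i j). Qed.

Lemma flux_derivable i j x v : derivable (fun v => F v i j) x v.
Proof. by have [_ /(_ v) [+ _]] := flux_Ck i j; apply. Qed.

Lemma flux_partial_continuous i j l : continuous (partial l (fun v => F v i j)).
Proof. by have [_ /(_ (delta_mx 0 l)) [_ [+ _]]] := flux_Ck i j; apply. Qed.

Lemma entropyE v : K v = 2^-1 * \sum_i (F v i i - F 0 i i).
Proof. by rewrite /entropy /mxtrace; congr (_ * _); apply: eq_bigr => i _; rewrite !mxE. Qed.

Lemma entropy_continuous : continuous K.
Proof.
rewrite (_ : K = fun v => 2^-1 * \sum_i (F v i i - F 0 i i)); last by apply/funext => v; rewrite entropyE.
apply: contM; first exact: cst_continuous.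
apply: continuous_sumr => i; apply: contB; first exact: flux_continuous.
exact: cst_continuous.
Qed.

Lemma entropy_is_derive x v :
  is_derive x v K (2^-1 * \sum_i 'D_v (fun y => F y i i) x).
Proof.
rewrite (_ : K = fun v => 2^-1 *: \sum_i (F v i i - F 0 i i)); last by apply/funext => y; rewrite entropyE.
apply: is_deriveZ.
rewrite (_ : (fun v : 'rV_n => _) = \sum_i (fun v : 'rV[R]_n => F v i i - F 0 i i)); last first.
  by apply/funext => y; rewrite fct_sumE.
apply: is_derive_sum => i.
have dF : is_derive x v (fun y => F y i i) ('D_v (fun y => F y i i) x).
  by apply: DeriveDef => //; exact: flux_derivable.
have := is_deriveB dF (is_derive_cst (F 0 i i) x v); rewrite subr0; exact.
Qed.

Lemma entropy_derivable x v : derivable K x v.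
Proof. by have [] := entropy_is_derive x v. Qed.

Lemma entropy_grad_continuous i : continuous (fun v => grad K v 0 i).
Proof.
rewrite (_ : (fun v => _) = fun v => 2^-1 * \sum_j partial i (fun y => F y j j) v); last first.
  apply/funext => v; rewrite mxE /partial.
  by have [_ ->] := entropy_is_derive v (delta_mx 0 i).
apply: contM; first exact: cst_continuous.
by apply: continuous_sumr => j; exact: flux_partial_continuous.
Qed.

Lemma entropy_convex : convex_function (setT : set 'rV[R]_n) K.
Proof. by have [_ [_ []]] := hFL. Qed.

Lemma entropy_even : even_fun K.
Proof. by have [_ [_ []]] := hFL. Qed.

Lemma entropy_ge0 v : 0 <= K v.
Proof. by have [_ [_ []]] := hFL. Qed.

Lemma entropy_strict : strictly_convex K.
Proof. by have [_ []] := hFL. Qed.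

Lemma entropy0 : K 0 = 0.
Proof. by rewrite /entropy subrr mxtrace0 mulr0. Qed.

Lemma entropy_superlinear (A : R) : exists2 r : R, 0 < r & forall x, r <= enorm x -> A * enorm x <= K x.
Proof.
have [_ [_ [_ _ _ [Pm [Pp [[_ _ _ _ [_ lim]] _ bnd]]]]] _ _ _] := hFL.
have [r [_ rP]] : \forall s \near +oo, A <= Pm s / s.
  by move: lim => /cvgryPge; exact.
exists (Num.max (r + 1) 1); first by rewrite lt_max ltr01 orbT.
move=> x; rewrite ge_max => /andP[rx x1].
have x0 : 0 < enorm x by exact: lt_le_trans x1.
have /andP[+ _] := bnd x; apply: le_trans.
by rewrite -ler_pdivlMr//; apply: rP; rewrite (lt_le_trans _ rx)// ltrDl.
Qed.

Lemma entropy_regular : legendre_regular K.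
Proof.
split; [exact: entropy_convex|exact: entropy_strict|exact: entropy_derivable|
  exact: entropy_continuous|exact: entropy0|exact: entropy_ge0|exact: entropy_even|
  exact: entropy_superlinear].
Qed.

Lemma sharp_invP v : grad Ks (sharp F v) = v.
Proof. exact: (grad_legendre_grad entropy_regular). Qed.

Lemma entropy_dual_grad_continuous i : continuous (fun y => grad Ks y 0 i).
Proof. by rewrite (grad_legendre entropy_regular); exact: continuous_conj_grad. Qed.

Lemma entropy_Delta2 : Delta2 K /\ Delta2 Ks.
Proof. by have [_ []] := hFL. Qed.

Lemma entropy_dilation (c : R) : exists C : R, 0 <= C /\
  forall (t : R) (x : 'rV[R]_n), `|t| <= c -> K (t *: x) <= C * (K x + 1).
Proof.
apply: dilation_le; [|exact: entropy0|exact: entropy_ge0|exact: entropy_even|exact: entropy_Delta2.1].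
by move=> t x y; exact: convex_functionP entropy_convex t x y.
Qed.

Lemma dual_dilation (c : R) : exists C : R, 0 <= C /\
  forall (t : R) (x : 'rV[R]_n), `|t| <= c -> Ks (t *: x) <= C * (Ks x + 1).
Proof.
have r := entropy_regular; apply: dilation_le; last exact: entropy_Delta2.2.
- by move=> t x y; exact: (legendre_convex r).
- exact: (legendre0 r).
- exact: (legendre_ge0 r).
- exact: (legendre_even r).
Qed.

Lemma dual_sum : exists C : R, 0 <= C /\ forall x y, Ks (x + y) <= C * (Ks x + Ks y + 1).
Proof.
have r := entropy_regular; apply: sum_le; last exact: entropy_Delta2.2.
- by move=> t x y; exact: (legendre_convex r).
- exact: (legendre0 r).
- exact: (legendre_ge0 r).
- exact: (legendre_even r).
Qed.

Lemma dual_sharp_le : exists C : R, 0 <= C /\ forall v, Ks (sharp F v) <= C * (K v + 1).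
Proof.
have [C [C0 H]] := entropy_dilation 2; exists C; split=> // v.
by apply: (le_trans (legendre_grad_le entropy_regular v)); apply: H; rewrite ger0_norm.
Qed.

Lemma entropy_dual_grad_le : exists C : R, 0 <= C /\ forall y, K (grad Ks y) <= C * (Ks y + 1).
Proof.
have [C [C0 H]] := dual_dilation 2; exists C; split=> // y.
rewrite (grad_legendre entropy_regular).
by apply: (le_trans (conj_grad_le entropy_regular y)); apply: H; rewrite ger0_norm.
Qed.

End Entropy.

(** * Localization in time and weights *)

Section Localization.
Context {R : realType} {d : nat}.
Local Notation leb := (@lebesgue_measure R).
Local Notation st := (spacetime R d).
Local Notation stin a b f := (st.-integrable (slab a b) (EFin \o f)).
Implicit Types (f g : R * 'rV[R]_d -> R) (S a b : R).

Lemma slab_empty a b : b <= a -> slab a b = set0 :> set (R * 'rV[R]_d).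
Proof.
move=> ba; apply/seteqP; split=> z // /slabP/andP[h1 h2].
by have := lt_le_trans (lt_trans h1 h2) ba; rewrite ltxx.
Qed.

Lemma loc_stin S f a b : loc_integrable S f -> 0 < a -> b < S -> stin a b f.
Proof.
move=> lf a0 bS; have [ab|ba] := ltP a b; last by rewrite slab_empty//; exact: integrable_set0.
apply: (integrableS _ _ _ (lf a b a0 ab bS)).
- rewrite (_ : [set z | _] = `[a, b]%classic `*` setT).
    by apply: measurableX => //; exact: measurable_itv.
  by apply/seteqP; split=> -[t x] /=; rewrite in_itv/= => // -[].
- exact: measurable_slab.
- by move=> z /slabP/andP[h1 h2] /=; rewrite (ltW h1) (ltW h2).
Qed.

Definition inner (S : R) (k : nat) : set (measurableTypeR R * 'rV[R]_d) :=
  slab k.+1%:R^-1 (S - k.+1%:R^-1).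

Lemma inner_bigcup S : slab 0 S = \bigcup_k inner S k.
Proof.
apply/seteqP; split=> z; last first.
  move=> [k _] /slabP/andP[h1 h2]; apply/slabP.
  have k0 : 0 < k.+1%:R^-1 :> R by rewrite invr_gt0.
  by rewrite (lt_trans k0 h1) (lt_trans h2)// ltrBlDr ltrDl.
move=> /slabP/andP[z0 zS].
pose m := Num.min z.1 (S - z.1).
have m0 : 0 < m by rewrite lt_min z0 subr_gt0.
pose k := Num.trunc m^-1.
have km : k.+1%:R^-1 < m.
  by rewrite invf_plt ?posrE//; exact: truncnS_gt.
exists k => //; apply/slabP; move: km; rewrite lt_min => /andP[-> h2]/=.
by rewrite ltrBrDr -ltrBrDl.
Qed.

Lemma loc_measurable S f : loc_integrable S f -> measurable_fun (slab 0 S) f.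
Proof.
move=> lf; rewrite inner_bigcup; apply/measurable_fun_bigcup => k; first exact: measurable_slab.
by apply: (intg_measurable (loc_stin lf _ _)); rewrite ?invr_gt0// ltrBlDr ltrDl invr_gt0.
Qed.

Lemma ae_slab_exhaust S (P : R * 'rV[R]_d -> Prop) :
  (forall a b, 0 < a -> a < b -> b < S -> {ae st, forall z, slab a b z -> P z}) ->
  {ae st, forall z, slab 0 S z -> P z}.
Proof.
move=> H; have : {ae st, forall z, forall k, inner S k z -> P z}.
  apply: ae_countable => k; rewrite /inner.
  have [ab|ba] := ltP (k.+1%:R^-1 : R) (S - k.+1%:R^-1).
    by apply: H => //; rewrite ltrBlDr ltrDl.
  by rewrite slab_empty//; apply: aeW.
by apply: aeS => z Pz; rewrite inner_bigcup => -[k _]; exact: Pz.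
Qed.

Lemma int_cyl_localize S a b f : 0 <= a -> b <= S -> (forall z, ~~ (a < z.1 < b) -> f z = 0) ->
  stin a b f -> int_cyl S f = (\int[st]_(z in slab a b) f z)%:E.
Proof.
move=> a0 bS f0 if_; rewrite /int_cyl cylinder_slab -EFin_Rintegral//; last exact: measurable_slab.
rewrite [LHS]integral_mkcond [RHS]integral_mkcond; congr integral; apply/funext => z.
rewrite !patchE; case: ifPn => [_|].
  case: ifPn => //; rewrite notin_setE => nz; rewrite f0//.
  by apply/negP => h; apply: nz; apply/slabP.
rewrite notin_setE => nz; case: ifPn => // /set_mem/slabP/andP[h1 h2].
by exfalso; apply: nz; apply/slabP; rewrite (le_lt_trans a0 h1) (lt_le_trans h2 bS).
Qed.

Lemma dt_supported a b (phi : R * 'rV[R]_d -> R) : smooth phi -> supported_in a b phi ->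
  supported_in a b (dt phi).
Proof.
move=> sphi supp t x tab.
have dphi := is_derive_tslice x t sphi.
have eq0 : \near t, (fun=> 0 : R) t = (fun s => phi (s, x)) t.
  move: tab; rewrite negb_and -!ltNge => /orP[ta|bt]; near=> s; rewrite supp// negb_and -!ltNge.
    by apply/orP; left; near: s; exact: lt_nbhsl.
  by apply/orP; right; near: s; exact: lt_nbhsr.
have d0 := @near_eq_is_derive R R^o R^o (fun=> 0 : R) _ t 1 0 eq0 (is_derive_cst (0 : R) t (1 : R)).
have [_ <-] := dphi; have [_ ->] := d0; by [].
Unshelve. all: by end_near. Qed.

Lemma weak_dt_primitive n S (f g : R * 'rV[R]_d -> 'rV[R]_n) (l : 'I_n) a b :
  weak_dt S f g -> 0 <= a -> a < b -> b <= S ->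
  stin a b (fun z => f z 0 l) -> stin a b (fun z => g z 0 l) ->
  exists c : 'rV[R]_d -> R, (torus R d).-integrable setT (EFin \o c) /\
    {ae st, forall z, slab a b z -> f z 0 l = c z.2 + time_primitive a (fun z => g z 0 l) z}.
Proof.
move=> wfg a0 ab bS if_ ig; have [_ _ tests] := wfg l.
apply: weak_derivative_primitive => // phi a' b' sphi aa' b'b supp.
have out (r : R * 'rV[R]_d -> R) : supported_in a' b' r -> forall z, ~~ (a < z.1 < b) -> r z = 0.
  move=> sr [t x] /= h; apply: sr; apply: contra h => /andP[h1 h2].
  by rewrite (lt_le_trans aa' h1) (le_lt_trans h2 b'b).
have [sp pp] := sphi.
have sdt := dt_supported sp supp.
have a'0 : 0 < a' by exact: le_lt_trans a0 aa'.
have b'S : b' < S by exact: lt_le_trans b'b bS.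
have pdt t : periodic (fun x => dt phi (t, x)).
  move=> x i; have [_ <-] := is_derive_tslice (x + delta_mx 0 i) t sp.
  have [_ <-] := is_derive_tslice x t sp.
  by congr ('D_1 _ t); apply/funext => s; exact: pp.
have := tests phi a' b' sphi a'0 b'S supp.
rewrite (int_cyl_localize a0 bS)//; last 2 first.
- by move=> z h; rewrite (out _ sdt z h) mulr0.
- by apply: stin_continuous_mul => //; exact/smooth_continuous/smooth_dt.
rewrite (int_cyl_localize a0 bS)//; last 2 first.
- by move=> z h; rewrite (out _ supp z h) mulr0.
- by apply: stin_continuous_mul => //; exact/smooth_continuous.
by rewrite -EFinN => -[].
Qed.

End Localization.

Section Weight.
Context {R : realType}.
Local Notation leb := (@lebesgue_measure R).
Local Notation intI a b f := (leb.-integrable `]a, b[ (EFin \o f)).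
Variables (S : R) (h : R -> R).
Hypotheses (S0 : 0 < S) (wh : is_weight S h).

Lemma weight_measurable : measurable_fun (`]0, S[%classic : set (measurableTypeR R)) h.
Proof.
have [mh _] := wh; apply: (measurable_funS _ _ mh) => //.
exact: subset_itv_oo_cc.
Qed.

Lemma weight_intI : intI 0 S h.
Proof.
have [_ [c [C [c0 hC]]]] := wh.
apply: (@intg_bounded _ _ _ _ _ _ C) => //.
- exact: lebesgue_itvoo_lty.
- exact: weight_measurable.
move=> t; rewrite /= in_itv/= => /andP[t0 tS].
have /hC/andP[h1 h2] : 0 <= t <= S by rewrite !ltW.
by rewrite ger0_norm// (le_trans (ltW c0) h1).
Qed.

Lemma primitiveE t : 0 <= t -> primitive h S t = \int[leb]_(s in `]t, S[) h s.
Proof.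
move=> t0; rewrite /primitive /Rintegral integral_itv_bndoo//.
apply/measurable_EFinP; apply: (measurable_funS _ _ weight_measurable) => //.
by apply: subset_itvr; rewrite bnd_simp.
Qed.

Lemma primitive_split t : 0 <= t <= S ->
  primitive h S t = primitive h S 0 - \int[leb]_(s in `]0, t[) h s.
Proof.
move=> /andP[t0 tS]; rewrite !primitiveE// (@Rintegral_cat _ h 0 t S)//; last exact: weight_intI.
by rewrite addrC addKr.
Qed.

Definition primitive_ext (t : R) : R :=
  primitive h S 0 - \int[leb]_(s in `]0, clamp S t[) h s.

Lemma primitive_extE t : 0 <= t <= S -> primitive_ext t = primitive h S t.
Proof. by move=> tS; rewrite /primitive_ext (clamp_id tS) (primitive_split tS). Qed.

Lemma primitive_ext_continuous : continuous primitive_ext.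
Proof.
apply: contB; first exact: cst_continuous.
by apply: continuous_primitive; [exact: ltW|exact: weight_intI].
Qed.

Lemma primitive_bounds : exists c C : R, [/\ 0 < c, 0 <= C &
  forall t, 0 <= t <= S -> c * (S - t) <= primitive h S t <= C].
Proof.
have [_ [c [C [c0 hC]]]] := wh.
have C0 : 0 <= C.
  have /hC/andP[h1 h2] : 0 <= (0 : R) <= S by rewrite lexx ltW.
  exact: le_trans (ltW c0) (le_trans h1 h2).
exists c, (C * S); split=> //; first by rewrite mulr_ge0// ltW.
move=> t /andP[t0 tS]; rewrite primitiveE//.
have it (k : R) : intI t S (fun=> k) by apply: continuous_intI; exact: cst_continuous.
have ith : intI t S h by exact: intI_sub weight_intI.
have val (k : R) : \int[leb]_(s in `]t, S[) k = k * (S - t).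
  rewrite Rintegral_cst//= lebesgue_measure_itv/=; case: ifPn => // tS'.
  have -> : S = t by apply/eqP; rewrite eq_le tS andbT leNgt.
  by rewrite subrr.
have hb s : s \in (`]t, S[ : interval R) -> c <= h s <= C.
  by rewrite in_itv/= => /andP[ts sS]; apply: hC; rewrite (le_trans t0 (ltW ts)) ltW.
apply/andP; split.
  by rewrite -val; apply: le_Rintegral => //= s /hb/andP[].
apply: (@le_trans _ _ (C * (S - t))); last by rewrite ler_wpM2l// gerBl.
by rewrite -val; apply: le_Rintegral => //= s /hb/andP[].
Qed.

End Weight.

(** * Regularity in time of a strong solution *)

Lemma torus_lty {R : realType} {d : nat} : (torus R d setT < +oo)%E.
Proof. by rewrite [X in (X < _)%E]probability_setT ltry. Qed.

Section TimeRegularity.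
Context {R : realType} {d n N : nat}.
Variables (F : 'rV[R]_n -> 'M[R]_N) (L : diffop R d n N).
Hypothesis hFL : standing_assumptions F L.
Local Notation leb := (@lebesgue_measure R).
Local Notation st := (spacetime R d).
Local Notation stin a b f := (st.-integrable (slab a b) (EFin \o f)).
Local Notation K := (entropy F).
Local Notation Ks := (legendre (entropy F)).
Implicit Types (S a b : R).
Let reg := entropy_regular hFL.
Let cKs : continuous Ks := continuous_legendre reg.
Let Ks0 : forall y, 0 <= Ks y := legendre_ge0 reg.

Lemma LKs_integrable S (f : R * 'rV[R]_d -> 'rV[R]_n) : in_LKs F S f ->
  stin 0 S (fun z => Ks (f z)).
Proof. by rewrite -cylinder_slab; apply: orlicz_integrable => //; rewrite cylinder_slab; exact: measurable_slab. Qed.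

Lemma LKs_coord S (f : R * 'rV[R]_d -> 'rV[R]_n) i : in_LKs F S f ->
  stin 0 S (fun z => f z 0 i).
Proof.
rewrite /in_LKs cylinder_slab => lf.
apply: (orlicz_coord _ cKs Ks0 _ _ lf) => //; [exact: measurable_slab|exact: slab_lty|].
by move=> y; exact: coord_le_legendre.
Qed.

Lemma LKs_intro S (f : R * 'rV[R]_d -> 'rV[R]_n) (B : R * 'rV[R]_d -> R) :
  (forall i, measurable_fun (slab 0 S) (fun z => f z 0 i)) -> stin 0 S B ->
  {ae st, forall z, slab 0 S z -> Ks (f z) <= B z} -> in_LKs F S f.
Proof.
move=> mf iB le; rewrite /in_LKs cylinder_slab.
have mS := @measurable_slab R d 0 S.
apply: integrable_orlicz => //.
have mK : measurable_fun (slab 0 S) (fun z => Ks (f z)) by exact: measurable_rV_comp.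
pose B' z := Num.max (B z) (Ks (f z)).
have iB' : stin 0 S B'.
  apply: (ae_intg mS _ _ iB); first by apply: measurable_maxr => //; exact: intg_measurable iB.
  by apply: aeS le => z h zS; rewrite /B' max_l// h.
apply: (intg_le mS mK _ iB') => z _.
by rewrite ger0_norm// le_max lexx orbT.
Qed.

Section ProductRule.
Variables (T : R) (h : R -> R).
Hypotheses (T0 : 0 < T) (wh : is_weight T h).
Variables f p e : R * 'rV[R]_d -> 'rV[R]_n.
Let H := primitive h T.
Hypotheses (wp : weak_dt T f p) (we : weak_dt T (fun z => H z.1 *: f z) e).
Hypotheses (lf : in_LKs F T f) (le : in_LKs F T e).

Let hr (t : R) := h (clamp T t).

Let mhr : measurable_fun (setT : set (measurableTypeR R)) hr.
Proof.
have [mh _] := wh.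
apply: (measurable_comp (F := (`[0, T]%classic : set (measurableTypeR R)))) mh _ => //.
  by move=> _ [t _ <-]; rewrite /= in_itv/=; apply: clampP; exact: ltW.
rewrite /clamp; apply: measurable_maxr => //.
by apply: measurable_minr.
Qed.

Let hrE t : 0 < t < T -> hr t = h t.
Proof. by move=> /andP[t0 tT]; rewrite /hr clamp_id// !ltW. Qed.

Let Hc := primitive_ext T h.

Let HcE t : 0 < t < T -> Hc t = H t.
Proof. by move=> /andP[t0 tT]; rewrite /Hc primitive_extE// !ltW. Qed.

Let mHc : measurable_fun setT (fun z : measurableTypeR R * 'rV[R]_d => Hc z.1).
Proof.
apply: measurable_time; apply: continuous_measurable_fun.
exact: primitive_ext_continuous.
Qed.

Let mhr_st : measurable_fun setT (fun z : measurableTypeR R * 'rV[R]_d => hr z.1).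
Proof. exact: measurable_time. Qed.

(** For almost every x both [f] and [H f] are primitives in time, and [product_rule_ae]
    compares their derivatives. *)
Lemma weighted_product_rule_slab a b l : 0 < a -> a < b -> b < T ->
  {ae st, forall z, slab a b z -> e z 0 l = H z.1 * p z 0 l - h z.1 * f z 0 l}.
Proof.
move=> a0 ab bT.
have mS := @measurable_slab R d a b.
have [c [C [c0 C0 Hb]]] := primitive_bounds T0 wh.
have [_ [ch [Ch [ch0 hb]]]] := wh.
have inT t : a < t < b -> 0 < t < T.
  by move=> /andP[h1 h2]; rewrite (lt_trans a0 h1) (lt_trans h2 bT).
have if_ : stin a b (fun z => f z 0 l) by exact: loc_stin (let: And3 x _ _ := wp l in x) a0 bT.
have ip : stin a b (fun z => p z 0 l) by exact: loc_stin (let: And3 _ x _ := wp l in x) a0 bT.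
have iHf : stin a b (fun z => (H z.1 *: f z) 0 l) by exact: loc_stin (let: And3 x _ _ := we l in x) a0 bT.
have ie : stin a b (fun z => e z 0 l) by exact: loc_stin (let: And3 _ x _ := we l in x) a0 bT.
have [c1 [_ E1]] := weak_dt_primitive wp (ltW a0) ab (ltW bT) if_ ip.
have [c2 [_ E2]] := weak_dt_primitive we (ltW a0) ab (ltW bT) iHf ie.
have iHp : stin a b (fun z => p z 0 l * Hc z.1).
  apply: (@intg_bounded_mul _ _ _ _ _ _ _ C) => //; first exact: measurable_funTS.
  move=> z /slabP/inT zT; rewrite HcE//; have /andP[z0 zT'] := zT.
  have /andP[h1 h2] : c * (T - z.1) <= H z.1 <= C by apply: Hb; rewrite !ltW.
  by rewrite ger0_norm// (le_trans _ h1)// mulr_ge0 ?(ltW c0)// subr_ge0 ltW.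
have ihf : stin a b (fun z => f z 0 l * hr z.1).
  apply: (@intg_bounded_mul _ _ _ _ _ _ _ Ch) => //; first exact: measurable_funTS.
  move=> z /slabP/inT zT; rewrite hrE//; have /andP[z0 zT'] := zT.
  have /andP[h1 h2] : ch <= h z.1 <= Ch by apply: hb; rewrite !ltW.
  by rewrite ger0_norm// (le_trans (ltW ch0)).
pose D z := e z 0 l - (p z 0 l * Hc z.1 - f z 0 l * hr z.1).
have iD : stin a b D by apply: intgB => //; exact: intgB.
suff D0 : {ae st, forall z, slab a b z -> `|D z| = 0}.
  apply: aeS D0 => z D0 zS; have zT := inT _ ((slabP _ _ _).1 zS).
  have := D0 zS => /normr0P/eqP; rewrite /D HcE// hrE// => /eqP.
  by rewrite subr_eq0 => /eqP ->; rewrite mulrC [f z 0 l * _]mulrC.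
apply: Rintegral0_ae => //; first exact: intg_norm.
rewrite slab_fubini2; last exact: intg_norm.
transitivity (\int[torus R d]_x (0 : R)); last by rewrite Rintegral_cst// mul0r.
apply: ae_Rintegral => //; first exact: intg_measurable (slab_integrable2 (intg_norm iD)).
have hp : leb.-integrable `]a, b[ (EFin \o h).
  by apply: (intI_sub _ _ (weight_intI wh)); exact: ltW.
have HS t : a < t < b -> H t = primitive h T a - \int[leb]_(r in `]a, t[) h r.
  move=> tab; have /andP[t0 tT] := inT _ tab; have /andP[at_ tb] := tab.
  have st_ : primitive h T t = primitive h T 0 - \int[leb]_(s in `]0, t[) h s.
    by apply: primitive_split => //; rewrite !ltW.
  have sa : primitive h T a = primitive h T 0 - \int[leb]_(s in `]0, a[) h s.
    by apply: primitive_split => //; rewrite !ltW// (lt_trans ab).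
  have cat := @Rintegral_cat _ h 0 a t (intI_sub (lexx 0) (ltW tT) (weight_intI wh)) (ltW a0) (ltW at_).
  by rewrite /H st_ sa cat opprD addrA.
have A1 := aeI (slab_ae2 E1) (slab_ae2 E2).
have A2 := aeI (slab_ae_integrable2 ip) (slab_ae_integrable2 ie).
have A3 := slab_ae_integrable2 (intg_norm iD).
apply: aeS (aeI A1 (aeI A2 A3)) => x [[e1 e2] [[ipx iex] iDx]] _.
have prod : {ae leb, forall t : R, a < t < b ->
    H t * (c1 x + \int[leb]_(r in `]a, t[) p (r, x) 0 l) = c2 x + \int[leb]_(r in `]a, t[) e (r, x) 0 l}.
  apply: aeS (aeI e1 e2) => t [E1t E2t] tab.
  have := E2t tab; rewrite mxE (E1t tab) /time_primitive/=; exact.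
have PR := product_rule_ae hp ipx iex HS prod.
transitivity (\int[leb]_(t in `]a, b[) (0 : R)); last by rewrite Rintegral_cst// mul0r.
apply: (@ae_Rintegral _ _ _ leb) => //; first exact: intg_measurable iDx.
apply: aeS (aeI e1 PR) => t [E1t Pt]; rewrite /= in_itv/= => tab.
apply/eqP; rewrite normr_eq0 /D/= HcE ?inT// hrE ?inT// (E1t tab) (Pt tab) /time_primitive/=.
by apply/eqP; ring.
Qed.

Lemma weighted_product_rule : {ae st, forall z, slab 0 T z -> forall l,
  e z 0 l = H z.1 * p z 0 l - h z.1 * f z 0 l}.
Proof.
apply: ae_slab_exhaust => a b a0 ab bT.
have : {ae st, forall z, forall l, slab a b z -> e z 0 l = H z.1 * p z 0 l - h z.1 * f z 0 l}.
  by apply: ae_finite => l; exact: weighted_product_rule_slab.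
by apply: aeS => z + zS l; apply.
Qed.

(** H p = e + h f, and H is bounded below away from the final time T. *)
Lemma time_derivative_LKs T1 : 0 < T1 -> T1 < T -> in_LKs F T1 p.
Proof.
move=> T10 T1T.
have [c [C [c0 C0 Hb]]] := primitive_bounds T0 wh.
have [_ [ch [Ch [ch0 hb]]]] := wh.
have [D1 [D10 dil1]] := dual_dilation hFL (c * (T - T1))^-1.
have [D2 [D20 dil2]] := dual_dilation hFL Ch.
have [D3 [D30 sum]] := dual_sum hFL.
pose B z := D1 * (D3 * (Ks (e z) + D2 * (Ks (f z) + 1) + 1) + 1).
have mS := @measurable_slab R d 0 T1.
apply: (LKs_intro (B := B)).
- move=> i; have [_ lp _] := wp i.
  by apply: (measurable_funS _ _ (loc_measurable lp)); [exact: measurable_slab|exact: slab_subset (ltW T1T)].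
- have i1 (r : R) : stin 0 T1 (fun=> r).
    by apply: (@intg_bounded _ _ _ _ _ _ `|r|) => //; exact: slab_lty.
  have ie : stin 0 T1 (fun z => Ks (e z)) by exact: stin_sub (ltW T1T) (LKs_integrable le).
  have if_ : stin 0 T1 (fun z => Ks (f z)) by exact: stin_sub (ltW T1T) (LKs_integrable lf).
  have a1 : stin 0 T1 (fun z => D2 * (Ks (f z) + 1)) by apply: intgZ => //; exact: intgD.
  apply: intgZ => //; apply: intgD => //; apply: intgZ => //; apply: intgD => //.
  exact: intgD.
apply: aeS weighted_product_rule => z PR /slabP/andP[z0 zT1].
have zT : z.1 < T by exact: lt_trans zT1 T1T.
have zS : slab 0 T z by apply/slabP; rewrite z0.
have /andP[Hl _] : c * (T - z.1) <= H z.1 <= C by apply: Hb; rewrite !ltW.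
have /andP[hl hu] : ch <= h z.1 <= Ch by apply: hb; rewrite !ltW.
have cT : 0 < c * (T - T1) by rewrite mulr_gt0// subr_gt0.
have Hc' : c * (T - T1) <= H z.1.
  by apply: le_trans Hl; rewrite ler_pM2l// lerD2l lerN2 ltW.
have H0 : 0 < H z.1 by exact: lt_le_trans Hc'.
have -> : p z = (H z.1)^-1 *: (e z + h z.1 *: f z).
  apply/rowP => l; rewrite !mxE (PR zS l) subrK mulrA mulVf ?gt_eqF// mul1r.
  by [].
apply: (le_trans (dil1 _ _ _)).
  by rewrite normfV gtr0_norm// lef_pV2 ?posrE.
rewrite /B ler_wpM2l// lerD2r (le_trans (sum _ _))// ler_wpM2l// lerD2r lerD2l.
by apply: dil2; rewrite ger0_norm// (le_trans (ltW ch0)).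
Qed.

End ProductRule.

(** A coordinate of y is at most Ks y up to a constant, by Young's inequality with a
    basis vector. *)
Lemma luxemburg_lt (mu : {measure set 'rV[R]_d -> \bar R}) (w : 'rV[R]_d -> 'rV[R]_n) (r : R) l :
  (forall i, measurable_fun setT (fun x => w x 0 i)) -> (mu setT < +oo)%E ->
  (luxemburg mu setT Ks w < r%:E)%E ->
  mu.-integrable setT (EFin \o (fun x => w x 0 l)) /\
  \int[mu]_x `|w x 0 l| <= r * (1 + K (delta_mx 0 l) * fine (mu setT)).
Proof.
move=> mw fin /ereal_inf_lt[_ [s [s0 sint] <-]]; rewrite lte_fin => sr.
have mw' i : measurable_fun setT (fun x => (s^-1 *: w x) 0 i).
  rewrite (_ : (fun x => _) = fun x => s^-1 * w x 0 i); last by apply/funext => x; rewrite mxE.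
  exact: measurable_funM.
have mK : measurable_fun setT (fun x => Ks (s^-1 *: w x)) by exact: measurable_rV_comp.
have iK : mu.-integrable setT (EFin \o (fun x => Ks (s^-1 *: w x))).
  apply/integrableP; split; first exact/measurable_EFinP.
  under eq_integral do rewrite /= ger0_norm//.
  exact: le_lt_trans sint (ltry _).
have ic : mu.-integrable setT (EFin \o (fun _ : 'rV[R]_d => K (delta_mx 0 l))).
  by apply: (@intg_bounded _ _ _ _ _ _ `|K (delta_mx 0 l)|).
have bnd x : `|w x 0 l| <= s * (Ks (s^-1 *: w x) + K (delta_mx 0 l)).
  have := coord_le_legendre reg (s^-1 *: w x) l.
  by rewrite mxE normrM normfV (gtr0_norm s0) => H; rewrite -ler_pdivrMl.
have ib : mu.-integrable setT (EFin \o (fun x => s * (Ks (s^-1 *: w x) + K (delta_mx 0 l)))).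
  by apply: intgZ => //; exact: intgD.
have iw : mu.-integrable setT (EFin \o (fun x => w x 0 l)) by exact: (intg_le _ (mw l) _ ib).
split=> //; apply: (@le_trans _ _ (\int[mu]_x (s * (Ks (s^-1 *: w x) + K (delta_mx 0 l))))).
  by apply: le_Rintegral => //; exact: intg_norm.
rewrite RintegralZl//; last exact: intgD.
rewrite RintegralD// Rintegral_cst//.
have K0 : 0 <= K (delta_mx 0 l) * fine (mu setT).
  by rewrite mulr_ge0 ?(entropy_ge0 hFL)// fine_ge0.
have i1 : \int[mu]_x Ks (s^-1 *: w x) <= 1.
  by rewrite -lee_fin -EFin_Rintegral.
apply: (@le_trans _ _ (s * (1 + K (delta_mx 0 l) * fine (mu setT)))).
  by rewrite ler_wpM2l ?(ltW s0)// lerD2r.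
by rewrite ler_wpM2r ?(ltW sr)// addr_ge0.
Qed.

Section InitialValue.
Variables (T T1 : R) (f p : R * 'rV[R]_d -> 'rV[R]_n) (f0 : 'rV[R]_d -> 'rV[R]_n).
Hypotheses (T10 : 0 < T1) (T1T : T1 <= T).
Hypotheses (wp : weak_dt T f p) (lf : in_LKs F T1 f) (lp : in_LKs F T1 p).
Hypothesis init : initial_value F T f f0.

(** As time decreases to 0, [f] tends in L^1 to the integration constant of
    [weak_dt_primitive], and also to [f0], since the Luxemburg norm controls the L^1 norm. *)
Lemma time_representation : {ae st, forall z, slab 0 T1 z ->
  forall l, f z 0 l = f0 z.2 0 l + time_primitive 0 (fun z => p z 0 l) z}.
Proof.
suff : {ae st, forall z, forall l, slab 0 T1 z ->
    f z 0 l = f0 z.2 0 l + time_primitive 0 (fun z => p z 0 l) z}.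
  by apply: aeS => z + zS l; apply.
apply: ae_finite => l.
have [w [wf wo wcont w0]] := init.
have ip := LKs_coord l lp; have if_ := LKs_coord l lf.
have [c [ic ce]] := weak_dt_primitive wp (lexx 0) T10 T1T if_ ip.
have T0 : 0 < T by exact: lt_le_trans T1T.
have mw t : 0 <= t < T -> forall i, measurable_fun setT (fun x => w t x 0 i).
  by move=> /wo[].
have T00 : 0 <= (0 : R) < T by rewrite lexx.
have iw0 : (torus R d).-integrable setT (EFin \o (fun x => w 0 x 0 l)).
  have o := wo 0 T00; apply: (orlicz_coord _ cKs Ks0 _ _ o) => //.
    exact: torus_lty.
  by move=> y; exact: coord_le_legendre.
suff E : {ae torus R d, forall x, c x = f0 x 0 l}.
  by apply: aeS (aeI ce (ae_slab_space 0 T1 E)) => z [h1 h2] zS; rewrite h1// h2.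
suff E : {ae torus R d, forall x, setT x -> `|c x - w 0 x 0 l| = 0}.
  apply: aeS (aeI E w0) => x [h1 h2]; have /normr0P := h1 I.
  by rewrite subr_eq0 h2 => /eqP.
have icw : (torus R d).-integrable setT (EFin \o (fun x => c x - w 0 x 0 l)) by exact: intgB.
apply: Rintegral0_ae => //; first exact: intg_norm.
apply/eqP; rewrite eq_le Rintegral_ge0// andbT; apply/ler_addgt0Pr => eps eps0; rewrite add0r.
pose M := 1 + K (delta_mx 0 l) * fine (torus R d setT).
have M0 : 0 < M by rewrite ltr_pwDl// mulr_ge0 ?(entropy_ge0 hFL)// fine_ge0.
pose m t := \int[torus R d]_x `|p (t, x) 0 l|.
have im : leb.-integrable `]0, T1[ (EFin \o m) by exact: slab_integrable1 (intg_norm ip).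
have cm := continuous_primitive (ltW T10) im.
have r0 : 0 < eps / 2 / M by rewrite !divr_gt0.
have near1 : \forall s \near within `[0, T[ (nbhs (0 : R)),
    (luxemburg (torus R d) setT Ks (fun x => (w s x - w 0 x)%R) < (eps / 2 / M)%:E)%E.
  apply: (wcont 0 T00 [set y : \bar R | (y < (eps / 2 / M)%:E)%E]).
  by apply: open_nbhs_nbhs; split; [exact: open_ereal_lt_ereal|rewrite /= lte_fin].
have near2 : \forall s \near (0 : R), \int[leb]_(r in `]0, clamp T1 s[) m r < eps / 2.
  have := cm 0; move=> /cvgrPdist_lt /(_ (eps / 2)); rewrite divr_gt0// => /(_ isT).
  apply: filterS => s; rewrite (clamp_id (b := T1)) ?lexx ?ltW// set_itvoo0 Rintegral_set0.
  by rewrite sub0r normrN => /(le_lt_trans (ler_norm _)).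
move: near1 near2 => /nbhs_ballP[d1 /= d10 near1] /nbhs_ballP[d2 /= d20 near2].
pose dd := Num.min (Num.min d1 d2) T1.
have dd0 : 0 < dd by rewrite !lt_min d10 d20.
have wf' : {ae st, forall z, slab 0 T z -> w z.1 z.2 = f z}.
  by move: wf; rewrite /ae_cyl cylinder_slab.
have good := aeI (slab_ae1 ce) (slab_ae1 wf').
have [s /andP[s0 sdd] [[gc gw] is_]] := ae_dense dd0 (aeI good (slab_ae_integrable1 (intg_norm ip))).
move: sdd; rewrite !lt_min => /andP[/andP[sd1 sd2] sT1].
have sT : s < T by exact: lt_le_trans sT1 T1T.
have sab : 0 < s < T1 by rewrite s0.
have sab' : 0 < s < T by rewrite s0.
have s0T : 0 <= s < T by rewrite ltW.
have lx : (luxemburg (torus R d) setT Ks (fun x => (w s x - w 0 x)%R) < (eps / 2 / M)%:E)%E.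
  apply: near1; last by rewrite /= in_itv/= ltW.
  by rewrite -ball_normE/= sub0r normrN gtr0_norm.
have pm : \int[leb]_(r in `]0, s[) m r < eps / 2.
  have := near2 s; rewrite -ball_normE/= sub0r normrN gtr0_norm// => /(_ sd2).
  by rewrite clamp_id// !ltW.
have mws i : measurable_fun setT (fun x => (w s x - w 0 x) 0 i).
  rewrite (_ : (fun x => _) = (fun x => w s x 0 i - w 0 x 0 i)); last first.
    by apply/funext => x; rewrite !mxE.
  by apply: measurable_funB; exact: mw.
have [_ lux] := luxemburg_lt l mws torus_lty lx.
have := lux; rewrite -/M mulfVK ?gt_eqF// => {}lux.
have ips : stin 0 s (fun z => p z 0 l) by exact: stin_sub (ltW sT1) ip.
have itp : (torus R d).-integrable setT (EFin \o (fun x => \int[leb]_(r in `]0, s[) `|p (r, x) 0 l|)).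
  exact: slab_integrable2 (intg_norm ips).
have tpe : \int[torus R d]_x \int[leb]_(r in `]0, s[) `|p (r, x) 0 l| = \int[leb]_(r in `]0, s[) m r.
  by rewrite -(slab_fubini2 (intg_norm ips)) (slab_fubini1 (intg_norm ips)).
have iws : (torus R d).-integrable setT (EFin \o (fun x => w s x 0 l)).
  have o := wo s s0T; apply: (orlicz_coord _ cKs Ks0 _ _ o) => //.
    exact: torus_lty.
  by move=> y; exact: coord_le_legendre.
have iwd : (torus R d).-integrable setT (EFin \o (fun x => `|w s x 0 l - w 0 x 0 l|)).
  by apply: intg_norm; exact: intgB.
apply: (@le_trans _ _ (\int[torus R d]_x (`|w s x 0 l - w 0 x 0 l| +
    \int[leb]_(r in `]0, s[) `|p (r, x) 0 l|))).
  apply: Rintegral_ae_le => //; [exact: intg_norm|exact: intgD|].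
  apply: aeS (aeI (aeI (gc sab) (gw sab')) (slab_ae_integrable2 ips)) => x [[h1 h2] h3] _.
  have := h1; rewrite -h2 /time_primitive/= => ->.
  set P := \int[leb]_(r in `]0, s[) p (r, x) 0 l.
  have PB : `|P| <= \int[leb]_(r in `]0, s[) `|p (r, x) 0 l| by exact: le_normr_Rintegral.
  have -> : c x - w 0 x 0 l = (c x + P - w 0 x 0 l) - P by rewrite addrAC addrK.
  by rewrite (le_trans (ler_normB _ _))// lerD2l.
rewrite RintegralD// tpe [leRHS](splitr eps) lerD ?(ltW pm)//.
rewrite (le_trans _ lux)// le_eqVlt; apply/orP; left; apply/eqP; apply: eq_Rintegral => x _.
by rewrite !mxE.
Qed.

End InitialValue.

End TimeRegularity.

(** * The space Lambda and its order *)

Section Frobenius.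
Context {R : realType} {N : nat}.
Implicit Types (A B P Q X : 'M[R]_N).

Lemma frobDl A B P : frob (A + B) P = frob A P + frob B P.
Proof.
rewrite /frob -big_split; apply: eq_bigr => i _; rewrite -big_split.
by apply: eq_bigr => j _; rewrite mxE mulrDl.
Qed.

Lemma frobZl (c : R) A P : frob (c *: A) P = c * frob A P.
Proof.
rewrite /frob mulr_sumr; apply: eq_bigr => i _; rewrite mulr_sumr.
by apply: eq_bigr => j _; rewrite mxE mulrA.
Qed.

Lemma frobC A B : frob A B = frob B A.
Proof. by apply: eq_bigr => i _; apply: eq_bigr => j _; rewrite mulrC. Qed.

Lemma frobNl A P : frob (- A) P = - frob A P.
Proof. by rewrite -scaleN1r frobZl mulN1r. Qed.

Lemma frobBl A B P : frob (A - B) P = frob A P - frob B P.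
Proof. by rewrite frobDl frobNl. Qed.

Lemma frobDr A B P : frob P (A + B) = frob P A + frob P B.
Proof. by rewrite frobC frobDl !(frobC P). Qed.

Lemma frobZr (c : R) A P : frob P (c *: A) = c * frob P A.
Proof. by rewrite frobC frobZl (frobC P). Qed.

Lemma frob0l P : frob 0 P = 0.
Proof. by rewrite -(scale0r 0) frobZl mul0r. Qed.

Lemma frob0r P : frob P 0 = 0.
Proof. by rewrite frobC frob0l. Qed.

Lemma frob_suml (I : Type) (r : seq I) (G : I -> 'M[R]_N) P :
  frob (\sum_(i <- r) G i) P = \sum_(i <- r) frob (G i) P.
Proof.
by elim: r => [|i r IH]; rewrite ?big_nil ?frob0l// !big_cons frobDl IH.
Qed.

Lemma frob_tr A P : frob A^T P^T = frob A P.
Proof. by rewrite /frob exchange_big; apply: eq_bigr => i _; apply: eq_bigr => j _; rewrite !mxE. Qed.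

Lemma frob_scalar A (c : R) : frob A c%:M = c * \tr A.
Proof.
rewrite /frob /mxtrace mulr_sumr; apply: eq_bigr => i _.
rewrite (bigD1 i)//= mxE eqxx mulr1n big1 ?addr0 1?mulrC// => j ji.
by rewrite mxE eq_sym (negbTE ji) mulr0n mulr0.
Qed.

Lemma frob_delta A i j : frob A (delta_mx i j) = A i j.
Proof.
rewrite /frob (bigD1 i)//= (bigD1 j)//= mxE !eqxx mulr1 big1 => [|k kj]; last first.
  by rewrite mxE (negbTE kj) andbF mulr0.
rewrite addr0 big1 ?addr0// => k ki; rewrite big1// => l _.
by rewrite mxE (negbTE ki) mulr0.
Qed.

Definition symmetrize (Q : 'M[R]_N) : 'M[R]_N := 2^-1 *: (Q + Q^T).

Lemma sym_symmetrize Q : sym (symmetrize Q).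
Proof. by rewrite /sym /symmetrize linearZ/= linearD/= trmxK addrC. Qed.

Lemma frob_symmetrize P Q : sym P -> frob P (symmetrize Q) = frob P Q.
Proof.
move=> sP; rewrite /symmetrize frobZr frobDr -(frob_tr P Q^T) trmxK sP.
by set a := frob P Q; lra.
Qed.

Definition mnorm1 P := \sum_i \sum_j `|P i j|.

Lemma mnorm1_ge0 P : 0 <= mnorm1 P.
Proof. by apply: sumr_ge0 => i _; apply: sumr_ge0. Qed.

Lemma quad_le P (x : 'rV[R]_N) : `|(x *m P *m x^T) 0 0| <= mnorm1 P * (x *m x^T) 0 0.
Proof.
have xx : (x *m x^T) 0 0 = \sum_k x 0 k ^+ 2.
  by rewrite mxE; apply: eq_bigr => k _; rewrite mxE expr2.
have sq k : x 0 k ^+ 2 <= (x *m x^T) 0 0.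
  by rewrite xx (bigD1 k)//= lerDl; apply: sumr_ge0 => j _; exact: sqr_ge0.
set X := (x *m x^T) 0 0 in xx sq *.
rewrite mxE (le_trans (ler_norm_sum _ _ _))//.
rewrite /mnorm1 exchange_big mulr_suml; apply: ler_sum => j _.
rewrite mxE normrM mulr_suml.
apply: (le_trans (ler_wpM2r (normr_ge0 _) (ler_norm_sum _ _ _))).
rewrite mulr_suml; apply: ler_sum => i _.
rewrite !mxE normrM mulrAC mulrC ler_wpM2l//.
have h : `|x 0 i| * `|x 0 j| <= 2^-1 * (x 0 i ^+ 2 + x 0 j ^+ 2).
  rewrite -(real_normK (num_real (x 0 i))) -(real_normK (num_real (x 0 j))).
  have := sqr_ge0 (`|x 0 i| - `|x 0 j|); set a := `|x 0 i|; set b := `|x 0 j|.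
  rewrite sqrrB => h; nra.
by apply: (le_trans h); have := sq i; have := sq j; lra.
Qed.

Lemma psd_shift P (c : R) : sym P -> mnorm1 P <= c -> psd (c%:M + P).
Proof.
move=> sP Pc; split; first by rewrite /sym linearD/= tr_scalar_mx sP.
move=> x; rewrite mulmxDr mulmxDl mxE mul_mx_scalar -scalemxAl mxE.
have := quad_le P x; rewrite ler_norml => /andP[lo _].
have xx : 0 <= (x *m x^T) 0 0.
  by rewrite mxE; apply: sumr_ge0 => k _; rewrite mxE -expr2 sqr_ge0.
have := ler_wpM2r xx Pc; lra.
Qed.

Lemma psd1 : psd (1%:M : 'M[R]_N).
Proof.
split; first exact: trmx1.
move=> x; rewrite mulmx1 mxE; apply: sumr_ge0 => k _.
by rewrite mxE -expr2 sqr_ge0.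
Qed.

End Frobenius.

Section LambdaSpace.
Context {R : realType} {d n N : nat}.
Variables (F : 'rV[R]_n -> 'M[R]_N) (L : diffop R d n N).

Let spans (V : {vspace 'M[R]_N}) := 1%:M \in V /\
  forall u x, smooth_torus_vec u -> apply_adj L u x \in V.

(** A subspace of minimal dimension among those in the definition of Lambda is contained
    in each of them. *)
Lemma Lambda_space : exists V : {vspace 'M[R]_N}, forall P, Lambda L P <-> P \in V.
Proof.
have ex : exists k, `[< exists V, spans V /\ \dim V = k >].
  by exists (\dim {:'M[R]_N}); apply/asboolP; exists fullv; split=> //; split=> *; exact: memvf.
have [k /asboolP[V [[V1 Vu] dV]] kmin] := ex_minnP ex.
exists V => P; split=> [LP|PV]; first exact: LP.
move=> W W1 Wu.
have VW : (V <= V :&: W)%VS.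
  have sVW : spans (V :&: W)%VS.
    by split=> [|u x su]; rewrite memv_cap ?V1 ?W1// Vu ?Wu.
  have /kmin kd : `[< exists W0, spans W0 /\ \dim W0 = \dim (V :&: W)%VS >].
    by apply/asboolP; exists (V :&: W)%VS.
  by rewrite -(geq_leqif (dimv_leqif_sup (capvSl V W))) dV.
by have := subvP VW _ PV; rewrite memv_cap => /andP[].
Qed.

Lemma apply_adj_Lambda u x : smooth_torus_vec u -> Lambda L (apply_adj L u x).
Proof. by move=> su V _; apply. Qed.

Lemma LambdaP_lin (c : R) P Q : Lambda L P -> Lambda L Q -> Lambda L (c *: P + Q).
Proof. by move=> LP LQ V V1 Vu; rewrite memvD// ?memvZ// ?LP ?LQ. Qed.

Lemma Lambda1 : Lambda L 1%:M.
Proof. by move=> V. Qed.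

Lemma apply_adj_sym u x : sym (apply_adj L u x).
Proof.
rewrite /sym /apply_adj linear_sum/=; apply: eq_bigr => a _.
rewrite linearZ/= linear_sum/=; congr (_ *: _); apply: eq_bigr => l _.
by rewrite linearZ/= dop_sym.
Qed.

Lemma Lambda_sym P : Lambda L P -> sym P.
Proof.
pose tr (X : 'M[R]_N) := X^T - X.
have lin : linear tr.
  by move=> c X Y; rewrite /tr linearP/= scalerBr opprD addrACA.
pose f : 'End('M[R]_N) := linfun (HB.pack_for {linear 'M[R]_N -> 'M[R]_N} tr (GRing.isLinear.Build _ _ _ _ tr lin)).
have kerE X : (X \in lker f) = (X^T - X == 0) by rewrite memv_ker lfunE.
move=> /(_ (lker f)); rewrite !kerE => H.
have : P^T - P == 0.
  apply: H; first by rewrite trmx1 subrr.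
  by move=> u x _; rewrite kerE apply_adj_sym subrr.
by rewrite subr_eq0 => /eqP.
Qed.

Let proj_entries (V : {vspace 'M[R]_N}) (P : 'M[R]_N) i j :
  projv V P i j = \sum_k \sum_l P k l * projv V (delta_mx k l) i j.
Proof.
rewrite {1}[P]matrix_sum_delta linear_sum summxE; apply: eq_bigr => k _.
by rewrite linear_sum summxE; apply: eq_bigr => l _; rewrite linearZ/= mxE.
Qed.

(** The equations state that [P] equals its projection on Lambda, entry by entry. *)
Lemma Lambda_tests : exists Q : 'I_N -> 'I_N -> 'M[R]_N, (forall i j, sym (Q i j)) /\
  forall P, sym P -> (Lambda L P <-> forall i j, frob P (Q i j) = 0).
Proof.
have [V VP] := Lambda_space.
pose Q0 i j : 'M[R]_N := \matrix_(k, l) (delta_mx k l - projv V (delta_mx k l)) i j.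
have Q0E P i j : frob P (Q0 i j) = (P - projv V P) i j.
  rewrite mxE [in RHS]mxE proj_entries {2}[P]matrix_sum_delta summxE -sumrB.
  rewrite /frob; apply: eq_bigr => k _; rewrite summxE -sumrB; apply: eq_bigr => l _.
  by rewrite !mxE mulrBr.
exists (fun i j => symmetrize (Q0 i j)); split=> [i j|P sP]; first exact: sym_symmetrize.
rewrite VP; split=> [PV i j|H].
  by rewrite frob_symmetrize// Q0E projv_id// subrr mxE.
have -> : P = projv V P; last exact: memv_proj.
apply/eqP; rewrite -subr_eq0; apply/eqP/matrixP => i j; rewrite [RHS]mxE.
by rewrite -Q0E -frob_symmetrize.
Qed.

Hypothesis hFL : standing_assumptions F L.
Local Notation K := (entropy F).

Lemma flux_sym v : sym (F v).
Proof. by have [[+ _] _ _ _ _] := hFL; apply. Qed.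

Lemma flux_cone v : Lambda_cone L (F v).
Proof. by have [_ _ _ [+ _] _] := hFL; apply. Qed.

Lemma tr_flux v : \tr (F v) = 2 * K v + \tr (F 0).
Proof. by rewrite /entropy mulrA mulfV// mul1r linearB/= subrK. Qed.

(** With c = mnorm1 P, the matrices c I + P and c I - P are nonnegative elements of Lambda,
    on which [F v] is nonnegative. *)
Lemma flux_pairing_le v P : Lambda L P -> `|frob (F v) P| <= mnorm1 P * \tr (F v).
Proof.
move=> LP; have [_ cone] := flux_cone v; have sP := Lambda_sym LP.
have L1 (c s : R) : Lambda L (c%:M + s *: P).
  have -> : c%:M + s *: P = s *: P + c *: 1%:M by rewrite addrC scalemx1.
  apply: LambdaP_lin => //; rewrite -[_ *: _]addr0; apply: LambdaP_lin; first exact: Lambda1.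
  by move=> V _ _; exact: mem0v.
have mN : mnorm1 (-1 *: P) = mnorm1 P.
  by apply: eq_bigr => i _; apply: eq_bigr => j _; rewrite mxE mulN1r normrN.
have p1 := cone _ (L1 (mnorm1 P) 1) (psd_shift (c := mnorm1 P) (P := 1 *: P) _ _).
have p2 := cone _ (L1 (mnorm1 P) (-1)) (psd_shift (c := mnorm1 P) (P := -1 *: P) _ _).
rewrite !frobDr !frobZr !frob_scalar mul1r mulN1r in p1 p2.
rewrite ler_norml; apply/andP; split.
  rewrite -subr_ge0 opprK addrC; apply: p1; rewrite ?scale1r//.
by rewrite -subr_ge0; apply: p2; rewrite ?mN//; rewrite /sym linearZ/= sP.
Qed.

(** The adjoint of a projection onto Lambda, applied to [F v]: it acts on Lambda as [F v]
    does, and its entries are pairings of [F v] with elements of Lambda, which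
    [flux_pairing_le] bounds by the entropy. *)
Lemma flux_majorant : exists M : 'rV[R]_n -> 'M[R]_N, [/\ forall v, sym (M v),
  forall v P, Lambda L P -> frob (M v) P = frob (F v) P,
  forall i j, continuous (fun v => M v i j) &
  exists C : R, 0 <= C /\ forall v i j, `|M v i j| <= C * (K v + 1)].
Proof.
have [V VP] := Lambda_space.
pose D k l : 'M[R]_N := projv V (delta_mx k l).
have LD k l : Lambda L (D k l) by apply/VP; exact: memv_proj.
pose M0 v : 'M[R]_N := \matrix_(k, l) frob (F v) (D k l).
exists (fun v => symmetrize (M0 v)); split.
- by move=> v; exact: sym_symmetrize.
- move=> v P LP; have sP := Lambda_sym LP; rewrite frobC frob_symmetrize//.
  have PV : projv V P = P by apply: projv_id; apply/VP.
  rewrite -[P in RHS]PV frobC [P in RHS]matrix_sum_delta linear_sum [RHS]frobC frob_suml /frob.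
  apply: eq_bigr => k _; rewrite linear_sum -/(frob _ _) frob_suml.
  by apply: eq_bigr => l _; rewrite linearZ/= frobZl [X in _ = _ * X]frobC mxE mulrC.
- move=> i j.
  have c0 k l : continuous (fun v => M0 v k l).
    under eq_fun do rewrite mxE.
    apply: continuous_sumr => a; apply: continuous_sumr => b.
    by apply: contM; [exact: (flux_continuous hFL)|exact: cst_continuous].
  rewrite (_ : (fun v => _) = fun v => 2^-1 * (M0 v i j + M0 v j i)); last first.
    by apply/funext => v; rewrite /symmetrize !mxE.
  by apply: contM; [exact: cst_continuous|exact: contD].
pose c := \sum_k \sum_l mnorm1 (D k l).
have cD k l : mnorm1 (D k l) <= c.
  rewrite /c (bigD1 k)//= (bigD1 l)//= -addrA lerDl addr_ge0//.
    by apply: sumr_ge0 => *; exact: mnorm1_ge0.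
  by apply: sumr_ge0 => *; apply: sumr_ge0 => *; exact: mnorm1_ge0.
have c0 : 0 <= c by apply: sumr_ge0 => *; apply: sumr_ge0 => *; exact: mnorm1_ge0.
have t0 v : 0 <= \tr (F v).
  by have [_ /(_ _ Lambda1)] := flux_cone v; rewrite frob_scalar mul1r; apply; exact: psd1.
have b0 v k l : `|M0 v k l| <= c * \tr (F v).
  by rewrite mxE (le_trans (flux_pairing_le v (LD k l)))// ler_wpM2r.
exists (c * (2 + \tr (F 0))); split; first by rewrite mulr_ge0// addr_ge0.
move=> v i j; have K0 := entropy_ge0 hFL v.
apply: (@le_trans _ _ (c * \tr (F v))).
  rewrite /symmetrize !mxE normrM ger0_norm ?invr_ge0// mulrC ler_pdivrMr//.
  rewrite (le_trans (ler_normD _ _))// mulr_natr mulr2n.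
  by apply: lerD; [have := b0 v i j|have := b0 v j i]; rewrite mxE.
rewrite -mulrA ler_wpM2l// tr_flux.
have := mulr_ge0 (t0 0) K0; nra.
Qed.

Lemma flux_convex_ge P u v : Lambda L P -> psd P ->
  frob (F v) P + \sum_l (u - v) 0 l * frob (mx_partial l F v) P <= frob (F u) P.
Proof.
move=> LP pP; have [_ _ cvx _ _] := hFL.
pose f v := frob (F v) P.
have dfl x w : is_derive x w f (\sum_i \sum_j 'D_w (fun y => F y i j) x * P i j).
  rewrite (_ : f = \sum_i (fun v : 'rV[R]_n => \sum_j F v i j * P i j)); last first.
    by apply/funext => y; rewrite /f fct_sumE.
  apply: is_derive_sum => i.
  rewrite (_ : (fun v => _) = \sum_j (fun v : 'rV[R]_n => P i j *: F v i j)); last first.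
    by apply/funext => y; rewrite fct_sumE; apply: eq_bigr => j _; rewrite mulrC.
  apply: is_derive_sum => j; rewrite mulrC; apply: is_deriveZ.
  by apply: DeriveDef => //; exact: (flux_derivable hFL).
have df x w : derivable f x w by have [] := dfl x w.
have cvxf := cvx P LP pP.
have := convex_grad_le cvxf df v u.
rewrite /dotv (eq_bigr (fun l => (u - v) 0 l * frob (mx_partial l F v) P))//.
move=> l _; rewrite mulrC; congr (_ * _); rewrite mxE /partial.
have [_ ->] := dfl v (delta_mx 0 l); rewrite /frob; apply: eq_bigr => i _.
by apply: eq_bigr => j _; rewrite mxE.
Qed.

End LambdaSpace.

(** * The constraint confines B to Lambda *)

Lemma intg_ae_bounded_mul {disp : measure_display} {T : measurableType disp} {R : realType}
    (mu : {measure set T -> \bar R}) (D : set T) (f g : T -> R) (C : R) :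
  measurable D -> measurable_fun D g -> {ae mu, forall z, D z -> `|g z| <= C} ->
  mu.-integrable D (EFin \o f) -> mu.-integrable D (EFin \o (fun z => f z * g z)).
Proof.
move=> mD mg gC if_; pose g' : T -> R := fun z => Num.max (- C) (Num.min (g z) C).
have mg' : measurable_fun D g' by apply: measurable_maxr => //; apply: measurable_minr.
apply: (@ae_intg _ _ _ mu D (fun z => f z * g' z)) => //.
- by apply: measurable_funM => //; exact: intg_measurable if_.
- apply: aeS gC => z gCz zD; have := gCz zD; rewrite ler_norml => /andP[h1 h2].
  by rewrite /g' min_l// max_r.
apply: (@intg_bounded_mul _ _ _ _ _ _ _ `|C|) => // z _.
have : - `|C| <= C <= `|C| by rewrite -ler_norml.
move=> /andP[h1 h2]; rewrite ler_norml /g' le_max ge_max ge_min.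
by rewrite lerN2 h2 /= !orbT lerNl h1.
Qed.

Section SeparatedTests.
Context {R : realType} {d n N : nat}.
Variable L : diffop R d n N.
Local Notation st := (spacetime R d).
Local Notation stin a b f := (st.-integrable (slab a b) (EFin \o f)).
Implicit Types (phi psi : 'rV[R]_d -> R) (Q : 'M[R]_N).

Lemma multi_partial_scale (a : 'I_d -> nat) (c : R) phi : smooth phi ->
  multi_partial a (fun y => c * phi y) = fun x => c * multi_partial a phi x.
Proof. by move=> sp; have [s [_ E]] := @multi_partialE R d a; rewrite !E partialsZ. Qed.

Lemma apply_op_scalar Q phi x l : smooth phi ->
  apply_op L (fun y => phi y *: Q) x 0 l =
  \sum_(a : {ffun 'I_d -> 'I_(dop_order L).+1})
    frob (dop_coef L a l) Q * multi_partial (fun i => a i) phi x.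
Proof.
move=> sp; rewrite mxE; apply: eq_bigr => a _.
have -> : mx_multi_partial (fun i => a i) (fun y => phi y *: Q) x =
    multi_partial (fun i => a i) phi x *: Q.
  apply/matrixP => i j; rewrite !mxE.
  rewrite (_ : (fun y => _) = fun y => Q i j * phi y); last first.
    by apply/funext => y; rewrite mxE mulrC.
  by rewrite multi_partial_scale// mulrC.
by rewrite frobZr mulrC.
Qed.

Lemma frob_apply_adj Q (u : 'rV[R]_d -> 'rV[R]_n) x : frob (apply_adj L u x) Q =
  \sum_(a : {ffun 'I_d -> 'I_(dop_order L).+1}) (-1) ^+ (\sum_i a i)%N *
    \sum_l multi_partial (fun i => a i) (fun y => u y 0 l) x * frob (dop_coef L a l) Q.
Proof.
rewrite /apply_adj frob_suml; apply: eq_bigr => a _.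
by rewrite frobZl frob_suml; congr (_ * _); apply: eq_bigr => l _; rewrite frobZl.
Qed.

Lemma multi_partial_reflect (a : 'I_d -> nat) z phi x : smooth phi ->
  multi_partial a (fun y => phi (z - y)) x = (-1) ^+ (\sum_i a i)%N * multi_partial a phi (z - x).
Proof. by move=> sp; have [s [<- E]] := @multi_partialE R d a; rewrite !E partials_reflect. Qed.

(** Up to the fixed matrix [Q], the operator at x is its adjoint applied to the reflection of
    [phi] through x: the signs of the adjoint cancel those of the reflected derivatives. *)
Lemma apply_op_annihilator Q phi x : (forall P, Lambda L P -> frob P Q = 0) ->
  smooth phi -> periodic phi -> apply_op L (fun y => phi y *: Q) x = 0.
Proof.
move=> QL sp pp; apply/rowP => l; rewrite [RHS]mxE apply_op_scalar//.
(* The reflection y |-> 2 x - y fixes x. *)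
pose z := x + x.
pose u (y : 'rV[R]_d) : 'rV[R]_n := \row_k ((k == l)%:R * phi (z - y)).
have su : smooth_torus_vec u.
  move=> k; rewrite (_ : (fun y => _) = fun y => (k == l)%:R * phi (z - y)); last first.
    by apply/funext => y; rewrite mxE.
  split; first by apply: smoothZ; exact: smooth_reflect.
  by move=> y i; rewrite (periodic_reflect z pp).
have adj0 := QL _ (apply_adj_Lambda x su); rewrite frob_apply_adj in adj0; rewrite -[RHS]adj0.
apply: eq_bigr => a _; set m := (\sum_i a i)%N; rewrite (bigD1 l)//= big1 => [|k kl]; last first.
  rewrite (_ : (fun y => _) = fun y => (k == l)%:R * phi (z - y)); last first.
    by apply/funext => y; rewrite mxE.
  rewrite multi_partial_scale; last exact: smooth_reflect.
  by rewrite (negbTE kl) !mul0r.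
rewrite addr0 (_ : (fun y => _) = fun y => phi (z - y)); last first.
  by apply/funext => y; rewrite mxE eqxx mul1r.
rewrite multi_partial_reflect// -/m /z addrK mulrA mulrA -exprMn mulrNN mulr1 expr1n mul1r.
exact: mulrC.
Qed.

Definition matrix_test (eta : R -> R) psi Q (z : R * 'rV[R]_d) : 'M[R]_N :=
  (eta z.1 * psi z.2) *: Q.

Lemma matrix_test_smooth eta psi Q : smooth eta -> smooth psi -> periodic psi -> sym Q ->
  smooth_st_sym (matrix_test eta psi Q).
Proof.
move=> se sp pp sQ; split=> [z|i j].
  by rewrite /sym /matrix_test linearZ/= sQ.
rewrite (_ : (fun z => _) = fun z => Q i j * (eta z.1 * psi z.2)); last first.
  by apply/funext => z; rewrite mxE mulrC.
have [s1 p1] := smooth_separated se sp pp.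
by split=> [|t x k]; [exact: smoothZ|rewrite p1].
Qed.

Lemma matrix_test_op eta psi Q z l : smooth psi ->
  apply_op_st L (matrix_test eta psi Q) z 0 l =
  eta z.1 * \sum_(a : {ffun 'I_d -> 'I_(dop_order L).+1})
    frob (dop_coef L a l) Q * multi_partial (fun i => a i) psi z.2.
Proof.
move=> sp; rewrite /apply_op_st /matrix_test apply_op_scalar/=; last exact: smoothZ.
rewrite mulr_sumr; apply: eq_bigr => a _; rewrite multi_partial_scale//.
by rewrite mulrCA.
Qed.

Lemma matrix_test_dt (Phi eta : R -> R) psi Q : (forall t : R, is_derive t (1 : R) Phi (eta t)) ->
  smooth Phi -> smooth psi -> periodic psi ->
  mx_dt (matrix_test Phi psi Q) = matrix_test eta psi Q.
Proof.
move=> dP sP sp pp; apply/funext => z; apply/matrixP => i j; rewrite !mxE.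
rewrite (_ : (fun y => _) = fun y => Q i j * (Phi y.1 * psi y.2)); last first.
  by apply/funext => y; rewrite mxE mulrC.
have s1 := (smooth_separated sP sp pp).1.
rewrite /dt deriveZ; last by exact: smooth_derivable.
have E := congr1 (fun f => f z) (dt_separated dP sP sp pp); rewrite /dt/= in E.
by rewrite [X in _ *: X]E; exact: mulrC.
Qed.

(** The test Phi(t) psi(x) Q with [Q] orthogonal to Lambda is annihilated by the operator, so
    only B remains in the constraint. *)
Lemma constraint_Lambda S (E : R * 'rV[R]_d -> 'rV[R]_n) (B : R * 'rV[R]_d -> 'M[R]_N) : 0 < S ->
  in_Linfty S B -> constraint L S E B -> ae_cyl S (fun z => Lambda L (B z)).
Proof.
move=> S0; rewrite /in_Linfty /ae_cyl cylinder_slab => -[sB mB [C BC]] cons.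
have [Q [sQ QP]] := Lambda_tests L.
suff : {ae st, forall z, forall ij : 'I_N * 'I_N, slab 0 S z -> frob (B z) (Q ij.1 ij.2) = 0}.
  by apply: aeS => z H zS; apply/QP => // i j; exact: (H (i, j)).
have mS := @measurable_slab R d 0 S.
apply: ae_finite => -[i j] /=.
have QL P : Lambda L P -> frob P (Q i j) = 0.
  by move=> LP; exact: (QP _ (Lambda_sym LP)).1.
have iB k l : stin 0 S (fun z => B z k l).
  apply: eq_integrable (@intg_ae_bounded_mul _ _ _ _ _ (fun=> 1) _ C mS (mB k l) _ _) => //.
  - by move=> z _ /=; rewrite mul1r.
  - by apply: aeS BC => z BCz zS; exact: BCz.
  - by apply: (@intg_bounded _ _ _ _ _ _ 1) => //; [exact: slab_lty|move=> *; rewrite normr1].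
apply: separated_tests_zero.
  apply: intg_sum => // k; apply: intg_sum => // l.
  by apply: (@intg_bounded_mul _ _ _ _ _ _ _ `|Q i j k l|).
move=> eta psi a' b' se eo a'0 b'S sp pp.
(* The primitive of [eta] from [a' / 2], before its support, vanishes at time 0. *)
have a'2 : a' / 2 < a' by rewrite gtr_pMr// invf_lt1// ltr1n.
have eta0 t : t <= a' / 2 -> eta t = 0.
  by move=> ta; apply: eo; rewrite negb_and -ltNge (le_lt_trans ta).
have [Phi [dP P0]] := antiderivative (smooth_continuous se) eta0.
have sP : smooth Phi by exact: smooth_R dP se.
have := cons (matrix_test Phi psi (Q i j)) (matrix_test_smooth sP sp pp (sQ i j)).
rewrite (matrix_test_dt _ dP sP sp pp) => H.
have : int_cyl S (fun z => frob (B z) (matrix_test eta psi (Q i j) z)) = 0%E.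
  rewrite -(H _); last by move=> x; rewrite /matrix_test P0 ?mul0r ?scale0r// divr_ge0 ?ltW.
  congr int_cyl; apply/funext => z; rewrite /apply_op_st.
  rewrite (_ : dotv _ _ = 0) ?addr0// (_ : apply_op _ _ _ = 0) ?dotv0r//.
  apply: (@apply_op_annihilator _ (fun x => Phi z.1 * psi x)) => //; first exact: smoothZ.
  by move=> x k; rewrite pp.
rewrite (_ : (fun z => _) = fun z => frob (B z) (Q i j) * (eta z.1 * psi z.2)); last first.
  by apply/funext => z; rewrite /matrix_test frobZr mulrC.
rewrite int_cylE; first by move=> -[].
apply: stin_continuous_mul.
- apply: intg_sum => // k; apply: intg_sum => // l.
  by apply: (@intg_bounded_mul _ _ _ _ _ _ _ `|Q i j k l|).
- exact/smooth_continuous/(smooth_separated se sp pp).1.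
- by move=> t x k; rewrite pp.
Qed.

End SeparatedTests.

(** * A periodic smoothing kernel *)

Section PeriodicKernel.
Context {R : realType}.
Local Notation leb := (@lebesgue_measure R).

(** If P is a primitive of [f], then P(c + 1) - P(c) does not depend on c. *)
Lemma periodic_mean (f : R -> R) (c : R) : continuous f -> (forall s, f (s + 1) = f s) -> -1 <= c ->
  \int[leb]_(s in `]0, 1[) f (s + c) = \int[leb]_(s in `]0, 1[) f s.
Proof.
move=> cf pf c1.
(* The cutoff kills [f] on the left of -3 and leaves it unchanged on [-2, +oo[; the product
   has a primitive on the whole line. *)
pose cut (t : R) : R := clamp 1 (t + 3).
have ccut : continuous cut.
  apply: (@continuous_ball_lt R R^o) => s e e0; exists e => // t; rewrite -ball_normE/=.
  apply: le_lt_trans; case/orP: (le_total s t) => st.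
    rewrite distrC [leRHS]distrC !ger0_norm ?subr_ge0 ?clamp_mono ?lerD2r//.
    have st3 : s + 3 <= t + 3 by rewrite lerD2r.
    by have := clamp_dist ler01 st3; rewrite /cut; lra.
  rewrite !ger0_norm ?subr_ge0 ?clamp_mono ?lerD2r//.
  have st3 : t + 3 <= s + 3 by rewrite lerD2r.
  by have := clamp_dist ler01 st3; rewrite /cut; lra.
pose ft t := f t * cut t.
have cft : continuous ft by exact: contM.
have ft0 t : t <= -3 -> ft t = 0.
  move=> t3; rewrite /ft /cut /clamp min_l; last by lra.
  by rewrite max_l ?mulr0//; lra.
have ftE t : -2 <= t -> ft t = f t.
  move=> t2; rewrite /ft /cut /clamp min_r; last by lra.
  by rewrite max_r// mulr1.
have [P [dP _]] := antiderivative cft ft0.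
have dPs (k t : R) : is_derive t (1 : R) (fun t => P (t + k)) (ft (t + k)).
  have dk : is_derive t (1 : R) (fun t => t + k) 1.
    by have := is_deriveD (is_derive_id t (1 : R)) (is_derive_cst k t (1 : R)); rewrite addr0; exact.
  have dPk : is_derive ((fun t => t + k) t) (1 : R) P (ft (t + k)) := dP (t + k).
  by have := @is_derive1_comp R P (fun t => t + k) t _ _ dPk dk; rewrite mulr1; exact.
have val (k : R) : -2 <= k -> \int[leb]_(s in `]0, 1[) f (s + k) = P (1 + k) - P k.
  move=> k2; have := FTC2_oo ler01 (dPs k) _; rewrite add0r => <-.
    by apply: eq_Rintegral => s; rewrite inE/= in_itv/= => /andP[s0 s1]; rewrite ftE//; lra.
  move=> s; apply: (@continuous_comp _ _ _ (fun t : R => t + k) ft); last exact: cft.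
  by apply: continuousD; [exact: cvg_id|exact: cvg_cst].
pose Q c := P (c + 1) - P (c + 0).
pose eta c := ft (c + 1) - ft (c + 0).
have dQ (t : R) : is_derive t (1 : R) Q (eta t) by exact: is_deriveB.
have eta0 t : -2 <= t -> eta t = 0 by move=> t2; rewrite /eta !ftE ?addr0 ?pf ?subrr//; lra.
have Qc t : -2 <= t -> Q t = Q (-2) by exact: constant_after dQ eta0.
have -> : \int[leb]_(s in `]0, 1[) f s = \int[leb]_(s in `]0, 1[) f (s + 0).
  by apply: eq_Rintegral => s _; rewrite addr0.
rewrite !val; [|lra|lra].
have q1 := Qc c; have q2 := Qc 0; move: q1 q2; rewrite /Q !addr0 add0r [c + 1]addrC.
move=> -> //; last by lra.
by move=> <- //; lra.
Qed.

(** A bump around the integers, the only zeros of sin (pi s). *)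
Definition peak (k : nat) (s : R) : R := flat 0 (k.+1%:R^-1 - sin (pi * s) ^+ 2).

Lemma smooth_peak k : smooth (peak k).
Proof.
apply: (smooth_comp_R (f := flat 0)); first exact: smooth_flat.
apply: smoothB; first exact: smooth_cst.
under eq_fun do rewrite expr2.
have ss : smooth (fun s : R => sin (pi * s)).
  by apply: (smooth_comp_R (f := sin)); [exact: smooth_sin|apply: smoothZ; exact: smooth_id].
exact: smoothM.
Qed.

Lemma peak_periodic k s : peak k (s + 1) = peak k s.
Proof. by rewrite /peak mulrDr mulr1 sinDpi sqrrN. Qed.

Lemma peak_even k s : peak k (- s) = peak k s.
Proof. by rewrite /peak mulrN sinN sqrrN. Qed.

Lemma peak_ge0 k s : 0 <= peak k s.
Proof. exact: flat_ge0. Qed.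

Lemma peak_neq0 k s : peak k s != 0 -> sin (pi * s) ^+ 2 < k.+1%:R^-1.
Proof.
by rewrite ltNge; apply: contraNN => h; rewrite /peak flat_le0// subr_le0.
Qed.

Lemma peak_gt0 k s : sin (pi * s) ^+ 2 < k.+1%:R^-1 -> 0 < peak k s.
Proof.
move=> h; rewrite /peak /flat subr_gt0 h expr0 mul1r; exact: expR_gt0.
Qed.

Definition peak_mass k : R := \int[leb]_(s in `]0, 1[) peak k s.

Lemma peak_mass_gt0 k : 0 < peak_mass k.
Proof.
rewrite lt_neqAle Rintegral_ge0 ?andbT; last by move=> *; exact: peak_ge0.
apply/eqP => m0.
have ip : leb.-integrable `]0, 1[ (EFin \o peak k) by exact/continuous_intI/smooth_continuous/smooth_peak.
have ae0 : {ae leb, forall s, (`]0, 1[%classic : set R) s -> peak k s = 0}.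
  by apply: Rintegral0_ae => // s _; exact: peak_ge0.
have c0 : continuous (fun s : R => sin (pi * s) ^+ 2).
  move=> s; apply: (@continuous_comp _ _ _ (fun s : R => sin (pi * s)) (fun x => x ^+ 2)); last exact: exprn_continuous.
  apply: (@continuous_comp _ _ _ (fun s : R => pi * s) sin); last exact: continuous_sin.
  by apply: continuousM; [exact: cvg_cst|exact: cvg_id].
have k0 : 0 < k.+1%:R^-1 :> R by rewrite invr_gt0.
have := c0 0; move=> /cvgrPdist_lt /(_ _ k0).
move=> /nbhs_ballP[del /= del0 H].
have d1 : 0 < Num.min 1 del by rewrite lt_min ltr01.
have [s /andP[s0 sd] sP] := ae_dense d1 ae0.
move: sd; rewrite lt_min => /andP[s1 sd].
have pos : 0 < peak k s.
  apply: peak_gt0; have := H s; rewrite -ball_normE/= sub0r normrN gtr0_norm// => /(_ sd).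
  by rewrite mulr0 sin0 expr0n/= sub0r normrN ger0_norm// sqr_ge0.
by move: pos; rewrite sP ?ltxx//= in_itv/= s0.
Qed.

Variable d : nat.

Definition kernel k (x : 'rV[R]_d) : R := \prod_i (peak k (x 0 i) / peak_mass k).

Lemma smooth_kernel k : smooth (kernel k).
Proof.
apply: smooth_prod => i; apply: (smooth_coord (f := fun s => peak k s / peak_mass k)).
by apply: smoothM; [exact: smooth_peak|exact: smooth_cst].
Qed.

Lemma kernel_periodic k : periodic (kernel k).
Proof.
move=> x i; apply: eq_bigr => j _; rewrite !mxE eqxx/=.
by have [->|] := eqVneq j i; rewrite ?peak_periodic// addr0.
Qed.

Lemma kernel_even k x : kernel k (- x) = kernel k x.
Proof. by apply: eq_bigr => j _; rewrite mxE peak_even. Qed.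

Lemma kernel_ge0 k x : 0 <= kernel k x.
Proof.
by apply: prodr_ge0 => i _; rewrite divr_ge0 ?peak_ge0// ltW// peak_mass_gt0.
Qed.

Lemma kernel_neq0 k x : kernel k x != 0 -> forall i, sin (pi * x 0 i) ^+ 2 < k.+1%:R^-1.
Proof.
move=> h i; apply: peak_neq0; apply: contraNN h => /eqP h.
by rewrite /kernel (bigD1 i)//= h !mul0r.
Qed.

Lemma kernel_mass k (y : 'rV[R]_d) : (forall i, 0 <= y 0 i <= 1) ->
  \int[torus R d]_x kernel k (x - y) = 1.
Proof.
move=> y01.
pose theta i s := peak k (s - y 0 i) / peak_mass k.
have th0 i s : 0 <= theta i s by rewrite divr_ge0 ?peak_ge0// ltW// peak_mass_gt0.
have sth i : smooth (theta i).
  apply: smoothM; last exact: smooth_cst.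
  by apply: (smooth_comp_R (f := peak k)); [exact: smooth_peak|apply: smoothB; [exact: smooth_id|exact: smooth_cst]].
have mth i : measurable_fun setT (theta i).
  by apply: continuous_measurable_fun; exact: smooth_continuous.
have E : (\int[torus R d]_x (kernel k (x - y))%:E = 1)%E.
  transitivity (\int[torus R d]_x (\prod_i theta i (x 0%R i))%:E)%E.
    apply: eq_integral => x _; congr (_%:E); apply: eq_bigr => i _.
    by rewrite /theta !mxE.
  rewrite torus_prod// big1// => i _.
  have ith : leb.-integrable `]0, 1[ (EFin \o theta i) by exact/continuous_intI/smooth_continuous.
  rewrite integral_itv_bndoo; last exact: measurable_int ith.
  rewrite EFin_Rintegral//; congr (_%:E).
  have ci : -1 <= - y 0 i by have /andP[_] := y01 i; rewrite lerN2.
  have := periodic_mean (smooth_continuous (smooth_peak k)) (peak_periodic k) ci => pm.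
  rewrite /theta.
  under eq_Rintegral do rewrite mulrC.
  have ip : leb.-integrable `]0, 1[ (EFin \o (fun s => peak k (s - y 0 i))).
    apply: continuous_intI; apply: smooth_continuous.
    by apply: (smooth_comp_R (f := peak k)); [exact: smooth_peak|apply: smoothB; [exact: smooth_id|exact: smooth_cst]].
  by rewrite RintegralZl// pm mulVf// gt_eqF// peak_mass_gt0.
by rewrite /Rintegral E.
Qed.

(** Interior points differ by less than 1 in each coordinate, so a small sine of pi times the
    difference forces a small difference. *)
Lemma kernel_concentrates (x : 'rV[R]_d) (e : R) : (forall i, 0 < x 0 i < 1) -> 0 < e ->
  exists k0 : nat, forall k, (k0 <= k)%N -> forall y : 'rV[R]_d, (forall i, 0 < y 0 i < 1) ->
    kernel k (x - y) != 0 -> forall i, `|x 0 i - y 0 i| < e.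
Proof.
move=> x01 e0.
have one i : exists2 m : R, 0 < m & forall u, 0 < u < 1 ->
    sin (pi * (x 0 i - u)) ^+ 2 < m -> `|x 0 i - u| < e.
  have /andP[x0 x1] := x01 i.
  pose M := Num.max (x 0 i) (1 - x 0 i).
  have M1 : M < 1 by rewrite gt_max x1/=; lra.
  have M0 : 0 < M by rewrite lt_max x0.
  have uM u : 0 < u < 1 -> `|x 0 i - u| <= M.
    move=> /andP[u0 u1]; rewrite ler_norml /M le_max lerNl le_max.
    by apply/andP; split; apply/orP; [right|left]; lra.
  have [eM|Me] := leP e M; last first.
    by exists 1 => // u u01 _; exact: le_lt_trans (uM u u01) Me.
  have cs : {within `[e, M], continuous (fun s : R => sin (pi * s))}.
    apply: continuous_subspaceT => s.
    apply: (@continuous_comp _ _ _ (fun s : R => pi * s) sin); last exact: continuous_sin.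
    by apply: continuousM; [exact: cvg_cst|exact: cvg_id].
  have [c cI cmin] := EVT_min eM cs.
  move: cI; rewrite in_itv/= => /andP[ec cM].
  have sc : 0 < sin (pi * c).
    apply: sin_gt0_pi; rewrite mulr_gt0 ?pi_gt0 ?(lt_le_trans e0 ec)//=.
    by rewrite gtr_pMr ?pi_gt0// (le_lt_trans cM).
  exists (sin (pi * c) ^+ 2); first by rewrite exprn_gt0.
  move=> u u01; rewrite ltNge => sm; rewrite ltNge; apply: contra sm => eu.
  have su : sin (pi * c) <= sin (pi * `|x 0 i - u|).
    by apply: cmin; rewrite in_itv/= eu uM.
  have -> : sin (pi * (x 0 i - u)) ^+ 2 = sin (pi * `|x 0 i - u|) ^+ 2.
    by have [_|_] := ger0P (x 0 i - u); rewrite // mulrN sinN sqrrN.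
  by rewrite !expr2; apply: ler_pM => //; exact: ltW.
have [m mP] : exists m : 'I_d -> R, forall i, 0 < m i /\ forall u, 0 < u < 1 ->
    sin (pi * (x 0 i - u)) ^+ 2 < m i -> `|x 0 i - u| < e.
  exists (fun i => projT1 (cid2 (one i))) => i.
  by case: cid2 => m m0 mP /=.
pose A := \sum_i (m i)^-1.
exists (Num.bound A) => k kA y y01 /kernel_neq0 ker i.
apply: (mP i).2 => //; have := ker i; rewrite !mxE => /lt_le_trans; apply.
have A0 : 0 <= A by apply: sumr_ge0 => j _; rewrite invr_ge0 ltW// (mP j).1.
rewrite invf_ple ?posrE ?(mP i).1//.
apply: (@le_trans _ _ A).
  rewrite /A (bigD1 i)//= lerDl; apply: sumr_ge0 => j _.
  by rewrite invr_ge0 ltW// (mP j).1.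
apply: (le_trans (ltW (archi_boundP A0))).
by rewrite ler_nat (leq_trans kA).
Qed.

End PeriodicKernel.

(** * Convolution on the torus *)

Section Convolution.
Context {R : realType} {d : nat}.
Local Notation mu := (torus R d).
Implicit Types (phi f : 'rV[R]_d -> R) (x y v : 'rV[R]_d).
Local Notation intT f := (mu.-integrable setT (EFin \o f)).

Lemma derive_periodic phi v : periodic phi -> periodic ('D_v phi).
Proof.
move=> pp x i.
have e : phi = fun y => phi (y + delta_mx 0 i) by apply/funext => y; rewrite pp.
rewrite [in RHS]e (derive_affine (A := fun y => y + delta_mx 0 i) (A' := id))//.
by move=> y h w; rewrite addrA.
Qed.

Lemma mean_value_bound phi v (C : R) : smooth phi -> (forall x, `|'D_v phi x| <= C) ->
  forall (h : R) x, `|phi (h *: v + x) - phi x| <= C * `|h|.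
Proof.
move=> sp DC.
have dphi w x : derivable phi x w by exact: smooth_derivable.
have pos h x : 0 < h -> `|phi (h *: v + x) - phi x| <= C * `|h|.
  move=> h0; have [s _ ->] := mean_value_line x (dphi v) h0.
  by rewrite normrM mulrC ler_wpM2r.
move=> h x; case: (ltrgtP 0 h) => [h0|h0|<-].
- exact: pos.
- rewrite distrC; have := pos (- h) (h *: v + x).
  by rewrite oppr_gt0 scaleNr addKr normrN; exact.
- by rewrite scale0r add0r subrr normr0 mulr0.
Qed.

Lemma periodic_lipschitz phi : smooth phi -> periodic phi ->
  exists C : R, 0 <= C /\ forall x y, `|phi x - phi y| <= C * norm1 (x - y).
Proof.
move=> sp pp.
have bnd i : exists C : R, forall x, `|'D_(delta_mx 0 i) phi x| <= C.
  apply: torus_periodic_bounded; last exact: derive_periodic.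
  exact/smooth_continuous/smooth_derive.
pose c i := projT1 (cid (bnd i)).
have cP i x : `|'D_(delta_mx 0 i) phi x| <= c i by rewrite /c; case: cid.
pose C := \sum_i `|c i|.
have C0 : 0 <= C by apply: sumr_ge0.
have CP i x : `|'D_(delta_mx 0 i) phi x| <= C.
  rewrite (le_trans (cP i x))// (le_trans (ler_norm _))// /C (bigD1 i)//= lerDl.
  exact: sumr_ge0.
exists C; split=> // x y.
(* The points [hyb s] lead from y to x by changing one coordinate at a time. *)
pose hyb (s : seq 'I_d) : 'rV[R]_d := \row_i (if i \in s then x 0 i else y 0 i).
have step s : uniq s -> `|phi (hyb s) - phi y| <= C * \sum_(i <- s) `|x 0 i - y 0 i|.
  elim: s => [_|i s IH /=/andP[is_ us]].
    rewrite big_nil mulr0 (_ : hyb [::] = y) ?subrr ?normr0//.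
    by apply/rowP => j; rewrite !mxE.
  rewrite big_cons mulrDr.
  apply: (le_trans (ler_distD (phi (hyb s)) _ _)); apply: lerD; last exact: IH.
  rewrite (_ : hyb (i :: s) = (x 0 i - y 0 i) *: delta_mx 0 i + hyb s); first exact: mean_value_bound.
  apply/rowP => j; rewrite !mxE eqxx/= in_cons.
  have [->|ji] := eqVneq j i; first by rewrite (negbTE is_)/= mulr1 subrK.
  by rewrite /= mulr0 add0r.
have := step (index_enum 'I_d) (index_enum_uniq _).
rewrite (_ : hyb _ = x); last by apply/rowP => j; rewrite !mxE mem_index_enum.
move=> /le_trans; apply; rewrite ler_wpM2l//.
by apply: ler_sum => i _; rewrite !mxE.
Qed.

(** [torus R d] is carried by the fundamental cell: for periodic [phi] this is the convolution
    on R^d / Z^d. *)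
Definition conv phi f x : R := \int[mu]_y (f y * phi (x - y)).

Lemma conv_integrable phi f x : smooth phi -> periodic phi -> intT f ->
  intT (fun y => f y * phi (x - y)).
Proof.
move=> sp pp if_; apply: torus_continuous_mul => //; last exact: periodic_reflect.
exact/smooth_continuous/smooth_reflect.
Qed.

Lemma conv_diff_le phi psi f x z (c : R) : smooth phi -> periodic phi -> smooth psi -> periodic psi ->
  intT f -> (forall y, `|phi (x - y) - psi (z - y)| <= c) ->
  `|conv phi f x - conv psi f z| <= c * \int[mu]_y `|f y|.
Proof.
move=> sp pp sp' pp' if_ H; rewrite /conv -RintegralB//; try exact: conv_integrable.
have ib : intT (fun y => f y * phi (x - y) - f y * psi (z - y)).
  by apply: intgB => //; exact: conv_integrable.
apply: (le_trans (le_normr_Rintegral _ ib)) => //.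
rewrite -RintegralZl//; last exact: intg_norm.
apply: le_Rintegral => //; first exact: intg_norm.
- by apply: intgZ => //; exact: intg_norm.
- by move=> y _; rewrite -mulrBr normrM mulrC ler_wpM2r.
Qed.

Lemma conv_continuous phi f : smooth phi -> periodic phi -> intT f -> continuous (conv phi f).
Proof.
move=> sp pp if_; have [C [C0 lip]] := periodic_lipschitz sp pp.
apply: continuous_ball_lt => x e e0.
pose I := \int[mu]_y `|f y|.
have I0 : 0 <= I by apply: Rintegral_ge0.
pose M := C * d%:R * I + 1.
have M0 : 0 < M by rewrite ltr_wpDl// !mulr_ge0.
exists (e / M); first by rewrite divr_gt0.
move=> y /(ball_rV _ _ (divr_gt0 e0 M0)) xy.
have n1 : norm1 (x - y) <= d%:R * (e / M).
  rewrite /norm1 (le_trans (ler_sum _ (G := fun=> e / M) _))//.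
    by move=> i _; rewrite !mxE ltW.
  by rewrite sumr_const card_ord mulr_natl.
have := @conv_diff_le phi phi f x y (C * (d%:R * (e / M))) sp pp sp pp if_.
move=> /(_ _)/le_lt_trans; apply.
  move=> z; apply: (le_trans (lip _ _)).
  have -> : x - z - (y - z) = x - y by rewrite opprB addrA subrK.
  by rewrite ler_wpM2l.
rewrite -/I (_ : _ * I = e * (C * d%:R * I / M)); last by field; rewrite gt_eqF.
by rewrite gtr_pMr// ltr_pdivrMr// mul1r /M ltrDl.
Qed.

Lemma conv_is_derive phi f x v : smooth phi -> periodic phi -> intT f ->
  is_derive x v (conv phi f) (conv ('D_v phi) f x).
Proof.
move=> sp pp if_.
have sD := smooth_derive v sp; have pD := derive_periodic v pp.
have [C [C0 lip]] := periodic_lipschitz sD pD.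
suff cv : h^-1 *: (conv phi f (h *: v + x) - conv phi f x) @[h --> 0^'] --> conv ('D_v phi) f x.
  by apply: DeriveDef; [apply/cvg_ex; exists (conv ('D_v phi) f x)|exact/cvg_lim].
pose I := \int[mu]_y `|f y|.
have I0 : 0 <= I by apply: Rintegral_ge0.
have bnd (h : R) z : h != 0 -> `|phi (h *: v + z) - phi z - h * 'D_v phi z| <= C * norm1 v * `|h| * `|h|.
  move=> h0.
  have dphi w y : derivable phi y w by exact: smooth_derivable.
  have [s [sh e]] : exists s : R, `|s| <= `|h| /\ phi (h *: v + z) - phi z = h * 'D_v phi (s *: v + z).
    have [hp|hn|h00] := ltrgtP 0 h; last by move: h0; rewrite -h00 eqxx.
      have [s /andP[s0 sh] e] := mean_value_line z (dphi v) hp.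
      by exists s; split=> //; rewrite !ger0_norm// ltW.
    have hp : 0 < - h by rewrite oppr_gt0.
    have [s /andP[s0 sh] e] := mean_value_line z (dphi (- v)) hp.
    exists (- s); split; first by rewrite normrN ger0_norm// ltr0_norm.
    move: e; rewrite scalerN scaleNr opprK => ->.
    by rewrite derive_opp_dir// mulrNN scalerN scaleNr.
  rewrite e -mulrBr normrM mulrC ler_wpM2r//; apply: (le_trans (lip _ _)).
  by rewrite addrK norm1Z -mulrA ler_wpM2l// mulrC ler_wpM2l ?norm1_ge0.
apply/cvgrPdist_le => e e0.
pose M := C * norm1 v * I + 1.
have M0 : 0 < M by rewrite ltr_wpDl// !mulr_ge0 ?norm1_ge0.
near=> h.
have h0 : h != 0 by near: h; exact: nbhs_dnbhs_neq.
have hM : `|h| <= e / M by near: h; apply: dnbhs0_le; rewrite divr_gt0.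
have iphi z : intT (fun y => f y * phi (z - y)) by exact: conv_integrable.
have iD : intT (fun y => f y * 'D_v phi (x - y)) by exact: (conv_integrable x sD pD if_).
have ir : intT (fun y => f y * phi (h *: v + x - y) - f y * phi (x - y)) by exact: intgB.
have ihD : intT (fun y => h * (f y * 'D_v phi (x - y))) by exact: intgZ.
have key : `|conv phi f (h *: v + x) - conv phi f x - h * conv ('D_v phi) f x| <=
    C * norm1 v * `|h| * `|h| * I.
  rewrite /conv -RintegralB// -RintegralZl// -RintegralB//.
  apply: (le_trans (le_normr_Rintegral _ (intgB _ ir ihD))) => //.
  rewrite -RintegralZl//; last exact: intg_norm.
  apply: le_Rintegral => //.
  - by apply: intg_norm; exact: intgB.
  - by apply: intgZ => //; exact: intg_norm.
  move=> y _; have -> : f y * phi (h *: v + x - y) - f y * phi (x - y) - h * (f y * 'D_v phi (x - y)) =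
      f y * (phi (h *: v + (x - y)) - phi (x - y) - h * 'D_v phi (x - y)) by rewrite addrA; ring.
  by rewrite normrM mulrC ler_wpM2r// bnd.
rewrite distrC -[_ *: _]/(h^-1 * (conv phi f (h *: v + x) - conv phi f x)).
set A := conv phi f (h *: v + x) - conv phi f x in key *; set D := conv ('D_v phi) f x in key *.
have -> : h^-1 * A - D = h^-1 * (A - h * D) by field.
rewrite normrM normfV ler_pdivrMl ?normr_gt0//; apply: (le_trans key).
rewrite mulrAC [leRHS]mulrC ler_wpM2r//.
apply: (@le_trans _ _ (M * `|h|)); last by rewrite mulrC -ler_pdivlMr.
by rewrite mulrAC ler_wpM2r// /M lerDl.
Unshelve. all: by end_near. Qed.

Lemma conv_derive phi f v : smooth phi -> periodic phi -> intT f ->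
  'D_v (conv phi f) = conv ('D_v phi) f.
Proof. by move=> sp pp if_; apply/funext => x; have [_ ->] := conv_is_derive x v sp pp if_. Qed.

Lemma smooth_conv phi f : smooth phi -> periodic phi -> intT f -> smooth (conv phi f).
Proof.
move=> sp pp if_ k; elim: k phi sp pp => [|k IH] phi sp pp.
  by split=> //; exact: conv_continuous.
split; first exact: conv_continuous.
move=> v; split; first by move=> x; have [] := conv_is_derive x v sp pp if_.
rewrite (conv_derive v sp pp if_); apply: IH; [exact: smooth_derive|exact: derive_periodic].
Qed.

Lemma conv_periodic phi f : periodic phi -> periodic (conv phi f).
Proof. by move=> pp x i; apply: eq_Rintegral => y _; rewrite addrAC pp. Qed.

Lemma partials_conv s phi f : smooth phi -> periodic phi -> intT f ->
  partials s (conv phi f) = conv (partials s phi) f.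
Proof.
move=> sp pp if_; elim: s => //= i s ->; rewrite /partial.
apply/funext => x; rewrite -(conv_derive (delta_mx 0 i))//; first exact: smooth_partials.
exact: partials_periodic.
Qed.

Lemma conv_sum (I : Type) (r : seq I) phi (f_ : I -> 'rV[R]_d -> R) x : smooth phi -> periodic phi ->
  (forall i, intT (f_ i)) ->
  conv phi (fun y => \sum_(i <- r) f_ i y) x = \sum_(i <- r) conv phi (f_ i) x.
Proof.
move=> sp pp if_; rewrite /conv -Rintegral_sum//; last by move=> i; exact: conv_integrable.
by apply: eq_Rintegral => y _; rewrite mulr_suml.
Qed.

Lemma convZ phi (c : R) f x : smooth phi -> periodic phi -> intT f ->
  conv phi (fun y => c * f y) x = c * conv phi f x.
Proof.
move=> sp pp if_; rewrite /conv -RintegralZl//; last exact: conv_integrable.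
by apply: eq_Rintegral => y _; rewrite mulrA.
Qed.

Lemma convB phi f g x : smooth phi -> periodic phi -> intT f -> intT g ->
  conv phi (fun y => f y - g y) x = conv phi f x - conv phi g x.
Proof.
move=> sp pp if_ ig; rewrite /conv -RintegralB//; try exact: conv_integrable.
by apply: eq_Rintegral => y _; rewrite mulrBl.
Qed.

End Convolution.

(** * The kernel as an approximate identity *)

(** The sum of the series of the [G j] is integrable; it dominates every term and its terms
    tend to 0 where it is finite. *)
Lemma summable_dominated {disp : measure_display} {T : measurableType disp} {R : realType}
    (mu : {measure set T -> \bar R}) (G : nat -> T -> R) :
  (forall j, mu.-integrable setT (EFin \o G j)) -> (forall j z, 0 <= G j z) ->
  (forall j, \int[mu]_z G j z <= 1 / (2 ^ j.+1)%:R) ->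
  exists D : T -> R, mu.-integrable setT (EFin \o D) /\
    {ae mu, forall z, (forall j, G j z <= D z) /\ G ^~ z @ \oo --> 0}.
Proof.
move=> iG G0 Gle; pose E z := (\sum_(j <oo) (G j z)%:E)%E.
have mG j : measurable_fun setT (fun z => (G j z)%:E) by exact: measurable_int (iG j).
have mE : measurable_fun setT E.
  have := @ge0_emeasurable_sum _ T R setT (fun j z => (G j z)%:E) xpredT.
  by apply=> // k z _ _; rewrite lee_fin.
have iE : mu.-integrable setT E.
  apply/integrableP; split=> //.
  rewrite (eq_integral E); last by move=> z _; rewrite gee0_abs//; apply: nneseries_ge0 => *; rewrite lee_fin.
  rewrite integral_nneseries//; last by move=> *; rewrite lee_fin.
  apply: (@le_lt_trans _ _ (\sum_(j <oo) (1 / (2 ^ j.+1)%:R)%:E)%E); last first.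
    by apply: (le_lt_trans (@epsilon_trick0 R 1 xpredT ler01)); exact: ltry.
  apply: lee_nneseries => [j _ _|j _]; first by apply: integral_ge0 => z _; rewrite lee_fin.
  by rewrite EFin_Rintegral// lee_fin.
have [iD _] := integrable_fine measurableT iE.
exists (fun z => fine (E z)); split=> //.
have := integrable_ae measurableT iE; apply: aeS => z Ez; have {}Ez := Ez I.
have bnd k : \sum_(0 <= i < k) G i z <= fine (E z).
  rewrite -lee_fin fineK// -sumEFin.
  by apply: (@nneseries_lim_ge R (fun j => (G j z)%:E) xpredT 0%N k) => *; rewrite lee_fin.
split=> [j|].
  have := bnd j.+1; rewrite big_nat_recr//=; apply: le_trans; rewrite lerDr.
  exact: sumr_ge0.
apply: cvg_series_cvg_0; apply: nondecreasing_is_cvgn.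
  apply/nondecreasing_seqP => k; rewrite /series/= big_nat_recr//= lerDl.
  exact: G0.
by exists (fine (E z)) => _ [k _ <-]; exact: bnd.
Qed.

Section ApproximateIdentity.
Context {R : realType} {d : nat}.
Local Notation mu := (torus R d).
Implicit Types (f g : 'rV[R]_d -> R).
Local Notation intT f := (mu.-integrable setT (EFin \o f)).
Local Notation A k f := (conv (@kernel R d k) f).

Let kersp k := @smooth_kernel R d k.
Let kerp k := @kernel_periodic R d k.

Lemma conv_kernel_integrable k f : intT f -> intT (A k f).
Proof.
move=> if_; have cA : continuous (A k f) by exact: conv_continuous.
have [C CP] := torus_periodic_bounded cA (conv_periodic f (@kerp k)).
by apply: (@intg_bounded _ _ _ _ _ _ C) => //; [exact: torus_lty|exact: continuous_measurable_rV].
Qed.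

Lemma kernel_mass_sub k (x : 'rV[R]_d) : (forall i, 0 <= x 0 i <= 1) -> \int[mu]_y kernel k (x - y) = 1.
Proof.
move=> x01; rewrite -(kernel_mass k x01); apply: eq_Rintegral => y _.
by rewrite -kernel_even opprB.
Qed.

Lemma torus_interior_le : {ae mu, forall x : 'rV[R]_d, forall i, 0 <= x 0 i <= 1}.
Proof.
by apply: aeS (torus_ae_interior d) => x H i; have /andP[h1 h2] := H i; rewrite !ltW.
Qed.

(** Fubini's theorem, as the kernel has mass 1 in either variable. *)
Lemma conv_kernel_contraction k f : intT f -> \int[mu]_x `|A k f x| <= \int[mu]_x `|f x|.
Proof.
move=> if_; have inf := intg_norm if_.
pose D : set ('rV[R]_d * 'rV[R]_d) := setT `*` setT.
pose G (z : 'rV[R]_d * 'rV[R]_d) := 1 * `|f z.2| * kernel k (z.1 - z.2).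
have [C CP] := torus_periodic_bounded (smooth_continuous (kersp k)) (@kerp k).
have mD : measurable D by exact: measurableX.
have mk : measurable_fun D (fun z : 'rV[R]_d * 'rV[R]_d => kernel k (z.1 - z.2)).
  apply: (measurable_rV_comp (f := fun z : 'rV[R]_d * 'rV[R]_d => z.1 - z.2)) => //; last first.
    exact: smooth_continuous (kersp k).
  move=> i; rewrite (_ : (fun z : 'rV[R]_d * 'rV[R]_d => (z.1 - z.2) 0 i) =
    fun z : 'rV[R]_d * 'rV[R]_d => z.1 0 i - z.2 0 i); last first.
    by apply/funext => z; rewrite !mxE.
  apply: measurable_funTS; apply: measurable_funB.
    exact: (measurableT_comp (measurable_coord i) measurable_fst).
  exact: (measurableT_comp (measurable_coord i) measurable_snd).
have i1 : intT (fun=> 1).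
  by apply: (@intg_bounded _ _ _ _ _ _ 1) => //; [exact: torus_lty|move=> *; rewrite normr1].
have iG : (mu \x mu)%E.-integrable D (EFin \o G).
  apply: (@intg_bounded_mul _ _ _ _ _ _ _ C) => //.
  exact: (tensor_integrable measurableT measurableT i1 inf).
have cA := conv_kernel_integrable k if_.
apply: (@le_trans _ _ (\int[mu]_x \int[mu]_y G (x, y))).
  apply: le_Rintegral => //; first exact: intg_norm.
    exact: (rect_integrable1 measurableT measurableT iG).
  move=> x _; have ic := conv_integrable x (kersp k) (@kerp k) if_.
  apply: (le_trans (le_normr_Rintegral _ ic)) => //.
  rewrite le_eqVlt; apply/orP; left; apply/eqP; apply: eq_Rintegral => y _.
  by rewrite /G mul1r normrM [`|kernel _ _|]ger0_norm// kernel_ge0.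
rewrite -(rect_fubini1 measurableT measurableT iG) (rect_fubini2 measurableT measurableT iG).
rewrite le_eqVlt; apply/orP; left; apply/eqP; apply: ae_Rintegral => //.
- exact: (intg_measurable (rect_integrable2 measurableT measurableT iG)).
- exact: intg_measurable inf.
apply: aeS torus_interior_le => y y01 _.
rewrite /G/= mul1r RintegralZl ?kernel_mass ?mulr1//.
apply: (@intg_bounded _ _ _ _ _ _ C) => //; first exact: torus_lty.
apply: continuous_measurable_rV; apply: smooth_continuous.
have := smooth_reflect y (kersp k); rewrite (_ : (fun z => _) = fun x => kernel k (x - y))//.
by apply/funext => x; rewrite -kernel_even opprB.
Qed.

Definition approximates f := forall e : R, 0 < e -> exists k0 : nat, forall k, (k0 <= k)%N ->
  \int[mu]_x `|A k f x - f x| <= e.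

Let iA k f (if_ : intT f) : intT (fun x => `|A k f x - f x|).
Proof. by apply: intg_norm; apply: intgB => //; exact: conv_kernel_integrable. Qed.

(** Mollification being a contraction of L^1, the convergence passes to L^1 limits. *)
Lemma approximates_closure f : intT f ->
  (forall e : R, 0 < e -> exists g, [/\ intT g, approximates g & \int[mu]_x `|f x - g x| <= e]) ->
  approximates f.
Proof.
move=> if_ H e e0; have e3 : 0 < e / 3 by rewrite divr_gt0.
have [g [ig ag fg]] := H _ e3; have [k0 k0P] := ag _ e3; exists k0 => k /k0P gk.
have ifg : intT (fun x => f x - g x) by exact: intgB.
have con := conv_kernel_contraction k ifg.
have i1 : intT (fun x => `|A k (fun x => f x - g x) x|) by apply: intg_norm; exact: conv_kernel_integrable.
have i2 := iA k ig; have i3 := intg_norm ifg.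
apply: (@le_trans _ _ (\int[mu]_x (`|A k (fun x => f x - g x) x| + `|A k g x - g x| + `|f x - g x|))).
  apply: le_Rintegral => //; first exact: iA.
    by apply: intgD => //; exact: intgD.
  move=> x _; rewrite convB//.
  rewrite [X in _ <= _ + X]distrC (le_trans _ (lerD (ler_normD _ _) (lexx _)))//.
  by rewrite (le_trans _ (ler_normD _ _))// le_eqVlt; apply/orP; left; apply/eqP; congr (`|_|); ring.
rewrite RintegralD//; last exact: intgD.
by rewrite RintegralD//; lra.
Qed.

Lemma approximates_linear (I : finType) (c : I -> R) (f_ : I -> 'rV[R]_d -> R) :
  (forall i, intT (f_ i)) -> (forall i, approximates (f_ i)) ->
  approximates (fun x => \sum_i c i * f_ i x).
Proof.
move=> if_ af e e0.
pose C := \sum_i `|c i| + 1.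
have C0 : 0 < C by rewrite ltr_wpDl// sumr_ge0.
have eC : 0 < e / C by rewrite divr_gt0.
have [k0 k0P] : exists k0 : I -> nat, forall i k, (k0 i <= k)%N -> \int[mu]_x `|A k (f_ i) x - f_ i x| <= e / C.
  exists (fun i => projT1 (cid (af i _ eC))) => i k; case: cid => m /= mP; exact: mP.
exists (\max_i k0 i) => k kk.
have icf i : intT (fun x => c i * f_ i x) by exact: intgZ.
have isum : intT (fun x => \sum_i c i * f_ i x) by exact: intg_sum.
have inorm i : intT (fun x => `|c i| * `|A k (f_ i) x - f_ i x|) by apply: intgZ => //; exact: iA.
apply: (@le_trans _ _ (\int[mu]_x (\sum_i `|c i| * `|A k (f_ i) x - f_ i x|))).
  apply: le_Rintegral => //; [exact: iA|exact: intg_sum|].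
  move=> x _; rewrite conv_sum// -sumrB (le_trans (ler_norm_sum _ _ _))//.
  by apply: ler_sum => i _; rewrite convZ// -mulrBr normrM.
rewrite Rintegral_sum//; apply: (@le_trans _ _ (\sum_i `|c i| * (e / C))).
  apply: ler_sum => i _; rewrite RintegralZl//; last exact: iA.
  by rewrite ler_wpM2l// k0P// (leq_trans _ kk)// leq_bigmax.
rewrite -mulr_suml mulrCA ler_piMr ?(ltW e0)// ler_pdivrMr// mul1r lerDl ler01.
by [].
Qed.

Let indic_int (B : set 'rV[R]_d) : measurable B -> intT (fun x => \1_B x).
Proof.
move=> mB; apply: (@intg_bounded _ _ _ _ _ _ 1) => //; first exact: torus_lty.
  exact: measurable_indic.
by move=> x _; rewrite indicE; case: (_ \in _); rewrite ?normr1 ?normr0.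
Qed.

Let approx_orthant (c : 'I_d -> R) : approximates (\1_[set x : 'rV[R]_d | forall i, c i < x 0 i]).
Proof.
set O := [set x | _].
have mO : measurable (O : set 'rV[R]_d).
  by rewrite measurable_orthants; apply: sub_sigma_algebra; exists c.
pose f : 'rV[R]_d -> R := \1_O.
have if_ : intT f by exact: indic_int.
have lim : \int[mu]_x `|A k f x - f x| @[k --> \oo] --> (0 : R).
  have [C CP] : exists C : R, forall k x, `|A k f x - f x| <= C \/ ~ (forall i, 0 <= x 0 i <= 1).
    exists 2 => k x; have [x01|] := pselect (forall i, 0 <= x 0 i <= 1); last by right.
    left; have f1 y : 0 <= f y <= 1 by rewrite /f indicE; case: (_ \in _); rewrite lexx ler01.
    have ic := conv_integrable x (kersp k) (@kerp k) if_.
    have ik : intT (fun y => kernel k (x - y)).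
      have [C CP] := torus_periodic_bounded (smooth_continuous (kersp k)) (@kerp k).
      apply: (@intg_bounded _ _ _ _ _ _ C) => //; first exact: torus_lty.
      by apply: continuous_measurable_rV; apply: smooth_continuous; exact: smooth_reflect.
    have a0 : 0 <= A k f x.
      by apply: Rintegral_ge0 => y _; rewrite mulr_ge0 ?kernel_ge0//; have /andP[] := f1 y.
    have a1 : A k f x <= 1.
      rewrite -(kernel_mass_sub k x01); apply: le_Rintegral => // y _.
      by rewrite ler_piMl ?kernel_ge0//; have /andP[] := f1 y.
    by have /andP[f0 f1'] := f1 x; rewrite ler_norml; apply/andP; split; lra.
  have i2 : intT (fun=> C).
    by apply: (@intg_bounded _ _ _ _ _ _ `|C|) => //; exact: torus_lty.
  suff [_] : intT (fun=> 0) /\ \int[mu]_x `|A k f x - f x| @[k --> \oo] --> \int[mu]_x (0 : R).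
    by rewrite Rintegral_cst// mul0r.
  apply: (@ae_Rdominated _ _ _ mu setT (fun k x => `|A k f x - f x|) (fun=> 0) (fun=> C)) => //.
  - by move=> k; exact: intg_measurable (iA k if_).
  - apply: aeS (aeI (torus_ae_interior d) (torus_ae_neq c)) => x [x01 xc] _.
    have [e e0 He] : exists2 e : R, 0 < e & forall y : 'rV[R]_d, (forall i, `|x 0 i - y 0 i| < e) -> f y = f x.
      have cx i : 0 < `|x 0 i - c i| by rewrite normr_gt0 subr_eq0.
      have [e e0 He] : exists2 e : R, 0 < e & forall i, e <= `|x 0 i - c i|.
        pose S := \sum_i `|x 0 i - c i|^-1 + 1.
        have S0 : 0 < S by rewrite ltr_wpDl// sumr_ge0// => i _; rewrite invr_ge0.
        exists S^-1; first by rewrite invr_gt0.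
        move=> i; rewrite invf_ple ?posrE// /S (bigD1 i)//= -addrA lerDl addr_ge0//.
        by apply: sumr_ge0 => j _; rewrite invr_ge0.
      exists e => // y xy; rewrite /f !indicE; congr (_%:R); congr nat_of_bool.
      have ey i : (c i < y 0 i) = (c i < x 0 i).
        have := lt_le_trans (xy i) (He i); have := xc i.
        rewrite neq_lt => /orP[xc'|cx']; last first.
          rewrite (ger0_norm (x := x 0 i - c i)) ?subr_ge0 ?ltW//.
          by rewrite cx' ltr_distlC => /andP[h _]; lra.
        rewrite [X in _ < X]distrC (ger0_norm (x := c i - x 0 i)) ?subr_ge0 ?ltW//.
        rewrite ltr_distlC => /andP[_ h].
        by rewrite [RHS]ltNge (ltW xc'); apply/negbTE; rewrite -leNgt; lra.
      by apply/idP/idP => /set_mem H; apply/mem_set => i; have := H i; rewrite ey.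
    have [k0 k0P] := kernel_concentrates x01 e0.
    apply: cvg_near_cst; exists k0 => // k /= kk.
    suff -> : A k f x = f x by rewrite subrr normr0.
    have x01' i : 0 <= x 0 i <= 1 by have /andP[h1 h2] := x01 i; rewrite !ltW.
    transitivity (\int[mu]_y (f x * kernel k (x - y))).
      apply: ae_Rintegral => //.
      + exact: intg_measurable (conv_integrable x (kersp k) (@kerp k) if_).
      + apply: measurable_funM => //; apply: continuous_measurable_rV; apply: smooth_continuous.
        exact: smooth_reflect.
      apply: aeS (torus_ae_interior d) => y y01 _.
      have [->|kn] := eqVneq (kernel k (x - y)) 0; first by rewrite !mulr0.
      by congr (_ * _); apply: He; exact: (k0P k kk y y01 kn).
    rewrite RintegralZl//; first by rewrite kernel_mass_sub// mulr1.
    have [C' C'P] := torus_periodic_bounded (smooth_continuous (kersp k)) (@kerp k).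
    apply: (@intg_bounded _ _ _ _ _ _ C') => //; first exact: torus_lty.
    by apply: continuous_measurable_rV; apply: smooth_continuous; exact: smooth_reflect.
  - apply: aeS torus_interior_le => x x01 _ k.
    by have [|h] := CP k x; [rewrite normr_id|exfalso; exact: h].
move=> e e0; move: lim => /cvgrPdist_le /(_ _ e0) [k0 _ k0P]; exists k0 => k kk.
by have := k0P k kk; rewrite /= sub0r normrN => /(le_trans (ler_norm _)).
Qed.

(** Dynkin's lemma, starting from orthants. *)
Lemma approximates_indic (B : set 'rV[R]_d) : measurable B -> approximates (\1_B).
Proof.
move=> mB; have := mB; rewrite measurable_orthants => sB.
have aT : approximates (\1_(setT : set 'rV[R]_d)).
  move=> e e0; exists 0%N => k _.
  have iT : intT (\1_(setT : set 'rV[R]_d)) by exact: indic_int.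
  rewrite (_ : Rintegral _ _ _ = \int[mu]_x (0 : R)); first by rewrite Rintegral_cst// mul0r ltW.
  apply: ae_Rintegral => //; first exact: intg_measurable (iA k iT).
  apply: aeS torus_interior_le => x x01 _.
  rewrite (_ : A k _ x = 1); first by rewrite indicE in_setT subrr normr0.
  rewrite -(kernel_mass_sub k x01); apply: eq_Rintegral => y _.
  by rewrite indicE in_setT mul1r.
pose P (S : set 'rV[R]_d) := approximates (\1_S).
apply: (@dynkin_induction _ 'rV[R]_d (@orthants R d) P (measurable_orthants d) (@orthants_setI _ d) aT _ _ _ _ sB).
- by move=> _ [c ->]; exact: approx_orthant.
- move=> S mS aS; rewrite /P.
  have -> : \1_(~` S) = (fun x => \sum_(b : bool) (if b then 1 else -1) * (if b then \1_(setT : set 'rV[R]_d) x else \1_S x)) :> ('rV[R]_d -> R).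
    apply/funext => x; rewrite big_bool/= !indicE in_setT in_setC.
    by case: (x \in S); rewrite /= ?mul1r ?mulN1r ?subrr ?subr0.
  apply: (@approximates_linear bool (fun b => if b then 1 else -1)
    (fun b x => if b then \1_(setT : set 'rV[R]_d) x else \1_S x)).
    by case; exact: indic_int.
  by case.
- move=> F mF tF aF; have mU : measurable (\bigcup_k F k) by exact: bigcupT_measurable.
  apply: approximates_closure; first exact: indic_int.
  pose g m x : R := \sum_(i < m) 1 * \1_(F i) x.
  have ig m : intT (g m) by apply: intg_sum => // i; apply: intgZ => //; exact: indic_int.
  have gin m x k : F k x -> g m x = (k < m)%N%:R.
    move=> Fkx; have Fi i : \1_(F i) x = (i == k)%:R :> R.
      rewrite indicE; have [->|ik] := eqVneq i k; first by rewrite mem_set.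
      rewrite memNset// => Fix; move/trivIsetP : tF => /(_ i k I I ik).
      by move=> /seteqP[/(_ x (conj Fix Fkx))].
    rewrite /g; elim: m => [|m IH]; first by rewrite big_ord0.
    rewrite big_ord_recr/= IH mul1r Fi ltnS [in RHS]leq_eqVlt (eq_sym k m).
    have [->|mk] := eqVneq m k; first by rewrite ltnn add0r.
    by rewrite addr0.
  have gout m x : ~ (\bigcup_k F k) x -> g m x = 0.
    move=> nx; rewrite /g big1// => i _; rewrite indicE memNset ?mulr0// => Fix.
    by apply: nx; exists i.
  have lim : \int[mu]_x `|\1_(\bigcup_k F k) x - g m x| @[m --> \oo] --> (0 : R).
    have iU := indic_int mU.
    have i1 : intT (fun=> 1).
      by apply: (@intg_bounded _ _ _ _ _ _ 1) => //; [exact: torus_lty|move=> *; rewrite normr1].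
    have inorm m : intT (fun x => `|\1_(\bigcup_k F k) x - g m x|) by apply: intg_norm; exact: intgB.
    suff [_] : intT (fun=> 0) /\ \int[mu]_x `|\1_(\bigcup_k F k) x - g m x| @[m --> \oo] --> \int[mu]_x (0 : R).
      by rewrite Rintegral_cst// mul0r.
    apply: (@ae_Rdominated _ _ _ mu setT (fun m x => `|\1_(\bigcup_k F k) x - g m x|) (fun=> 0) (fun=> 1)) => //.
    - by move=> m; exact: intg_measurable (inorm m).
    - apply: aeW => x _; apply: cvg_near_cst.
      have [[k _ Fkx]|nx] := pselect ((\bigcup_k F k) x).
        exists k.+1 => // m /= km; rewrite (gin m x k Fkx) km indicE mem_set ?subrr ?normr0//.
        by exists k.
      by exists 0%N => // m _; rewrite gout// indicE memNset// subrr normr0.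
    - apply: aeW => x _ m; rewrite normr_id.
      have [[k _ Fkx]|nx] := pselect ((\bigcup_k F k) x).
        rewrite (gin m x k Fkx) indicE mem_set; last by exists k.
        by case: (k < m)%N; rewrite /= ?subrr ?normr0// subr0 normr1.
      by rewrite gout// indicE memNset// subrr normr0.
  move=> e e0; move: lim => /cvgrPdist_le /(_ _ e0) [m _ mP].
  exists (g m); split=> //; first apply: (@approximates_linear 'I_m (fun=> 1) (fun i => \1_(F i))) => i.
  - exact: indic_int.
  - exact: aF.
  by have := mP m (leqnn m); rewrite /= sub0r normrN => /(le_trans (ler_norm _)).
Qed.

Import HBSimple.

Lemma approximates_L1 f : intT f -> approximates f.
Proof.
move=> if_; apply: approximates_closure => // e e0.
have [g [ig _ gl]] := @approximation_sfun_integrable _ _ _ mu setT measurableT _ if_.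
have [m] : exists m, (\int[mu]_(z in setT) `|(f z)%:E - (g m z)%:E| <= e%:E)%E.
  have : \forall m \near \oo, (\int[mu]_(z in setT) `|(f z)%:E - (g m z)%:E| < e%:E)%E.
    apply: (gl [set y : \bar R | (y < e%:E)%E]).
    by apply: open_nbhs_nbhs; split; [exact: open_ereal_lt_ereal|rewrite /= lte_fin].
  by move=> [m _ /(_ m (leqnn m)) h]; exists m; exact: ltW.
move=> gm; exists (g m); split; first exact: ig.
  have -> : (g m : 'rV[R]_d -> R) = _ := funext (fimfunEord (g m)).
  apply: approximates_linear => i; first by apply: indic_int; exact: measurable_sfunP.
  by apply: approximates_indic; exact: measurable_sfunP.
rewrite -lee_fin -EFin_Rintegral//; apply: intg_norm; apply: intgB => //.
Qed.

(** Along a subsequence with summable errors the convergence is dominated and almost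
    everywhere, for finitely many functions at once. *)
Lemma mollified_subsequence (I : finType) (f_ : I -> 'rV[R]_d -> R) : (forall i, intT (f_ i)) ->
  exists (kk : nat -> nat) (D : 'rV[R]_d -> R), intT D /\
    {ae mu, forall x, forall i, (forall j, `|A (kk j) (f_ i) x - f_ i x| <= D x) /\
       A (kk j) (f_ i) x @[j --> \oo] --> f_ i x}.
Proof.
move=> if_; pose G k x := \sum_i `|A k (f_ i) x - f_ i x|.
have iG k : intT (G k) by apply: intg_sum => // i; exact: iA.
have small (e : R) : 0 < e -> exists k, \int[mu]_x G k x <= e.
  move=> e0; pose C : R := #|I|%:R + 1.
  have C0 : 0 < C by rewrite ltr_wpDl.
  have eC : 0 < e / C by rewrite divr_gt0.
  have [k0 k0P] : exists k0 : I -> nat, forall i k, (k0 i <= k)%N -> \int[mu]_x `|A k (f_ i) x - f_ i x| <= e / C.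
    exists (fun i => projT1 (cid (approximates_L1 (if_ i) eC))) => i k; case: cid => m /= mP; exact: mP.
  exists (\max_i k0 i); rewrite Rintegral_sum//; last by move=> i; exact: iA.
  apply: (@le_trans _ _ (\sum_(i : I) e / C)).
    by apply: ler_sum => i _; apply: k0P; exact: leq_bigmax.
  by rewrite sumr_const -mulr_natl mulrCA ler_piMr ?(ltW e0)// ler_pdivrMr// mul1r lerDl ler01.
have e0 j : 0 < 1 / (2 ^ j.+1)%:R :> R by rewrite divr_gt0// ltr0n expn_gt0.
pose kk j := projT1 (cid (small _ (e0 j))).
have kkP j : \int[mu]_x G (kk j) x <= 1 / (2 ^ j.+1)%:R by rewrite /kk; case: cid.
have G0 k x : 0 <= G k x by apply: sumr_ge0.
have [D [iD DP]] := summable_dominated (fun j => iG (kk j)) (fun j => G0 (kk j)) kkP.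
exists kk, D; split=> //; apply: aeS DP => x [GD Gc] i.
have le j : `|A (kk j) (f_ i) x - f_ i x| <= G (kk j) x.
  by rewrite /G (bigD1 i)//= lerDl; apply: sumr_ge0.
split=> [j|]; first exact: le_trans (le j) (GD j).
apply/cvgrPdist_le => e e1; move: Gc => /cvgrPdist_le /(_ _ e1); apply: filterS => j.
rewrite sub0r normrN => /(le_trans (ler_norm _)) h.
by rewrite distrC (le_trans (le j)).
Qed.

End ApproximateIdentity.

(** * Conservativity for rough fields *)

Lemma ae_countType {disp : measure_display} {T : measurableType disp} {R : realType}
    (mu : {measure set T -> \bar R}) (I : countType) (P : I -> T -> Prop) :
  (forall i, {ae mu, forall z, P i z}) -> {ae mu, forall z, forall i, P i z}.
Proof.
move=> H; have : {ae mu, forall z, forall m : nat, if unpickle m is Some i then P i z else True}.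
  apply: ae_countable => m; case: unpickle => [i|]; first exact: H.
  exact: aeW.
by apply: aeS => z Pz i; have := Pz (pickle i); rewrite pickleK.
Qed.

Lemma ae_torus_cst {R : realType} {d : nat} (P : Prop) : {ae torus R d, forall x, P} -> P.
Proof.
move=> aeP; apply: contrapT => nP.
have : (torus R d).-negligible setT by apply: negligibleS aeP => x _ /=.
move=> /negligibleP -/(_ measurableT) h.
have : (torus R d setT = 1)%E by exact: probability_setT.
by rewrite h => /eqP; rewrite eqe eq_sym oner_eq0.
Qed.

Lemma continuous_eq_dense {R : realType} {n : nat} (f g : 'rV[R]_n -> R) : continuous f -> continuous g ->
  (forall q : 'rV[rat]_n, f (map_mx ratr q) = g (map_mx ratr q)) -> forall x, f x = g x.
Proof.
move=> cf cg fg x; apply/eqP; rewrite -subr_eq0; apply: contraT => neq.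
have ch : continuous (fun x => f x - g x) by exact: contB.
have := ch x; move=> /cvgrPdist_lt /(_ `|f x - g x|); rewrite normr_gt0 => /(_ neq).
move=> /nbhs_ballP[e /= e0 H]; have [q xq] := rV_ratr_dense x e0.
by have := H _ xq; rewrite fg subrr subr0 ltxx.
Qed.

Lemma cvg_rV_comp {R : realType} {n : nat} (phi : 'rV[R]_n -> R) (u : nat -> 'rV[R]_n) (w : 'rV[R]_n) :
  continuous phi -> (forall i, u j 0 i @[j --> \oo] --> w 0 i) -> phi (u j) @[j --> \oo] --> phi w.
Proof.
move=> cphi cu; apply/cvgrPdist_lt => e e0.
have := cphi w; move=> /cvgrPdist_lt /(_ _ e0) /nbhs_ballP[del /= del0 H].
have near_all : \forall j \near \oo, forall i, `|w 0 i - u j 0 i| < del.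
  by apply: filter_forall => i; have := cu i; move=> /cvgrPdist_lt /(_ _ del0).
by near=> j; apply: H; apply/(ball_rV _ _ del0); near: j.
Unshelve. all: by end_near. Qed.

Lemma cvg_sumr {R : realType} (I : finType) (f : I -> nat -> R) (l : I -> R) :
  (forall i, f i j @[j --> \oo] --> l i) -> \sum_i f i j @[j --> \oo] --> \sum_i l i.
Proof.
move=> cf; elim: (index_enum I) => [|i s IH].
  by under eq_fun do rewrite big_nil; rewrite big_nil; exact: cvg_cst.
under eq_fun do rewrite big_cons.
by rewrite big_cons; apply: cvgD; [exact: cf|exact: IH].
Qed.

Section SliceConservativity.
Context {R : realType} {d n N : nat}.
Variables (F : 'rV[R]_n -> 'M[R]_N) (L : diffop R d n N).
Hypothesis hFL : standing_assumptions F L.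
Local Notation mu := (torus R d).
Local Notation leb := (@lebesgue_measure R).
Local Notation st := (spacetime R d).
Local Notation stin a b f := (st.-integrable (slab a b) (EFin \o f)).
Local Notation intT f := (mu.-integrable setT (EFin \o f)).
Local Notation K := (entropy F).
Local Notation Ks := (legendre (entropy F)).
Local Notation ker k := (@kernel R d k).
Let kersp k := @smooth_kernel R d k.
Let kerp k := @kernel_periodic R d k.
Let reg := entropy_regular hFL.

Lemma smooth_multi_partial (a : 'I_d -> nat) (phi : 'rV[R]_d -> R) : smooth phi -> periodic phi ->
  smooth (multi_partial a phi) /\ periodic (multi_partial a phi).
Proof.
move=> sp pp; have [s [_ E]] := @multi_partialE R d a; rewrite E.
by split; [exact: smooth_partials|exact: partials_periodic].
Qed.

Lemma smooth_apply_op_scalar (Q : 'M[R]_N) (phi : 'rV[R]_d -> R) l : smooth phi -> periodic phi ->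
  smooth (fun x => apply_op L (fun y => phi y *: Q) x 0 l) /\
  periodic (fun x => apply_op L (fun y => phi y *: Q) x 0 l).
Proof.
move=> sp pp; rewrite (_ : (fun x => _) = fun x => \sum_(a : {ffun 'I_d -> 'I_(dop_order L).+1})
  frob (dop_coef L a l) Q * multi_partial (fun i => a i) phi x); last first.
  by apply/funext => x; rewrite apply_op_scalar.
split; last first.
  by move=> x i; apply: eq_bigr => a _; have [_ ->] := smooth_multi_partial (fun i => a i) sp pp.
apply: smooth_sum => a; apply: smoothZ.
by have [] := smooth_multi_partial (fun i => a i) sp pp.
Qed.

Lemma tr_flux_ge0 v : 0 <= \tr (F v).
Proof.
have [_ c] := flux_cone hFL v; have := c _ (@Lambda1 R d n N L) psd1.
by rewrite frob_scalar mul1r.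
Qed.

Section WeakAdjoint.
Variables (S : R) (f : R * 'rV[R]_d -> 'rV[R]_n) (G : R * 'rV[R]_d -> 'M[R]_N).
Hypothesis wG : weak_adj L S f G.

(** The identity tested with eta(t) psi(x) Q says that a function of t has zero integral
    against every eta. *)
Lemma weak_adj_slice (psi : 'rV[R]_d -> R) (Q : 'M[R]_N) : smooth psi -> periodic psi -> sym Q ->
  {ae leb, forall t : R, 0 < t < S ->
    \int[mu]_x (dotv (f (t, x)) (apply_op L (fun y => psi y *: Q) x) - frob (G (t, x)) (psi x *: Q)) = 0}.
Proof.
move=> sp pp sQ; have [sG lf lG tests] := wG.
pose r z := dotv (f z) (apply_op L (fun y => psi y *: Q) z.2) - frob (G z) (psi z.2 *: Q).
pose m t := \int[mu]_x r (t, x).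
suff : {ae st, forall z, slab 0 S z -> m z.1 = 0}.
  by move=> /slab_ae1; apply: aeS => t H tS; exact: (@ae_torus_cst R d (m t = 0) (H tS)).
apply: ae_slab_exhaust => a b a0 ab bS.
have mS := @measurable_slab R d a b.
have ce (l : 'I_n) := smooth_apply_op_scalar Q l sp pp.
have i1 : stin a b (fun z => dotv (f z) (apply_op L (fun y => psi y *: Q) z.2)).
  apply: intg_sum => // l; apply: stin_continuous_mul.
  - exact: loc_stin (lf l) a0 bS.
  - exact: (smooth_continuous (smooth_snd (ce l).1)).
  - by move=> t x i; exact: (ce l).2.
have i2 : stin a b (fun z => frob (G z) (psi z.2 *: Q)).
  apply: intg_sum => // i; apply: intg_sum => // j.
  apply: stin_continuous_mul.
  - exact: loc_stin (lG i j) a0 bS.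
  - rewrite (_ : (fun z => _) = fun z : R * 'rV[R]_d => Q i j * psi z.2); last first.
      by apply/funext => z; rewrite mxE mulrC.
    by apply: smooth_continuous; apply: smoothZ; exact: smooth_snd.
  - by move=> t x k; rewrite !mxE pp.
have ir : stin a b r by exact: intgB.
have im : leb.-integrable `]a, b[ (EFin \o m) by exact: slab_integrable1.
have iT1 : intT (fun=> 1).
  by apply: (@intg_bounded _ _ _ _ _ _ 1) => //; [exact: torus_lty|move=> *; rewrite normr1].
have imr : stin a b (fun z => m z.1).
  have [+ _] := slab_tensor im iT1; apply: eq_integrable => // z _.
  by rewrite /= mulr1.
apply: separated_tests_zero => // eta psi' a' b' se eo aa' b'b sp' pp'.
have ime : leb.-integrable `]a, b[ (EFin \o (fun t => m t * eta t)).
  by apply: intI_continuous_mul => //; exact: smooth_continuous.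
have ip' : intT psi'.
  have [C CP] := torus_periodic_bounded (smooth_continuous sp') pp'.
  apply: (@intg_bounded _ _ _ _ _ _ C) => //; first exact: torus_lty.
  by apply: continuous_measurable_rV; exact: smooth_continuous.
have [_ E] := slab_tensor ime ip'.
transitivity (\int[st]_(z in slab a b) (m z.1 * eta z.1 * psi' z.2)).
  by apply: eq_Rintegral => z _; rewrite mulrA.
rewrite E (_ : Rintegral _ _ _ = 0) ?mul0r//.
have ire : stin a b (fun z => r z * eta z.1).
  by apply: stin_continuous_mul => //; exact/smooth_continuous/smooth_fst.
transitivity (\int[st]_(z in slab a b) (r z * eta z.1)).
  rewrite (slab_fubini1 ire); apply: ae_Rintegral => //.
  - exact: intg_measurable ime.
  - exact: intg_measurable (slab_integrable1 ire).
  apply: aeS (slab_ae_integrable1 ir) => t irt; rewrite /= in_itv/= => tab.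
  by rewrite /= RintegralZr//; exact: irt.
have out t x : ~~ (a' <= t <= b') -> matrix_test eta psi Q (t, x) = 0.
  by move=> /eo h; rewrite /matrix_test h mul0r scale0r.
have zero z : ~~ (a < z.1 < b) -> eta z.1 = 0.
  move=> h; apply: eo; apply: contra h => /andP[h1 h2].
  by rewrite (lt_le_trans aa' h1) (le_lt_trans h2 b'b).
have opE z : dotv (f z) (apply_op_st L (matrix_test eta psi Q) z) =
    dotv (f z) (apply_op L (fun y => psi y *: Q) z.2) * eta z.1.
  rewrite /dotv mulr_suml; apply: eq_bigr => l _.
  by rewrite matrix_test_op// apply_op_scalar//= -mulrA; congr (_ * _); exact: mulrC.
have mxE' z : frob (G z) (matrix_test eta psi Q z) = frob (G z) (psi z.2 *: Q) * eta z.1.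
  by rewrite /matrix_test !frobZr; ring.
have j1 : stin a b (fun z => dotv (f z) (apply_op L (fun y => psi y *: Q) z.2) * eta z.1).
  by apply: stin_continuous_mul => //; exact/smooth_continuous/smooth_fst.
have j2 : stin a b (fun z => frob (G z) (psi z.2 *: Q) * eta z.1).
  by apply: stin_continuous_mul => //; exact/smooth_continuous/smooth_fst.
have := tests _ a' b' (matrix_test_smooth se sp pp sQ) (lt_trans a0 aa') (lt_trans b'b bS) out.
rewrite (funext opE) (funext mxE').
rewrite (int_cyl_localize (ltW a0) (ltW bS) _ j1); last by move=> z /zero ->; rewrite mulr0.
rewrite (int_cyl_localize (ltW a0) (ltW bS) _ j2); last by move=> z /zero ->; rewrite mulr0.
move=> [EE]; transitivity (\int[st]_(z in slab a b) (dotv (f z) (apply_op L (fun y => psi y *: Q) z.2) * eta z.1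
    - frob (G z) (psi z.2 *: Q) * eta z.1)).
  by apply: eq_Rintegral => z _; rewrite mulrBl.
by rewrite RintegralB// EE subrr.
Qed.

Definition conv_vec k (w : 'rV[R]_d -> 'rV[R]_n) (x : 'rV[R]_d) : 'rV[R]_n :=
  \row_l conv (ker k) (fun y => w y 0 l) x.

Definition conv_mx k (B : 'rV[R]_d -> 'M[R]_N) (x : 'rV[R]_d) : 'M[R]_N :=
  \matrix_(i, j) conv (ker k) (fun y => B y i j) x.

Lemma conv_vec_smooth k (w : 'rV[R]_d -> 'rV[R]_n) : (forall l, intT (fun y => w y 0 l)) -> smooth_torus_vec (conv_vec k w).
Proof.
move=> iw l; rewrite (_ : (fun x => _) = conv (ker k) (fun y => w y 0 l)); last first.
  by apply/funext => x; rewrite mxE.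
by split; [exact: smooth_conv|exact: conv_periodic].
Qed.

Lemma multi_partial_conv (a : 'I_d -> nat) k f0 : intT f0 ->
  multi_partial a (conv (ker k) f0) = conv (multi_partial a (ker k)) f0.
Proof. by move=> i0; have [s [_ E]] := @multi_partialE R d a; rewrite !E partials_conv. Qed.

Lemma frob_adj_conv k (w : 'rV[R]_d -> 'rV[R]_n) (Q : 'M[R]_N) x : (forall l, intT (fun y => w y 0 l)) ->
  frob (apply_adj L (conv_vec k w) x) Q =
  \int[mu]_y dotv (w y) (apply_op L (fun y => ker k (x - y) *: Q) y).
Proof.
move=> iw; have sk a := smooth_multi_partial a (@kersp k) (@kerp k).
have sr := smooth_reflect x (@kersp k).
transitivity (\int[mu]_y \sum_l \sum_(a : {ffun 'I_d -> 'I_(dop_order L).+1})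
    ((-1) ^+ (\sum_i a i)%N * frob (dop_coef L a l) Q) *
    (w y 0 l * multi_partial (fun i => a i) (ker k) (x - y))); last first.
  apply: eq_Rintegral => y _; apply: eq_bigr => l _; rewrite apply_op_scalar// mulr_sumr.
  by apply: eq_bigr => a _; rewrite multi_partial_reflect//; ring.
have ic l (a : {ffun 'I_d -> 'I_(dop_order L).+1}) :
    intT (fun y => w y 0 l * multi_partial (fun i => a i) (ker k) (x - y)).
  by have [s1 p1] := sk (fun i => a i); exact: conv_integrable.
rewrite Rintegral_sum//; last first.
  by move=> l; apply: intg_sum => // a; apply: intgZ.
rewrite frob_apply_adj.
under eq_bigr do rewrite mulr_sumr.
rewrite exchange_big; apply: eq_bigr => l _ /=.
rewrite Rintegral_sum//; last by move=> a; apply: intgZ.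
apply: eq_bigr => a _; rewrite RintegralZl//.
rewrite (_ : (fun y => conv_vec k w y 0 l) = conv (ker k) (fun y => w y 0 l)); last first.
  by apply/funext => y; rewrite mxE.
by rewrite multi_partial_conv// /conv; ring.
Qed.

Lemma frob_conv_mx k (B : 'rV[R]_d -> 'M[R]_N) (Q : 'M[R]_N) x : (forall i j, intT (fun y => B y i j)) ->
  frob (conv_mx k B x) Q = \int[mu]_y frob (B y) (ker k (x - y) *: Q).
Proof.
move=> iB; have ic i j := conv_integrable x (@kersp k) (@kerp k) (iB i j).
transitivity (\int[mu]_y \sum_i \sum_j Q i j * (B y i j * ker k (x - y))); last first.
  by apply: eq_Rintegral => y _; apply: eq_bigr => i _; apply: eq_bigr => j _; rewrite mxE; ring.
rewrite Rintegral_sum//; last by move=> i; apply: intg_sum => // j; apply: intgZ.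
apply: eq_bigr => i _; rewrite Rintegral_sum//; last by move=> j; apply: intgZ.
by apply: eq_bigr => j _; rewrite RintegralZl// mxE mulrC.
Qed.

(** The kernels reflected at rational points are countably many tests, with a common null
    set of times. Both sides are continuous in x, hence they agree everywhere. *)
Lemma adj_conv_slice : {ae leb, forall t : R, 0 < t < S ->
  (forall l, intT (fun x => f (t, x) 0 l)) -> (forall i j, intT (fun x => G (t, x) i j)) ->
  forall k x, apply_adj L (conv_vec k (fun y => f (t, y))) x = conv_mx k (fun y => G (t, y)) x}.
Proof.
have [sG lf lG _] := wG.
pose Q (ij : 'I_N * 'I_N) : 'M[R]_N := symmetrize (delta_mx ij.1 ij.2).
have : {ae leb, forall t : R, forall p : ('rV[rat]_d * nat) * ('I_N * 'I_N), 0 < t < S ->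
    \int[mu]_x (dotv (f (t, x)) (apply_op L (fun y => ker p.1.2 (map_mx ratr p.1.1 - y) *: Q p.2) x) -
      frob (G (t, x)) (ker p.1.2 (map_mx ratr p.1.1 - x) *: Q p.2)) = 0}.
  apply: ae_countType => -[[q k] ij] /=.
  apply: weak_adj_slice; [exact: smooth_reflect|exact: periodic_reflect|exact: sym_symmetrize].
apply: aeS => t H tS iw iG k x.
have symc y : sym (conv_mx k (fun y => G (t, y)) y).
  apply/matrixP => i j; rewrite !mxE; apply: eq_Rintegral => z _.
  by rewrite -[in LHS](sG (t, z)) mxE.
suff E ij : forall y, frob (apply_adj L (conv_vec k (fun y => f (t, y))) y) (Q ij) =
    frob (conv_mx k (fun y => G (t, y)) y) (Q ij).
  apply/matrixP => i j; have := E (i, j) x.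
  by rewrite !frob_symmetrize ?frob_delta//; exact: apply_adj_sym.
have scv := conv_vec_smooth k iw.
apply: continuous_eq_dense.
- rewrite (_ : (fun y => _) = fun y => \sum_(a : {ffun 'I_d -> 'I_(dop_order L).+1}) (-1) ^+ (\sum_i a i)%N *
    \sum_l multi_partial (fun i => a i) (fun y => conv_vec k (fun y => f (t, y)) y 0 l) y * frob (dop_coef L a l) (Q ij)); last first.
    by apply/funext => y; rewrite frob_apply_adj.
  apply: smooth_continuous; apply: smooth_sum => a; apply: smoothZ; apply: smooth_sum => l.
  apply: smoothM; last exact: smooth_cst.
  by have [s1 p1] := scv l; have [] := smooth_multi_partial (fun i => a i) s1 p1.
- apply: continuous_sumr => i; apply: continuous_sumr => j.
  apply: contM; last exact: cst_continuous.
  under eq_fun do rewrite mxE.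
  exact: conv_continuous.
move=> q; rewrite frob_adj_conv// frob_conv_mx//.
have := H ((q, k), ij) tS => /=.
set x0 := map_mx ratr q.
have srk := smooth_reflect x0 (@kersp k); have prk := periodic_reflect x0 (@kerp k).
have i1 : intT (fun y => dotv (f (t, y)) (apply_op L (fun y => ker k (x0 - y) *: Q ij) y)).
  apply: intg_sum => // l; have [s1 p1] := smooth_apply_op_scalar (Q ij) l srk prk.
  by apply: torus_continuous_mul => //; exact: smooth_continuous.
have i2 : intT (fun y => frob (G (t, y)) (ker k (x0 - y) *: Q ij)).
  apply: intg_sum => // i; apply: intg_sum => // j.
  under eq_fun do rewrite mxE mulrA /=.
  apply: (@intg_bounded_mul _ _ _ _ _ _ _ `|Q ij i j|) => //.
  exact: conv_integrable.
by rewrite RintegralB// => /eqP; rewrite subr_eq0 => /eqP.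
Qed.

End WeakAdjoint.

Section Mollification.
Variables (w : 'rV[R]_d -> 'rV[R]_n) (B : 'rV[R]_d -> 'M[R]_N) (C : R).
Hypotheses (iw : forall l, intT (fun y => w y 0 l)) (iKw : intT (fun y => Ks (w y))).
Hypotheses (iB : forall i j, intT (fun y => B y i j)).
Hypothesis BC : {ae mu, forall y, forall i j, `|B y i j| <= C}.
Hypothesis adj : forall k x, apply_adj L (conv_vec k w) x = conv_mx k B x.

(** The supporting hyperplane of [Ks] at the averaged value is integrated against the kernel. *)
Lemma dual_jensen k (x : 'rV[R]_d) : (forall i, 0 <= x 0 i <= 1) ->
  Ks (conv_vec k w x) <= conv (ker k) (fun y => Ks (w y)) x.
Proof.
move=> x01; set y0 := conv_vec k w x; set g0 := grad Ks y0.
have ik : intT (fun y => ker k (x - y)).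
  have [C0 CP] := torus_periodic_bounded (smooth_continuous (@kersp k)) (@kerp k).
  apply: (@intg_bounded _ _ _ _ _ _ C0) => //; first exact: torus_lty.
  by apply: continuous_measurable_rV; apply: smooth_continuous; exact: smooth_reflect.
have iKc := conv_integrable x (@kersp k) (@kerp k) iKw.
have iwc l := conv_integrable x (@kersp k) (@kerp k) (iw l).
have id : intT (fun y => \sum_l g0 0 l * (w y 0 l * ker k (x - y))).
  by apply: intg_sum => // l; apply: intgZ.
have i0 : intT (fun y => (Ks y0 - dotv y0 g0) * ker k (x - y)) by exact: intgZ.
have -> : Ks y0 = \int[mu]_y ((Ks y0 - dotv y0 g0) * ker k (x - y) + \sum_l g0 0 l * (w y 0 l * ker k (x - y))).
  rewrite RintegralD// RintegralZl// kernel_mass_sub// mulr1 Rintegral_sum//; last first.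
    by move=> l; apply: intgZ.
  rewrite [X in _ + X](_ : _ = dotv y0 g0) ?subrK//.
  by apply: eq_bigr => l _; rewrite RintegralZl// mulrC [y0 0 l]mxE.
apply: le_Rintegral => //; first exact: intgD.
move=> y _.
have -> : \sum_l g0 0 l * (w y 0 l * ker k (x - y)) = dotv (w y) g0 * ker k (x - y).
  by rewrite /dotv mulr_suml; apply: eq_bigr => l _; ring.
rewrite -mulrDl ler_wpM2r ?kernel_ge0//.
have := legendre_subgradient reg y0 (w y).
by rewrite -/g0 -(grad_legendre reg) -/g0 dotvBl; lra.
Qed.

(** Conservativity holds for the mollified field. The passage to the limit is dominated: on
    Lambda the flux is bounded by its trace, that is by [Ks] of the mollified field, and
    [dual_jensen] bounds this by the mollification of [Ks]. *)
Lemma mollified_conservativity :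
  \int[mu]_x frob (F (grad Ks (w x))) (B x) = 0.
Proof.
have [_ _ _ _ cons] := hFL.
(* One subsequence for the coordinates of [w], the entries of [B] and [Ks] of [w]. *)
pose I := ('I_n + ('I_N * 'I_N) + unit)%type.
pose fam (i : I) : 'rV[R]_d -> R := match i with
  | inl (inl l) => fun y => w y 0 l
  | inl (inr ij) => fun y => B y ij.1 ij.2
  | inr _ => fun y => Ks (w y) end.
have ifam i : intT (fam i) by case: i => [[l|ij]|u] //=.
have [kk [D [iD DP]]] := mollified_subsequence ifam.
pose h j x := frob (F (grad Ks (conv_vec (kk j) w x))) (conv_mx (kk j) B x).
pose hh x := frob (F (grad Ks (w x))) (B x).
have [C1 [C10 KC1]] := entropy_dual_grad_le hFL.
have cg i : continuous (fun y => grad Ks y 0 i) by exact: (entropy_dual_grad_continuous hFL).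
have cFg i j : continuous (fun y => F (grad Ks y) i j).
  move=> y; apply: (@continuous_comp _ _ _ (fun y => grad Ks y) (fun v => F v i j)).
    exact: continuous_rV.
  exact: (flux_continuous hFL).
have cu k l : continuous (fun x => conv_vec k w x 0 l).
  by have [/smooth_continuous] := conv_vec_smooth k iw l.
have ch j : continuous (h j).
  apply: continuous_sumr => i; apply: continuous_sumr => i'; apply: contM.
    move=> x; apply: (@continuous_comp _ _ _ (conv_vec (kk j) w) (fun y => F (grad Ks y) i i')); last exact: cFg.
    by apply: continuous_rV => l; exact: cu.
  by under eq_fun do rewrite mxE; exact: conv_continuous.
pose M := \sum_(i < N) \sum_(j < N) `|C|.
have M0 : 0 <= M by apply: sumr_ge0 => *; apply: sumr_ge0.
have t0 : 0 <= \tr (F 0).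
  exact: tr_flux_ge0.
pose bnd x := M * (2 * (C1 * (Ks (w x) + D x + 1)) + \tr (F 0)).
have icst (c : R) : intT (fun=> c).
  by apply: (@intg_bounded _ _ _ _ _ _ `|c|) => //; exact: torus_lty.
have ibnd : intT bnd.
  apply: intgZ => //; apply: intgD => //; apply: intgZ => //; apply: intgZ => //.
  by apply: intgD => //; exact: intgD.
have mhh : measurable_fun setT hh.
  apply: measurable_sum => i; apply: measurable_sum => j; apply: measurable_funM; last first.
    exact: intg_measurable (iB i j).
  apply: (measurable_rV_comp (f := w) (phi := fun y => F (grad Ks y) i j)) => //.
  by move=> l; exact: intg_measurable (iw l).
have [_ lim] : intT hh /\ \int[mu]_x h j x @[j --> \oo] --> \int[mu]_x hh x.
  apply: (@ae_Rdominated _ _ _ mu setT h hh bnd) => //.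
  - by move=> j; exact: continuous_measurable_rV.
  - apply: aeS DP => x Hx _; rewrite /h /hh /frob.
    apply: cvg_sumr => i; apply: cvg_sumr => j; apply: cvgM.
      apply: (cvg_rV_comp (phi := fun y => F (grad Ks y) i j)) => // l.
      by under eq_fun do rewrite mxE; exact: (Hx (inl (inl l))).2.
    by under eq_fun do rewrite mxE; exact: (Hx (inl (inr (i, j)))).2.
  - apply: aeS (aeI DP (torus_interior_le (R := R) (d := d))) => x [Hx x01] _ j.
    rewrite /h -adj.
    have LA : Lambda L (apply_adj L (conv_vec (kk j) w) x).
      exact: apply_adj_Lambda (conv_vec_smooth (kk j) iw).
    apply: (le_trans (flux_pairing_le hFL _ LA)).
    have Bb i i' : `|conv_mx (kk j) B x i i'| <= `|C|.
      rewrite mxE.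
      have ic := conv_integrable x (@kersp (kk j)) (@kerp (kk j)) (iB i i').
      have ik : intT (fun y => ker (kk j) (x - y)).
        have [C0 CP] := torus_periodic_bounded (smooth_continuous (@kersp (kk j))) (@kerp (kk j)).
        apply: (@intg_bounded _ _ _ _ _ _ C0) => //; first exact: torus_lty.
        by apply: continuous_measurable_rV; apply: smooth_continuous; exact: smooth_reflect.
      apply: (le_trans (le_normr_Rintegral _ ic)) => //.
      apply: (@le_trans _ _ (\int[mu]_y (`|C| * ker (kk j) (x - y)))).
        apply: Rintegral_ae_le => //; [exact: intg_norm|exact: intgZ|].
        apply: aeS BC => y BCy _; rewrite normrM [`|ker _ _|]ger0_norm ?kernel_ge0//.
        rewrite ler_wpM2r ?kernel_ge0// (le_trans (BCy i i'))//.
        exact: ler_norm.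
      by rewrite RintegralZl// kernel_mass_sub// mulr1.
    apply: ler_pM => //; first exact: mnorm1_ge0.
    + exact: tr_flux_ge0.
    + rewrite adj; apply: ler_sum => i _; apply: ler_sum => i' _; exact: Bb.
    rewrite (tr_flux F) lerD2r ler_pM2l// (le_trans (KC1 _))// ler_wpM2l// lerD2r.
    apply: (le_trans (dual_jensen (kk j) x01)).
    have := (Hx (inr tt)).1 j; rewrite ler_norml => /andP[_].
    by rewrite /fam; lra.
have h0 j : \int[mu]_x h j x = 0.
  have := cons _ (conv_vec_smooth (kk j) iw).
  rewrite (_ : (fun x => _) = fun x => (h j x)%:E); last first.
    by apply/funext => x; rewrite /h adj.
  by rewrite /Rintegral => ->.
have lim0 : \int[mu]_x h j x @[j --> \oo] --> (0 : R).
  by rewrite (_ : (fun j => _) = fun=> 0); [exact: cvg_cst|apply/funext].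
by have /cvg_lim <- // := lim; have /cvg_lim <- // := lim0.
Qed.

End Mollification.
End SliceConservativity.

(** * Restriction and multiplication by functions of time *)

Section Restriction.
Context {R : realType} {d : nat}.
Local Notation st := (spacetime R d).
Local Notation stin a b f := (st.-integrable (slab a b) (EFin \o f)).

Lemma int_cyl_sub (S T : R) (f g : R * 'rV[R]_d -> R) : S <= T ->
  (forall z, 0 < z.1 < S -> f z = g z) -> (forall z, S <= z.1 -> f z = 0) ->
  int_cyl T f = int_cyl S g.
Proof.
move=> ST fg f0; rewrite /int_cyl !cylinder_slab [LHS]integral_mkcond [RHS]integral_mkcond.
congr integral; apply/funext => z; rewrite !patchE.
case: ifPn => [/set_mem/slabP/andP[z0 zT]|].
  case: ifPn => [/set_mem/slabP zS|]; first by rewrite fg.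
  rewrite notin_setE => nS; rewrite f0// leNgt; apply/negP => zS.
  by apply: nS; apply/slabP; rewrite z0.
rewrite notin_setE => nT; case: ifPn => // /set_mem zS; exfalso; apply: nT.
exact: slab_subset zS.
Qed.

Lemma int_cyl_eq (S : R) (f g : R * 'rV[R]_d -> R) : (forall z, 0 < z.1 < S -> f z = g z) ->
  int_cyl S f = int_cyl S g.
Proof.
move=> fg; rewrite /int_cyl cylinder_slab; apply: eq_integral => z /set_mem/slabP zS.
by rewrite fg.
Qed.

Lemma loc_integrable_sub (S T : R) (f : R * 'rV[R]_d -> R) : S <= T -> loc_integrable T f ->
  loc_integrable S f.
Proof. by move=> ST lf a b a0 ab bS; apply: lf => //; exact: lt_le_trans ST. Qed.

Lemma loc_integrable_eq (S : R) (f g : R * 'rV[R]_d -> R) : (forall z, 0 < z.1 < S -> f z = g z) ->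
  loc_integrable S f -> loc_integrable S g.
Proof.
move=> fg lf a b a0 ab bS; apply: eq_integrable (lf a b a0 ab bS).
  rewrite (_ : [set z | _] = `[a, b]%classic `*` setT); first by apply: measurableX => //; exact: measurable_itv.
  by apply/seteqP; split=> -[t x] /=; rewrite in_itv/= => // -[].
move=> z /set_mem/andP[az zb] /=; rewrite fg//.
by rewrite (lt_le_trans a0 az) (le_lt_trans zb bS).
Qed.

Lemma closed_slab_measurable (a b : R) :
  measurable ([set z : R * 'rV[R]_d | a <= z.1 <= b] : set (measurableTypeR R * 'rV[R]_d)).
Proof.
rewrite (_ : [set z | _] = `[a, b]%classic `*` setT); first by apply: measurableX => //; exact: measurable_itv.
by apply/seteqP; split=> -[t x] /=; rewrite in_itv/= => // -[].
Qed.

Lemma loc_integrable_mul (S : R) (theta : R -> R) (f : R * 'rV[R]_d -> R) : continuous theta ->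
  loc_integrable S f -> loc_integrable S (fun z => theta z.1 * f z).
Proof.
move=> ct lf a b a0 ab bS.
have [C CP] : exists C, forall (t : R) (x : 'rV[R]_d), a <= t <= b -> `|theta t| <= C.
  apply: (@periodic_bounded R d a b (fun z => theta z.1)) => //.
  move=> z; apply: (@continuous_comp _ _ _ fst theta); last exact: ct.
  exact: cvg_fst.
have mt : measurable_fun setT (fun z : measurableTypeR R * 'rV[R]_d => theta z.1).
  by apply: measurable_time; exact: continuous_measurable_fun.
have mC := closed_slab_measurable a b.
have : st.-integrable [set z : R * 'rV[R]_d | a <= z.1 <= b] (EFin \o (fun z => f z * theta z.1)).
  apply: (@intg_bounded_mul _ _ _ _ _ _ _ C) => //; first exact: measurable_funTS.
    by move=> z zab; exact: (CP z.1 z.2).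
  exact: lf.
by apply: eq_integrable => // z _; rewrite /= mulrC.
Qed.

Lemma loc_integrableD (S : R) (f g : R * 'rV[R]_d -> R) : loc_integrable S f -> loc_integrable S g ->
  loc_integrable S (fun z => f z + g z).
Proof.
move=> lf lg a b a0 ab bS; have mC := closed_slab_measurable a b.
by apply: intgD => //; [exact: lf|exact: lg].
Qed.

Lemma weak_dt_sub n (S T : R) (f g : R * 'rV[R]_d -> 'rV[R]_n) : S <= T -> weak_dt T f g ->
  weak_dt S f g.
Proof.
move=> ST wfg l; have [lf lg tests] := wfg l; split; [exact: loc_integrable_sub lf|exact: loc_integrable_sub lg|].
move=> phi a b sphi a0 bS supp; have := tests phi a b sphi a0 (lt_le_trans bS ST) supp.
have sdt := dt_supported sphi.1 supp.
have out (r : R * 'rV[R]_d -> R) : supported_in a b r -> forall z, S <= z.1 -> r z = 0.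
  by move=> sr [t x] /= tS; apply: sr; rewrite negb_and -!ltNge (lt_le_trans bS tS) orbT.
rewrite (@int_cyl_sub S T _ (fun z => f z 0 l * dt phi z) ST)//; last by move=> z h; rewrite (out _ sdt z h) mulr0.
rewrite (@int_cyl_sub S T _ (fun z => g z 0 l * phi z) ST)//.
by move=> z h; rewrite (out _ supp z h) mulr0.
Qed.

Lemma weak_dt_eq n (S : R) (f f' g g' : R * 'rV[R]_d -> 'rV[R]_n) :
  (forall z, 0 < z.1 < S -> f z = f' z) -> (forall z, 0 < z.1 < S -> g z = g' z) ->
  weak_dt S f g -> weak_dt S f' g'.
Proof.
move=> ff gg wfg l; have [lf lg tests] := wfg l; split.
- by apply: loc_integrable_eq lf => z zS; rewrite ff.
- by apply: loc_integrable_eq lg => z zS; rewrite gg.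
move=> phi a b sphi a0 bS supp; have := tests phi a b sphi a0 bS supp.
rewrite (@int_cyl_eq S _ (fun z => f' z 0 l * dt phi z)); last by move=> z zS; rewrite ff.
by rewrite (@int_cyl_eq S (fun z => (g z 0 l * phi z)%R) (fun z => g' z 0 l * phi z))// => z zS; rewrite gg.
Qed.

Lemma dt_mul_time (theta theta' : R -> R) (phi : R * 'rV[R]_d -> R) (z : R * 'rV[R]_d) :
  (forall t : R, is_derive t (1 : R) theta (theta' t)) -> smooth theta -> smooth phi ->
  dt (fun z => theta z.1 * phi z) z = theta' z.1 * phi z + theta z.1 * dt phi z.
Proof.
move=> dth sth sphi; case: z => t x /=.
have s1 : smooth (fun z : R * 'rV[R]_d => theta z.1 * phi z).
  by apply: smoothM => //; exact: smooth_fst.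
have [_ <-] := is_derive_tslice x t s1.
have dphi := is_derive_tslice x t sphi.
have := is_deriveM (dth t) dphi => -[_ E].
rewrite (_ : (fun t0 => theta (t0, x).1 * phi (t0, x)) = theta \* (fun t0 => phi (t0, x)))//.
rewrite E addrC /GRing.scale/=; congr (_ + _); exact: mulrC.
Qed.

Lemma weak_dt_mul n (S : R) (theta theta' : R -> R) (f g : R * 'rV[R]_d -> 'rV[R]_n) : 0 < S ->
  (forall t : R, is_derive t (1 : R) theta (theta' t)) -> smooth theta -> continuous theta' ->
  weak_dt S f g ->
  weak_dt S (fun z => theta z.1 *: f z) (fun z => theta z.1 *: g z + theta' z.1 *: f z).
Proof.
move=> S0 dth sth cth' wfg l; have [lf lg tests] := wfg l.
have cth := smooth_continuous sth.
have l1 := loc_integrable_mul cth lf; have l2 := loc_integrable_mul cth lg.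
have l3 := loc_integrable_mul cth' lf; have l4 := loc_integrableD l2 l3.
split.
- by apply: loc_integrable_eq l1 => z _; rewrite mxE.
- by apply: loc_integrable_eq l4 => z _; rewrite !mxE.
move=> phi a b sphi a0 bS supp; have [sp pp] := sphi.
have s1 : smooth_st (fun z : R * 'rV[R]_d => theta z.1 * phi z).
  split; first by apply: smoothM => //; exact: smooth_fst.
  by move=> t x i; rewrite pp.
have supp1 : supported_in a b (fun z : R * 'rV[R]_d => theta z.1 * phi z).
  by move=> t x h; rewrite supp// mulr0.
have := tests _ a b s1 a0 bS supp1.
have sdt := dt_supported sp supp; have sdt1 := dt_supported s1.1 supp1.
pose a' := a / 2; pose b' := (b + S) / 2.
have a'0 : 0 < a' by rewrite divr_gt0.
have a'a : a' < a by rewrite gtr_pMr// invf_lt1// ltr1n.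
have bb' : b < b' by rewrite ltr_pdivlMr// mulr_natr mulr2n ltrD2l.
have b'S : b' < S by rewrite ltr_pdivrMr// mulr_natr mulr2n ltrD2r.
have out (r : R * 'rV[R]_d -> R) : supported_in a b r -> forall z, ~~ (a' < z.1 < b') -> r z = 0.
  move=> sr [t x] /= h; apply: sr; apply: contra h => /andP[h1 h2].
  by rewrite (lt_le_trans a'a h1) (le_lt_trans h2 bb').
have cdt := smooth_continuous (smooth_dt sp).
have pdt t : periodic (fun x => dt phi (t, x)).
  move=> x i; have [_ <-] := is_derive_tslice (x + delta_mx 0 i) t sp.
  have [_ <-] := is_derive_tslice x t sp.
  by congr ('D_1 _ t); apply/funext => s; exact: pp.
have j1 : stin a' b' (fun z => theta z.1 * f z 0 l * dt phi z).
  by apply: stin_continuous_mul => //; exact: loc_stin l1 a'0 b'S.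
have j2 : stin a' b' (fun z => theta z.1 * g z 0 l * phi z).
  by apply: stin_continuous_mul => //; [exact: loc_stin l2 a'0 b'S|exact: smooth_continuous].
have j3 : stin a' b' (fun z => theta' z.1 * f z 0 l * phi z).
  by apply: stin_continuous_mul => //; [exact: loc_stin l3 a'0 b'S|exact: smooth_continuous].
have mS := @measurable_slab R d a' b'.
rewrite (_ : (fun z => f z 0 l * _) = fun z => theta z.1 * f z 0 l * dt phi z + theta' z.1 * f z 0 l * phi z); last first.
  by apply/funext => z; rewrite (dt_mul_time z dth sth sp); ring.
rewrite (_ : (fun z => (g z 0 l * _)%R) = fun z => theta z.1 * g z 0 l * phi z); last first.
  by apply/funext => z; ring.
rewrite (_ : (fun z => (theta z.1 *: f z) 0 l * _) = fun z => theta z.1 * f z 0 l * dt phi z); last first.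
  by apply/funext => z; rewrite mxE.
rewrite (_ : (fun z => ((theta z.1 *: g z + theta' z.1 *: f z) 0 l * _)%R) =
    fun z => theta z.1 * g z 0 l * phi z + theta' z.1 * f z 0 l * phi z); last first.
  by apply/funext => z; rewrite !mxE mulrDl.
have loc r : stin a' b' r -> (forall z, ~~ (a' < z.1 < b') -> r z = 0) ->
    int_cyl S r = (\int[st]_(z in slab a' b') r z)%:E.
  by move=> ir r0; exact: int_cyl_localize (ltW a'0) (ltW b'S) r0 ir.
rewrite !loc//.
- by rewrite !RintegralD// -!EFinN => -[E]; congr EFin; move: E; set A := Rintegral _ _ _; set B := Rintegral _ _ _; set C := Rintegral _ _ _; lra.
- exact: intgD.
- by move=> z h; rewrite (out _ supp z h) !mulr0 addr0.
- by move=> z h; rewrite (out _ sdt z h) !mulr0.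
- by move=> z h; rewrite (out _ supp z h) !mulr0.
- exact: intgD.
- by move=> z h; rewrite (out _ supp z h) (out _ sdt z h) !mulr0 addr0.
Qed.

Context {n N : nat}.
Variable L : diffop R d n N.

Lemma weak_adj_sub (S T : R) (f : R * 'rV[R]_d -> 'rV[R]_n) (G : R * 'rV[R]_d -> 'M[R]_N) : S <= T ->
  weak_adj L T f G -> weak_adj L S f G.
Proof.
move=> ST [sG lf lG tests]; split=> //; [by move=> l; exact: loc_integrable_sub (lf l)|by move=> i j; exact: loc_integrable_sub (lG i j)|].
move=> Psi a b sP a0 bS supp; have := tests Psi a b sP a0 (lt_le_trans bS ST) supp.
have out t (x : 'rV[R]_d) : S <= t -> ~~ (a <= t <= b).
  by move=> tS; rewrite negb_and -!ltNge (lt_le_trans bS tS) orbT.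
rewrite (@int_cyl_sub S T _ (fun z => dotv (f z) (apply_op_st L Psi z)) ST)//; last first.
  move=> [t x] /= /(out t x) h; rewrite /apply_op_st/=.
  rewrite (_ : (fun x0 => Psi (t, x0)) = fun x0 => 0 *: 0); last first.
    by apply/funext => y; rewrite supp// scale0r.
  rewrite (_ : apply_op _ _ _ = 0) ?dotv0r//; apply/rowP => l.
  rewrite [RHS]mxE (@apply_op_scalar R d n N L 0 (fun=> 0) x l); last exact: smooth_cst.
  by rewrite big1// => i _; rewrite frob0r mul0r.
rewrite (@int_cyl_sub S T _ (fun z => frob (G z) (Psi z)) ST)//.
by move=> [t x] /= /(out t x) h; rewrite supp// frob0r.
Qed.

Lemma weak_adj_eq (S : R) (f f' : R * 'rV[R]_d -> 'rV[R]_n) (G G' : R * 'rV[R]_d -> 'M[R]_N) :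
  (forall z, 0 < z.1 < S -> f z = f' z) -> (forall z, 0 < z.1 < S -> G z = G' z) ->
  (forall z, sym (G' z)) -> weak_adj L S f G -> weak_adj L S f' G'.
Proof.
move=> ff gg sG' [sG lf lG tests]; split=> //.
- by move=> l; apply: loc_integrable_eq (lf l) => z zS; rewrite ff.
- by move=> i j; apply: loc_integrable_eq (lG i j) => z zS; rewrite gg.
move=> Psi a b sP a0 bS supp; have := tests Psi a b sP a0 bS supp.
rewrite (@int_cyl_eq S _ (fun z => dotv (f' z) (apply_op_st L Psi z))); last by move=> z zS; rewrite ff.
by rewrite (@int_cyl_eq S (fun z => frob (G z) (Psi z)) (fun z => frob (G' z) (Psi z)))// => z zS; rewrite gg.
Qed.

Lemma mx_test_mul (theta : R -> R) (Psi : R * 'rV[R]_d -> 'M[R]_N) : smooth theta -> smooth_st_sym Psi ->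
  smooth_st_sym (fun z => theta z.1 *: Psi z) /\
  forall z, apply_op_st L (fun z => theta z.1 *: Psi z) z = theta z.1 *: apply_op_st L Psi z.
Proof.
move=> sth [sP smP]; split; first split=> [z|i j].
- by rewrite /sym linearZ/= sP.
- have [s1 p1] := smP i j; split.
    rewrite (_ : (fun z => _) = fun z => theta z.1 * Psi z i j); last by apply/funext => z; rewrite mxE.
    by apply: smoothM => //; exact: smooth_fst.
  by move=> t x k; rewrite !mxE p1.
move=> z; apply/rowP => l; rewrite !mxE mulr_sumr; apply: eq_bigr => a _.
rewrite -frobZr; congr frob; apply/matrixP => i j; rewrite !mxE/=.
rewrite (_ : (fun y => _) = fun y => theta z.1 * Psi (z.1, y) i j); last by apply/funext => y; rewrite mxE.
by rewrite multi_partial_scale//; exact: (smooth_slice z.1 (smP i j).1).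
Qed.

Lemma weak_adj_mul (S : R) (theta : R -> R) (f : R * 'rV[R]_d -> 'rV[R]_n) (G : R * 'rV[R]_d -> 'M[R]_N) :
  smooth theta -> weak_adj L S f G -> weak_adj L S (fun z => theta z.1 *: f z) (fun z => theta z.1 *: G z).
Proof.
move=> sth [sG lf lG tests]; have cth := smooth_continuous sth; split.
- by move=> z; rewrite /sym linearZ/= sG.
- by move=> l; apply: loc_integrable_eq (loc_integrable_mul cth (lf l)) => z _; rewrite mxE.
- by move=> i j; apply: loc_integrable_eq (loc_integrable_mul cth (lG i j)) => z _; rewrite mxE.
move=> Psi a b sP a0 bS supp; have [sP' opP'] := mx_test_mul sth sP.
have supp' : supported_in a b (fun z : R * 'rV[R]_d => theta z.1 *: Psi z).
  by move=> t x h; rewrite supp// scaler0.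
have := tests _ a b sP' a0 bS supp'.
rewrite (_ : (fun z => dotv (f z) _) = fun z => dotv (theta z.1 *: f z) (apply_op_st L Psi z)); last first.
  by apply/funext => z; rewrite opP' dotvZl dotvZr.
rewrite (_ : (fun z => frob (G z) _) = fun z => frob (theta z.1 *: G z) (Psi z))//.
by apply/funext => z; rewrite frobZr frobZl.
Qed.

End Restriction.

(** * The exponential weight and the dual pair *)

Section ExponentialWeight.
Context {R : realType}.
Variables (gamma S : R).
Hypothesis gamma0 : 0 < gamma.
Local Notation leb := (@lebesgue_measure R).

Definition exp_weight (t : R) : R := expR (- gamma * t).

(** The integral of the weight over ]t, S[ when t <= S; the formula is smooth on the line. *)
Definition exp_tail (t : R) : R := gamma^-1 * (exp_weight t - exp_weight S).

Lemma smooth_exp_weight : smooth exp_weight.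
Proof. by apply: (smooth_comp_R (f := expR)); [exact: smooth_expR|apply: smoothZ; exact: smooth_id]. Qed.

Lemma smooth_exp_tail : smooth exp_tail.
Proof. by apply: smoothZ; apply: smoothB; [exact: smooth_exp_weight|exact: smooth_cst]. Qed.

Lemma exp_weight_gt0 t : 0 < exp_weight t.
Proof. exact: expR_gt0. Qed.

Lemma exp_weight_is_derive (t : R) : is_derive t (1 : R) exp_weight (- gamma * exp_weight t).
Proof.
have dl : is_derive t (1 : R) (fun s : R => - gamma * s) (- gamma).
  by have := is_deriveZ (- gamma) (is_derive_id t (1 : R)); rewrite /GRing.scale/= mulr1; exact.
have := @is_derive1_comp R expR (fun s => - gamma * s) t _ _ (is_derive_expR _) dl.
by rewrite mulrC; exact.
Qed.

Lemma exp_tail_is_derive (t : R) : is_derive t (1 : R) exp_tail (- exp_weight t).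
Proof.
have := is_deriveZ gamma^-1 (is_deriveB (exp_weight_is_derive t) (is_derive_cst (exp_weight S) t (1 : R))).
by rewrite subr0 /GRing.scale/= mulrA mulrN mulVf ?gt_eqF// mulN1r; exact.
Qed.

Lemma exp_tail_int t : t <= S -> \int[leb]_(s in `]t, S[) exp_weight s = exp_tail t.
Proof.
move=> tS.
have dN (s : R) : is_derive s (1 : R) (fun s => - exp_tail s) (exp_weight s).
  by have := is_deriveN (exp_tail_is_derive s); rewrite opprK; exact.
rewrite (FTC2_oo tS dN); last exact/smooth_continuous/smooth_exp_weight.
by rewrite opprK {1}/exp_tail subrr mulr0 oppr0 add0r.
Qed.

Lemma exp_weight_le1 t : 0 <= t -> exp_weight t <= 1.
Proof. by move=> t0; rewrite /exp_weight -expR0 ler_expR mulNr oppr_le0 mulr_ge0// ltW. Qed.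

Lemma exp_weight_anti s t : s <= t -> exp_weight t <= exp_weight s.
Proof. by move=> st; rewrite /exp_weight ler_expR !mulNr lerN2 ler_wpM2l// ltW. Qed.

Lemma exp_tail_ge0 t : t <= S -> 0 <= exp_tail t.
Proof. by move=> tS; rewrite mulr_ge0 ?invr_ge0 ?(ltW gamma0)// subr_ge0 exp_weight_anti. Qed.

Lemma exp_tail_gt0 t : t < S -> 0 < exp_tail t.
Proof. by move=> tS; rewrite mulr_gt0 ?invr_gt0// subr_gt0 /exp_weight ltr_expR !mulNr ltrN2 ltr_pM2l. Qed.

Lemma exp_tail_le t : gamma * exp_tail t <= exp_weight t.
Proof. by rewrite mulrA mulfV ?gt_eqF// mul1r gerBl ltW// exp_weight_gt0. Qed.

Lemma exp_tail_bound t : 0 <= t <= S -> 0 <= exp_tail t <= gamma^-1.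
Proof.
move=> /andP[t0 tS]; rewrite exp_tail_ge0//= /exp_tail -[leRHS]mulr1 ler_wpM2l ?invr_ge0 ?(ltW gamma0)//.
by have := exp_weight_le1 t0; have := exp_weight_gt0 S; lra.
Qed.

Lemma primitive_exp_weight t : 0 <= S -> 0 <= t <= S -> primitive exp_weight S t = exp_tail t.
Proof.
move=> S0 /andP[t0 tS]; rewrite -exp_tail_int//.
rewrite /primitive /Rintegral integral_itv_bndoo//.
apply/measurable_EFinP; apply: measurable_funTS; apply: continuous_measurable_fun.
exact/smooth_continuous/smooth_exp_weight.
Qed.

End ExponentialWeight.

Lemma is_derive_bigsum {R : realType} {V : normedModType R} (I : Type) (r : seq I)
    (g : I -> V -> R) (dg : I -> R) (x v : V) : (forall i, is_derive x v (g i) (dg i)) ->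
  is_derive x v (fun y => \sum_(i <- r) g i y) (\sum_(i <- r) dg i).
Proof.
move=> dgi; elim: r => [|i r IH].
  by under eq_fun do rewrite big_nil; rewrite big_nil; exact: is_derive_cst.
by under eq_fun do rewrite big_cons; rewrite big_cons; exact: is_deriveD.
Qed.

Section DualPair.
Context {R : realType} {d n N : nat}.
Variables (F : 'rV[R]_n -> 'M[R]_N) (L : diffop R d n N).
Hypothesis hFL : standing_assumptions F L.
Local Notation leb := (@lebesgue_measure R).
Local Notation mu := (torus R d).
Local Notation st := (spacetime R d).
Local Notation stin a b f := (st.-integrable (slab a b) (EFin \o f)).
Local Notation intI a b f := (leb.-integrable `]a, b[ (EFin \o f)).
Local Notation K := (entropy F).
Local Notation Ks := (legendre (entropy F)).
Variables (S gamma : R) (f p : R * 'rV[R]_d -> 'rV[R]_n) (f0 : 'rV[R]_d -> 'rV[R]_n).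
Variables (G : R * 'rV[R]_d -> 'M[R]_N) (CG : R).
Hypotheses (S0 : 0 < S) (gamma0 : 0 < gamma).
Hypotheses (lf : in_LKs F S f) (lp : in_LKs F S p).
Hypothesis rep : {ae st, forall z, slab 0 S z ->
  forall l, f z 0 l = f0 z.2 0 l + time_primitive 0 (fun z => p z 0 l) z}.
Hypotheses (wG : weak_adj L S f G).
Hypothesis GC : {ae st, forall z, slab 0 S z -> forall i j, `|G z i j| <= CG}.
Local Notation h := (exp_weight gamma).
Local Notation W := (exp_tail gamma S).

(** When [p] is the time derivative of [f], this is the time derivative of W f. *)
Definition dual_E (z : R * 'rV[R]_d) : 'rV[R]_n := W z.1 *: p z - h z.1 *: f z.

Definition dual_B (z : R * 'rV[R]_d) : 'M[R]_N := W z.1 *: G z.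

Let mS := @measurable_slab R d 0 S.
Let cW : continuous W := smooth_continuous (smooth_exp_tail gamma S).
Let ch : continuous h := smooth_continuous (smooth_exp_weight gamma).

Let time_mul (q : R -> R) (g : R * 'rV[R]_d -> R) : continuous q -> stin 0 S g ->
  stin 0 S (fun z => q z.1 * g z).
Proof.
move=> cq ig; apply: eq_integrable (stin_continuous_mul ig _ _) => //.
- by move=> z _; rewrite /= mulrC.
- by move=> z; apply: (@continuous_comp _ _ _ fst q); [exact: cvg_fst|exact: cq].
- by [].
Qed.

Lemma dual_E_integrable l : stin 0 S (fun z => dual_E z 0 l).
Proof.
have i1 := time_mul cW (LKs_coord hFL l lp); have i2 := time_mul ch (LKs_coord hFL l lf).
by apply: eq_integrable (intgB mS i1 i2) => // z _; rewrite /= !mxE.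
Qed.

Lemma dual_E_LKs : in_LKs F S dual_E.
Proof.
have [D1 [D10 dil1]] := dual_dilation hFL gamma^-1.
have [D2 [D20 dil2]] := dual_dilation hFL 1.
have [D3 [D30 sum]] := dual_sum hFL.
pose B z := D3 * (D1 * (Ks (p z) + 1) + D2 * (Ks (f z) + 1) + 1).
have i1 (r : R) : stin 0 S (fun=> r).
  by apply: (@intg_bounded _ _ _ _ _ _ `|r|) => //; exact: slab_lty.
apply: (LKs_intro hFL (B := B)).
- by move=> i; exact: intg_measurable (dual_E_integrable i).
- apply: intgZ => //; apply: intgD => //; apply: intgD => //; apply: intgZ => //; apply: intgD => //.
    exact: LKs_integrable hFL _ _ lp.
  exact: LKs_integrable hFL _ _ lf.
apply: aeW => z /slabP/andP[z0 zS].
have zS' : 0 <= z.1 <= S by rewrite !ltW.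
apply: (le_trans (sum _ _)); rewrite /B ler_wpM2l// lerD2r; apply: lerD.
  by apply: dil1; have /andP[w0 w1] := exp_tail_bound gamma0 zS'; rewrite ger0_norm.
rewrite -scaleNr; apply: dil2; rewrite normrN ger0_norm ?exp_weight_le1 ?(ltW z0)//.
by rewrite ltW// exp_weight_gt0.
Qed.

Lemma dual_G_measurable i j : measurable_fun (slab 0 S) (fun z => G z i j).
Proof. by have [_ _ lG _] := wG; exact: loc_measurable (lG i j). Qed.

Lemma dual_G_integrable i j : stin 0 S (fun z => G z i j).
Proof.
apply: eq_integrable (@intg_ae_bounded_mul _ _ _ st _ (fun=> 1) (fun z => G z i j) CG mS (dual_G_measurable i j) _ _) => //.
- by move=> z _ /=; rewrite mul1r.
- by apply: aeS GC => z H zS; exact: H.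
- by apply: (@intg_bounded _ _ _ _ _ _ 1) => //; [exact: slab_lty|move=> *; rewrite normr1].
Qed.

Lemma dual_B_integrable i j : stin 0 S (fun z => dual_B z i j).
Proof. by apply: eq_integrable (time_mul cW (dual_G_integrable i j)) => // z _; rewrite /= mxE. Qed.

Lemma dual_B_bound : {ae st, forall z, slab 0 S z -> forall i j, `|dual_B z i j| <= gamma^-1 * CG}.
Proof.
apply: aeS GC => z H zS i j; move: (zS) => /slabP/andP[z0 zS1].
have zS' : 0 <= z.1 <= S by rewrite !ltW.
have /andP[w0 w1] := exp_tail_bound gamma0 zS'.
by rewrite mxE normrM ger0_norm// ler_pM// H.
Qed.

Lemma dual_B_Linfty : in_Linfty S dual_B.
Proof.
rewrite /in_Linfty cylinder_slab; split.
- by move=> z; have [sG _ _ _] := wG; rewrite /sym linearZ/= sG.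
- by move=> i j; exact: intg_measurable (dual_B_integrable i j).
- exists (gamma^-1 * CG); exact: dual_B_bound.
Qed.

(** [dual_E] is the derivative of W f, which vanishes at S. *)
Lemma dual_E_tail : {ae mu, forall x, forall l,
  intI 0 S (fun t => dual_E (t, x) 0 l) /\
  forall t, 0 <= t -> t < S -> \int[leb]_(s in `]t, S[) dual_E (s, x) 0 l =
    - (W t * (f0 x 0 l + \int[leb]_(r in `]0, t[) p (r, x) 0 l))}.
Proof.
apply: ae_finite => l.
have A1 := slab_ae_integrable2 (LKs_coord hFL l lp).
have A2 := slab_ae_integrable2 (dual_E_integrable l).
apply: aeS (aeI (slab_ae2 rep) (aeI A1 A2)) => x [repx [ipx iEx]]; split=> // t t0 tS.
pose u (s : R) := f0 x 0 l + \int[leb]_(r in `]0, s[) p (r, x) 0 l.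
have ip : intI t S (fun s => p (s, x) 0 l) by exact: intI_sub ipx.
have ih : intI t S h by exact: continuous_intI.
have iWp : intI t S (fun s => W s * p (s, x) 0 l).
  by apply: eq_integrable (intI_continuous_mul ip cW) => // s _; rewrite /= mulrC.
have icp := continuous_primitive (ltW S0) ipx.
have ihP : intI t S (fun s => h s * \int[leb]_(r in `]t, s[) p (r, x) 0 l).
  have c0 : continuous (fun s => \int[leb]_(r in `]0, clamp S s[) p (r, x) 0 l - \int[leb]_(r in `]0, t[) p (r, x) 0 l).
    by apply: contB => //; exact: cst_continuous.
  apply: eq_integrable (intI_continuous_mul ih c0) => // s.
  rewrite inE/= in_itv/= => /andP[ts sS].
  rewrite clamp_id ?(ltW sS) ?(le_trans t0 (ltW ts))//.
  rewrite (@Rintegral_cat _ (fun r => p (r, x) 0 l) 0 t s) ?(ltW ts)//; last exact: intI_sub (ltW sS) ipx.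
  by rewrite addrAC subrr add0r.
transitivity (\int[leb]_(s in `]t, S[) (W s * p (s, x) 0 l - (u t * h s + h s * \int[leb]_(r in `]t, s[) p (r, x) 0 l))).
  have iR : intI t S (fun s => u t * h s + h s * \int[leb]_(r in `]t, s[) p (r, x) 0 l).
    by apply: intgD => //; exact: intgZ.
  apply: (@ae_Rintegral _ _ _ leb) => //.
  - by apply: intg_measurable; exact: intI_sub iEx.
  - by apply: measurable_funB; [exact: intg_measurable iWp|exact: intg_measurable iR].
  apply: aeS repx => s H; rewrite /= in_itv/= => /andP[ts sS].
  have s0 : 0 < s by exact: le_lt_trans ts.
  rewrite /dual_E !mxE/= H ?s0 ?sS// /time_primitive/=.
  rewrite (@Rintegral_cat _ (fun r => p (r, x) 0 l) 0 t s) ?(ltW ts)//; last exact: intI_sub (ltW sS) ipx.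
  by rewrite /u; ring.
have iuh : intI t S (fun s => u t * h s) by exact: intgZ.
rewrite RintegralB//; last exact: intgD.
rewrite RintegralD// RintegralZl// exp_tail_int ?(ltW tS)//.
have tf := triangle_fubini ip ih.
have tW : \int[leb]_(s in `]t, S[) (p (s, x) 0 l * \int[leb]_(r in `]s, S[) h r) =
    \int[leb]_(s in `]t, S[) (W s * p (s, x) 0 l).
  apply: eq_Rintegral => s; rewrite inE/= in_itv/= => /andP[ts sS].
  by rewrite exp_tail_int ?(ltW sS)// mulrC.
by rewrite [X in _ - (_ + X)]tf tW -/(u t); ring.
Qed.

Let opc (Psi : R * 'rV[R]_d -> 'M[R]_N) l (z : R * 'rV[R]_d) := apply_op_st L Psi z 0 l.

Lemma apply_op_st_smooth Psi l : smooth_st_sym Psi ->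
  smooth_st (opc Psi l) /\ forall z, dt (opc Psi l) z = apply_op_st L (mx_dt Psi) z 0 l.
Proof.
move=> [sP smP].
have E z : opc Psi l z = \sum_(a : {ffun 'I_d -> 'I_(dop_order L).+1})
    \sum_i \sum_j dop_coef L a l i j * multi_partial (fun k => a k) (fun y => Psi (z.1, y) i j) z.2.
  rewrite /opc mxE; apply: eq_bigr => a _; apply: eq_bigr => i _; apply: eq_bigr => j _.
  by rewrite mxE.
have mpE (a : 'I_d -> nat) : exists s, forall (phi : R * 'rV[R]_d -> R), smooth phi ->
    forall z, multi_partial a (fun y => phi (z.1, y)) z.2 = st_partials s phi z.
  have [s [_ H]] := @multi_partialE R d a; exists s => phi sphi z.
  by rewrite H (partials_slice s z.1 sphi); case: z.
pose sq (a : {ffun 'I_d -> 'I_(dop_order L).+1}) := projT1 (cid (mpE (fun k => a k))).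
have sqP (a : {ffun 'I_d -> 'I_(dop_order L).+1}) (phi : R * 'rV[R]_d -> R) : smooth phi ->
    forall z, multi_partial (fun k => a k) (fun y => phi (z.1, y)) z.2 = st_partials (sq a) phi z.
  by rewrite /sq; case: (cid _) => s /= H; exact: H.
have E' : opc Psi l = fun z => \sum_(a : {ffun 'I_d -> 'I_(dop_order L).+1})
    \sum_i \sum_j dop_coef L a l i j * st_partials (sq a) (fun z => Psi z i j) z.
  apply/funext => z; rewrite E; apply: eq_bigr => a _; apply: eq_bigr => i _; apply: eq_bigr => j _.
  by rewrite (sqP a (fun z => Psi z i j) (smP i j).1).
have ss a i j : smooth (st_partials (sq a) (fun z => Psi z i j)) by apply: smooth_st_partials; exact: (smP i j).1.
split.
  split.
    rewrite E'; apply: smooth_sum => a; apply: smooth_sum => i; apply: smooth_sum => j.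
    by apply: smoothZ; exact: ss.
  move=> t x k; rewrite !E /=; apply: eq_bigr => a _; apply: eq_bigr => i _; apply: eq_bigr => j _.
  have [s1 p1] := smP i j.
  by have [_ ->] := smooth_multi_partial (fun k => a k) (smooth_slice t s1) (p1 t).
move=> z; rewrite E'.
have sdt i j : smooth (fun z => mx_dt Psi z i j).
  rewrite (_ : (fun z => _) = dt (fun z => Psi z i j)); last by apply/funext => y; rewrite mxE.
  exact: smooth_dt (smP i j).1.
have D1 : is_derive z ((1, 0) : R * 'rV[R]_d) (fun z => \sum_(a : {ffun 'I_d -> 'I_(dop_order L).+1})
    \sum_i \sum_j dop_coef L a l i j * st_partials (sq a) (fun z => Psi z i j) z)
    (\sum_(a : {ffun 'I_d -> 'I_(dop_order L).+1})
    \sum_i \sum_j dop_coef L a l i j * dt (st_partials (sq a) (fun z => Psi z i j)) z).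
  apply: is_derive_bigsum => a; apply: is_derive_bigsum => i; apply: is_derive_bigsum => j.
  apply: is_deriveZ; apply: DeriveDef => //.
  by exact: smooth_derivable.
rewrite /dt (derive_val (is_derive := D1)) mxE; apply: eq_bigr => a _; apply: eq_bigr => i _; apply: eq_bigr => j _.
rewrite mxE (sqP a (fun z => mx_dt Psi z i j) (sdt i j)) (dt_st_partials _ (smP i j).1); congr (_ * _).
by congr (st_partials (sq a) _ z); apply/funext => y; rewrite mxE.
Qed.

Lemma mx_dt_smooth (Psi : R * 'rV[R]_d -> 'M[R]_N) : smooth_st_sym Psi -> smooth_st_sym (mx_dt Psi).
Proof.
move=> [sP smP]; split=> [z|i j].
  apply/matrixP => i j; rewrite !mxE; congr (dt _ z); apply/funext => y.
  by rewrite -[in LHS](sP y) mxE.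
have [s1 p1] := smP i j.
rewrite (_ : (fun z => _) = dt (fun z => Psi z i j)); last by apply/funext => y; rewrite mxE.
split; first exact: smooth_dt.
move=> t x k; have [_ <-] := is_derive_tslice (x + delta_mx 0 k) t s1.
have [_ <-] := is_derive_tslice x t s1.
by congr ('D_1 _ t); apply/funext => s; exact: p1.
Qed.

(** The definition of [weak_adj] covers tests supported inside ]0, S[; a cutoff in time
    reduces to them and is removed by dominated convergence. *)
Lemma dual_adjoint Psi : smooth_st_sym Psi ->
  \int[st]_(z in slab 0 S) frob (dual_B z) (Psi z) =
  \int[st]_(z in slab 0 S) dotv (W z.1 *: f z) (apply_op_st L Psi z).
Proof.
move=> sP; have [sPs smP] := sP.
have wB := weak_adj_mul (smooth_exp_tail gamma S) wG.
have [_ _ _ tests] := wB.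
have iB : stin 0 S (fun z => frob (dual_B z) (Psi z)).
  apply: intg_sum => // i; apply: intg_sum => // j; have [s1 p1] := smP i j.
  by apply: stin_continuous_mul => //; [exact: dual_B_integrable|exact: smooth_continuous].
have if_ : stin 0 S (fun z => dotv (W z.1 *: f z) (apply_op_st L Psi z)).
  apply: intg_sum => // l; have [[s1 p1] _] := apply_op_st_smooth l sP.
  apply: stin_continuous_mul => //; last exact: smooth_continuous.
  by apply: eq_integrable (time_mul cW (LKs_coord hFL l lf)) => // z _; rewrite /= mxE.
pose chi k z : R := time_bump 0 S k z.1.
have mchi k : measurable_fun (slab 0 S) (fun z : measurableTypeR R * 'rV[R]_d => time_bump 0 S k z.1).
  apply: measurable_funTS; apply: measurable_time; apply: continuous_measurable_fun.
  exact/smooth_continuous/smooth_time_bump.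
have chi1 k t : `|time_bump 0 S k t| <= 1 by rewrite ger0_norm ?time_bump_ge0// time_bump_le1.
have lim (r : R * 'rV[R]_d -> R) : stin 0 S r ->
    \int[st]_(z in slab 0 S) (r z * time_bump 0 S k z.1) @[k --> \oo] --> \int[st]_(z in slab 0 S) r z.
  move=> ir; have mr := intg_measurable ir.
  suff [_] : stin 0 S r /\ \int[st]_(z in slab 0 S) (r z * time_bump 0 S k z.1) @[k --> \oo] -->
    \int[st]_(z in slab 0 S) r z by [].
  apply: (@Rdominated _ _ _ st (slab 0 S) (fun k z => r z * time_bump 0 S k z.1) r (fun z => `|r z|)) => //.
  - by move=> k; exact: measurable_funM.
  - apply: aeW => z /slabP zS; rewrite -[X in _ --> X]mulr1.
    apply: cvgM; first exact: cvg_cst.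
    by have := @cvg_time_bump R 0 S z.1; rewrite zS.
  - exact: intg_norm.
  - by move=> k z _; rewrite normrM ler_piMr.
have E k : \int[st]_(z in slab 0 S) (frob (dual_B z) (Psi z) * time_bump 0 S k z.1) =
    \int[st]_(z in slab 0 S) (dotv (W z.1 *: f z) (apply_op_st L Psi z) * time_bump 0 S k z.1).
  have [sP' opP'] := mx_test_mul L (smooth_time_bump 0 S k) sP.
  have supp : supported_in (0 + k.+1%:R^-1) (S - k.+1%:R^-1) (fun z : R * 'rV[R]_d => time_bump 0 S k z.1 *: Psi z).
    by move=> t x hh; rewrite /= time_bump_out// scale0r.
  have k0 : 0 < k.+1%:R^-1 :> R by rewrite invr_gt0.
  have a0 : 0 < 0 + k.+1%:R^-1 :> R by rewrite add0r.
  have bS : S - k.+1%:R^-1 < S by rewrite ltrBlDr ltrDl.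
  have := tests _ _ _ sP' a0 bS supp.
  rewrite (_ : (fun z => dotv _ _) = fun z => dotv (W z.1 *: f z) (apply_op_st L Psi z) * time_bump 0 S k z.1); last first.
    by apply/funext => z; rewrite opP' dotvZr mulrC.
  rewrite (_ : (fun z => frob _ _) = fun z => frob (dual_B z) (Psi z) * time_bump 0 S k z.1); last first.
    by apply/funext => z; rewrite frobZr mulrC.
  rewrite !int_cylE; first by move=> [].
    by apply: (@intg_bounded_mul _ _ _ _ _ _ _ 1).
  by apply: (@intg_bounded_mul _ _ _ _ _ _ _ 1).
have l1 := lim _ iB; have l2 := lim _ if_.
rewrite (funext E) in l1.
by have /cvg_lim <- // := l1; have /cvg_lim <- // := l2.
Qed.

(** Integration by parts in time for almost every x: L Psi is the integral from 0 of
    L (dt Psi), and by Fubini on the triangle it meets the tail of [dual_E], which is - W f.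
    What remains is [dual_adjoint] for dt Psi. *)
Lemma dual_constraint : constraint L S dual_E dual_B.
Proof.
move=> Psi sP Psi0.
have sdP := mx_dt_smooth sP.
have iB : stin 0 S (fun z => frob (dual_B z) (mx_dt Psi z)).
  apply: intg_sum => // i; apply: intg_sum => // j; have [s1 p1] := sdP.2 i j.
  by apply: stin_continuous_mul => //; [exact: dual_B_integrable|exact: smooth_continuous].
have iEl l : stin 0 S (fun z => dual_E z 0 l * apply_op_st L Psi z 0 l).
  have [[s1 p1] _] := apply_op_st_smooth l sP.
  by apply: stin_continuous_mul => //; [exact: dual_E_integrable|exact: smooth_continuous].
have iE : stin 0 S (fun z => dotv (dual_E z) (apply_op_st L Psi z)) by exact: intg_sum.
have iWl l : stin 0 S (fun z => (W z.1 *: f z) 0 l * apply_op_st L (mx_dt Psi) z 0 l).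
  have [[s1 p1] _] := apply_op_st_smooth l sdP.
  apply: stin_continuous_mul => //; last exact: smooth_continuous.
  by apply: eq_integrable (time_mul cW (LKs_coord hFL l lf)) => // z _; rewrite /= mxE.
rewrite int_cylE; last exact: intgD.
rewrite RintegralD// (dual_adjoint sdP) /dotv Rintegral_sum// Rintegral_sum// -big_split big1//= => l _.
apply/eqP; rewrite addrC addr_eq0; apply/eqP.
rewrite (slab_fubini2 (iEl l)) (slab_fubini2 (iWl l)) -mulN1r -RintegralZl//; last exact: slab_integrable2 (iWl l).
apply: ae_Rintegral => //.
- exact: intg_measurable (slab_integrable2 (iEl l)).
- by apply: intg_measurable; apply: intgZ => //; exact: slab_integrable2 (iWl l).
have [[sq pq] dq] := apply_op_st_smooth l sP.
have [[sdq pdq] _] := apply_op_st_smooth l sdP.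
have A1 := aeI (slab_ae2 rep) dual_E_tail.
have A2 := aeI (slab_ae_integrable2 (iWl l)) (slab_ae_integrable2 (LKs_coord hFL l lp)).
apply: aeS (aeI A1 A2) => x [[repx tail] [iWx ipx]] _.
have [iEx tailx] := tail l.
have idq : intI 0 S (fun s => apply_op_st L (mx_dt Psi) (s, x) 0 l).
  apply: continuous_intI; apply: smooth_continuous.
  exact: (smooth_tslice x sdq).
have qE t : 0 < t -> apply_op_st L Psi (t, x) 0 l = \int[leb]_(s in `]0, t[) apply_op_st L (mx_dt Psi) (s, x) 0 l.
  move=> t0.
  have dqx (s : R) : is_derive s (1 : R) (fun s => opc Psi l (s, x)) (apply_op_st L (mx_dt Psi) (s, x) 0 l).
    by rewrite -dq; exact: is_derive_tslice.
  rewrite (FTC2_oo (ltW t0) dqx); last by apply: smooth_continuous; exact: (smooth_tslice x sdq).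
  rewrite (_ : opc Psi l (0, x) = 0) ?subr0//.
  rewrite /opc /apply_op_st/= (_ : (fun x0 => Psi (0, x0)) = fun x0 => 0 *: 0); last first.
    by apply/funext => y; rewrite Psi0 scale0r.
  rewrite (@apply_op_scalar R d n N L 0 (fun=> 0) x l); last exact: smooth_cst.
  by rewrite big1// => i _; rewrite frob0r mul0r.
transitivity (\int[leb]_(t in `]0, S[) (dual_E (t, x) 0 l * \int[leb]_(s in `]0, t[) apply_op_st L (mx_dt Psi) (s, x) 0 l)).
  by apply: eq_Rintegral => t; rewrite inE/= in_itv/= => /andP[t0 tS]; rewrite qE.
rewrite triangle_fubini// -RintegralZl//.
have icp := continuous_primitive (ltW S0) ipx.
pose P t := apply_op_st L (mx_dt Psi) (t, x) 0 l *
  (- (W t * (f0 x 0 l + \int[leb]_(r in `]0, clamp S t[) p (r, x) 0 l))).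
have cP : continuous P.
  apply: contM; first by apply: smooth_continuous; exact: (smooth_tslice x sdq).
  rewrite (_ : (fun t => _) = fun t => 0 - (W t * (f0 x 0 l + \int[leb]_(r in `]0, clamp S t[) p (r, x) 0 l))); last first.
    by apply/funext => t; rewrite sub0r.
  apply: contB; first exact: cst_continuous.
  by apply: contM => //; apply: contD => //; exact: cst_continuous.
transitivity (\int[leb]_(t in `]0, S[) P t).
  apply: eq_Rintegral => t; rewrite inE/= in_itv/= => /andP[t0 tS].
  by rewrite tailx ?(ltW t0)// /P clamp_id// !ltW.
apply: (@ae_Rintegral _ _ _ leb) => //.
- by apply: measurable_funTS; exact: continuous_measurable_fun.
- by apply: measurable_funM => //; exact: intg_measurable iWx.
apply: aeS repx => t H; rewrite /= in_itv/= => /andP[t0 tS].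
have -> : (W t *: f (t, x)) 0 l = W t * f (t, x) 0 l by rewrite mxE.
rewrite /P H ?t0// /time_primitive/= clamp_id ?(ltW t0) ?(ltW tS)//.
by ring.
Qed.

Lemma dual_feasible_pair : feasible F L S (dual_E, dual_B).
Proof. by split; [exact: dual_E_LKs|exact: dual_B_Linfty|exact: dual_constraint]. Qed.

End DualPair.

(** * The energy identity *)

Section Pairings.
Context {R : realType} {d n N : nat}.
Variables (F : 'rV[R]_n -> 'M[R]_N) (L : diffop R d n N).
Hypothesis hFL : standing_assumptions F L.
Local Notation leb := (@lebesgue_measure R).
Local Notation mu := (torus R d).
Local Notation st := (spacetime R d).
Local Notation stin a b f := (st.-integrable (slab a b) (EFin \o f)).
Local Notation K := (entropy F).
Local Notation Ks := (legendre (entropy F)).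
Let reg := entropy_regular hFL.
Implicit Types (v E : R * 'rV[R]_d -> 'rV[R]_n) (B M : R * 'rV[R]_d -> 'M[R]_N) (S : R).

Lemma stin_cst S (r : R) : stin 0 S (fun=> r).
Proof. by apply: (@intg_bounded _ _ _ _ _ _ `|r|) => //; [exact: measurable_slab|exact: slab_lty]. Qed.

Lemma LK_measurable S v i : in_LK F S v -> measurable_fun (slab 0 S) (fun z => v z 0 i).
Proof. by rewrite /in_LK cylinder_slab => -[]. Qed.

Lemma LK_integrable S v : in_LK F S v -> stin 0 S (fun z => K (v z)).
Proof.
rewrite /in_LK cylinder_slab; apply: orlicz_integrable; first exact: measurable_slab.
  exact: entropy_continuous hFL.
exact: entropy_ge0 hFL.
Qed.

Lemma LK_intro S v : (forall i, measurable_fun (slab 0 S) (fun z => v z 0 i)) ->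
  stin 0 S (fun z => K (v z)) -> in_LK F S v.
Proof.
move=> mv iK; rewrite /in_LK cylinder_slab.
by apply: integrable_orlicz => //; exact: entropy_ge0 hFL.
Qed.

Lemma LK_continuous_measurable S v (phi : 'rV[R]_n -> R) : in_LK F S v -> continuous phi ->
  measurable_fun (slab 0 S) (fun z => phi (v z)).
Proof.
move=> lv cphi; apply: (measurable_rV_comp (f := v)) => //; first exact: measurable_slab.
by move=> i; exact: LK_measurable lv.
Qed.

Lemma young_integrable S v E : in_LK F S v -> in_LKs F S E -> stin 0 S (fun z => dotv (v z) (E z)).
Proof.
move=> lv lE; have mS := @measurable_slab R d 0 S.
apply: (@intg_le _ _ _ st (slab 0 S) _ (fun z => K (v z) + Ks (E z))) => //.
- apply: measurable_sum => l; apply: measurable_funM; first exact: LK_measurable lv.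
  exact: intg_measurable (LKs_coord hFL l lE).
- by move=> z _; rewrite dotvC; exact: dotv_le_K.
- exact: (intgD mS (LK_integrable lv) (LKs_integrable hFL lE)).
Qed.

Lemma LK_initial S (w : 'rV[R]_d -> 'rV[R]_n) : orlicz mu setT K w -> in_LK F S (fun z => w z.2).
Proof.
move=> ow; have [mw _] := ow; apply: LK_intro => [i|].
  by apply: measurable_funTS; exact: (measurable_space (p := fun x => w x 0 i) (mw i)).
have iKw := orlicz_integrable measurableT (entropy_continuous hFL) (entropy_ge0 hFL) ow.
have i1 : leb.-integrable `]0, S[ (EFin \o (fun=> 1 : R)).
  by apply: continuous_intI => x; exact: cvg_cst.
have [+ _] := slab_tensor i1 iKw; apply: eq_integrable => //; first exact: measurable_slab.
by move=> z _; rewrite /= mul1r.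
Qed.

Lemma LK_sharp S v : in_LK F S v -> in_LKs F S (fun z => sharp F (v z)).
Proof.
move=> lv; have [C [C0 HC]] := dual_sharp_le hFL.
apply: (LKs_intro hFL (B := fun z => C * (K (v z) + 1))).
- move=> i; apply: (LK_continuous_measurable lv (phi := fun y => grad K y 0 i)).
  exact: entropy_grad_continuous hFL i.
- apply: intgZ; first exact: measurable_slab.
  by apply: intgD; [exact: measurable_slab|exact: LK_integrable|exact: stin_cst].
- by apply: aeW => z _; exact: HC.
Qed.

Lemma Linfty_mul_integrable S B (M : R * 'rV[R]_d -> 'M[R]_N) : in_Linfty S B ->
  (forall i j, stin 0 S (fun z => M z i j)) -> stin 0 S (fun z => frob (M z) (B z)).
Proof.
move=> lB iM; have mS := @measurable_slab R d 0 S.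
move: lB; rewrite /in_Linfty cylinder_slab => -[sB mB [C BC]].
apply: intg_sum => // i; apply: intg_sum => // j.
apply: (@intg_ae_bounded_mul _ _ _ _ _ _ _ C) => //.
by apply: aeS BC => z H zS; exact: H.
Qed.

Lemma flux_majorant_LK S v : in_LK F S v ->
  exists M, [/\ forall z, sym (M z), forall z P, Lambda L P -> frob (M z) P = frob (F (v z)) P &
    forall i j, stin 0 S (fun z => M z i j)].
Proof.
move=> lv; have [M [sM MF cM [C [C0 MC]]]] := flux_majorant hFL.
have mS := @measurable_slab R d 0 S.
exists (fun z => M (v z)); split=> [z|z P|i j]; [exact: sM|exact: MF|].
apply: (@intg_le _ _ _ st (slab 0 S) _ (fun z => C * (K (v z) + 1))) => //.
- exact: (LK_continuous_measurable (phi := fun y => M y i j) lv (cM i j)).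
- apply: intgZ => //; apply: intgD => //; [exact: LK_integrable|exact: stin_cst].
Qed.

Lemma flux_measurable S v B : in_LK F S v -> (forall i j, measurable_fun (slab 0 S) (fun z => B z i j)) ->
  measurable_fun (slab 0 S) (fun z => frob (F (v z)) (B z)).
Proof.
move=> lv mB; apply: measurable_sum => i; apply: measurable_sum => j; apply: measurable_funM => //.
exact: (LK_continuous_measurable (phi := fun y => F y i j) lv (@flux_continuous _ _ _ _ F L hFL i j)).
Qed.

(** The field [F v] need not be integrable, but its pairing with an element of Lambda is that
    of the integrable majorant. *)
Lemma flux_pairing_integrable S v B : in_LK F S v -> in_Linfty S B ->
  ae_cyl S (fun z => Lambda L (B z)) -> stin 0 S (fun z => frob (F (v z)) (B z)).
Proof.
move=> lv lB; rewrite /ae_cyl cylinder_slab => LB; have mS := @measurable_slab R d 0 S.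
have [M [sM MF iM]] := flux_majorant_LK lv.
apply: (ae_intg mS _ _ (Linfty_mul_integrable lB iM)).
  apply: flux_measurable => // i j; move: lB; rewrite /in_Linfty cylinder_slab => -[_ + _].
  exact.
by apply: aeS LB => z H zS; rewrite MF//; exact: H.
Qed.

End Pairings.

Section Energy.
Context {R : realType} {d n N : nat}.
Variables (F : 'rV[R]_n -> 'M[R]_N) (L : diffop R d n N).
Hypothesis hFL : standing_assumptions F L.
Local Notation leb := (@lebesgue_measure R).
Local Notation mu := (torus R d).
Local Notation st := (spacetime R d).
Local Notation stin a b f := (st.-integrable (slab a b) (EFin \o f)).
Local Notation intI a b f := (leb.-integrable `]a, b[ (EFin \o f)).
Local Notation K := (entropy F).
Local Notation Ks := (legendre (entropy F)).
Variables (S gamma : R) (v p : R * 'rV[R]_d -> 'rV[R]_n) (v0 : 'rV[R]_d -> 'rV[R]_n).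
Variables (G : R * 'rV[R]_d -> 'M[R]_N) (CG : R).
Let f z := sharp F (v z).
Let f0 x := sharp F (v0 x).
Hypotheses (S0 : 0 < S) (gamma0 : 0 < gamma).
Hypotheses (lv : in_LK F S v) (lv0 : orlicz mu setT K v0) (lp : in_LKs F S p).
Hypothesis rep : {ae st, forall z, slab 0 S z ->
  forall l, f z 0 l = f0 z.2 0 l + time_primitive 0 (fun z => p z 0 l) z}.
Hypotheses (wG : weak_adj L S f G).
Hypothesis GC : {ae st, forall z, slab 0 S z -> forall i j, `|G z i j| <= CG}.
Hypothesis weak : weak_solution F L S v0 v.
Local Notation h := (exp_weight gamma).
Local Notation W := (exp_tail gamma S).
Local Notation E := (dual_E S gamma f p).
Local Notation B := (dual_B S gamma G).
Let mS := @measurable_slab R d 0 S.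
Let reg := entropy_regular hFL.
Let lf : in_LKs F S f := LK_sharp hFL lv.
Let cW : continuous W := smooth_continuous (smooth_exp_tail gamma S).
Let ch : continuous h := smooth_continuous (smooth_exp_weight gamma).
Let feas : feasible F L S (E, B) := dual_feasible_pair hFL S0 gamma0 lf lp rep wG GC.

Lemma dual_pair_Lambda : ae_cyl S (fun z => Lambda L (B z)).
Proof. by have [_ lB cons] := feas; exact: constraint_Lambda lB cons. Qed.

Lemma flux_dual_B_integrable : stin 0 S (fun z => frob (F (v z)) (B z)).
Proof. by have [_ lB _] := feas; exact: (flux_pairing_integrable (L := L) hFL lv lB dual_pair_Lambda). Qed.

(** [mollified_conservativity] at almost every time. *)
Lemma conservative_pairing : \int[st]_(z in slab 0 S) frob (F (v z)) (B z) = 0.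
Proof.
rewrite (slab_fubini1 flux_dual_B_integrable).
transitivity (\int[leb]_(t in `]0, S[) (0 : R)); last by rewrite Rintegral_cst// mul0r.
apply: (@ae_Rintegral _ _ _ leb) => //.
  exact: intg_measurable (slab_integrable1 flux_dual_B_integrable).
have A1 : {ae leb, forall t : R, forall l, 0 < t < S -> mu.-integrable setT (EFin \o (fun x => f (t, x) 0 l))}.
  by apply: ae_finite => l; exact: slab_ae_integrable1 (LKs_coord hFL l lf).
have A2 : {ae leb, forall t : R, forall ij : 'I_N * 'I_N, 0 < t < S ->
    mu.-integrable setT (EFin \o (fun x => G (t, x) ij.1 ij.2))}.
  apply: ae_finite => ij.
  exact: (slab_ae_integrable1 (f := fun z => G z ij.1 ij.2) (dual_G_integrable wG GC ij.1 ij.2)).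
have A3 := slab_ae_integrable1 (LKs_integrable hFL lf).
have A4 := slab_ae1 GC.
have A5 := slab_ae_integrable1 flux_dual_B_integrable.
have A6 := adj_conv_slice wG.
apply: aeS (aeI (aeI A1 A2) (aeI (aeI A3 A4) (aeI A5 A6))) => t [[a1 a2] [[a3 a4] [a5 a6]]].
rewrite /= in_itv/= => tS.
have iw l := a1 l tS; have iG i j := a2 (i, j) tS.
have := mollified_conservativity hFL iw (a3 tS) iG (a4 tS) (a6 tS iw iG).
have WtE x : frob (F (v (t, x))) (B (t, x)) = W t * frob (F (grad Ks (f (t, x)))) (G (t, x)).
  by rewrite /dual_B frobZr (sharp_invP hFL).
move=> H; under eq_Rintegral do rewrite WtE.
have [W0|Wn0] := eqVneq (W t) 0.
  by rewrite W0; under eq_Rintegral do rewrite mul0r; rewrite Rintegral_cst// mul0r.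
rewrite RintegralZl ?H ?mulr0//.
have := intgZ (W t)^-1 measurableT (a5 tS); apply: eq_integrable => // x _.
by rewrite /= WtE mulrA mulVf// mul1r.
Qed.

Let sharp_dual x : dotv (v0 x) (f0 x) = K (v0 x) + Ks (f0 x).
Proof. by rewrite /f0 /sharp (legendre_grad reg) dotvC; ring. Qed.

Let time_mul (q : R -> R) (g : R * 'rV[R]_d -> R) : continuous q -> stin 0 S g ->
  stin 0 S (fun z => q z.1 * g z).
Proof.
move=> cq ig; apply: eq_integrable (stin_continuous_mul ig _ _) => //.
- by move=> z _; rewrite /= mulrC.
- by move=> z; apply: (@continuous_comp _ _ _ fst q); [exact: cvg_fst|exact: cq].
- by [].
Qed.

Let iKv0 : mu.-integrable setT (EFin \o (fun x => K (v0 x))).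
Proof. exact: (orlicz_integrable measurableT (entropy_continuous hFL) (entropy_ge0 hFL) lv0). Qed.

Let iKsf0 : mu.-integrable setT (EFin \o (fun x => Ks (f0 x))).
Proof.
have [C [C0 HC]] := dual_sharp_le hFL; have [mv0 _] := lv0.
have i1 : mu.-integrable setT (EFin \o (fun=> 1 : R)).
  by apply: (@intg_bounded _ _ _ _ _ _ 1) => //; [exact: torus_lty|move=> *; rewrite normr1].
apply: (@intg_le _ _ _ _ _ _ (fun x => C * (K (v0 x) + 1))) => //.
- apply: (measurable_rV_comp (f := fun x => f0 x) (phi := Ks)) => //; last exact: continuous_legendre.
  move=> i; apply: (measurable_rV_comp (f := v0) (phi := fun y => grad K y 0 i)) => //.
  exact: entropy_grad_continuous hFL i.
- by move=> x _; rewrite ger0_norm ?(legendre_ge0 reg)//; exact: HC.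
- by apply: intgZ => //; exact: intgD.
Qed.

Let ivp : stin 0 S (fun z => W z.1 * dotv (v z) (p z)).
Proof. exact: (time_mul cW (young_integrable hFL lv lp)). Qed.

Let ihKs : stin 0 S (fun z => h z.1 * Ks (f z)).
Proof. exact: (time_mul ch (LKs_integrable hFL lf)). Qed.

Lemma energy_integrable : stin 0 S (fun z => h z.1 * K (v z)).
Proof. exact: (time_mul ch (LK_integrable hFL lv)). Qed.

(** The weighted chain rule for [Ks] along t |-> f(t, x), where the gradient of [Ks] is v. *)
Lemma dual_energy : \int[st]_(z in slab 0 S) (h z.1 * Ks (f z)) =
  W 0 * (\int[mu]_x Ks (f0 x)) + \int[st]_(z in slab 0 S) (W z.1 * dotv (v z) (p z)).
Proof.
have iX := slab_integrable2 ivp.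
have iW : mu.-integrable setT (EFin \o (fun x => W 0 * Ks (f0 x))) := intgZ (W 0) measurableT iKsf0.
rewrite (slab_fubini2 ihKs) (slab_fubini2 ivp) -(RintegralZl _ measurableT iKsf0) -(RintegralD measurableT iW iX).
have ipl l := LKs_coord hFL l lp.
apply: ae_Rintegral => //.
- exact: intg_measurable (slab_integrable2 ihKs).
- exact: intg_measurable (intgD measurableT iW iX).
have A1 : {ae mu, forall x, forall l, intI 0 S (fun t => p (t, x) 0 l)}.
  by apply: ae_finite => l; exact: slab_ae_integrable2 (ipl l).
have A2 := aeI (slab_ae_integrable2 ihKs) (slab_ae_integrable2 ivp).
apply: aeS (aeI (slab_ae2 rep) (aeI A1 A2)) => x [repx [ipx [iKx ivx]]] _.
pose u t : 'rV[R]_n := \row_l (f0 x 0 l + \int[leb]_(r in `]0, clamp S t[) p (r, x) 0 l).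
have cu i : continuous (fun t => u t 0 i).
  under eq_fun do rewrite mxE; apply: contD; first exact: cst_continuous.
  by apply: continuous_primitive (ipx i); exact: ltW.
have uq i (s t : R) : 0 <= s -> s <= t -> t <= S -> u t 0 i - u s 0 i = \int[leb]_(r in `]s, t[) p (r, x) 0 i.
  move=> s0 st_ tS; rewrite !mxE !clamp_id ?s0 ?(le_trans s0 st_) ?(le_trans st_ tS)//.
  rewrite (@Rintegral_cat _ (fun r => p (r, x) 0 i) 0 s t)//; last exact: intI_sub (ipx i).
  by ring.
have u0 : u 0 = f0 x.
  apply/rowP => l; rewrite mxE clamp_id ?lexx ?(ltW S0)//.
  by rewrite set_itvoo0 Rintegral_set0 addr0.
have uf : {ae leb, forall t : R, 0 < t < S -> u t = f (t, x)}.
  apply: aeS repx => t H tS; apply/rowP => l; rewrite (H tS) mxE /time_primitive/= clamp_id//.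
  by have /andP[t0 tS'] := tS; rewrite !ltW.
have ih : intI 0 S h by exact: continuous_intI.
have wc := weighted_chain_rule (legendre_subgradient reg) (fun i => @continuous_conj_grad _ _ _ reg i) (ltW S0) cu ipx uq ih.
have cKu : continuous (fun t => Ks (u t)).
  move=> t; apply: (@continuous_comp R 'rV[R]_n R u Ks); last exact: continuous_legendre.
  exact: continuous_rV.
have ihKu : intI 0 S (fun t => h t * Ks (u t)) by exact: intI_continuous_mul.
have -> : \int[leb]_(t in `]0, S[) (h (t, x).1 * Ks (f (t, x))) = \int[leb]_(t in `]0, S[) (h t * Ks (u t)).
  apply: (@ae_Rintegral _ _ _ leb) => //; [exact: intg_measurable iKx|exact: intg_measurable ihKu|].
  by apply: aeS uf => t H; rewrite /= in_itv/= => /H ->.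
have -> : \int[leb]_(t in `]0, S[) (W (t, x).1 * dotv (v (t, x)) (p (t, x))) =
    \int[leb]_(s in `]0, S[) (dotv (p (s, x)) (conj_grad reg (u s)) * \int[leb]_(t in `]s, S[) h t).
  transitivity (\int[leb]_(s in `]0, S[) (dotv (p (s, x)) (conj_grad reg (u s)) * W s)); last first.
    apply: eq_Rintegral => s; rewrite inE/= in_itv/= => /andP[s0 sS].
    by rewrite exp_tail_int ?(ltW sS).
  have ic := chain_integrable (fun i => @continuous_conj_grad _ _ _ reg i) cu ipx.
  apply: (@ae_Rintegral _ _ _ leb) => //; first exact: intg_measurable ivx.
    by apply: intg_measurable; exact: intI_continuous_mul ic cW.
  apply: aeS uf => t H; rewrite /= in_itv/= => /H ->.
  by rewrite -(grad_legendre reg) /f (sharp_invP hFL) dotvC mulrC.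
rewrite -wc u0.
have ihc : intI 0 S (fun t => Ks (f0 x) * h t) by exact: intgZ.
transitivity (\int[leb]_(t in `]0, S[) (h t * Ks (u t) - Ks (f0 x) * h t) + W 0 * Ks (f0 x)).
  by rewrite RintegralB// RintegralZl// exp_tail_int ?(ltW S0)//; ring.
rewrite addrC; congr (_ + _); apply: eq_Rintegral => t _; ring.
Qed.

Lemma initial_pairing : \int[st]_(z in slab 0 S) dotv (v0 z.2) (E z) =
  - (W 0 * \int[mu]_x (K (v0 x) + Ks (f0 x))).
Proof.
have lE : in_LKs F S E by have [] := feas.
have iv0E := young_integrable hFL (LK_initial hFL S lv0) lE.
have iKK := intgD measurableT iKv0 iKsf0.
rewrite (slab_fubini2 iv0E) -mulNr -(RintegralZl _ measurableT iKK).
apply: ae_Rintegral => //.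
- exact: intg_measurable (slab_integrable2 iv0E).
- exact: intg_measurable (intgZ (- W 0) measurableT iKK).
apply: aeS (dual_E_tail hFL S0 gamma0 lf lp rep) => x tail _.
rewrite /dotv Rintegral_sum//=; last first.
  by move=> l; apply: intgZ => //; exact: (tail l).1.
rewrite -sharp_dual /dotv mulr_sumr; apply: eq_bigr => l _.
rewrite RintegralZl//; last exact: (tail l).1.
rewrite (tail l).2// set_itvoo0 Rintegral_set0 addr0; ring.
Qed.

(** Conservation of energy, integrated against the weight: the weak formulation is tested
    with the dual pair, whose flux term vanishes by conservativity, and the terms in [Ks]
    cancel by [dual_energy] and [initial_pairing]. *)
Lemma energy_identity : \int[st]_(z in slab 0 S) (h z.1 * K (v z)) = W 0 * \int[mu]_x K (v0 x).
Proof.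
have lE : in_LKs F S E by have [] := feas.
have ivE := young_integrable hFL lv lE.
have iv0E := young_integrable hFL (LK_initial hFL S lv0) lE.
have iFB := flux_dual_B_integrable.
have [_ /(_ _ _ feas) weq] := weak.
have iEE := intgB mS ivE iv0E; have iall := intgD mS iEE iFB.
have vE z : dotv (v z) (E z) = W z.1 * dotv (v z) (p z) - (h z.1 * K (v z) + h z.1 * Ks (f z)).
  rewrite /dual_E dotvBr !dotvZr; congr (_ - _).
  by rewrite /f /sharp (legendre_grad reg) dotvC; ring.
have e0 : \int[st]_(z in slab 0 S) (dotv (v z) (E z) - dotv (v0 z.2) (E z) + frob (F (v z)) (B z)) = 0.
  apply: EFin_inj; rewrite -(int_cylE iall).
  by rewrite -[RHS]weq; apply: int_cyl_eq => z _; rewrite dotvBl.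
rewrite (RintegralD mS iEE iFB) (RintegralB mS ivE iv0E) conservative_pairing initial_pairing addr0 in e0.
have e1 : \int[st]_(z in slab 0 S) dotv (v z) (E z) = \int[st]_(z in slab 0 S) (W z.1 * dotv (v z) (p z))
    - (\int[st]_(z in slab 0 S) (h z.1 * K (v z)) + \int[st]_(z in slab 0 S) (h z.1 * Ks (f z))).
  transitivity (\int[st]_(z in slab 0 S) (W z.1 * dotv (v z) (p z) - (h z.1 * K (v z) + h z.1 * Ks (f z)))).
    by apply: eq_Rintegral => z _; exact: vE.
  have i2 := intgD mS energy_integrable ihKs.
  by rewrite (RintegralB mS ivp i2) (RintegralD mS energy_integrable ihKs).
rewrite e1 dual_energy (RintegralD measurableT iKv0 iKsf0) in e0.
by move: e0; set a := Rintegral _ _ _; set b := Rintegral _ _ _; set c := Rintegral _ _ _; set e := Rintegral _ _ _; lra.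
Qed.

End Energy.

(** * Optimal values *)

(** (u0, p0) is a saddle point, at which the functional does not vary with p. *)
Lemma saddle_values {R : realType} (U P : Type) (A : set U) (B : set P) (f : U -> P -> \bar R) u0 p0 a :
  A u0 -> B p0 -> (forall p, B p -> f u0 p = a) -> (forall u, A u -> (a <= f u p0)%E) ->
  ereal_inf [set ereal_sup [set f u p | p in B] | u in A] = a /\
  ereal_sup [set ereal_inf [set f u p | u in A] | p in B] = a.
Proof.
move=> Au Bp fa af; split; apply/eqP; rewrite eq_le; apply/andP; split.
- apply: (@le_trans _ _ (ereal_sup [set f u0 p | p in B])).
    by apply: ereal_inf_lbound; exists u0.
  by apply: ge_ereal_sup => _ [p Bp' <-]; rewrite fa.
- apply: le_ereal_inf_tmp => _ [u Au' <-]; apply: (le_trans (af u Au')).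
  by apply: ereal_sup_ubound; exists p0.
- apply: ge_ereal_sup => _ [p Bp' <-]; rewrite -(fa p Bp').
  by apply: ereal_inf_lbound; exists u0.
- apply: (@le_trans _ _ (ereal_inf [set f u p0 | u in A])).
    by apply: le_ereal_inf_tmp => _ [u Au' <-]; exact: af.
  by apply: ereal_sup_ubound; exists p0.
Qed.

Lemma tr_mx_partial {R : realType} {d n N : nat} (F : 'rV[R]_n -> 'M[R]_N) (L : diffop R d n N) l v :
  standing_assumptions F L -> \tr (mx_partial l F v) = 2 * sharp F v 0 l.
Proof.
move=> hFL; rewrite /sharp mxE /partial.
have -> : entropy F = fun v => 2^-1 * ((\sum_i F v i i) - \tr (F 0)).
  by apply/funext => w; rewrite /entropy linearB.
have D1 : is_derive v (delta_mx 0 l : 'rV[R]_n) (fun w => 2^-1 * ((\sum_i F w i i) - \tr (F 0)))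
    (2^-1 * ((\sum_i 'D_(delta_mx 0 l) (fun y => F y i i) v) - 0)).
  apply: is_deriveZ; apply: is_deriveB; apply: is_derive_bigsum => i.
  apply: DeriveDef => //; exact: (@flux_derivable _ _ _ _ F L hFL).
rewrite (derive_val (is_derive := D1)) subr0 mulrA mulfV// mul1r.
by apply: eq_bigr => i _; rewrite mxE.
Qed.

Section Values.
Context {R : realType} {d n N : nat}.
Variables (F : 'rV[R]_n -> 'M[R]_N) (L : diffop R d n N).
Hypothesis hFL : standing_assumptions F L.
Local Notation leb := (@lebesgue_measure R).
Local Notation mu := (torus R d).
Local Notation st := (spacetime R d).
Local Notation stin a b f := (st.-integrable (slab a b) (EFin \o f)).
Local Notation intI a b f := (leb.-integrable `]a, b[ (EFin \o f)).
Local Notation K := (entropy F).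
Local Notation Ks := (legendre (entropy F)).
Local Notation dualp := ((R * 'rV[R]_d -> 'rV[R]_n) * (R * 'rV[R]_d -> 'M[R]_N))%type.
Variables (S gamma : R) (v p : R * 'rV[R]_d -> 'rV[R]_n) (v0 : 'rV[R]_d -> 'rV[R]_n).
Variables (G : R * 'rV[R]_d -> 'M[R]_N) (CG : R).
Local Notation f := (fun z => sharp F (v z)).
Local Notation f0 := (fun x => sharp F (v0 x)).
Hypotheses (S0 : 0 < S) (gamma0 : 0 < gamma).
Hypotheses (lv : in_LK F S v) (lv0 : orlicz mu setT K v0) (lp : in_LKs F S p).
Hypothesis rep : {ae st, forall z, slab 0 S z ->
  forall l, f z 0 l = f0 z.2 0 l + time_primitive 0 (fun z => p z 0 l) z}.
Hypotheses (wG : weak_adj L S f G).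
Hypothesis GC : {ae st, forall z, slab 0 S z -> forall i j, `|G z i j| <= CG}.
Hypothesis weak : weak_solution F L S v0 v.
Hypothesis pde : {ae st, forall z, slab 0 S z -> forall l, p z 0 l + frob (G z) (mx_partial l F (v z)) = 0}.
Hypothesis gammaC : 2 * (\sum_(i < N) \sum_(j < N) CG) <= gamma.
Local Notation h := (exp_weight gamma).
Local Notation W := (exp_tail gamma S).
Local Notation E := (dual_E S gamma f p).
Local Notation B := (dual_B S gamma G).
Local Notation A := ((W 0)%:E * K0 F v0)%E.
Local Notation weighted q := (fun z => (h z.1)%:M + 2 *: (snd q) z).
Let mS := @measurable_slab R d 0 S.
Let ch : continuous h := smooth_continuous (smooth_exp_weight gamma).
Let lf : in_LKs F S f := LK_sharp hFL lv.
Let feas : feasible F L S (E, B) := dual_feasible_pair hFL S0 gamma0 lf lp rep wG GC.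

Let ih : intI 0 S h. Proof. exact: continuous_intI. Qed.

Let ih1 : stin 0 S (fun z => h z.1).
Proof.
have i1 : mu.-integrable setT (EFin \o (fun=> 1 : R)).
  by apply: (@intg_bounded _ _ _ _ _ _ 1) => //; [exact: torus_lty|move=> *; rewrite normr1].
have [+ _] := slab_tensor ih i1; apply: eq_integrable => //.
by move=> z _; rewrite /= mulr1.
Qed.

Let int_h : \int[st]_(z in slab 0 S) h z.1 = W 0.
Proof.
rewrite (slab_fubini1 ih1) -(exp_tail_int gamma0 (ltW S0)).
apply: eq_Rintegral => t _ /=; rewrite Rintegral_cst//.
have -> : fine (mu setT) = 1 by have := @probability_setT _ _ _ mu; move=> ->.
by rewrite mulr1.
Qed.

Lemma K0E : K0 F v0 = ((\int[mu]_x K (v0 x)) + 2^-1 * \tr (F 0))%:E.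
Proof.
have iKv0 : mu.-integrable setT (EFin \o (fun x => K (v0 x))).
  exact: (orlicz_integrable measurableT (entropy_continuous hFL) (entropy_ge0 hFL) lv0).
have i1 (r : R) : mu.-integrable setT (EFin \o (fun=> r)).
  by apply: (@intg_bounded _ _ _ _ _ _ `|r|) => //; exact: torus_lty.
rewrite /K0; under eq_integral do rewrite tr_flux.
have i2 := intgZ 2 measurableT iKv0.
have i3 := intgD measurableT i2 (i1 (\tr (F 0))).
have -> : (\int[mu]_x (2 * K (v0 x) + \tr (F 0))%:E = (\int[mu]_x (2 * K (v0 x) + \tr (F 0)))%:E)%E.
  by have := EFin_Rintegral measurableT i3.
rewrite -EFinM (RintegralD measurableT i2 (i1 _)).
rewrite (RintegralZl _ measurableT iKv0) Rintegral_cst//.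
have -> : fine (mu setT) = 1 by have := @probability_setT _ _ _ mu; move=> ->.
rewrite mulr1.
by congr (_%:E); rewrite mulrDr mulrA mulVf// mul1r.
Qed.

Lemma weightedE (q : dualp) (X : 'M[R]_N) z :
  2^-1 * frob X (weighted q z) = 2^-1 * (h z.1 * \tr X) + frob X (q.2 z).
Proof. by rewrite frobDr frob_scalar frobZr mulrDr mulrA [in X in _ + X]mulrA mulVf// mul1r -mulrA. Qed.

Lemma weighted_Lambda (q : dualp) z : Lambda L (q.2 z) -> Lambda L (weighted q z).
Proof.
move=> Lq; rewrite /= addrC -[_%:M]scalemx1; apply: LambdaP_lin => //.
by rewrite -[_ *: _]addr0; apply: LambdaP_lin; [exact: Lambda1|move=> V _ _; exact: mem0v].
Qed.

Lemma weighted_Linfty (q : dualp) : in_Linfty S q.2 -> in_Linfty S (weighted q).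
Proof.
rewrite /in_Linfty cylinder_slab => -[sB mB [C BC]]; split.
- by move=> z; rewrite /sym linearD/= tr_scalar_mx linearZ/= sB.
- move=> i j; rewrite (_ : (fun z => _) = fun z => h z.1 * (i == j)%:R + 2 * q.2 z i j); last first.
    by apply/funext => z; rewrite !mxE mulr_natr.
  apply: measurable_funD; last by apply: measurable_funM => //; exact: mB.
  by apply: measurable_funM => //; exact: intg_measurable ih1.
exists (1 + 2 * C); apply: aeS BC => z H zS i j; rewrite !mxE.
move: (zS) => /slabP/andP[z0 zS1].
apply: (le_trans (ler_normD _ _)); apply: lerD.
  case: (i == j); rewrite ?mulr1n ?mulr0n ?normr0//.
  by rewrite ger0_norm ?exp_weight_le1 ?(ltW z0)// ltW// exp_weight_gt0.
by rewrite normrM ger0_norm// ler_wpM2l// H.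
Qed.

Lemma flux_weighted_integrable u (q : dualp) : in_LK F S u -> feasible F L S q ->
  stin 0 S (fun z => frob (F (u z)) (weighted q z)).
Proof.
move=> lu [lE lB cons]; apply: (flux_pairing_integrable (L := L) hFL lu (weighted_Linfty lB)).
have := constraint_Lambda S0 lB cons; apply: aeS => z H zS; exact: weighted_Lambda (H zS).
Qed.

Lemma lagrangian_split u M (q : dualp) : in_LK F S u -> in_LKs F S q.1 ->
  stin 0 S (fun z => frob (M z) (weighted q z)) ->
  [/\ lagrangian h S v0 u M q =
      (\int[st]_(z in slab 0 S) (dotv (u z) (q.1 z) + 2^-1 * frob (M z) (weighted q z))
        - \int[st]_(z in slab 0 S) dotv (v0 z.2) (q.1 z))%:E,
    int_cyl S (fun z => dotv (v0 z.2) (q.1 z)) = (\int[st]_(z in slab 0 S) dotv (v0 z.2) (q.1 z))%:E &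
    int_cyl S (fun z => dotv (u z) (q.1 z) + 2^-1 * frob (M z) (weighted q z)) =
    (\int[st]_(z in slab 0 S) (dotv (u z) (q.1 z) + 2^-1 * frob (M z) (weighted q z)))%:E].
Proof.
move=> lu lq iM.
have iuq := young_integrable hFL lu lq.
have i0q := young_integrable hFL (LK_initial hFL S lv0) lq.
have i1 := intgD mS iuq (intgZ 2^-1 mS iM).
split; last 2 first; [exact: int_cylE|exact: int_cylE|].
rewrite -(RintegralB mS i1 i0q) -(int_cylE (intgB mS i1 i0q)) /lagrangian.
by apply: int_cyl_eq => z _; rewrite dotvBl; ring.
Qed.

(** The terms of the integrand that contain [q] form the weak formulation, which vanishes;
    the others form the energy, given by [energy_identity]. *)
Lemma solution_lagrangian (M : R * 'rV[R]_d -> 'M[R]_N) (q : dualp) :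
  (forall i j, measurable_fun (slab 0 S) (fun z => M z i j)) ->
  (forall z P, Lambda L P -> frob (M z) P = frob (F (v z)) P) -> feasible F L S q ->
  stin 0 S (fun z => frob (M z) (weighted q z)) /\ lagrangian h S v0 v M q = A.
Proof.
move=> mM MF fq; have [lq lB cons] := fq.
have LB := constraint_Lambda S0 lB cons.
have iFq := flux_weighted_integrable lv fq.
have [_ mB _] := weighted_Linfty lB.
have iM : stin 0 S (fun z => frob (M z) (weighted q z)).
  apply: (ae_intg mS _ _ iFq).
    apply: measurable_sum => i; apply: measurable_sum => j; apply: measurable_funM => //.
    by have := mB i j; rewrite cylinder_slab.
  move: LB; rewrite /ae_cyl cylinder_slab; apply: aeS => z H zS.
  by rewrite MF//; exact: weighted_Lambda (H zS).
split=> //.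
have [-> _ _] := lagrangian_split lv lq iM.
have ivq := young_integrable hFL lv lq.
have i0q := young_integrable hFL (LK_initial hFL S lv0) lq.
have iFB := flux_pairing_integrable (L := L) hFL lv lB LB.
have iM2 := intgZ 2^-1 mS iM.
have iK := energy_integrable hFL gamma lv.
have ih2 := intgZ (2^-1 * \tr (F 0)) mS ih1.
have iKh := intgD mS iK ih2.
have e1 : \int[st]_(z in slab 0 S) (2^-1 * frob (M z) (weighted q z)) =
    \int[st]_(z in slab 0 S) frob (F (v z)) (q.2 z) + (W 0 * \int[mu]_x K (v0 x) + 2^-1 * \tr (F 0) * W 0).
  rewrite -(energy_identity hFL S0 gamma0 lv lv0 lp rep wG GC weak) -[in X in _ + X]int_h -(RintegralZl _ mS ih1).
  rewrite -(RintegralD mS iK ih2) -(RintegralD mS iFB iKh).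
  apply: ae_Rintegral => //; [exact: intg_measurable iM2|exact: intg_measurable (intgD mS iFB iKh)|].
  move: LB; rewrite /ae_cyl cylinder_slab; apply: aeS => z H zS.
  rewrite MF; last exact: weighted_Lambda (H zS).
  by rewrite weightedE tr_flux mulrDr mulrDr; field.
have [_ /(_ q.1 q.2)] := weak; case: q fq lq lB cons LB iFq mB iM ivq i0q iFB iM2 e1 => q1 q2 /=.
move=> fq lq lB cons LB iFq mB iM ivq i0q iFB iM2 e1 /(_ fq) weq.
have e0 : \int[st]_(z in slab 0 S) (dotv (v z) (q1 z) - dotv (v0 z.2) (q1 z) + frob (F (v z)) (q2 z)) = 0.
  apply: EFin_inj; rewrite -(int_cylE (intgD mS (intgB mS ivq i0q) iFB)).
  by rewrite -[RHS]weq; apply: int_cyl_eq => z _; rewrite dotvBl.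
rewrite (RintegralD mS (intgB mS ivq i0q) iFB) (RintegralB mS ivq i0q) in e0.
rewrite (RintegralD mS ivq iM2) e1 K0E -EFinM; congr (_%:E).
by move: e0; set a := Rintegral _ _ _; set b := Rintegral _ _ _; set c := Rintegral _ _ _; set e := Rintegral _ _ _; lra.
Qed.

(** Since gamma W <= h, the condition on gamma lets h I absorb 2 W G. *)
Lemma dual_weighted_psd : {ae st, forall z, slab 0 S z -> psd ((h z.1)%:M + 2 *: B z)}.
Proof.
apply: aeS GC => z H zS; move: (zS) => /slabP/andP[z0 zS1].
have [sG _ _ _] := wG.
have W0 := exp_tail_ge0 gamma0 (ltW zS1).
apply: (@psd_shift _ _ (2 *: B z)); first by rewrite /dual_B scalerA /sym linearZ/= sG.
apply: (le_trans _ (exp_tail_le S gamma0 z.1)); apply: (@le_trans _ _ (2 * (\sum_(i < N) \sum_(j < N) CG) * W z.1)); last first.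
  by rewrite ler_wpM2r.
rewrite -mulrA mulr_suml mulr_sumr; apply: ler_sum => i _; rewrite mulr_suml mulr_sumr; apply: ler_sum => j _.
have -> : (2 *: B z) i j = (2 * W z.1) * G z i j by rewrite !mxE mulrA.
have w0 : 0 <= 2 * W z.1 by rewrite mulr_ge0.
have -> : 2 * (CG * W z.1) = 2 * W z.1 * CG by ring.
rewrite normrM (ger0_norm w0); apply: ler_wpM2l => //.
exact: H.
Qed.

(** The equation for the time derivative says that v is a critical point of the integrand,
    which is convex in v because the weighted matrix is a nonnegative element of Lambda. *)
Lemma dual_gradient : {ae st, forall z, slab 0 S z -> forall u,
  dotv (v z) (E z) + 2^-1 * frob (F (v z)) (weighted (E, B) z) <=
  dotv u (E z) + 2^-1 * frob (F u) (weighted (E, B) z)}.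
Proof.
have LB := dual_pair_Lambda hFL S0 gamma0 lv lp rep wG GC.
rewrite /ae_cyl cylinder_slab in LB.
apply: aeS (aeI (aeI dual_weighted_psd LB) pde) => z [[ps Lz] pz] zS u.
have LP := weighted_Lambda (q := (E, B)) (Lz zS).
have cv := flux_convex_ge hFL u (v z) LP (ps zS).
rewrite /=.
have -> : dotv (v z) (E z) = dotv u (E z) - dotv (u - v z) (E z) by rewrite dotvBl; ring.
have -> : dotv (u - v z) (E z) = - (2^-1 * \sum_l (u - v z) 0 l * frob (mx_partial l F (v z)) (weighted (E, B) z)).
  rewrite mulr_sumr -sumrN; apply: eq_bigr => l _.
  rewrite mulrCA weightedE (tr_mx_partial _ _ hFL) /= frobZr frobC -mulrN; congr (_ * _).
  have := pz zS l; move/eqP; rewrite addr_eq0 => /eqP pl.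
  have cc (a b : R) (x y : 'rV[R]_n) : (a *: x - b *: y) 0 l = a * x 0 l - b * y 0 l by rewrite !mxE.
  by rewrite /dual_E cc pl; field.
by move: cv; set a := frob _ _; set b := \sum_l _; set c := frob _ _; lra.
Qed.

Lemma dual_lower_bound u (M : R * 'rV[R]_d -> 'M[R]_N) : in_LK F S u ->
  {ae st, forall z, slab 0 S z -> forall P, Lambda L P -> psd P -> frob (F (u z)) P <= frob (M z) P} ->
  stin 0 S (fun z => frob (M z) (weighted (E, B) z)) ->
  (A <= lagrangian h S v0 u M (E, B))%E.
Proof.
move=> lu FM iM; have [lE lB cons] := feas.
have mF i j : measurable_fun (slab 0 S) (fun z => F (v z) i j).
  exact: (LK_continuous_measurable (phi := fun y => F y i j) lv (@flux_continuous _ _ _ _ F L hFL i j)).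
have [iF <-] := solution_lagrangian (M := fun z => F (v z)) mF (fun z P _ => erefl) feas.
have [-> _ _] := lagrangian_split (q := (E, B)) lu lE iM.
have [-> _ _] := lagrangian_split (q := (E, B)) lv lE iF.
rewrite lee_fin lerD2r.
have LB := dual_pair_Lambda hFL S0 gamma0 lv lp rep wG GC.
rewrite /ae_cyl cylinder_slab in LB.
have i1 := intgD mS (young_integrable hFL lv lE) (intgZ 2^-1 mS iF).
have i2 := intgD mS (young_integrable hFL lu lE) (intgZ 2^-1 mS iM).
apply: (Rintegral_ae_le mS i1 i2).
apply: aeS (aeI (aeI dual_weighted_psd LB) (aeI dual_gradient FM)) => z [[ps Lz] [gr FMz]] zS.
apply: (le_trans (gr zS (u z))); rewrite lerD2l ler_wpM2l//.
by apply: FMz => //; [exact: (weighted_Lambda (q := (E, B)) (Lz zS))|exact: ps].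
Qed.

(** [F v] may fail to be integrable; its majorant is, and it has the same pairings with Lambda. *)
Lemma relaxed_candidate : exists M, relaxed F L S (v, M) /\
  (forall q : dualp, feasible F L S q -> lagrangian h S v0 v M q = A /\ 
     stin 0 S (fun z => frob (M z) (weighted q z))).
Proof.
have [M [sM MF iM]] := flux_majorant_LK hFL lv.
have mM i j : measurable_fun (slab 0 S) (fun z => M z i j) by exact: intg_measurable (iM i j).
exists M; split.
  split => //=; first by split=> // i j; rewrite cylinder_slab; exact: iM.
  apply: aeW => z _; split; last by move=> P LP _; rewrite frobBl MF// subrr.
  by rewrite /sym linearB/= sM (flux_sym hFL).
by move=> q fq; have [iq lq] := solution_lagrangian mM MF fq.
Qed.

Let relaxed_integrable (q : dualp) (r : dualp) : relaxed F L S r -> feasible F L S q ->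
  stin 0 S (fun z => frob (r.2 z) (weighted q z)).
Proof.
move=> [_ [_ iM] _] [_ lB _]; apply: Linfty_mul_integrable; first exact: weighted_Linfty.
by move=> i j; have := iM i j; rewrite cylinder_slab.
Qed.

Let relaxed_lower (r : dualp) : relaxed F L S r -> (A <= lagrangian h S v0 r.1 r.2 (E, B))%E.
Proof.
move=> rr; apply: dual_lower_bound; [by have [] := rr| |exact: relaxed_integrable].
have [_ _] := rr; rewrite /ae_cyl cylinder_slab; apply: aeS => z H zS P LP pP.
by have [_ /(_ P LP pP)] := H zS; rewrite frobBl subr_ge0.
Qed.

Lemma optimal_values :
  [/\ pI F L h S v0 = A, pJ_relaxed F L h S v0 = A, pI_relaxed F L h S v0 = A & pJ F L h S v0 = A].
Proof.
have mF i j : measurable_fun (slab 0 S) (fun z => F (v z) i j).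
  exact: (LK_continuous_measurable (phi := fun y => F y i j) lv (@flux_continuous _ _ _ _ F L hFL i j)).
have solF q : feasible F L S q -> lagrangian h S v0 v (F \o v) q = A.
  by move=> fq; have [] := solution_lagrangian (M := F \o v) mF (fun z P _ => erefl) fq.
have lowF u : in_LK F S u -> (A <= lagrangian h S v0 u (F \o u) (E, B))%E.
  move=> lu; apply: dual_lower_bound => //; first by apply: aeW => z _ P _ _.
  exact: flux_weighted_integrable lu feas.
have [eI eJ] := saddle_values (f := fun u q => lagrangian h S v0 u (F \o u) q) lv feas solF lowF.
have [M [rM solM]] := relaxed_candidate.
have solM' q (fq : feasible F L S q) : lagrangian h S v0 (v, M).1 (v, M).2 q = A by have [] := solM q fq.
have [eI' eJ'] := saddle_values (f := fun r q => lagrangian h S v0 r.1 r.2 q) rM feas solM' relaxed_lower.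
by split.
Qed.

Lemma dual_pair_maximizer : dual_maximizer F L h S v0 (E, B).
Proof.
split.
  split; first exact: feas.
  by rewrite /ae_cyl cylinder_slab; exact: dual_weighted_psd.
move=> q [fq _]; apply: (@le_trans _ _ A).
  have [M [rM solM]] := relaxed_candidate; have [lM iM] := solM q fq.
  have [lq _ _] := fq; have [e1 e2 e3] := lagrangian_split lv lq iM.
  rewrite /dual_cost e2 -lM e1 EFinB addeC.
  apply: leeD2l.
  by rewrite -e3; apply: ereal_inf_lbound; exists (v, M).
have [lE _ _] := feas.
have i0 : int_cyl S (fun z => dotv (v0 z.2) (E z)) = (\int[st]_(z in slab 0 S) dotv (v0 z.2) (E z))%:E.
  exact: int_cylE (young_integrable hFL (LK_initial hFL S lv0) lE).
rewrite /dual_cost i0 addeC -leeBlDr// oppeK.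
apply: le_ereal_inf_tmp => _ [r rr <-]; have [lr _ _] := rr.
have [e1 _ e3] := lagrangian_split (q := (E, B)) lr lE (relaxed_integrable rr feas).
have := relaxed_lower rr; rewrite e1 EFinB leeBrDr//.
by rewrite -e3.
Qed.

End Values.

(** * Restriction to a shorter time interval *)

Section Restriction.
Context {R : realType} {d n N : nat}.
Variables (F : 'rV[R]_n -> 'M[R]_N) (L : diffop R d n N).
Hypothesis hFL : standing_assumptions F L.
Local Notation mu := (torus R d).
Local Notation st := (spacetime R d).
Local Notation stin a b f := (st.-integrable (slab a b) (EFin \o f)).
Local Notation K := (entropy F).
Local Notation Ks := (legendre (entropy F)).
Variables (S T : R).
Hypothesis ST : S <= T.

Definition cut (V : zmodType) (f : R * 'rV[R]_d -> V) (z : R * 'rV[R]_d) : V :=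
  if z.1 < S then f z else 0.

Let slab_cut (z : R * 'rV[R]_d) : slab 0 T z -> z.1 < S -> slab 0 S z.
Proof. by move=> /slabP/andP[z0 _] zS; apply/slabP; rewrite z0. Qed.

Let cutE (V : zmodType) (f : R * 'rV[R]_d -> V) z : 0 < z.1 < S -> cut f z = f z.
Proof. by move=> /andP[_ zS]; rewrite /cut zS. Qed.

Let cut0 (V : zmodType) (f : R * 'rV[R]_d -> V) z : S <= z.1 -> cut f z = 0.
Proof. by move=> zS; rewrite /cut ltNge zS. Qed.

Lemma measurable_cut (f : R * 'rV[R]_d -> R) :
  measurable_fun (slab 0 S) f -> measurable_fun (slab 0 T) (cut f).
Proof.
move=> mf; apply: (eq_measurable_fun (f \_ (slab 0 S))).
  move=> z /set_mem zT; rewrite patchE /cut; case: ifPn => [/set_mem/slabP/andP[_ ->]//|].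
  by rewrite notin_setE => nS; case: ifPn => // /(slab_cut zT).
apply: measurable_funTS; apply/(measurable_restrictT f) => //.
exact: measurable_slab.
Qed.

Lemma ae_cyl_sub (P : R * 'rV[R]_d -> Prop) : ae_cyl T P -> ae_cyl S P.
Proof.
by rewrite /ae_cyl !cylinder_slab; apply: aeS => z H zS; apply: H; exact: slab_subset zS.
Qed.

Lemma LK_sub (v : R * 'rV[R]_d -> 'rV[R]_n) : in_LK F T v -> in_LK F S v.
Proof.
move=> lv; apply: (LK_intro hFL) => [i|].
  by apply: (measurable_funS _ _ (LK_measurable i lv)); [exact: measurable_slab|exact: slab_subset].
exact: stin_sub (LK_integrable hFL lv).
Qed.

(** Extension by zero after S respects the constraint: a test on [0, T] restricts to a test on
    [0, S], as tests only have to vanish at time 0. *)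
Lemma feasible_cut (E : R * 'rV[R]_d -> 'rV[R]_n) (B : R * 'rV[R]_d -> 'M[R]_N) :
  feasible F L S (E, B) -> feasible F L T (cut E, cut B).
Proof.
move=> [/= lE lB cons]; split=> /=.
- split.
    move=> i; rewrite cylinder_slab; apply: (eq_measurable_fun (cut (fun z => E z 0 i))).
      by move=> z _; rewrite /cut; case: ifP => // _; rewrite mxE.
    exact: measurable_cut (intg_measurable (LKs_coord hFL i lE)).
  have := @int_cyl_sub R d S T (fun z => Ks (cut E z)) (fun z => Ks (E z)) ST.
  rewrite /int_cyl => -> //; first by have [] := lE.
    by move=> z zS; rewrite cutE.
  by move=> z zS; rewrite cut0// (legendre0 (entropy_regular hFL)).
- move: lB; rewrite /in_Linfty !cylinder_slab => -[sB mB [C BC]]; split.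
  + by move=> z; rewrite /cut; case: ifP => _; [exact: sB|rewrite /sym linear0].
  + move=> i j; apply: (eq_measurable_fun (cut (fun z => B z i j))).
      by move=> z _; rewrite /cut; case: ifP => // _; rewrite mxE.
    exact: measurable_cut.
  exists `|C|; apply: aeS BC => z H zT i j; rewrite /cut; case: ifPn => [/(slab_cut zT)/H/(_ i j) h|_].
    exact: le_trans h (ler_norm _).
  by rewrite mxE normr0.
- move=> Psi sP P0; rewrite -(cons Psi sP P0); apply: int_cyl_sub => // z zS.
    by rewrite !cutE.
  by rewrite !cut0// frob0l dotv0l addr0.
Qed.

Lemma weak_solution_sub (v0 : 'rV[R]_d -> 'rV[R]_n) (v : R * 'rV[R]_d -> 'rV[R]_n) :
  weak_solution F L T v0 v -> weak_solution F L S v0 v.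
Proof.
move=> [lv weak]; split; first exact: LK_sub.
move=> E B fEB; rewrite -(weak _ _ (feasible_cut fEB)); apply/esym/int_cyl_sub => // z zS.
  by rewrite !cutE.
by rewrite !cut0// frob0r dotv0r addr0.
Qed.

Lemma initial_value_sub (f : R * 'rV[R]_d -> 'rV[R]_n) (f0 : 'rV[R]_d -> 'rV[R]_n) :
  initial_value F T f f0 -> initial_value F S f f0.
Proof.
move=> [w [wf wo wc w0]]; exists w; split=> //; first exact: ae_cyl_sub.
- by move=> t /andP[t0 tS]; apply: wo; rewrite t0 (lt_le_trans tS).
move=> t /andP[t0 tS]; have := wc t; rewrite t0 (lt_le_trans tS)// => /(_ isT).
apply: cvg_trans; apply: cvg_app; apply: within_subset => s /=.
by rewrite !in_itv/= => /andP[-> sS]; rewrite (lt_le_trans sS).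
Qed.

End Restriction.

Section Strong.
Context {R : realType} {d n N : nat}.
Variables (F : 'rV[R]_n -> 'M[R]_N) (L : diffop R d n N).
Hypothesis hFL : standing_assumptions F L.
Local Notation leb := (@lebesgue_measure R).
Local Notation mu := (torus R d).
Local Notation st := (spacetime R d).
Local Notation Ks := (legendre (entropy F)).

(** The weight in the bound on H L^* v^# vanishes only at time T. *)
Lemma adjoint_bounded (T S : R) (h0 : R -> R) (G : R * 'rV[R]_d -> 'M[R]_N) : 0 < T -> S < T ->
  is_weight T h0 -> in_Linfty T (fun z => primitive h0 T z.1 *: G z) ->
  exists C : R, 0 <= C /\ {ae st, forall z, slab 0 S z -> forall i j, `|G z i j| <= C}.
Proof.
move=> T0 ST wh; rewrite /in_Linfty cylinder_slab => -[_ _ [C HC]].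
have [c [C' [c0 _ Hb]]] := primitive_bounds T0 wh.
have cTS : 0 < c * (T - S) by rewrite mulr_gt0// subr_gt0.
exists ((c * (T - S))^-1 * `|C|); split; first by rewrite mulr_ge0// invr_ge0 ltW.
apply: aeS HC => z H zS i j; move: (zS) => /slabP/andP[z0 zS1].
have zT : z.1 < T by exact: lt_trans ST.
have := H _ i j; rewrite mxE normrM => /(_ (slab_subset (lexx 0) (ltW ST) zS)) le1.
have /andP[lo _] : c * (T - z.1) <= primitive h0 T z.1 <= C' by apply: Hb; rewrite !ltW.
have lo' : c * (T - S) <= primitive h0 T z.1.
  by apply: le_trans lo; rewrite ler_wpM2l ?(ltW c0)// lerD2l lerN2 ltW.
rewrite ler_pdivlMl//; apply: le_trans (le_trans le1 (ler_norm C)).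
by apply: ler_wpM2r => //; apply: (le_trans lo'); exact: ler_norm.
Qed.

(** By [dual_E_tail] the integral of - E over [t, S] is W v^#. *)
Lemma weighted_dual_formula (S gamma : R) (v p : R * 'rV[R]_d -> 'rV[R]_n) (v0 : 'rV[R]_d -> 'rV[R]_n) :
  0 < S -> 0 < gamma -> in_LK F S v -> in_LKs F S p ->
  {ae st, forall z, slab 0 S z ->
    forall l, sharp F (v z) 0 l = sharp F (v0 z.2) 0 l + time_primitive 0 (fun z => p z 0 l) z} ->
  ae_cyl S (fun z => v z = grad Ks ((primitive (exp_weight gamma) S z.1)^-1 *:
    \row_l (\int[leb]_(s in `[z.1, S]) - dual_E S gamma (fun z => sharp F (v z)) p (s, z.2) 0 l))).
Proof.
move=> S0 gamma0 lv lp rep; have lf := LK_sharp hFL lv.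
have tail := dual_E_tail (f0 := fun x => sharp F (v0 x)) hFL S0 gamma0 lf lp rep.
rewrite /ae_cyl cylinder_slab.
apply: aeS (aeI rep (ae_slab_space 0 S tail)) => z [rz tz] zS; move: (zS) => /slabP/andP[z0 zS1].
rewrite -[LHS](sharp_invP hFL); congr (grad _ _); apply/rowP => l.
rewrite rz// [RHS]mxE (primitive_exp_weight gamma0 (ltW S0)) ?(ltW z0) ?(ltW zS1)//.
rewrite [X in _ * X]mxE; have [iE tE] := tz zS l.
have iEt : leb.-integrable `]z.1, S[ (EFin \o (fun s => dual_E S gamma (fun z => sharp F (v z)) p (s, z.2) 0 l)).
  by apply: intI_sub iE => //; exact: ltW.
have -> : \int[leb]_(s in `[z.1, S]) - dual_E S gamma (fun z => sharp F (v z)) p (s, z.2) 0 l =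
    - \int[leb]_(s in `]z.1, S[) dual_E S gamma (fun z => sharp F (v z)) p (s, z.2) 0 l.
  rewrite -mulN1r -(RintegralZl _ _ iEt)// /Rintegral integral_itv_bndoo//.
    by congr fine; apply: eq_integral => s _; rewrite mulN1r.
  apply/measurable_EFinP; exact: intg_measurable (intgN _ iEt).
have W0 := exp_tail_gt0 gamma0 zS1.
by rewrite (tE _ (ltW z0) zS1) opprK mulrA mulVf ?gt_eqF// mul1r.
Qed.

End Strong.

(** * Consistency *)

Theorem mainTheorem2 (R : realType) (d n N : nat)
    (F : 'rV[R]_n -> 'M[R]_N) (L : diffop R d n N)
    (hFL : standing_assumptions F L)
    (T : R) (v0 : 'rV[R]_d -> 'rV[R]_n)
    (hv0 : orlicz (torus R d) setT (entropy F) v0)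
    (h0 : R -> R) (hh0 : is_weight T h0)
    (v : R * 'rV[R]_d -> 'rV[R]_n)
    (hv : strong_solution F L h0 T v0 v) :
  forall T1 : R, 0 < T1 < T ->
  exists gamma : R, 0 < gamma /\
  let h := fun t : R => expR (- gamma * t) in
  let H := primitive h T1 in
  let a := fun z : R * 'rV[R]_d => H z.1 *: sharp F (v z) in
  [/\ strong_solution F L h T1 v0 v,
      exists G, weak_adj L T1 (fun z => sharp F (v z)) G /\
        ae_cyl T1 (fun z => loewner_ge (h z.1)%:M (- (2 * H z.1) *: G z)),
      [/\ pI F L h T1 v0 = ((H 0)%:E * K0 F v0)%E,
          pJ_relaxed F L h T1 v0 = ((H 0)%:E * K0 F v0)%E,
          pI_relaxed F L h T1 v0 = ((H 0)%:E * K0 F v0)%E &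
          pJ F L h T1 v0 = ((H 0)%:E * K0 F v0)%E] &
      exists E B,
      [/\ weak_dt T1 a E /\ weak_adj L T1 a B,
          in_LKs F T1 E /\ in_Linfty T1 B,
          dual_maximizer F L h T1 v0 (E, B) &
          ae_cyl T1 (fun z => v z = grad (legendre (entropy F))
            ((H z.1)^-1 *: \row_l
              (\int[lebesgue_measure]_(s in `[z.1, T1]) - E (s, z.2) 0 l)))]].
Proof.
move=> T1 /andP[S0 ST]; have T0 := lt_trans S0 ST.
have [weakT [Dt [G [[wDtT wGT] [E0 [wE0 lE0]] LG pdeT initT]]]] := hv.
have lvT : in_LK F T v by have [] := weakT.
have weak := weak_solution_sub hFL (ltW ST) weakT.
have lv : in_LK F T1 v by have [] := weak.
have lf := LK_sharp hFL lv.
have lp : in_LKs F T1 Dt := time_derivative_LKs hFL T0 hh0 wDtT wE0 (LK_sharp hFL lvT) lE0 S0 ST.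
have rep := time_representation hFL S0 (ltW ST) wDtT lf lp initT.
have wDt := weak_dt_sub (ltW ST) wDtT; have wG := weak_adj_sub (ltW ST) wGT.
have [C [C0 GC]] := adjoint_bounded T0 ST hh0 LG.
have init := initial_value_sub (ltW ST) initT.
have pde0 := ae_cyl_sub (ltW ST) pdeT.
have pde : {ae spacetime R d, forall z, slab 0 T1 z ->
    forall l, Dt z 0 l + frob (G z) (mx_partial l F (v z)) = 0}.
  move: pde0; rewrite /ae_cyl cylinder_slab; apply: aeS => z H zS l.
  by have := H zS l; rewrite (sharp_invP hFL).
(* The last term keeps gamma positive when C = 0. *)
pose gamma := 2 * (\sum_(i < N) \sum_(j < N) C) + 1.
have gamma0 : 0 < gamma.
  by rewrite ltr_wpDl// mulr_ge0// sumr_ge0// => i _; rewrite sumr_ge0.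
have gammaC : 2 * (\sum_(i < N) \sum_(j < N) C) <= gamma by rewrite lerDl.
exists gamma; split=> //= .
rewrite -[fun t => expR _]/(exp_weight gamma).
set h := exp_weight gamma; set H := primitive h T1.
have HW (z : R * 'rV[R]_d) : 0 < z.1 < T1 -> H z.1 = exp_tail gamma T1 z.1.
  by move=> /andP[z0 zS]; rewrite /H primitive_exp_weight// ?ltW// ?z0.
have H0 : H 0 = exp_tail gamma T1 0 by rewrite /H primitive_exp_weight ?lexx ?ltW.
pose E := dual_E T1 gamma (fun z => sharp F (v z)) Dt; pose B := dual_B T1 gamma G.
have lE : in_LKs F T1 E := dual_E_LKs hFL gamma0 lf lp.
have lB : in_Linfty T1 B := dual_B_Linfty gamma0 wG GC.
have wE : weak_dt T1 (fun z => H z.1 *: sharp F (v z)) E.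
  have ch : continuous (fun t => - h t).
    by move=> t; apply: cvgN; exact: (smooth_continuous (smooth_exp_weight gamma)).
  have := weak_dt_mul S0 (exp_tail_is_derive T1 gamma0) (smooth_exp_tail gamma T1) ch wDt.
  apply: weak_dt_eq => z zS; first by rewrite HW.
  by rewrite /E /dual_E scaleNr.
have sG : forall z, sym (G z) by have [] := wG.
have wB : weak_adj L T1 (fun z => H z.1 *: sharp F (v z)) B.
  have := weak_adj_mul (smooth_exp_tail gamma T1) wG.
  by apply: weak_adj_eq => [z zS|z zS|z]; rewrite ?HW// /sym linearZ/= sG.
split.
- split=> //; exists Dt, G; split=> //; first by exists E.
  move: lB; rewrite /in_Linfty cylinder_slab => -[_ mB [C' BC]]; split.
  + by move=> z; rewrite /sym linearZ/= sG.
  + move=> i j; apply: eq_measurable_fun (mB i j) => z /set_mem/slabP zS.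
    by rewrite /B /dual_B -(HW z zS).
  exists C'; apply: aeS BC => z HB zS i j; have := HB zS i j.
  by rewrite /B /dual_B -HW//; exact/slabP.
- exists G; split=> //; rewrite /ae_cyl cylinder_slab.
  apply: aeS (dual_weighted_psd gamma0 wG GC gammaC) => z psdz zS.
  have := psdz zS; rewrite /loewner_ge /= /dual_B HW; last exact/slabP.
  by rewrite scaleNr opprK scalerA.
- by rewrite H0; have [-> -> -> ->] := optimal_values hFL S0 gamma0 lv hv0 lp rep wG GC weak pde gammaC.
exists E, B; split; [exact: (conj wE wB)|exact: (conj lE lB)| |].
- exact: (dual_pair_maximizer hFL S0 gamma0 lv hv0 lp rep wG GC weak pde gammaC).
- exact: (weighted_dual_formula hFL S0 gamma0 lv lp rep).
Qed.
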